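(* Consider the two-sample setting described in the context, under the null hypothesis that $X^{(0)}$ and $X^{(1)}$ have the same distribution, and let $n_1\to\infty$ with $n_1/n\to 0$, where $n=n_0+n_1$. (1) If $\xi_{0,1}>0$, then $n_1^{1/2}T\xrightarrow{d}N(0,m_1^2\xi_{0,1})$. (2) Suppose $\xi_{0,1}=0$ and $\xi_{0,2}>0$, and at least one of the following holds: (a) $\xi_{1,0}=0$; (b) $n_1^2/n_0\to 0$. Then $$n_1T\xrightarrow{d}\frac{m_1(m_1-1)}{2}\,\eta,\qquad \eta=\sum_{j=1}^\infty\lambda_j(\chi^2_{1j}-1),$$ where the $\chi^2_{1j}$ are independent $\chi^2_1$ random variables and the $\lambda_j$ are the eigenvalues of the integral operator $Ag(x)=\int h_{0,2}(x,y)g(y)\,dF(y)$, with $F$ the distribution of $X^{(1)}$.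
   Context: Observations $X_1^{(0)},\dots,X_{n_0}^{(0)}$ (controls, class $Y=0$) are i.i.d. in $\mathbb{R}^p$, and $X_1^{(1)},\dots,X_{n_1}^{(1)}$ (cases, class $Y=1$) are i.i.d. in $\mathbb{R}^p$; the two samples are independent. Fix integers $m_0,m_1\ge1$. Let $h:(\mathbb{R}^p)^{m_0}\times(\mathbb{R}^p)^{m_1}\to\mathbb{R}$ be a measurable kernel that is symmetric in its first $m_0$ arguments and symmetric in its last $m_1$ arguments, with $\mathrm{E}\,h(X_1^{(0)},\dots,X_{m_0}^{(0)};X_1^{(1)},\dots,X_{m_1}^{(1)})=0$ and finite second moment. Define $$T=\binom{n_0}{m_0}^{-1}\binom{n_1}{m_1}^{-1}\sum h\big(X_{i_1}^{(0)},\dots,X_{i_{m_0}}^{(0)};X_{j_1}^{(1)},\dots,X_{j_{m_1}}^{(1)}\big),$$ the sum running over all $1\le i_1<\dots<i_{m_0}\le n_0$ and all $1\le j_1<\dots<j_{m_1}\le n_1$. For $0\le a\le m_0$, $0\le b\le m_1$ define the projection $$h_{a,b}(x_1,\dots,x_a;y_1,\dots,y_b)=\mathrm{E}\{h(X_1^{(0)},\dots,X_{m_0}^{(0)};X_1^{(1)},\dots,X_{m_1}^{(1)})\mid X_1^{(0)}=x_1,\dots,X_a^{(0)}=x_a,X_1^{(1)}=y_1,\dots,X_b^{(1)}=y_b\},$$ and $\xi_{a,b}=\operatorname{Var}\{h_{a,b}(X_1^{(0)},\dots,X_a^{(0)};X_1^{(1)},\dots,X_b^{(1)})\}$. *)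

(* Defs.v *)
From HB Require Import structures.
From mathcomp Require Import all_boot all_order all_algebra.
From mathcomp Require Import all_classical all_reals all_analysis.
Set Implicit Arguments. Unset Strict Implicit. Unset Printing Implicit Defensive.
Import Order.TTheory GRing.Theory Num.Theory.
Import numFieldNormedType.Exports.
Local Open Scope classical_set_scope.
Local Open Scope ring_scope.

Definition mutually_independent {d dS} {Omega : measurableType d}
    {S : measurableType dS} {R : realType} {I : eqType}
    (P : probability Omega R) (X : I -> Omega -> S) : Prop :=
  forall (J : seq I) (A : I -> set S), uniq J ->
    (forall i, i \in J -> measurable (A i)) ->
    P (\big[setI/setT]_(i <- J) (X i @^-1` A i)) =
    (\prod_(i <- J) P (X i @^-1` A i))%E.

Definition cvg_in_dist {d d'} {Omega : measurableType d}
    {Omega' : measurableType d'} {R : realType}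
    (P : probability Omega R) (Y : nat -> Omega -> R)
    (P' : probability Omega' R) (Z : Omega' -> R) : Prop :=
  forall f : R -> R, continuous f -> (exists M : R, forall x, `|f x| <= M) ->
    (fun k => fine (\int[P]_w (f (Y k w))%:E)%E) @ \oo -->
      fine (\int[P']_w (f (Z w))%:E)%E.

Section Ustat.
Variables (d : measure_display) (Omega : measurableType d) (R : realType)
  (p m0 m1 : nat).
Local Notation S := (p.-tuple R).
Variables (P : probability Omega R)
  (X : bool * nat -> Omega -> S)  (* X (false, i) = X_{i+1}^{(0)}, X (true, j) = X_{j+1}^{(1)} *)
  (h : m0.-tuple S -> m1.-tuple S -> R).

Definition Ustat (n0 n1 : nat) (w : Omega) : R :=
  ('C(n0, m0)%:R)^-1 * ('C(n1, m1)%:R)^-1 *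
  \sum_(s : m0.-tuple 'I_n0 | sorted (fun a b : 'I_n0 => (a < b)%N) s)
   \sum_(t : m1.-tuple 'I_n1 | sorted (fun a b : 'I_n1 => (a < b)%N) t)
     h [tuple X (false, nat_of_ord (tnth s i)) w | i < m0]
       [tuple X (true, nat_of_ord (tnth t j)) w | j < m1].

Definition hfill (a b : nat) (x y : nat -> S) (w : Omega) : R :=
  h [tuple if (i < a)%N then x (nat_of_ord i) else X (false, nat_of_ord i) w | i < m0]
    [tuple if (j < b)%N then y (nat_of_ord j) else X (true, nat_of_ord j) w | j < m1].

(** Projection h_{a,b}(x_1..x_a; y_1..y_b)
    = E h(x_1,..,x_a, X_{a+1}^{(0)},..; y_1,..,y_b, X_{b+1}^{(1)},..),
    a version of the conditional expectation in the paper (by independence). *)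
Definition hproj (a b : nat) (x y : nat -> S) : R :=
  fine ('E_P[hfill a b x y]).

Definition xi (a b : nat) : \bar R :=
  'V_P[fun w => hproj a b (fun i => X (false, i) w) (fun j => X (true, j) w)].

End Ustat.

(** [lam] lists the (nonzero) eigenvalues, repeated according to multiplicity
    (padded with zeros), of the integral operator
    A g (x) = \int k(x,y) g(y) dF(y) on L^2(F):
    there are F-orthonormal square-integrable eigenfunctions phi_j for the
    nonzero lam_j, and for each nonzero mu, the phi_j with lam_j = mu span the
    mu-eigenspace (no nonzero L^2(F) eigenfunction of mu is orthogonal to
    all of them). *)
Definition eigenvalue_seq {dS} {S : measurableType dS} {R : realType}
    (F : probability S R) (k : S -> S -> R) (lam : nat -> R) : Prop :=
  exists phi : nat -> S -> R,
    (forall j, lam j != 0 -> measurable_fun setT (phi j) /\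
        F.-integrable setT (fun x => (phi j x ^+ 2)%:E)) /\
    (forall i j, lam i != 0 -> lam j != 0 ->
        (\int[F]_x (phi i x * phi j x)%:E = (if i == j then 1 else 0)%:E)%E) /\
    (forall j, lam j != 0 ->
        {ae F, forall x, (\int[F]_y (k x y * phi j y)%:E = (lam j * phi j x)%:E)%E}) /\
    (forall (mu : R) (g : S -> R), mu != 0 ->
        measurable_fun setT g -> F.-integrable setT (fun x => (g x ^+ 2)%:E) ->
        {ae F, forall x, (\int[F]_y (k x y * g y)%:E = (mu * g x)%:E)%E} ->
        (forall j, lam j = mu -> (\int[F]_x (g x * phi j x)%:E = 0)%E) ->
        {ae F, forall x, g x = 0}).

(* Main.v *)
Require Import Defs.
From HB Require Import structures.
From mathcomp Require Import all_boot all_order all_algebra.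
From mathcomp Require Import perm.
From mathcomp Require Import all_classical all_reals all_analysis.
From mathcomp Require Import measurable_realfun ring lra.
Import Order.TTheory GRing.Theory Num.Theory.
Import numFieldNormedType.Exports.
Local Open Scope classical_set_scope.
Local Open Scope ring_scope.
Set Implicit Arguments.
Unset Strict Implicit.

(** Part (1) is Hajek projection: subtracting from [h] the sum of its first-order
projections [h_{0,1}] leaves a U-statistic whose variance is
[O(1/n0 + 1/n1^2) = o(1/n1)], so [sqrt n1 T] is asymptotically a normalised sum
of i.i.d. variables.  In part (2) [h_{0,1}] vanishes almost surely and the same
variance estimate, with condition (a) or (b) taking care of the order [1/n0]
terms, reduces [n1 T] to [m1 (m1 - 1) / 2] times the degenerate U-statistic of
order two with kernel [h_{0,2}].  The eigenfunction expansion of [h_{0,2}]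
converges in L2 (a symmetric L2 kernel which is nonzero after removal of the
listed eigenfunctions still has an eigenfunction for a nonzero eigenvalue, obtained
as a limit of normalised iterates of the kernel), and truncating it leaves finitely
many squares of normalised sums, to which the law of large numbers (for the
diagonal) and the central limit theorem apply.

The central limit theorem is proved by Lindeberg replacement.  To avoid
multivariate Taylor expansions, test functions are compositions of a smooth
function of one variable with a sum [\sum_l theta_l (s_l)] of bounded smooth
functions of the coordinates; squares are replaced by [(1 - cos (e x)) * 2 / e^2]
with [e] small. *)

(** Conditioning is replaced by resampling: independence allows some coordinates to be read from a
    second, independent sample point, and Fubini then integrates them out. The variance estimate
    rests on a count: two random index sets share at least a controls and b cases with probability
    of order n0^-a n1^-b, and two terms with overlap exactly (a, b) are uncorrelated as soon as
    h_{a,b} vanishes almost everywhere. In part (2) the overlap (1, 0) costs n1^2 / n0 after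
    scaling, which is why either xi_{1,0} = 0 or that ratio has to vanish. The eigenfunctions are
    only known to be orthonormal and to exhaust the nonzero eigenspaces, so convergence of the
    expansion has to be derived: a nonzero limit of the residual kernels would have an eigenfunction
    orthogonal to all listed ones, and it would be an eigenfunction of h_{0,2} as well. The
    truncation level is fixed before the sample grows; this works because the discarded tail
    contributes an L2 error bounded uniformly in n1. The limit law enters the replacement argument
    through its mean, its covariances and its stability, so coordinates of variance zero are
    allowed. *)

Definition Ex {d} {T : measurableType d} {R : realType} (P : probability T R)
  (f : T -> R) : R := fine (\int[P]_x (f x)%:E)%E.

Definition L1 {d} {T : measurableType d} {R : realType} (P : probability T R)
  (f : T -> R) : Prop := P.-integrable setT (fun x => (f x)%:E).

Definition L2 {d} {T : measurableType d} {R : realType} (P : probability T R)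
  (f : T -> R) : Prop :=
  measurable_fun setT f /\ L1 P (fun x => f x ^+ 2).

(** * Real-valued expectations, L1 and L2 *)

Section real_expectation.
Context {d : measure_display} {T : measurableType d} {R : realType}
  (P : probability T R).
Implicit Types (f g : T -> R).

Lemma ExE f : Ex P f = \int[P]_x f x.
Proof. by []. Qed.

Lemma eq_Ex f g : f =1 g -> Ex P f = Ex P g.
Proof. by move=> fg; congr fine; apply: eq_integral => x _; rewrite fg. Qed.

Lemma eq_L1 f g : f =1 g -> L1 P f -> L1 P g.
Proof. by move=> fg; apply: eq_integrable => // x _; rewrite fg. Qed.

Lemma L1_measurable f : L1 P f -> measurable_fun setT f.
Proof. by move=> /measurable_int /measurable_EFinP. Qed.

Lemma L1_int f : L1 P f -> (\int[P]_x (f x)%:E = (Ex P f)%:E)%E.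
Proof. by move=> Lf; rewrite fineK//; exact: integrable_fin_num. Qed.

Lemma L1_dom f g : measurable_fun setT f -> (forall x, `|f x| <= g x) ->
  L1 P g -> L1 P f.
Proof.
move=> mf fg; apply: le_integrable => //; first exact/measurable_EFinP.
by move=> x _ /=; rewrite lee_fin (le_trans (fg x))// ler_norm.
Qed.

Lemma L1_cst (c : R) : L1 P (fun=> c).
Proof. exact: finite_measure_integrable_cst. Qed.

Lemma L1_bnd f (M : R) : measurable_fun setT f -> (forall x, `|f x| <= M) -> L1 P f.
Proof. by move=> mf fM; apply: (L1_dom (g := fun=> M)) => //; exact: L1_cst. Qed.

Lemma L1D f g : L1 P f -> L1 P g -> L1 P (fun x => f x + g x).
Proof. by move=> Lf Lg; exact: eq_integrable (integrableD measurableT Lf Lg). Qed.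

Lemma L1B f g : L1 P f -> L1 P g -> L1 P (fun x => f x - g x).
Proof. by move=> Lf Lg; exact: eq_integrable (integrableB measurableT Lf Lg). Qed.

Lemma L1Z f (c : R) : L1 P f -> L1 P (fun x => c * f x).
Proof. by move=> Lf; exact: eq_integrable (integrableZl measurableT c Lf). Qed.

Lemma L1_norm f : L1 P f -> L1 P (fun x => `|f x|).
Proof. by move=> Lf; exact: eq_integrable (integrable_abse Lf). Qed.

Lemma L1_sum (I : Type) (s : seq I) (Q : pred I) (F : I -> T -> R) :
  (forall i, Q i -> L1 P (F i)) -> L1 P (fun x => \sum_(i <- s | Q i) F i x).
Proof.
move=> LF; elim: s => [|i s IH].
  by apply: (@eq_L1 (fun=> 0)) (L1_cst 0) => x; rewrite big_nil.
apply: (@eq_L1 (fun x => (if Q i then F i x else 0) +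
    \sum_(i <- s | Q i) F i x)) => [x|].
  by rewrite big_cons; case: (Q i); rewrite ?add0r.
by apply: L1D => //; case Qi: (Q i); [exact: LF|exact: L1_cst].
Qed.

Lemma ExD f g : L1 P f -> L1 P g -> Ex P (fun x => f x + g x) = Ex P f + Ex P g.
Proof. by move=> Lf Lg; exact: RintegralD. Qed.

Lemma ExB f g : L1 P f -> L1 P g -> Ex P (fun x => f x - g x) = Ex P f - Ex P g.
Proof. by move=> Lf Lg; exact: RintegralB. Qed.

Lemma ExZ f (c : R) : L1 P f -> Ex P (fun x => c * f x) = c * Ex P f.
Proof. by move=> Lf; exact: RintegralZl. Qed.

Lemma Ex_cst (c : R) : Ex P (fun=> c) = c.
Proof.
have := Rintegral_cst P measurableT c; rewrite -ExE => ->.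
by rewrite -[RHS]mulr1; congr (_ * _); exact: (congr1 fine (probability_setT P)).
Qed.

Lemma Ex_sum (I : Type) (s : seq I) (Q : pred I) (F : I -> T -> R) :
  (forall i, Q i -> L1 P (F i)) ->
  Ex P (fun x => \sum_(i <- s | Q i) F i x) = \sum_(i <- s | Q i) Ex P (F i).
Proof.
move=> LF; elim: s => [|i s IH].
  by rewrite big_nil -[RHS](Ex_cst 0); apply: eq_Ex => x; rewrite big_nil.
rewrite big_cons -IH; case Qi: (Q i); last first.
  by apply: eq_Ex => x; rewrite big_cons Qi.
rewrite -ExD; [by apply: eq_Ex => x; rewrite big_cons Qi|exact: LF|exact: L1_sum].
Qed.

Lemma Ex_ge0 f : (forall x, 0 <= f x) -> 0 <= Ex P f.
Proof. by move=> f0; exact: Rintegral_ge0. Qed.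

Lemma le_Ex f g : L1 P f -> L1 P g -> (forall x, f x <= g x) -> Ex P f <= Ex P g.
Proof. by move=> Lf Lg fg; apply: le_Rintegral. Qed.

Lemma normr_Ex f : L1 P f -> `|Ex P f| <= Ex P (fun x => `|f x|).
Proof. by move=> Lf; exact: le_normr_Rintegral. Qed.

Lemma normr_Ex_le f (M : R) : L1 P f -> (forall x, `|f x| <= M) -> `|Ex P f| <= M.
Proof.
move=> Lf fM; apply: le_trans (normr_Ex Lf) _.
by rewrite -[leRHS]Ex_cst; apply: le_Ex => //; [exact: L1_norm|exact: L1_cst].
Qed.

Lemma ae_eq_Ex f g : measurable_fun setT f -> measurable_fun setT g ->
  {ae P, forall x, f x = g x} -> Ex P f = Ex P g.
Proof.
move=> mf mg fg; congr fine; apply: ae_eq_integral => //.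
- exact/measurable_EFinP.
- exact/measurable_EFinP.
- by apply: filterS fg => x /= -> .
Qed.

Lemma Ex0_ae f : L1 P f -> (forall x, 0 <= f x) -> Ex P f = 0 ->
  {ae P, forall x, f x = 0}.
Proof.
move=> Lf f0 Ef.
have : (\int[P]_x `|(f x)%:E| = 0)%E.
  by rewrite -[RHS]/((0 : R)%:E) -Ef -L1_int//; apply: eq_integral => x _ /=;
     rewrite ger0_norm.
move/ae_eq_integral_abs => /(_ measurableT (measurable_int P Lf)).
by apply: filterS => x /(_ I) [].
Qed.

Lemma L2_measurable f : L2 P f -> measurable_fun setT f.
Proof. by case. Qed.

Lemma eq_L2 f g : f =1 g -> L2 P f -> L2 P g.
Proof. by move=> /funext ->. Qed.

Lemma L2M f g : L2 P f -> L2 P g -> L1 P (fun x => f x * g x).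
Proof.
move=> [mf Lf] [mg Lg]; apply: (L1_dom (g := fun x => f x ^+ 2 + g x ^+ 2)).
- exact: measurable_funM.
- move=> x; rewrite normrM -(real_normK (num_real (f x))).
  rewrite -(real_normK (num_real (g x))).
  have := sqr_ge0 (`|f x| - `|g x|); have := normr_ge0 (f x).
  have := normr_ge0 (g x); nra.
- exact: L1D.
Qed.

Lemma L2_cst (c : R) : L2 P (fun=> c).
Proof. by split => //; exact: L1_cst. Qed.

Lemma L2_L1 f : L2 P f -> L1 P f.
Proof.
by move=> Lf; apply: eq_L1 (L2M Lf (L2_cst 1)) => x; rewrite mulr1.
Qed.

Lemma L2_bnd f (M : R) : measurable_fun setT f -> (forall x, `|f x| <= M) -> L2 P f.
Proof.
move=> mf fM; split => //; apply: (L1_bnd (M := M ^+ 2)).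
  exact: measurable_funX.
move=> x; rewrite normrX lerXn2r ?nnegrE//.
exact: le_trans (normr_ge0 _) (fM x).
Qed.

Lemma L2D f g : L2 P f -> L2 P g -> L2 P (fun x => f x + g x).
Proof.
move=> Lf Lg; split; first by apply: measurable_funD; [case: Lf|case: Lg].
apply: (@eq_L1 (fun x => f x ^+ 2 + (2 * (f x * g x) + g x ^+ 2))).
  by move=> x; ring.
by apply: L1D; [case: Lf|apply: L1D; [exact/L1Z/L2M|case: Lg]].
Qed.

Lemma L2Z f (c : R) : L2 P f -> L2 P (fun x => c * f x).
Proof.
move=> Lf; split; first by apply: measurable_funM => //; case: Lf.
apply: (@eq_L1 (fun x => c ^+ 2 * f x ^+ 2)); first by move=> x; ring.
by apply: L1Z; case: Lf.
Qed.

Lemma L2B f g : L2 P f -> L2 P g -> L2 P (fun x => f x - g x).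
Proof.
move=> Lf Lg; apply: (@eq_L2 (fun x => f x + -1 * g x)).
  by move=> x; ring.
exact/L2D/L2Z.
Qed.

Lemma L2_sum (I : Type) (s : seq I) (Q : pred I) (F : I -> T -> R) :
  (forall i, Q i -> L2 P (F i)) -> L2 P (fun x => \sum_(i <- s | Q i) F i x).
Proof.
move=> LF; elim: s => [|i s IH].
  by apply: (@eq_L2 (fun=> 0)) (L2_cst 0) => x; rewrite big_nil.
apply: (@eq_L2 (fun x => (if Q i then F i x else 0) +
    \sum_(i <- s | Q i) F i x)) => [x|].
  by rewrite big_cons; case: (Q i); rewrite ?add0r.
by apply: L2D => //; case Qi: (Q i); [exact: LF|exact: L2_cst].
Qed.

Lemma L2_norm f : L2 P f -> L2 P (fun x => `|f x|).
Proof.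
move=> [mf Lf]; split; first exact: measurableT_comp.
by apply: eq_L1 Lf => x; rewrite real_normK ?num_real.
Qed.

Lemma Ex_cauchy_schwarz f g : L2 P f -> L2 P g ->
  Ex P (fun x => f x * g x) ^+ 2 <=
  Ex P (fun x => f x ^+ 2) * Ex P (fun x => g x ^+ 2).
Proof.
move=> Lf Lg; set a := Ex P _; set b := Ex P _; set c := Ex P _.
have b0 : 0 <= b by apply: Ex_ge0 => x; exact: sqr_ge0.
have c0 : 0 <= c by apply: Ex_ge0 => x; exact: sqr_ge0.
have H s t : 0 <= s ^+ 2 * b + 2 * s * t * a + t ^+ 2 * c.
  have -> : s ^+ 2 * b + 2 * s * t * a + t ^+ 2 * c =
      Ex P (fun x => (s * f x + t * g x) ^+ 2).
    rewrite -!ExZ//; [|by case: Lg|exact: L2M|by case: Lf].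
    rewrite -!ExD.
    + by apply: eq_Ex => x; ring.
    + by apply: L1D; [apply: L1Z; case: Lf|exact/L1Z/L2M].
    + by apply: L1Z; case: Lg.
    + by apply: L1Z; case: Lf.
    + exact/L1Z/L2M.
  by apply: Ex_ge0 => x; exact: sqr_ge0.
have [c_eq0|c_neq0] := eqVneq c 0.
  have [->|a0] := eqVneq a 0; first by rewrite expr0n/= mulr_ge0.
  (* For c = 0 the form is affine in its second variable, and this value makes it -1. *)
  have := H 1 (- (b + 1) / (2 * a)).
  have -> : 1 ^+ 2 * b + 2 * 1 * (- (b + 1) / (2 * a)) * a +
      (- (b + 1) / (2 * a)) ^+ 2 * c = -1.
    by rewrite c_eq0; field.
  lra.
have c1 : 0 < c by rewrite lt_neqAle eq_sym c_neq0.
have := H c (- a).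
have -> : c ^+ 2 * b + 2 * c * - a * a + (- a) ^+ 2 * c = c * (b * c - a ^+ 2).
  by ring.
by rewrite pmulr_rge0// subr_ge0.
Qed.

Lemma sqr_Ex_norm_le f : L2 P f ->
  Ex P (fun x => `|f x|) ^+ 2 <= Ex P (fun x => f x ^+ 2).
Proof.
move=> Lf; have := Ex_cauchy_schwarz (L2_norm Lf) (L2_cst 1).
rewrite (@eq_Ex (fun x => 1 ^+ 2) (fun=> 1)) ?Ex_cst; last by move=> x; rewrite expr1n.
rewrite mulr1 (@eq_Ex (fun x => `|f x| * 1) (fun x => `|f x|)); last first.
  by move=> x; rewrite mulr1.
by rewrite (@eq_Ex (fun x => `|f x| ^+ 2) (fun x => f x ^+ 2))// => x;
   rewrite real_normK ?num_real.
Qed.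

Lemma Ex_norm_le_sqrt f (e : R) : L2 P f -> 0 <= e ->
  Ex P (fun x => f x ^+ 2) <= e ^+ 2 -> Ex P (fun x => `|f x|) <= e.
Proof.
move=> Lf e0 fe; rewrite -(ler_pXn2r (n := 2))// ?nnegrE//.
  exact: le_trans (sqr_Ex_norm_le Lf) fe.
by apply: Ex_ge0.
Qed.

End real_expectation.

(** * Fubini and Tonelli for real-valued expectations *)

Section real_fubini.
Context {d d' : measure_display} {T : measurableType d} {T' : measurableType d'}
  {R : realType} (P : probability T R) (Q : probability T' R).
Implicit Types (f : T * T' -> R).

Lemma measurable_slice1 f x : measurable_fun setT f ->
  measurable_fun setT (fun y => f (x, y)).
Proof. by move=> mf; exact: measurableT_comp. Qed.

Lemma measurable_slice2 f y : measurable_fun setT f ->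
  measurable_fun setT (fun x => f (x, y)).
Proof. by move=> mf; exact: measurableT_comp. Qed.

(** Integrability of the slices is not at stake: an integral is the difference of the integrals of
    the positive and negative parts, each measurable in x by Tonelli, and [fine] is measurable. *)
Lemma measurable_Ex_slice f : measurable_fun setT f ->
  measurable_fun setT (fun x => Ex Q (fun y => f (x, y))).
Proof.
move=> mf; apply: measurableT_comp => //=.
have mfE : measurable_fun setT (fun z => (f z)%:E) by exact/measurable_EFinP.
rewrite (_ : (fun x => _) = (fun x => (fubini_F Q (fun z => (f z)%:E)^\+) x -
    (fubini_F Q (fun z => (f z)%:E)^\-) x)%E); last first.
  apply/funext => x; rewrite [LHS]integralE /fubini_F /=; congr (_ - _)%E.
    by apply: eq_integral => y _; rewrite !funeposE.
  by apply: eq_integral => y _; rewrite !funenegE.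
apply: emeasurable_funB; apply: measurable_fun_fubini_tonelli_F => //.
- exact: measurable_funepos.
- exact: measurable_funeneg.
Qed.

Lemma L1_fubini f : L1 (P \x Q)%E f -> L1 P (fun x => Ex Q (fun y => f (x, y))).
Proof.
move=> Lf; have Lf' := integrable_fubini_F Lf.
have mf : measurable_fun setT f by exact: (L1_measurable Lf).
move/integrableP : Lf' => [mF iF].
apply/integrableP; split; first by apply/measurable_EFinP; exact: measurable_Ex_slice.
apply: le_lt_trans iF; apply: ge0_le_integral => //.
- by apply/measurable_EFinP; apply: measurableT_comp => //; exact: measurable_Ex_slice.
- exact: measurableT_comp.
(* [fine] sends an infinite inner integral to 0, which can only lower the absolute value. *)
- move=> x _ /=; rewrite /Ex /fubini_F.
  by case: (\int[Q]_y _)%E => //= *; rewrite ?normr0 ?leey.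
Qed.

Lemma Ex_fubini f : L1 (P \x Q)%E f ->
  Ex (P \x Q)%E f = Ex P (fun x => Ex Q (fun y => f (x, y))).
Proof.
move=> Lf; rewrite /Ex -fubini1//; congr fine; apply: ae_eq_integral => //.
- exact: (measurable_fubini_F Lf).
- by apply/measurable_EFinP; apply: measurable_Ex_slice; exact: (L1_measurable Lf).
- apply: filterS (ae_integrable1 Lf) => x Lfx _.
  by rewrite -[LHS]fineK//; exact: integrable_fin_num.
Qed.

Lemma L1_slice_ae f : L1 (P \x Q)%E f -> {ae P, forall x, L1 Q (fun y => f (x, y))}.
Proof. by move=> Lf; exact: (ae_integrable1 Lf). Qed.

Lemma L1_tonelli f : measurable_fun setT f -> (forall x, L1 Q (fun y => f (x, y))) ->
  L1 P (fun x => Ex Q (fun y => `|f (x, y)|)) -> L1 (P \x Q)%E f.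
Proof.
move=> mf Lf LL; apply/integrableP; split; first exact/measurable_EFinP.
rewrite fubini_tonelli1//; last first.
  by apply: measurableT_comp => //; exact/measurable_EFinP.
rewrite (eq_integral (fun x => (Ex Q (fun y => `|f (x, y)|))%:E)); last first.
  by move=> x _; rewrite /fubini_F -L1_int//; exact: L1_norm.
by rewrite (L1_int LL) ltry.
Qed.

End real_fubini.

Section real_fubini_swap.
Context {d d' : measure_display} {T : measurableType d} {T' : measurableType d'}
  {R : realType} (P : probability T R) (Q : probability T' R).
Implicit Types (f : T * T' -> R).

Lemma measurable_swapped f : measurable_fun setT f ->
  measurable_fun setT (fun z : T' * T => f (z.2, z.1)).
Proof.
by move=> mf; apply: measurableT_comp => //; exact: measurable_fun_pair.
Qed.

Lemma measurable_Ex_slice2 f : measurable_fun setT f ->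
  measurable_fun setT (fun y => Ex P (fun x => f (x, y))).
Proof. by move=> /measurable_swapped; exact: measurable_Ex_slice. Qed.

Lemma Ex_fubini2 f : L1 (P \x Q)%E f ->
  Ex (P \x Q)%E f = Ex Q (fun y => Ex P (fun x => f (x, y))).
Proof.
move=> Lf; rewrite /Ex -fubini2//; congr fine; apply: ae_eq_integral => //.
- exact: (measurable_fubini_G Lf).
- by apply/measurable_EFinP; apply: measurable_Ex_slice2; exact: (L1_measurable Lf).
- apply: filterS (ae_integrable2 Lf) => x Lfx _.
  by rewrite -[LHS]fineK//; exact: integrable_fin_num.
Qed.

Lemma L1_slice2_ae f : L1 (P \x Q)%E f -> {ae Q, forall y, L1 P (fun x => f (x, y))}.
Proof. by move=> Lf; exact: (ae_integrable2 Lf). Qed.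

Lemma Ex_swap f : L1 (P \x Q)%E f ->
  Ex P (fun x => Ex Q (fun y => f (x, y))) = Ex Q (fun y => Ex P (fun x => f (x, y))).
Proof. by move=> Lf; rewrite -Ex_fubini// -Ex_fubini2. Qed.

Lemma L1_prod (f : T -> R) (g : T' -> R) : L1 P f -> L1 Q g ->
  L1 (P \x Q)%E (fun z => f z.1 * g z.2).
Proof.
move=> Lf Lg; apply: L1_tonelli.
- by apply: measurable_funM; apply: measurableT_comp => //;
    [exact: (L1_measurable Lf)|exact: (L1_measurable Lg)].
- by move=> x /=; exact: L1Z.
- apply: (@eq_L1 _ _ _ P (fun x => Ex Q (fun y => `|g y|) * `|f x|)).
    by move=> x /=; rewrite mulrC -ExZ; [apply: eq_Ex => y; rewrite normrM|exact: L1_norm].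
  exact/L1Z/L1_norm.
Qed.

Lemma Ex_prod (f : T -> R) (g : T' -> R) : L1 P f -> L1 Q g ->
  Ex (P \x Q)%E (fun z => f z.1 * g z.2) = Ex P f * Ex Q g.
Proof.
move=> Lf Lg; rewrite Ex_fubini; last exact: L1_prod.
rewrite mulrC -ExZ//; apply: eq_Ex => x /=; rewrite mulrC -ExZ//.
Qed.

End real_fubini_swap.

(** * Expectations under the law of a random variable *)

Section change_of_law.
Context {d d' : measure_display} {T : measurableType d} {T' : measurableType d'}
  {R : realType} (P : probability T R) (X : {RV P >-> T'}).

Lemma L1_distribution (f : T' -> R) : measurable_fun setT f ->
  L1 P (fun w => f (X w)) <-> L1 (distribution P X) f.
Proof.
move=> mf; have mfX : measurable_fun setT (fun w => f (X w)) by exact: measurableT_comp.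
have H : (\int[distribution P X]_y `|f y|%:E = \int[P]_w `|f (X w)|%:E)%E.
  rewrite ge0_integral_distribution//.
  exact/measurable_EFinP/measurableT_comp.
split => /integrableP[_ fin]; apply/integrableP; split.
- exact/measurable_EFinP.
- by rewrite H.
- exact/measurable_EFinP.
- by rewrite -H.
Qed.

Lemma Ex_distribution (f : T' -> R) : measurable_fun setT f ->
  L1 P (fun w => f (X w)) -> Ex (distribution P X) f = Ex P (fun w => f (X w)).
Proof.
move=> mf Lf; rewrite /Ex integral_distribution//.
exact/measurable_EFinP.
Qed.

End change_of_law.

(** * Laws of finite families *)

Section law_of_tuples.
Context {d : measure_display} {S : measurableType d} {R : realType}.

(** Boxes are closed under intersection and generate the sigma-algebra of tuples, so two
    probabilities that agree on boxes are equal. *)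
Lemma tuple_law_unique n (mu nu : probability (n.-tuple S) R) :
  (forall A : 'I_n -> set S, (forall i, measurable (A i)) ->
     mu [set t | forall i, A i (tnth t i)] = nu [set t | forall i, A i (tnth t i)]) ->
  forall B, measurable B -> mu B = nu B.
Proof.
move=> munu.
pose G := [set B : set (n.-tuple S) | exists2 A : 'I_n -> set S,
  (forall i, measurable (A i)) & B = [set t | forall i, A i (tnth t i)]].
have GT : G setT by exists (fun=> setT) => //; apply/seteqP; split.
apply: (measure_unique G (fun=> setT)) => //.
- apply/seteqP; split => [B|B].
  + move=> mB; have {mB} : <<s \big[setU/set0]_(i < n)
      preimage_set_system setT (fun t : n.-tuple S => tnth t i) measurable >> B by exact: mB.
    apply: smallest_sub; first exact: smallest_sigma_algebra.
    move=> C; rewrite -bigcup_seq => -[i _] /= [B' mB' <-].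
    apply: sub_sigma_algebra; exists (fun j => if j == i then B' else setT).
      by move=> j; case: ifP.
    rewrite setTI; apply/seteqP; split => [t /= Bt j|t /= /(_ i)]; last by rewrite eqxx.
    by case: ifPn => // /eqP ->.
  + apply: smallest_sub; first exact: sigma_algebra_measurable.
    move=> _ [A mA ->].
    rewrite (_ : [set t | _] = \bigcap_(i in [set: 'I_n]) ((fun t => tnth t i) @^-1` A i)).
      apply: fin_bigcap_measurable => // i _.
      by rewrite -[X in measurable X]setTI; exact: measurable_tnth.
    by apply/seteqP; split => [t /= At i _|t /= At i]; exact: At.
- move=> _ _ [A mA ->] [B mB ->]; exists (fun i => A i `&` B i).
    by move=> i; exact: measurableI.
  apply/seteqP; split => [t [At Bt] i|t AB]; first by split.
  by split => i; case: (AB i).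
- by apply/seteqP; split => // t _; exists 0%N.
- by move=> B [A mA ->]; exact: munu.
- by move=> k; rewrite ltey_eq fin_num_measure.
Qed.

End law_of_tuples.

Lemma bigsetIP (I : eqType) (T : Type) (L : seq I) (F : I -> set T) w :
  (\big[setI/setT]_(i <- L) F i) w <-> (forall i, i \in L -> F i w).
Proof.
elim: L => [|i L IH]; first by rewrite big_nil; split.
rewrite big_cons; split => [[Fi /IH FL] j|FL].
  by rewrite in_cons => /predU1P[->|/FL].
by split; [apply: FL; rewrite mem_head|apply/IH => j jL; apply: FL; rewrite in_cons jL orbT].
Qed.

Section finitary_functionals.
Context {d : measure_display} {S : measurableType d} {R : realType} {I : eqType}.
Implicit Types (L : seq I) (Phi Psi : (I -> S) -> R).

(* A functional of a family [z : I -> S] which looks at the coordinates in [L]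
   only and is measurable along every measurable family. *)
Definition finitary L Phi : Prop :=
  (forall z z', (forall i, i \in L -> z i = z' i) -> Phi z = Phi z') /\
  (forall (d' : measure_display) (T : measurableType d') (Y : I -> T -> S),
     (forall i, measurable_fun setT (Y i)) ->
     measurable_fun setT (fun w => Phi (Y ^~ w))).

Lemma finitary_sub L L' Phi : {subset L <= L'} -> finitary L Phi -> finitary L' Phi.
Proof.
by move=> LL' [Phi_dep Phi_meas]; split => // z z' zz'; apply: Phi_dep => i iL;
   apply: zz'; exact: LL'.
Qed.

Context {d1 d2 : measure_display} {O1 : measurableType d1} {O2 : measurableType d2}
  (P1 : probability O1 R) (P2 : probability O2 R)
  (Y1 : I -> O1 -> S) (Y2 : I -> O2 -> S).
Hypothesis mY1 : forall i, measurable_fun setT (Y1 i).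
Hypothesis mY2 : forall i, measurable_fun setT (Y2 i).

Definition same_law L := forall A : I -> set S, (forall i, measurable (A i)) ->
  P1 (\big[setI/setT]_(i <- L) (Y1 i @^-1` A i)) =
  P2 (\big[setI/setT]_(i <- L) (Y2 i @^-1` A i)).

Let tup (T : Type) L (Y : I -> T -> S) (w : T) : (size L).-tuple S :=
  [tuple Y (tnth (in_tuple L) i) w | i < size L].

Let mtup (d' : measure_display) (T : measurableType d') L (Y : I -> T -> S) :
  (forall i, measurable_fun setT (Y i)) -> measurable_fun setT (tup L Y).
Proof.
move=> mY; apply/measurable_fun_tnthP => i.
by rewrite (_ : _ \o _ = Y (tnth (in_tuple L) i))//; apply/funext => w /=;
   rewrite tnth_mktuple.
Qed.

(** The functional factors through the tuple of the coordinates in [L], whose two laws agree on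
    boxes and hence everywhere. Treating positive and negative parts separately gives the equality
    of the extended integrals, integrable or not. *)
Lemma same_law_integral L Phi : uniq L -> same_law L -> finitary L Phi ->
  (\int[P1]_w (Phi (Y1 ^~ w))%:E = \int[P2]_w (Phi (Y2 ^~ w))%:E)%E.
Proof.
move=> uL YY [Phi_dep Phi_meas].
(* Rebuilds a family from a tuple: coordinate [i] is read at the position of [i] in [L], and
   coordinates outside [L] get the default point. *)
pose phi (t : (size L).-tuple S) := Phi (fun i => nth point t (index i L)).
have mphi : measurable_fun setT phi.
  apply: (Phi_meas _ _ (fun i (t : (size L).-tuple S) => nth point t (index i L))) => i.
  have [iL|iL] := boolP (index i L < size L)%N.
    rewrite (_ : (fun _ => _) = fun t : (size L).-tuple S => tnth t (Ordinal iL)).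
      exact: measurable_tnth.
    by apply/funext => t; rewrite (tnth_nth point).
  rewrite (_ : (fun _ => _) = fun=> point)//; apply/funext => t.
  by rewrite nth_default// size_tuple leqNgt.
have phiE (T : Type) (Y : I -> T -> S) w : phi (tup L Y w) = Phi (Y ^~ w).
  apply: Phi_dep => i iL.
  have iL' : (index i L < size L)%N by rewrite index_mem.
  rewrite -[X in nth _ _ X]/(nat_of_ord (Ordinal iL')) -tnth_nth tnth_mktuple.
  by rewrite (tnth_nth i) /= nth_index.
have mU1 := mtup (L := L) mY1; have mU2 := mtup (L := L) mY2.
pose U1 : {RV P1 >-> (size L).-tuple S} := mfun_Sub (mem_set mU1).
pose U2 : {RV P2 >-> (size L).-tuple S} := mfun_Sub (mem_set mU2).
have U1E : (U1 : _ -> _) = tup L Y1 by [].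
have U2E : (U2 : _ -> _) = tup L Y2 by [].
have event (T : Type) (Y : I -> T -> S) (A : 'I_(size L) -> set S) :
    tup L Y @^-1` [set t | forall i, A i (tnth t i)] =
    \big[setI/setT]_(i <- L) (Y i @^-1`
      (if insub (index i L) is Some j then A j else setT)).
  apply/seteqP; split => [w /= At|w /bigsetIP /= At i].
    apply/bigsetIP => i iL /=; case: insubP => //= j _ ji; have := At j.
    by rewrite tnth_mktuple (tnth_nth i) /= ji nth_index.
  rewrite tnth_mktuple; have iL : tnth (in_tuple L) i \in L by exact: mem_tnth.
  have := At _ iL; rewrite (_ : index _ L = i).
    by rewrite insubT//= => ?; rewrite (_ : Sub _ _ = i)//; exact: val_inj.
  by rewrite (tnth_nth (tnth (in_tuple L) i)) /= index_uniq.
have UU B : measurable B -> distribution P1 U1 B = distribution P2 U2 B.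
  apply: tuple_law_unique => A mA.
  change (P1 (tup L Y1 @^-1` [set t | forall i, A i (tnth t i)]) =
          P2 (tup L Y2 @^-1` [set t | forall i, A i (tnth t i)])).
  rewrite !event; apply: YY => i.
  by case: insubP.
have pos (f : (size L).-tuple S -> \bar R) : measurable_fun setT f ->
    (forall t, 0 <= f t)%E ->
    (\int[P1]_w f (tup L Y1 w) = \int[P2]_w f (tup L Y2 w))%E.
  move=> mf f0.
  have -> : (\int[P1]_w f (tup L Y1 w) = \int[distribution P1 U1]_t f t)%E.
    by rewrite ge0_integral_distribution.
  have -> : (\int[P2]_w f (tup L Y2 w) = \int[distribution P2 U2]_t f t)%E.
    by rewrite ge0_integral_distribution.
  by apply: eq_measure_integral => B mB _; exact: UU.
have mphiE : measurable_fun setT (fun t => (phi t)%:E) by exact/measurable_EFinP.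
under eq_integral do rewrite -phiE.
under [RHS]eq_integral do rewrite -phiE.
rewrite integralE [RHS]integralE; congr (_ - _)%E.
  rewrite (eq_integral (fun w => ((fun t => (phi t)%:E)^\+)%E (tup L Y1 w))); last first.
    by move=> w _; rewrite !funeposE.
  rewrite pos//; last exact: measurable_funepos.
  by apply: eq_integral => w _; rewrite !funeposE.
rewrite (eq_integral (fun w => ((fun t => (phi t)%:E)^\-)%E (tup L Y1 w))); last first.
  by move=> w _; rewrite !funenegE.
rewrite pos//; last exact: measurable_funeneg.
by apply: eq_integral => w _; rewrite !funenegE.
Qed.

End finitary_functionals.

(** * Resampling and relabelling of independent families *)

Section independent_copies.
Context {d dS : measure_display} {O : measurableType d} {S : measurableType dS}
  {R : realType} {I : eqType} (P : probability O R) (X : I -> O -> S).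
Hypothesis mX : forall i, measurable_fun setT (X i).
Hypothesis iX : mutually_independent P X.

(* Independence: the coordinates in [A] may be resampled. *)
Definition remix (A : pred I) (i : I) (z : O * O) : S := X i (if A i then z.2 else z.1).

Lemma measurable_remix A i : measurable_fun setT (remix A i).
Proof. by rewrite /remix; case: (A i); exact: measurableT_comp. Qed.

(** On the product space the event is a rectangle with the untouched coordinates on one side and the
    resampled ones on the other. Its measure is the product that independence gives on the original
    space. *)
Lemma remix_same_law A L : uniq L -> same_law P (P \x P)%E X (remix A) L.
Proof.
move=> uL B mB.
have -> : \big[setI/setT]_(i <- L) (remix A i @^-1` B i) =
    (\big[setI/setT]_(i <- [seq i <- L | ~~ A i]) (X i @^-1` B i)) `*`
    (\big[setI/setT]_(i <- [seq i <- L | A i]) (X i @^-1` B i)).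
  apply/seteqP; split => [z /bigsetIP zB|z [/bigsetIP z1 /bigsetIP z2]].
    split; apply/bigsetIP => i; rewrite mem_filter => /andP[Ai iL];
      by have := zB _ iL; rewrite /= /remix ?Ai ?(negbTE Ai).
  apply/bigsetIP => i iL; rewrite /= /remix; case: ifPn => Ai.
    by apply: z2; rewrite mem_filter Ai.
  by apply: z1; rewrite mem_filter Ai.
have mXB i : measurable (X i @^-1` B i) by rewrite -[X in measurable X]setTI; exact: mX.
have mXBs (s : seq I) : measurable (\big[setI/setT]_(i <- s) (X i @^-1` B i)).
  exact: bigsetI_measurable.
apply: etrans (esym (product_measure1E P P (mXBs _) (mXBs _))).
have iXB (s : seq I) : uniq s -> P (\big[setI/setT]_(i <- s) (X i @^-1` B i)) =
    (\prod_(i <- s) P (X i @^-1` B i))%E by move=> us; exact: iX.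
apply: etrans (iXB _ uL) _.
rewrite (bigID A) /= muleC.
by congr (_ * _)%E; rewrite -big_filter; exact/esym/iXB/filter_uniq.
Qed.

Lemma Ex_remix A L Phi : finitary L Phi ->
  Ex P (fun w => Phi (X ^~ w)) = Ex (P \x P)%E (fun z => Phi (remix A ^~ z)).
Proof.
move=> PhiL; have PhiL' : finitary (undup L) Phi.
  by apply: finitary_sub PhiL => i; rewrite mem_undup.
by rewrite /Ex (same_law_integral mX (measurable_remix A) (undup_uniq L)
  (remix_same_law A (undup_uniq L)) PhiL').
Qed.

Lemma finitary_norm L (Phi : (I -> S) -> R) : finitary L Phi -> finitary L (fun z => `|Phi z|).
Proof.
move=> [Pd Pm]; split => [z z' zz'|d' T Y mY]; first by rewrite (Pd z z').
by apply: measurableT_comp => //; exact: Pm.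
Qed.

Lemma L1_remix A L Phi : finitary L Phi ->
  L1 P (fun w => Phi (X ^~ w)) <-> L1 (P \x P)%E (fun z => Phi (remix A ^~ z)).
Proof.
move=> PhiL; have PhiL' : finitary (undup L) (fun z => `|Phi z|).
  by apply: finitary_sub (finitary_norm PhiL) => i; rewrite mem_undup.
have H := same_law_integral mX (measurable_remix A) (undup_uniq L)
  (remix_same_law A (undup_uniq L)) PhiL'.
case: (PhiL) => _ Pm.
split => /integrableP[_ fin]; apply/integrableP; split.
- by apply/measurable_EFinP; apply: Pm; exact: measurable_remix.
- by move: fin; rewrite /= H.
- by apply/measurable_EFinP; exact: Pm.
- by move: fin; rewrite /= H.
Qed.

(** This replaces conditioning on the coordinates outside [A]: the inner expectation, over a fresh
    [w'], integrates out those in [A]. *)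
Lemma Ex_resample A L Phi : finitary L Phi -> L1 P (fun w => Phi (X ^~ w)) ->
  Ex P (fun w => Phi (X ^~ w)) =
  Ex P (fun w => Ex P (fun w' => Phi (fun i => X i (if A i then w' else w)))).
Proof.
move=> PhiL Lf; rewrite (Ex_remix A PhiL) Ex_fubini//.
exact: (L1_remix A PhiL).1.
Qed.

Hypothesis idX : forall i j A, measurable A -> P (X i @^-1` A) = P (X j @^-1` A).

Lemma reindex_same_law (f : I -> I) L : uniq L -> {in L &, injective f} ->
  same_law P P X (fun i => X (f i)) L.
Proof.
move=> uL fI B mB.
(* The constraint at index j is the intersection over the fibre of [f] above j. By injectivity the
   fibre is a single index, so no inverse of [f] has to be chosen. *)
have -> : \big[setI/setT]_(i <- L) (X (f i) @^-1` B i) =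
   \big[setI/setT]_(j <- [seq f i | i <- L])
     (X j @^-1` (\big[setI/setT]_(i <- [seq i <- L | f i == j]) B i)).
  rewrite big_map; apply: eq_big_seq => i iL /=; congr (_ @^-1` _).
  rewrite (_ : [seq _ <- L | _] = [:: i]) ?big_seq1//.
  rewrite (_ : [seq _ <- L | _] = [seq j <- L | j == i]).
    by rewrite filter_pred1_uniq.
  by apply: eq_in_filter => j jL; apply/eqP/eqP => [/fI ->//|->].
rewrite !iX ?map_inj_in_uniq//; last first.
  by move=> j _; exact: bigsetI_measurable.
rewrite big_map; apply: eq_big_seq => i iL.
rewrite (_ : [seq _ <- L | _] = [:: i]) ?big_seq1//; first exact: idX.
rewrite (_ : [seq _ <- L | _] = [seq j <- L | j == i]).
  by rewrite filter_pred1_uniq.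
by apply: eq_in_filter => j jL; apply/eqP/eqP => [/fI ->//|->].
Qed.

Lemma Ex_reindex (f : I -> I) L Phi : {in L &, injective f} -> finitary L Phi ->
  Ex P (fun w => Phi (X ^~ w)) = Ex P (fun w => Phi (fun i => X (f i) w)).
Proof.
move=> fI PhiL; rewrite /Ex (@same_law_integral _ _ _ _ _ _ _ _ P P X (fun i => X (f i))
  mX (fun i => mX (f i)) (undup L))//.
- exact: undup_uniq.
- apply: reindex_same_law; first exact: undup_uniq.
  by move=> i j; rewrite !mem_undup; exact: fI.
- by apply: finitary_sub PhiL => i; rewrite mem_undup.
Qed.

Lemma L1_reindex (f : I -> I) L Phi : {in L &, injective f} -> finitary L Phi ->
  L1 P (fun w => Phi (X ^~ w)) -> L1 P (fun w => Phi (fun i => X (f i) w)).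
Proof.
move=> fI PhiL /integrableP[_ fin].
have H : (\int[P]_w `|Phi (X ^~ w)|%:E = \int[P]_w `|Phi (fun i => X (f i) w)|%:E)%E.
  apply: (@same_law_integral _ _ _ _ _ _ _ _ P P X (fun i => X (f i))
    mX (fun i => mX (f i)) (undup L) (fun z => `|Phi z|)).
  - exact: undup_uniq.
  - apply: reindex_same_law; first exact: undup_uniq.
    by move=> i j; rewrite !mem_undup; exact: fI.
  - by apply: finitary_sub (finitary_norm PhiL) => i; rewrite mem_undup.
apply/integrableP; split; last by rewrite -H.
by case: PhiL => _ Pm; apply/measurable_EFinP; exact: Pm.
Qed.

End independent_copies.

(** * Weak convergence *)

Section expectation_limits.
Context {d : measure_display} {T : measurableType d} {R : realType}
  (P : probability T R).

Lemma Ex_dct (f_ : nat -> T -> R) (f g : T -> R) :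
  (forall n, measurable_fun setT (f_ n)) -> measurable_fun setT f ->
  L1 P g -> (forall n x, `|f_ n x| <= g x) ->
  {ae P, forall x, f_ n x @[n --> \oo] --> f x} ->
  Ex P (f_ n) @[n --> \oo] --> Ex P f.
Proof.
move=> mf_ mf Lg fg f_f.
have mE (u : T -> R) : measurable_fun setT u -> measurable_fun setT (fun x => (u x)%:E).
  by move=> mu; exact/measurable_EFinP.
have fE : {ae P, forall x, setT x -> (f_ n x)%:E @[n --> \oo] --> (f x)%:E}.
  by apply: filterS f_f => x fx _; apply: cvg_EFin => //; exact: nearW.
have gE : {ae P, forall x n, setT x -> (`|(f_ n x)%:E| <= (g x)%:E)%E}.
  by apply: aeW => x n _; rewrite lee_fin.
have [Lf _] := dominated_convergence measurableT (fun n => mE _ (mf_ n)) (mE _ mf) fE Lg gE.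
by rewrite (L1_int Lf) => /fine_cvgP[].
Qed.

End expectation_limits.

(** * Mean value and Taylor estimates *)

Section derivative_bounds.
Context {R : realType}.

Lemma is_derive_continuous (f f1 : R -> R) : (forall x : R, is_derive x 1 f (f1 x)) -> continuous f.
Proof.
move=> df x; apply: differentiable_continuous; apply/derivable1_diffP.
by case: (df x).
Qed.

Lemma derive_mvt (f f1 : R -> R) (x y : R) : (forall x : R, is_derive x 1 f (f1 x)) ->
  exists2 c, `|c - x| <= `|y - x| & f y - f x = f1 c * (y - x).
Proof.
move=> df; have cf := is_derive_continuous df.
have [xy|yx] := leP x y.
  have [c cI E] := MVT_segment xy (fun t _ => df t) (continuous_subspaceT cf).
  exists c => //; move: cI; rewrite in_itv /= => /andP[xc cy].
  by rewrite !ger0_norm ?subr_ge0// lerB.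
have [c cI E] := MVT_segment (ltW yx) (fun t _ => df t) (continuous_subspaceT cf).
exists c; last by rewrite -opprB E -mulrN opprB.
move: cI; rewrite in_itv /= => /andP[xc cy].
by rewrite !ler0_norm ?subr_le0// ?(ltW yx)// !opprB lerB.
Qed.

Lemma derive_lipschitz (f f1 : R -> R) (M : R) : (forall x : R, is_derive x 1 f (f1 x)) ->
  (forall x, `|f1 x| <= M) -> forall x y, `|f x - f y| <= M * `|x - y|.
Proof.
move=> df f1M x y; have [c _ ->] := derive_mvt y x df.
by rewrite normrM ler_wpM2r.
Qed.

(** The mean value theorem is applied to [f] and then to [f1], hence the constant M instead of M /
    2. *)
Lemma taylor2_quad (f f1 f2 : R -> R) (M : R) : (forall x : R, is_derive x 1 f (f1 x)) ->
  (forall x : R, is_derive x 1 f1 (f2 x)) -> (forall x, `|f2 x| <= M) ->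
  forall x h, `|f (x + h) - f x - f1 x * h| <= M * h ^+ 2.
Proof.
move=> df df1 f2M x h; have [c cx ->] := derive_mvt x (x + h) df.
rewrite addrAC subrr add0r in cx *.
rewrite -mulrBl normrM -(real_normK (num_real h)) expr2 mulrA.
apply: ler_wpM2r => //; apply: le_trans (derive_lipschitz df1 f2M c x) _.
by apply: ler_wpM2l => //; exact: le_trans (normr_ge0 _) (f2M 0).
Qed.

Lemma taylor2_cubic (f f1 f2 : R -> R) (K : R) : (forall x : R, is_derive x 1 f (f1 x)) ->
  (forall x : R, is_derive x 1 f1 (f2 x)) ->
  (forall x y, `|f2 x - f2 y| <= K * `|x - y|) ->
  forall x h, `|f (x + h) - f x - f1 x * h - f2 x * h ^+ 2 / 2| <= K * `|h| ^+ 3.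
Proof.
move=> df df1 f2K x h.
(* Up to the constant f x, this is the second-order remainder as a function of y. The mean value
   theorem for [g] and then for [f1] leaves a difference of two values of [f2]. *)
pose g y := f y - f1 x * (y - x) - f2 x * (y - x) ^+ 2 / 2.
have dg (y : R) : is_derive y 1 g (f1 y - f1 x - f2 x * (y - x)).
  have dl : is_derive y 1 (fun y => y - x) (1 : R).
    by have := is_deriveB (is_derive_id y (1 : R)) (is_derive_cst x y (1 : R));
       rewrite subr0.
  have := is_deriveB (is_deriveB (df y) (is_deriveZ (f1 x) dl))
    (is_deriveZ (f2 x / 2) (is_deriveM dl dl)).
  rewrite (_ : _ - _ - _ = g); last first.
    by apply/funext => t; rewrite /g /=; rewrite !fctE /= /GRing.scale /=; ring.
  by move=> h1; apply: is_derive_eq; rewrite /GRing.scale /=; field.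
have [c cx E] := derive_mvt x (x + h) dg.
have -> : f (x + h) - f x - f1 x * h - f2 x * h ^+ 2 / 2 = g (x + h) - g x.
  by rewrite /g; ring.
rewrite E addrAC subrr add0r in cx *.
have [e ex E1] := derive_mvt x c df1.
rewrite E1 -mulrBl !normrM.
have K0 : 0 <= K.
  by have := le_trans (normr_ge0 _) (f2K 1 0); rewrite subr0 normr1 mulr1.
rewrite (_ : K * _ = K * `|h| * `|h| * `|h|); last by ring.
apply: ler_pM => //; apply: ler_pM => //.
by apply: le_trans (f2K _ _) _; apply: ler_wpM2l => //; exact: le_trans cx.
Qed.

End derivative_bounds.

(** * Smoothing by moving averages *)

Section smoothing.
Context {R : realType}.
Implicit Types (f : R -> R).
Local Notation mu := (@lebesgue_measure R).

Definition moving_average (e : R) f (x : R) : R :=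
  e^-1 * \int[mu]_(t in `[x, x + e]) f t.

Lemma continuous_integrable_itv f (a b : R) : continuous f ->
  mu.-integrable `[a, b] (EFin \o f).
Proof.
move=> cf; apply: continuous_compact_integrable; first exact: segment_compact.
exact: continuous_subspaceT.
Qed.

Lemma is_derive_moving_average (e : R) f (x : R) : 0 < e -> continuous f ->
  is_derive x 1 (moving_average e f) (e^-1 * (f (x + e) - f x)).
Proof.
(* A base point strictly to the left of x: both ends of the window become integrals from [a],
   differentiable at interior points. *)
move=> e0 cf; pose a := x - 1.
pose F y := \int[mu]_(t in [set` Interval (BLeft a) (BRight y)]) f t.
have dF (y : R) : a < y -> is_derive y 1 F (f y).
  move=> ay.
  have yy1 : y < y + 1 by rewrite ltrDl.
  have [|dFy Fy] := continuous_FTC1 yy1 (continuous_integrable_itv a (y + 1) cf) _ (cf y).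
    by rewrite lte_fin.
  by apply: DeriveDef; [exact: dFy|rewrite -Fy derive1E].
have ax : a < x by rewrite /a ltrBlDr ltrDl.
have E : \forall y \near x, e^-1 * (F (y + e) - F y) = moving_average e f y.
  near=> y; congr (_ * _).
  have ay : a < y by near: y; exact: lt_nbhsr.
  rewrite /F Rintegral_itvB.
  - rewrite Rintegral_itv_obnd_cbnd//.
    have iy := continuous_integrable_itv y (y + e) cf.
    by apply: integrableS iy => //; exact: subset_itv_oc_cc.
  - exact: continuous_integrable_itv.
  - by rewrite bnd_simp ltW.
  - by rewrite bnd_simp lerDl ltW.
apply: near_eq_is_derive E _.
have d1 : is_derive x 1 (fun y => F (y + e)) (f (x + e)).
  have ds : is_derive x 1 (fun y => y + e) (1 : R).
    by have := is_deriveD (is_derive_id x (1 : R)) (is_derive_cst e x (1 : R)); rewrite addr0.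
  have := @is_derive1_comp R F (fun y => y + e) x _ _ (dF (x + e) _) ds.
  by rewrite mulr1; apply; rewrite (lt_trans ax)// ltrDl.
exact: (is_deriveZ e^-1 (is_deriveB d1 (dF x ax))).
Unshelve. all: by end_near. Qed.

Lemma moving_average_between (e m M : R) f : 0 < e -> continuous f -> forall x : R,
  (forall y : R, x <= y <= x + e -> m <= f y <= M) -> m <= moving_average e f x <= M.
Proof.
move=> e0 cf x mfM.
have xe : x < x + e by rewrite ltrDl.
have int_cst (c : R) : \int[mu]_(t in `[x, x + e]) c = c * e.
  rewrite Rintegral_cst//; congr (_ * _).
  have := lebesgue_measure_itv (`[x, x + e] : interval R).
  by rewrite /= lte_fin xe => /(congr1 fine) E; apply: etrans E _; rewrite /= addrAC subrr add0r.
have intc (c : R) : mu.-integrable `[x, x + e] (EFin \o (fun=> c)).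
  by apply: continuous_integrable_itv => y; exact: cvg_cst.
have intf := continuous_integrable_itv x (x + e) cf.
apply/andP; split; rewrite /moving_average mulrC.
  rewrite ler_pdivlMr// -int_cst; apply: le_Rintegral => // y /=.
  by rewrite in_itv /= => /mfM /andP[].
rewrite ler_pdivrMr// -int_cst; apply: le_Rintegral => // y /=.
by rewrite in_itv /= => /mfM /andP[].
Qed.

Lemma moving_average_near (e K : R) f : 0 < e -> continuous f ->
  (forall x y, `|f x - f y| <= K * `|x - y|) ->
  forall x, `|moving_average e f x - f x| <= K * e.
Proof.
move=> e0 cf fK x.
have K0 : 0 <= K by have := le_trans (normr_ge0 _) (fK 1 0); rewrite subr0 normr1 mulr1.
rewrite ler_distl; apply: moving_average_between => // y /andP[xy ye].
rewrite -ler_distl (le_trans (fK _ _))// ler_wpM2l//.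
by rewrite ger0_norm ?subr_ge0// lerBlDl.
Qed.

Lemma moving_average_bnd (e M : R) f : 0 < e -> continuous f ->
  (forall x, `|f x| <= M) -> forall x, `|moving_average e f x| <= M.
Proof.
by move=> e0 cf fM x; rewrite ler_norml; apply: moving_average_between => // y _;
   rewrite -ler_norml.
Qed.

(** This is exactly the regularity that two moving averages give to a bounded Lipschitz function. A
    Lipschitz second derivative takes the place of a bounded third one and is enough for a cubic
    Taylor remainder. *)
Definition smooth (f : R -> R) : Prop := exists f1 f2 : R -> R, exists M : R,
  [/\ forall x : R, is_derive x 1 f (f1 x), forall x : R, is_derive x 1 f1 (f2 x) &
   [/\ forall x, `|f x| <= M, forall x, `|f1 x| <= M, forall x, `|f2 x| <= M &
    forall x y, `|f2 x - f2 y| <= M * `|x - y|]].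

Lemma lipschitz_continuous f (K : R) :
  (forall x y, `|f x - f y| <= K * `|x - y|) -> continuous f.
Proof.
move=> fK x; apply/cvgrPdist_le => e e0.
have K0 : 0 <= K by have := le_trans (normr_ge0 _) (fK 1 0); rewrite subr0 normr1 mulr1.
near=> y; rewrite (le_trans (fK _ _))//.
have : `|x - y| <= e / (K + 1).
  by near: y; apply: cvgr_dist_le => //; rewrite divr_gt0// ltr_wpDl.
rewrite ler_pdivlMr ?ltr_wpDl// mulrDr mulr1 mulrC; have := normr_ge0 (x - y); lra.
Unshelve. all: by end_near. Qed.

Lemma lipschitz_smooth_approx f (K M e : R) : 0 < e ->
  (forall x y, `|f x - f y| <= K * `|x - y|) -> (forall x, `|f x| <= M) ->
  exists2 g, smooth g & forall x, `|g x - f x| <= e.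
Proof.
move=> e0 fK fM; have cf := lipschitz_continuous fK.
have K0 : 0 <= K by have := le_trans (normr_ge0 _) (fK 1 0); rewrite subr0 normr1 mulr1.
have M0 : 0 <= M by exact: le_trans (normr_ge0 _) (fM 0).
(* Each of the two averages moves a K-Lipschitz function by at most K h, and 2 K h <= e. *)
pose h := e / (2 * (K + 1)).
have h0 : 0 < h by rewrite divr_gt0// mulr_gt0// ltr_wpDl.
pose g := moving_average h f; pose g1 x := h^-1 * (f (x + h) - f x).
have dg (x : R) : is_derive x 1 g (g1 x) by exact: is_derive_moving_average.
have g1K x : `|g1 x| <= K.
  rewrite /g1 normrM ger0_norm; last by rewrite invr_ge0 ltW.
  rewrite ler_pdivrMl// mulrC.
  by rewrite (le_trans (fK _ _))// addrAC subrr add0r gtr0_norm.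
have gK := derive_lipschitz dg g1K.
have cg := is_derive_continuous dg.
exists (moving_average h g); last first.
  move=> x; have := moving_average_near h0 cg gK x; have := moving_average_near h0 cf fK x.
  have -> : moving_average h g x - f x = (moving_average h g x - g x) + (g x - f x) by ring.
  move=> H1 H2; rewrite (le_trans (ler_normD _ _))// (le_trans (lerD H2 H1))//.
  rewrite -mulr2n -mulr_natl mulrA /h mulrCA mulrA.
  rewrite ler_pdivrMr ?mulr_gt0 ?ltr_wpDl//; nra.
pose G1 x := h^-1 * (g (x + h) - g x); pose G2 x := h^-1 * (g1 (x + h) - g1 x).
have dgh (x : R) : is_derive x 1 (fun y => g (y + h)) (g1 (x + h)).
  have ds : is_derive x 1 (fun y => y + h) (1 : R).
    by have := is_deriveD (is_derive_id x (1 : R)) (is_derive_cst h x (1 : R)); rewrite addr0.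
  by have := @is_derive1_comp R g (fun y => y + h) x _ _ (dg (x + h)) ds; rewrite mulr1.
have h'0 : 0 <= h^-1 by rewrite invr_ge0 ltW.
have g1L x y : `|g1 x - g1 y| <= h^-1 * (2 * K) * `|x - y|.
  rewrite /g1 -mulrBr normrM ger0_norm// -mulrA ler_wpM2l//.
  have -> : f (x + h) - f x - (f (y + h) - f y) = (f (x + h) - f (y + h)) - (f x - f y) by ring.
  rewrite (le_trans (ler_normB _ _))//; have := fK (x + h) (y + h); have := fK x y.
  have -> : x + h - (y + h) = x - y by ring.
  lra.
exists G1, G2, (M + K + h^-1 * (2 * K) + h^-1 * (h^-1 * (2 * K)) *+ 2).
have a1 : 0 <= h^-1 * (2 * K) by rewrite mulr_ge0// mulr_ge0.
have a2 : 0 <= h^-1 * (h^-1 * (2 * K)) by rewrite mulr_ge0.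
split.
- by move=> x; exact: is_derive_moving_average.
- move=> x; exact: (is_deriveZ h^-1 (is_deriveB (dgh x) (dg x))).
split.
- move=> x; apply: le_trans (moving_average_bnd h0 cg (moving_average_bnd h0 cf fM) x) _.
  rewrite -mulr_natl; lra.
- move=> x; rewrite normrM ger0_norm//; apply: le_trans (_ : K <= _); last first.
    rewrite -mulr_natl; lra.
  rewrite ler_pdivrMl// mulrC (le_trans (gK _ _))// addrAC subrr add0r gtr0_norm//.
- move=> x; rewrite normrM ger0_norm//; apply: le_trans (_ : h^-1 * (2 * K) <= _); last first.
    rewrite -mulr_natl; lra.
  rewrite ler_wpM2l// (le_trans (ler_normB _ _))//; have := g1K (x + h); have := g1K x; lra.
- move=> x y; rewrite -mulrBr normrM ger0_norm//.
  have -> : g1 (x + h) - g1 x - (g1 (y + h) - g1 y) =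
    (g1 (x + h) - g1 (y + h)) - (g1 x - g1 y) by ring.
  apply: le_trans (_ : h^-1 * (h^-1 * (2 * K) *+ 2 * `|x - y|) <= _).
    rewrite ler_wpM2l// (le_trans (ler_normB _ _))//.
    have := g1L (x + h) (y + h); have -> : x + h - (y + h) = x - y by ring.
    have := g1L x y; rewrite mulr2n mulrDl; lra.
  move: a1 a2; set A := h^-1 * (2 * K) => a1 a2.
  have -> : h^-1 * (A *+ 2 * `|x - y|) = h^-1 * A *+ 2 * `|x - y|.
    by rewrite mulrA mulrnAr.
  by rewrite ler_wpM2r// lerDr !addr_ge0.
Qed.

End smoothing.

(** * Reduction of weak convergence to smooth test functions *)

Section portmanteau.
Context {d d' : measure_display} {O : measurableType d} {O' : measurableType d'}
  {R : realType} (P : probability O R) (P' : probability O' R)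
  (Y : nat -> O -> R) (Z : O' -> R).
Hypothesis mY : forall k, measurable_fun setT (Y k).
Hypothesis mZ : measurable_fun setT Z.

Let mcomp (dT : measure_display) (T : measurableType dT) (f : R -> R) (V : T -> R) :
  continuous f -> measurable_fun setT V -> measurable_fun setT (fun w => f (V w)).
Proof.
by move=> cf mV; apply: measurableT_comp => //; exact: continuous_measurable_fun.
Qed.

(* The inf-convolutions of [f] with [j * |x|] are Lipschitz and increase to [f]. *)
Let infconv (f : R -> R) (j : nat) (x : R) : R :=
  inf [set f y + j%:R * `|x - y| | y in setT].

(** Each Lipschitz minorant of [f] gives an asymptotic lower bound for the expectations of f (Y k).
    Letting the minorant increase to [f] only uses dominated convergence under the limit law, so no
    tightness of [Y] enters. The upper bound is the lower bound for - f. *)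
Lemma cvg_in_dist_lipschitz :
  (forall (f : R -> R) (K M : R), (forall x y, `|f x - f y| <= K * `|x - y|) ->
     (forall x, `|f x| <= M) ->
     Ex P (fun w => f (Y k w)) @[k --> \oo] --> Ex P' (fun w => f (Z w))) ->
  cvg_in_dist P Y P' Z.
Proof.
move=> lip f cf [M fM].
have lower (g : R -> R) : continuous g -> (forall x, `|g x| <= M) -> forall e : R, 0 < e ->
    \forall k \near \oo, Ex P' (fun w => g (Z w)) - e <= Ex P (fun w => g (Y k w)).
  move=> cg gM e e0.
  have nz j x : [set g y + j%:R * `|x - y| | y in setT] !=set0.
    by exists (g x + j%:R * `|x - x|); exists x.
  have lbd j x : lbound [set g y + j%:R * `|x - y| | y in setT] (- M).
    move=> _ [y _ <-]; have := gM y; rewrite ler_norml => /andP[h _].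
    by rewrite (le_trans h)// lerDl mulr_ge0.
  have hlb j x : has_lbound [set g y + j%:R * `|x - y| | y in setT].
    by exists (- M); exact: lbd.
  have le_g j x : infconv g j x <= g x.
    by apply: ge_inf => //; exists x => //; rewrite subrr normr0 mulr0 addr0.
  have ge_M j x : - M <= infconv g j x by exact: lb_le_inf.
  have bnd j x : `|infconv g j x| <= M.
    rewrite ler_norml ge_M/= (le_trans (le_g j x))//.
    by have := gM x; rewrite ler_norml => /andP[].
  have half j x y : infconv g j x - j%:R * `|x - y| <= infconv g j y.
    apply: lb_le_inf => // _ [t _ <-]; rewrite lerBlDr.
    apply: le_trans (_ : g t + j%:R * `|x - t| <= _); first by apply: ge_inf => //; exists t.
    rewrite -addrA lerD2l -mulrDr ler_wpM2l//.
    by rewrite (le_trans _ (ler_normD _ _))// [leRHS](_ : _ = `|x - t|)//; congr (`|_|); ring.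
  have lipg j x y : `|infconv g j x - infconv g j y| <= j%:R * `|x - y|.
    rewrite ler_norml; have := half j x y; have := half j y x; rewrite distrC; lra.
  have cvgj x : infconv g j x @[j --> \oo] --> g x.
    apply/cvgrPdist_le => a a0.
    have /cvgrPdist_lt /(_ a a0) := cg x.
    rewrite -nbhs_ballE => -[r /= r0 ball_r].
    have M0 : 0 <= M by exact: le_trans (normr_ge0 _) (gM 0).
    near=> j; rewrite ger0_norm ?subr_ge0// lerBlDr -lerBlDl.
    apply: lb_le_inf => // _ [y _ <-].
    (* Points closer than r have g y > g x - a by continuity; farther ones pay a penalty j r >= 2 M,
       more than g can vary. *)
    have [xy|xy] := ltP `|x - y| r.
      have := ball_r y xy; rewrite ltr_norml => /andP[_ h].
      have : 0 <= j%:R * `|x - y| by rewrite mulr_ge0.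
      lra.
    have : 2 * M <= j%:R * r.
      by rewrite -ler_pdivrMr//; near: j; exact: nbhs_infty_ger.
    have : j%:R * r <= j%:R * `|x - y| by rewrite ler_wpM2l.
    have := gM x; have := gM y; rewrite !ler_norml; lra.
  have clip j : continuous (infconv g j) by exact: lipschitz_continuous (lipg j).
  have cvE : Ex P' (fun w => infconv g j (Z w)) @[j --> \oo] --> Ex P' (fun w => g (Z w)).
    apply: (Ex_dct (g := fun=> M)) => //.
    - by move=> j; exact: mcomp.
    - exact: mcomp.
    - exact: L1_cst.
    - by apply: aeW => w; exact: cvgj.
  have e20 : 0 < e / 2 by rewrite divr_gt0.
  have /cvgrPdist_le /(_ _ e20) [j _ /(_ j (leqnn j)) Hj] := cvE.
  have /cvgrPdist_le /(_ _ e20) := lip _ _ _ (lipg j) (bnd j).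
  apply: filterS => k Hk.
  apply: le_trans (_ : Ex P (fun w => infconv g j (Y k w)) <= _); last first.
    apply: le_Ex => //; apply: (L1_bnd _ (M := M)) => //; exact: mcomp.
  move: Hj Hk; rewrite !ler_norml; lra.
apply/cvgrPdist_le => e e0.
have cNf : continuous (fun x => - f x) by move=> x; apply: cvgN; exact: cf.
have NfM x : `|- f x| <= M by rewrite normrN.
have := lower _ cf fM e e0; have := lower _ cNf NfM e e0.
apply: filterS2 => k h1 h2.
rewrite -!/(Ex _ _) ler_norml.
have N dT (T : measurableType dT) (Q : probability T R) (V : T -> R) :
    measurable_fun setT V -> Ex Q (fun w => - f (V w)) = - Ex Q (fun w => f (V w)).
  move=> mV; rewrite -mulN1r -ExZ; first by apply: eq_Ex => w; rewrite mulN1r.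
  by apply: (L1_bnd _ (M := M)) => //; exact: mcomp.
move: h1 h2; rewrite !N//; lra.
Unshelve. all: by end_near. Qed.

Lemma cvg_in_dist_smooth :
  (forall f : R -> R, smooth f ->
     Ex P (fun w => f (Y k w)) @[k --> \oo] --> Ex P' (fun w => f (Z w))) ->
  cvg_in_dist P Y P' Z.
Proof.
move=> sm; apply: cvg_in_dist_lipschitz => f K M fK fM.
have cf := lipschitz_continuous fK.
apply/cvgrPdist_le => e e0.
have e30 : 0 < e / 3 by rewrite divr_gt0.
have [g sg gf] := lipschitz_smooth_approx e30 fK fM.
have [g1 [g2 [N [dg _ [gN _ _ _]]]]] := sg.
have cg := is_derive_continuous dg.
have close dT (T : measurableType dT) (Q : probability T R) (V : T -> R) :
    measurable_fun setT V -> `|Ex Q (fun w => g (V w)) - Ex Q (fun w => f (V w))| <= e / 3.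
  move=> mV; have L1f : L1 Q (fun w => f (V w)).
    by apply: (L1_bnd _ (M := M)) => //; exact: mcomp.
  have L1g : L1 Q (fun w => g (V w)) by apply: (L1_bnd _ (M := N)) => //; exact: mcomp.
  by rewrite -ExB//; apply: normr_Ex_le => //; exact: L1B.
have /cvgrPdist_le /(_ _ e30) := sm g sg.
apply: filterS => k; have := close _ _ P _ (mY k); have := close _ _ P' _ mZ.
rewrite !ler_norml; lra.
Qed.

End portmanteau.

(** * Lindeberg's replacement argument *)

Lemma cvg_invsqrtn (R : realType) : (Num.sqrt n%:R)^-1 @[n --> \oo] --> (0 : R).
Proof.
apply/cvgrPdist_le => e e0; near=> n.
have en : e^-1 <= Num.sqrt n%:R.
  have e'0 : 0 <= e^-1 by rewrite invr_ge0 ltW.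
  rewrite -(ger0_norm e'0) -sqrtr_sqr ler_wsqrtr//.
  by near: n; exact: nbhs_infty_ger.
have s0 : 0 < Num.sqrt n%:R :> R by apply: lt_le_trans en; rewrite invr_gt0.
by rewrite sub0r normrN ger0_norm ?invr_ge0// -[e]invrK lef_pV2// posrE invr_gt0.
Unshelve. all: by end_near. Qed.

(** * Second-order expansion of the test functions *)

Section test_functions.
Context {R : realType} (J : nat) (M : R).
Variables (f f1 f2 : R -> R) (theta theta1 theta2 : nat -> R -> R).
Hypothesis df : forall x : R, is_derive x 1 f (f1 x).
Hypothesis df1 : forall x : R, is_derive x 1 f1 (f2 x).
Hypothesis f_bnd : forall x, `|f x| <= M.
Hypothesis f1_bnd : forall x, `|f1 x| <= M.
Hypothesis f2_bnd : forall x, `|f2 x| <= M.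
Hypothesis f2_lip : forall x y, `|f2 x - f2 y| <= M * `|x - y|.
Hypothesis dtheta : forall l (x : R), is_derive x 1 (theta l) (theta1 l x).
Hypothesis dtheta1 : forall l (x : R), is_derive x 1 (theta1 l) (theta2 l x).
Hypothesis theta1_bnd : forall l x, `|theta1 l x| <= M.
Hypothesis theta2_bnd : forall l x, `|theta2 l x| <= M.
Hypothesis theta2_lip : forall l x y, `|theta2 l x - theta2 l y| <= M * `|x - y|.

Definition ridge (r : nat -> R) : R := f (\sum_(l < J) theta l (r l)).

Definition ridge_grad (r : nat -> R) (l : nat) : R :=
  f1 (\sum_(l < J) theta l (r l)) * theta1 l (r l).

(** Half of the Hessian matrix, so that the second-order Taylor term is a plain double sum. The
    second derivatives of the [theta l] occur on the diagonal only. *)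
Definition ridge_hess (r : nat -> R) (l m : nat) : R :=
  (if l == m then f1 (\sum_(l < J) theta l (r l)) * theta2 l (r l) / 2 else 0) +
  f2 (\sum_(l < J) theta l (r l)) / 2 * (theta1 l (r l) * theta1 m (r m)).

Definition norm1 (v : nat -> R) : R := \sum_(l < J) `|v l|.

Let M0 : 0 <= M.
Proof. exact: le_trans (normr_ge0 _) (f_bnd 0). Qed.

Lemma norm1_ge0 v : 0 <= norm1 v.
Proof. exact: sumr_ge0. Qed.

Lemma norm1_pow_le (v : nat -> R) n : \sum_(l < J) `|v l| ^+ n.+1 <= norm1 v ^+ n.+1.
Proof.
have vN (l : 'I_J) : `|v l| <= norm1 v.
  by rewrite /norm1 (bigD1 l)//= lerDl sumr_ge0.
rewrite [leRHS]exprS [X in X * _]/norm1 mulr_suml; apply: ler_sum => l _.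
by rewrite exprS ler_wpM2l// lerXn2r// nnegrE norm1_ge0.
Qed.

Lemma ridge_hess_sum (r v : nat -> R) : \sum_(l < J) \sum_(m < J) ridge_hess r l m * (v l * v m) =
  f1 (\sum_(l < J) theta l (r l)) * (\sum_(l < J) theta2 l (r l) * v l ^+ 2 / 2) +
  f2 (\sum_(l < J) theta l (r l)) * (\sum_(l < J) theta1 l (r l) * v l) ^+ 2 / 2.
Proof.
set t := \sum_(l < J) theta l (r l).
rewrite mulr_sumr expr2 mulr_suml mulr_sumr mulr_suml -big_split /=.
apply: eq_bigr => l _; rewrite mulr_sumr mulr_sumr mulr_suml.
rewrite (eq_bigr (fun m : 'I_J => (if l == m then f1 t * theta2 l (r l) / 2 * v l ^+ 2 else 0) +
   f2 t * (theta1 l (r l) * v l * (theta1 m (r m) * v m)) / 2)).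
  rewrite big_split /=; congr (_ + _).
  by rewrite -big_mkcond (big_pred1 l)/=; [ring|move=> m; rewrite eq_sym].
move=> m _; rewrite /ridge_hess -/t -val_eqE /=; case: eqP => [/val_inj->|_].
  by ring.
by ring.
Qed.

(** Both powers are needed: with second moments only, the square serves as integrable bound, while
    the cube supplies the gain of n^(-1/2). *)
Lemma ridge_taylor : exists2 C : R, 0 <= C & forall r v : nat -> R,
  `|ridge (fun l => r l + v l) - ridge r - \sum_(l < J) ridge_grad r l * v l -
    \sum_(l < J) \sum_(m < J) ridge_hess r l m * (v l * v m)| <=
  C * Num.min (norm1 v ^+ 2) (norm1 v ^+ 3).
Proof.
(* A common bound for the constants of the two branches, 2 M^3 + 2 M^2 for the square and M^4 + M^3
   + M^2 for the cube. *)
exists (M ^+ 4 + 4 * M ^+ 3 + 4 * M ^+ 2) => [|r v].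
  by rewrite !addr_ge0// ?mulr_ge0// exprn_ge0.
rewrite ridge_hess_sum.
set t := \sum_(l < J) theta l (r l); set N := norm1 v.
have N0 : 0 <= N := norm1_ge0 v.
(* [D] is the increment of the inner sum; [a] and [b] are its first- and second-order parts. *)
pose D := \sum_(l < J) (theta l (r l + v l) - theta l (r l)).
pose a := \sum_(l < J) theta1 l (r l) * v l.
pose b := \sum_(l < J) theta2 l (r l) * v l ^+ 2 / 2.
have tD : \sum_(l < J) theta l (r l + v l) = t + D.
  by rewrite /D /t -big_split/=; apply: eq_bigr => l _; ring.
have gradE : \sum_(l < J) ridge_grad r l * v l = f1 t * a.
  by rewrite /a mulr_sumr; apply: eq_bigr => l _; rewrite /ridge_grad mulrA.
rewrite /ridge tD gradE -/t -/a -/b.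
have sumb (g : 'I_J -> R) n : (forall l, `|g l| <= M * `|v l| ^+ n.+1) ->
    `|\sum_l g l| <= M * N ^+ n.+1.
  move=> gM; apply: le_trans (ler_norm_sum _ _ _) _.
  apply: le_trans (_ : \sum_(l < J) M * `|v l| ^+ n.+1 <= _); first exact: ler_sum.
  by rewrite -mulr_sumr ler_wpM2l// norm1_pow_le.
have HD : `|D| <= M * N.
  apply: (sumb _ 0%N) => l; rewrite expr1.
  have := derive_lipschitz (dtheta l) (theta1_bnd l) (r l + v l) (r l).
  by rewrite addrAC subrr add0r.
have Ha : `|a| <= M * N.
  by apply: (sumb _ 0%N) => l; rewrite expr1 normrM ler_wpM2r.
have Hb : `|b| <= M * N ^+ 2.
  apply: (sumb _ 1%N) => l; rewrite normrM normrM normrX [`|2^-1|]ger0_norm ?invr_ge0//.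
  have h1 := theta2_bnd l (r l); have h2 : 0 <= `|v l| ^+ 2 by rewrite exprn_ge0.
  have h3 : `|theta2 l (r l)| * `|v l| ^+ 2 <= M * `|v l| ^+ 2 by rewrite ler_wpM2r.
  have h4 : 0 <= M * `|v l| ^+ 2 by rewrite mulr_ge0.
  lra.
have HDa : `|D - a| <= M * N ^+ 2.
  rewrite /D /a -sumrB; apply: (sumb _ 1%N) => l.
  rewrite real_normK ?num_real//.
  exact: (taylor2_quad (dtheta l) (dtheta1 l) (theta2_bnd l)).
have HDab : `|D - a - b| <= M * N ^+ 3.
  rewrite /D /a /b -!sumrB; apply: (sumb _ 2%N) => l.
  exact: (taylor2_cubic (dtheta l) (dtheta1 l) (theta2_lip l)).
have Hf2 := taylor2_quad df df1 f2_bnd t D.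
have Hf3 := taylor2_cubic df df1 f2_lip t D.
have MN0 : 0 <= M * N by rewrite mulr_ge0.
have D2 : D ^+ 2 <= (M * N) ^+ 2.
  by rewrite -(real_normK (num_real D)) lerXn2r// nnegrE.
have a2 : a ^+ 2 <= (M * N) ^+ 2.
  by rewrite -(real_normK (num_real a)) lerXn2r// nnegrE.
have D3 : `|D| ^+ 3 <= (M * N) ^+ 3 by rewrite lerXn2r// nnegrE.
rewrite minEle; case: ifP => _.
- have -> : f (t + D) - f t - f1 t * a - (f1 t * b + f2 t * a ^+ 2 / 2) =
      (f (t + D) - f t - f1 t * D) + f1 t * (D - a) - f1 t * b - f2 t * a ^+ 2 / 2 by ring.
  have e1 : `|f1 t * (D - a)| <= M * (M * N ^+ 2) by rewrite normrM ler_pM.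
  have e2 : `|f1 t * b| <= M * (M * N ^+ 2) by rewrite normrM ler_pM.
  have e3 : `|f2 t * a ^+ 2 / 2| <= M * (M * N) ^+ 2.
    have a20 := sqr_ge0 a.
    rewrite normrM (normrM (f2 t)) [`|2^-1|]ger0_norm ?invr_ge0// (ger0_norm a20).
    have h3 : `|f2 t| * a ^+ 2 <= M * (M * N) ^+ 2 by rewrite ler_pM.
    have h4 : 0 <= `|f2 t| * a ^+ 2 by rewrite mulr_ge0.
    lra.
  have e0 : `|f (t + D) - f t - f1 t * D| <= M * (M * N) ^+ 2.
    by apply: le_trans Hf2 _; rewrite ler_wpM2l.
  apply: le_trans (_ : M * (M * N) ^+ 2 + M * (M * N ^+ 2) + M * (M * N ^+ 2) +
      M * (M * N) ^+ 2 <= _).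
    apply: le_trans (ler_normB _ _) _; apply: lerD => //.
    apply: le_trans (ler_normB _ _) _; apply: lerD => //.
    by apply: le_trans (ler_normD _ _) _; apply: lerD.
  have -> : M * (M * N) ^+ 2 + M * (M * N ^+ 2) + M * (M * N ^+ 2) + M * (M * N) ^+ 2 =
    (2 * M ^+ 3 + 2 * M ^+ 2) * N ^+ 2 by ring.
  apply: ler_wpM2r; first exact: exprn_ge0.
  have := exprn_ge0 4 M0; have := exprn_ge0 3 M0; have := exprn_ge0 2 M0; lra.
(* In the cubic branch the quadratic term is taken at D, and D^2 - a^2 = (D - a)(D + a) is a product
   of factors of orders 2 and 1. *)
- have -> : f (t + D) - f t - f1 t * a - (f1 t * b + f2 t * a ^+ 2 / 2) =
      (f (t + D) - f t - f1 t * D - f2 t * D ^+ 2 / 2) + f1 t * (D - a - b) +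
      f2 t * ((D - a) * (D + a)) / 2 by field.
  have e0 : `|f (t + D) - f t - f1 t * D - f2 t * D ^+ 2 / 2| <= M * (M * N) ^+ 3.
    by apply: le_trans Hf3 _; rewrite ler_wpM2l.
  have e1 : `|f1 t * (D - a - b)| <= M * (M * N ^+ 3) by rewrite normrM ler_pM.
  have e2 : `|f2 t * ((D - a) * (D + a)) / 2| <= M * (M * N ^+ 2 * (M * N)).
    have Da : `|D + a| <= M * N + M * N by apply: le_trans (ler_normD _ _) _; apply: lerD.
    rewrite !normrM [`|2^-1|]ger0_norm ?invr_ge0//.
    have h1 : `|D - a| * `|D + a| <= M * N ^+ 2 * (M * N + M * N) by rewrite ler_pM.
    have h3 : `|f2 t| * (`|D - a| * `|D + a|) <= M * (M * N ^+ 2 * (M * N + M * N)).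
      by rewrite ler_pM// mulr_ge0.
    lra.
  apply: le_trans (_ : M * (M * N) ^+ 3 + M * (M * N ^+ 3) + M * (M * N ^+ 2 * (M * N)) <= _).
    apply: le_trans (ler_normD _ _) _; apply: lerD => //.
    by apply: le_trans (ler_normD _ _) _; apply: lerD.
  have -> : M * (M * N) ^+ 3 + M * (M * N ^+ 3) + M * (M * N ^+ 2 * (M * N)) =
    (M ^+ 4 + M ^+ 2 + M ^+ 3) * N ^+ 3 by ring.
  apply: ler_wpM2r; first exact: exprn_ge0.
  have := exprn_ge0 4 M0; have := exprn_ge0 3 M0; have := exprn_ge0 2 M0; lra.
Qed.

Lemma measurable_ridge d (T : measurableType d) (y : nat -> T -> R) :
  (forall l, (l < J)%N -> measurable_fun setT (y l)) ->
  measurable_fun setT (fun w => ridge (y ^~ w)).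
Proof.
move=> my; apply: measurableT_comp.
  by apply: continuous_measurable_fun; exact: (is_derive_continuous df).
apply: measurable_sum => l; apply: measurableT_comp (my _ (ltn_ord l)).
by apply: continuous_measurable_fun; exact: (is_derive_continuous (dtheta l)).
Qed.

Lemma ridge_bnd r : `|ridge r| <= M.
Proof. exact: f_bnd. Qed.

Section one_replacement.
Context {d d' : measure_display} {O : measurableType d} {O' : measurableType d'}
  (P : probability O R) (P' : probability O' R)
  (V : nat -> O -> R) (W : nat -> O' -> R).
Hypothesis L2V : forall l, (l < J)%N -> L2 P (V l).
Hypothesis L2W : forall l, (l < J)%N -> L2 P' (W l).
Hypothesis meanV : forall l, (l < J)%N -> Ex P (V l) = 0.
Hypothesis meanW : forall l, (l < J)%N -> Ex P' (W l) = 0.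
Hypothesis covVW : forall l m, (l < J)%N -> (m < J)%N ->
  Ex P (fun w => V l w * V m w) = Ex P' (fun w => W l w * W m w).

Let rem dT (T : measurableType dT) (Q : probability T R) (U : nat -> T -> R) (c : R) :=
  Ex Q (fun w => Num.min ((c * norm1 (U ^~ w)) ^+ 2) ((c * norm1 (U ^~ w)) ^+ 3)).

Lemma L1_rem dT (T : measurableType dT) (Q : probability T R) (U : nat -> T -> R) (c : R) :
  0 <= c -> (forall l, (l < J)%N -> L2 Q (U l)) ->
  L1 Q (fun w => Num.min ((c * norm1 (U ^~ w)) ^+ 2) ((c * norm1 (U ^~ w)) ^+ 3)).
Proof.
move=> c0 LU; have LN : L2 Q (fun w => c * norm1 (U ^~ w)).
  by apply: L2Z; apply: L2_sum => l _; apply: L2_norm; exact: LU.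
have mN := L2_measurable LN; case: (LN) => _ LN2.
apply: L1_dom LN2 => [|w].
  by apply: measurable_minr; exact: measurable_funX.
have N0 : 0 <= c * norm1 (U ^~ w) by rewrite mulr_ge0// norm1_ge0.
by rewrite ger0_norm ?ge_min ?lexx// le_min !exprn_ge0.
Qed.

(** In expectation the gradient term vanishes because [U] is centred, and the Hessian term sees [U]
    through its covariances alone. Two vectors with equal covariances therefore differ by remainders
    only. *)
Lemma ridge_expansion (C : R) dT (T : measurableType dT) (Q : probability T R)
    (U : nat -> T -> R) (c : R) (r : nat -> R) :
  0 <= c -> (forall l, (l < J)%N -> L2 Q (U l)) ->
  (forall l, (l < J)%N -> Ex Q (U l) = 0) ->
  (forall r v : nat -> R,
    `|ridge (fun l => r l + v l) - ridge r - \sum_(l < J) ridge_grad r l * v l -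
      \sum_(l < J) \sum_(m < J) ridge_hess r l m * (v l * v m)| <=
    C * Num.min (norm1 v ^+ 2) (norm1 v ^+ 3)) ->
  `|Ex Q (fun w => ridge (fun l => r l + c * U l w)) - ridge r -
    c ^+ 2 * \sum_(l < J) \sum_(m < J) ridge_hess r l m * Ex Q (fun w => U l w * U m w)|
  <= C * rem Q U c.
Proof.
move=> c0 LU EU HC.
have L1F : L1 Q (fun w => ridge (fun l => r l + c * U l w)).
  apply: (L1_bnd _ (M := M)) => [|w]; last exact: ridge_bnd.
  apply: measurable_ridge => l lJ; apply: measurable_funD => //.
  by apply: measurable_funM => //; exact: L2_measurable (LU l lJ).
have L1G : L1 Q (fun w => \sum_(l < J) ridge_grad r l * (c * U l w)).
  by apply: L1_sum => l _; apply: L1Z; apply: L1Z; exact/L2_L1/LU.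
have L1H : L1 Q (fun w => \sum_(l < J) \sum_(m < J)
    ridge_hess r l m * (c * U l w * (c * U m w))).
  apply: L1_sum => l _; apply: L1_sum => m _; apply: L1Z.
  by apply: L2M; apply: L2Z; exact: LU.
have -> : Ex Q (fun w => ridge (fun l => r l + c * U l w)) - ridge r -
    c ^+ 2 * \sum_(l < J) \sum_(m < J) ridge_hess r l m * Ex Q (fun w => U l w * U m w) =
  Ex Q (fun w => ridge (fun l => r l + c * U l w) - ridge r -
    \sum_(l < J) ridge_grad r l * (c * U l w) -
    \sum_(l < J) \sum_(m < J) ridge_hess r l m * (c * U l w * (c * U m w))).
  have L1c := L1_cst Q (ridge r).
  rewrite !ExB//; [|exact: L1B|exact: L1B (L1B L1F L1c) L1G].
  rewrite Ex_cst [X in _ = _ - X - _]Ex_sum; last first.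
    by move=> l _; apply: L1Z; apply: L1Z; exact/L2_L1/LU.
  rewrite [X in _ = _ - X - _]big1 ?subr0; last first.
    move=> l _; rewrite ExZ ?ExZ ?EU ?mulr0//; first exact/L2_L1/LU.
    by apply: L1Z; exact/L2_L1/LU.
  congr (_ - _); rewrite Ex_sum; last first.
    by move=> l _; apply: L1_sum => m _; apply: L1Z; apply: L2M; apply: L2Z; exact: LU.
  rewrite mulr_sumr; apply: eq_bigr => l _; rewrite Ex_sum; last first.
    by move=> m _; apply: L1Z; apply: L2M; apply: L2Z; exact: LU.
  rewrite mulr_sumr; apply: eq_bigr => m _.
  rewrite -!ExZ; first by apply: eq_Ex => w; ring.
  - by apply: L1Z; apply: L2M; exact: LU.
  - by apply: L2M; exact: LU.
apply: le_trans (normr_Ex _) _; first by apply: L1B => //; apply: L1B => //; apply: L1B => //; exact: L1_cst.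
rewrite /rem -ExZ; last exact: L1_rem.
apply: le_Ex.
- by apply: L1_norm; apply: L1B => //; apply: L1B => //; apply: L1B => //; exact: L1_cst.
- by apply: L1Z; exact: L1_rem.
- move=> w; apply: le_trans (HC r (fun l => c * U l w)) _.
  have -> : norm1 (fun l => c * U l w) = c * norm1 (U ^~ w).
    by rewrite /norm1 mulr_sumr; apply: eq_bigr => l _; rewrite normrM ger0_norm.
  by [].
Qed.

(** Lindeberg's condition for i.i.d. summands: after multiplication by n the integrand is at most
    norm1^2, which is integrable, and at most n^(-1/2) norm1^3, which tends to 0 pointwise. *)
Lemma rem_cvg dT (T : measurableType dT) (Q : probability T R) (U : nat -> T -> R) :
  (forall l, (l < J)%N -> L2 Q (U l)) ->
  n%:R * rem Q U (Num.sqrt n%:R)^-1 @[n --> \oo] --> (0 : R).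
Proof.
move=> LU; have LN : L2 Q (fun w => norm1 (U ^~ w)).
  by apply: L2_sum => l _; apply: L2_norm; exact: LU.
pose g n w := n%:R * Num.min (((Num.sqrt n%:R)^-1 * norm1 (U ^~ w)) ^+ 2)
   (((Num.sqrt n%:R)^-1 * norm1 (U ^~ w)) ^+ 3).
rewrite (_ : (fun n => _) = (fun n => Ex Q (g n))); last first.
  by apply/funext => n; rewrite ExZ//; apply: L1_rem.
have g0 n w : 0 <= g n w.
  have N0 : 0 <= (Num.sqrt n%:R)^-1 * norm1 (U ^~ w) by rewrite mulr_ge0// ?norm1_ge0// invr_ge0.
  by rewrite mulr_ge0// le_min !exprn_ge0.
have sq n : n != 0%N -> n%:R * (Num.sqrt n%:R)^-1 ^+ 2 = 1 :> R.
  move=> n0; rewrite exprVn sqr_sqrtr// divff//; rewrite pnatr_eq0//.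
rewrite -[X in _ --> X](Ex_cst Q 0).
apply: (Ex_dct (g := fun w => norm1 (U ^~ w) ^+ 2)) => //.
- move=> n; apply: measurable_funM => //; apply: measurable_minr; apply: measurable_funX;
  by apply: measurable_funM => //; exact: L2_measurable LN.
- by case: LN.
- move=> n w; rewrite ger0_norm//.
  have [->|n0] := eqVneq n 0%N; first by rewrite /g mul0r sqr_ge0.
  apply: le_trans (_ : n%:R * ((Num.sqrt n%:R)^-1 * norm1 (U^~ w)) ^+ 2 <= _).
    by rewrite ler_wpM2l// ge_min lexx.
  by rewrite exprMn mulrA sq// mul1r.
apply: aeW => w; set N := norm1 (U ^~ w); have N0 : 0 <= N := norm1_ge0 _.
apply: (@squeeze_cvgr _ _ _ _ (fun=> 0) (fun n => (Num.sqrt n%:R)^-1 * N ^+ 3)).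
- near=> n; have n0 : n != 0%N by rewrite -lt0n; near: n; exact: nbhs_infty_gt.
  rewrite g0/=.
  apply: le_trans (_ : n%:R * ((Num.sqrt n%:R)^-1 * N) ^+ 3 <= _).
    by rewrite ler_wpM2l// ge_min lexx orbT.
  have -> : n%:R * ((Num.sqrt n%:R)^-1 * N) ^+ 3 =
    n%:R * (Num.sqrt n%:R)^-1 ^+ 2 * ((Num.sqrt n%:R)^-1 * N ^+ 3) by ring.
  by rewrite sq// mul1r.
- exact: cvg_cst.
- rewrite -[X in _ --> X](mul0r (N ^+ 3)); apply: cvgM; last exact: cvg_cst.
  exact: cvg_invsqrtn.
Unshelve. all: by end_near. Qed.

Definition replacement_error (C c : R) : R := C * (rem P V c + rem P' W c).

Lemma one_replacement : exists2 C : R, 0 <= C & forall (c : R) (r : nat -> R), 0 <= c ->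
  `|Ex P (fun w => ridge (fun l => r l + c * V l w)) -
    Ex P' (fun w => ridge (fun l => r l + c * W l w))| <= replacement_error C c.
Proof.
have [C C0 HC] := ridge_taylor; exists C => // c r c0.
have := ridge_expansion r c0 L2V meanV HC; have := ridge_expansion r c0 L2W meanW HC.
rewrite (eq_bigr (fun l : 'I_J => \sum_(m < J) ridge_hess r l m *
   Ex P (fun w => V l w * V m w))); last first.
  by move=> l _; apply: eq_bigr => m _; rewrite covVW.
rewrite /replacement_error mulrDr !ler_norml; lra.
Qed.

Lemma replacement_error_cvg (C : R) :
  n%:R * replacement_error C (Num.sqrt n%:R)^-1 @[n --> \oo] --> (0 : R).
Proof.
rewrite (_ : (fun n => _) = (fun n => C * (n%:R * rem P V (Num.sqrt n%:R)^-1 +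
   n%:R * rem P' W (Num.sqrt n%:R)^-1))); last first.
  by apply/funext => n; rewrite /replacement_error; ring.
rewrite -[X in _ --> X](mulr0 C); apply: cvgM; first exact: cvg_cst.
rewrite -[X in _ --> X]addr0.
by apply: cvgD; exact: rem_cvg.
Qed.

End one_replacement.

Section all_replacements.
Context {d d' dS : measure_display} {O : measurableType d} {O' : measurableType d'}
  {S : measurableType dS} (P : probability O R) (P' : probability O' R)
  (X : nat -> O -> S) (u : nat -> S -> R) (W : nat -> O' -> R).
Hypothesis mX : forall i, measurable_fun setT (X i).
Hypothesis iX : mutually_independent P X.
Hypothesis mu_ : forall l, (l < J)%N -> measurable_fun setT (u l).
Hypothesis mW : forall l, (l < J)%N -> measurable_fun setT (W l).
(* The only property of the normal law used here is its stability. *)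
Hypothesis stableW : forall (a b : R) (r : nat -> R), 0 <= a -> 0 <= b ->
  Ex P' (fun w => Ex P' (fun w' => ridge (fun l => r l + a * W l w + b * W l w'))) =
  Ex P' (fun w => ridge (fun l => r l + Num.sqrt (a ^+ 2 + b ^+ 2) * W l w)).

(** Induction on n. The last summand is resampled and exchanged for c W at cost D. After swapping
    the integrals the induction hypothesis applies with the shift r + c W, and stability merges c W
    with c sqrt(n) W' into c sqrt(n + 1) W. *)
Lemma all_replacements (c D : R) : 0 <= c ->
  (forall i (r : nat -> R), `|Ex P (fun w => ridge (fun l => r l + c * u l (X i w))) -
     Ex P' (fun w => ridge (fun l => r l + c * W l w))| <= D) ->
  forall n (r : nat -> R),
  `|Ex P (fun w => ridge (fun l => r l + c * \sum_(i < n) u l (X i w))) -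
    Ex P' (fun w => ridge (fun l => r l + c * Num.sqrt n%:R * W l w))| <= n%:R * D.
Proof.
move=> c0 HD; elim=> [|n IH] r.
  rewrite (@eq_Ex _ _ _ P _ (fun=> ridge r)); last first.
    move=> w; rewrite /ridge; congr f; apply: eq_bigr => l _.
    by rewrite big_ord0 mulr0 addr0.
  rewrite (@eq_Ex _ _ _ P' _ (fun=> ridge r)); last first.
    move=> w; rewrite /ridge; congr f; apply: eq_bigr => l _.
    by rewrite sqrtr0 mulr0 mul0r addr0.
  by rewrite !Ex_cst subrr normr0 mul0r.
pose Phi (z : nat -> S) := ridge (fun l => r l + c * \sum_(i < n.+1) u l (z i)).
have finPhi : finitary (iota 0 n.+1) Phi.
  split => [z z' zz'|dT T Y mY].
    congr f; apply: eq_bigr => l _; congr (theta l (_ + _ * _)); apply: eq_bigr => i _.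
    by rewrite zz'// mem_iota/= add0n ltn_ord.
  apply: measurable_ridge => l lJ; apply: measurable_funD => //; apply: measurable_funM => //.
  by apply: measurable_sum => i; apply: measurableT_comp; [exact: mu_|exact: mY].
pose A : pred nat := fun i => i == n.
have L1Phi : L1 P (fun w => Phi (X ^~ w)).
  apply: (L1_bnd _ (M := M)); last by move=> w; exact: ridge_bnd.
  by case: finPhi => _; apply.
have E1 : Ex P (fun w => Phi (X ^~ w)) = Ex P (fun w => Ex P (fun w' =>
    ridge (fun l => (r l + c * \sum_(i < n) u l (X i w)) + c * u l (X n w')))).
  rewrite (Ex_resample mX iX A finPhi L1Phi); apply: eq_Ex => w; apply: eq_Ex => w'.
  rewrite /Phi /ridge; congr f; apply: eq_bigr => l _; congr (theta l _).
  rewrite big_ord_recr /= /A eqxx mulrDr addrA; congr (_ + _ * _ + _).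
  by apply: eq_bigr => i _; rewrite ltn_eqF.
have msum l : (l < J)%N -> measurable_fun setT (fun w => \sum_(i < n) u l (X i w)).
  move=> lJ; apply: measurable_sum => i.
  by apply: measurableT_comp; [exact: mu_|exact: mX].
have mE2 : measurable_fun setT (fun z : O * O' =>
    ridge (fun l => (r l + c * \sum_(i < n) u l (X i z.1)) + c * W l z.2)).
  apply: measurable_ridge => l lJ; apply: measurable_funD.
    apply: measurable_funD => //; apply: measurable_funM => //.
    exact: (measurableT_comp (msum l lJ)).
  by apply: measurable_funM => //; exact: (measurableT_comp (mW lJ)).
have L1E2 : L1 (P \x P')%E (fun z : O * O' =>
    ridge (fun l => (r l + c * \sum_(i < n) u l (X i z.1)) + c * W l z.2)).
  by apply: (L1_bnd _ (M := M)) => // z; exact: ridge_bnd.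
have E2 := Ex_swap L1E2; rewrite /= in E2.
have mE1 : measurable_fun setT (fun z : O * O =>
    ridge (fun l => (r l + c * \sum_(i < n) u l (X i z.1)) + c * u l (X n z.2))).
  apply: measurable_ridge => l lJ; apply: measurable_funD.
    apply: measurable_funD => //; apply: measurable_funM => //.
    exact: (measurableT_comp (msum l lJ)).
  apply: measurable_funM => //; apply: (measurableT_comp (mu_ lJ)).
  exact: (measurableT_comp (mX n)).
have mE3 : measurable_fun setT (fun z : O' * O' =>
    ridge (fun l => r l + c * W l z.1 + c * Num.sqrt n%:R * W l z.2)).
  apply: measurable_ridge => l lJ; apply: measurable_funD.
    by apply: measurable_funD => //; apply: measurable_funM => //; exact: (measurableT_comp (mW lJ)).
  by apply: measurable_funM => //; exact: (measurableT_comp (mW lJ)).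
have bE dT (T : measurableType dT) (Q : probability T R) (y : nat -> T -> R) :
    (forall l, (l < J)%N -> measurable_fun setT (y l)) -> `|Ex Q (fun w => ridge (y ^~ w))| <= M.
  move=> my; apply: normr_Ex_le => [|w]; last exact: ridge_bnd.
  by apply: (L1_bnd _ (M := M)) => [|w]; [exact: measurable_ridge|exact: ridge_bnd].
have step1 : `|Ex P (fun w => Ex P (fun w' =>
    ridge (fun l => (r l + c * \sum_(i < n) u l (X i w)) + c * u l (X n w')))) -
    Ex P (fun w => Ex P' (fun w' =>
    ridge (fun l => (r l + c * \sum_(i < n) u l (X i w)) + c * W l w')))| <= D.
  rewrite -ExB.
  - apply: normr_Ex_le; last by move=> w; exact: HD.
    apply: (L1_bnd _ (M := D)); last by move=> w; exact: HD.
    by apply: measurable_funB; [exact: (measurable_Ex_slice P mE1)|exact: (measurable_Ex_slice P' mE2)].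
  - apply: (L1_bnd _ (M := M)) => [|w]; first exact: (measurable_Ex_slice P mE1).
    apply: bE => l lJ; apply: measurable_funD => //; apply: measurable_funM => //.
    exact: (measurableT_comp (mu_ lJ)).
  - apply: (L1_bnd _ (M := M)) => [|w]; first exact: (measurable_Ex_slice P' mE2).
    apply: bE => l lJ; apply: measurable_funD => //; apply: measurable_funM => //.
    exact: mW.
have step2 : `|Ex P' (fun w' => Ex P (fun w =>
    ridge (fun l => (r l + c * \sum_(i < n) u l (X i w)) + c * W l w'))) -
    Ex P' (fun w => Ex P' (fun w' =>
      ridge (fun l => r l + c * W l w + c * Num.sqrt n%:R * W l w')))| <= n%:R * D.
  have pt w' : `|Ex P (fun w =>
      ridge (fun l => (r l + c * \sum_(i < n) u l (X i w)) + c * W l w')) -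
      Ex P' (fun w'' => ridge (fun l => r l + c * W l w' + c * Num.sqrt n%:R * W l w''))|
      <= n%:R * D.
    have := IH (fun l => r l + c * W l w').
    rewrite (@eq_Ex _ _ _ P _ (fun w => ridge (fun l =>
      (r l + c * \sum_(i < n) u l (X i w)) + c * W l w')))// => w.
    by congr f; apply: eq_bigr => l _; rewrite addrAC.
  have m1 := measurable_Ex_slice2 P mE2; have m2 := measurable_Ex_slice P' mE3.
  rewrite -ExB.
  - apply: normr_Ex_le => //; apply: (L1_bnd _ (M := n%:R * D)) => //.
    exact: measurable_funB.
  - apply: (L1_bnd _ (M := M)) => // w; apply: bE => l lJ.
    apply: measurable_funD => //; apply: measurable_funD => //.
    by apply: measurable_funM => //; exact: msum.
  - apply: (L1_bnd _ (M := M)) => // w; apply: bE => l lJ.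
    by apply: measurable_funD => //; apply: measurable_funM => //; exact: mW.
have cn0 : 0 <= c * Num.sqrt n%:R by rewrite mulr_ge0.
have E3 : Ex P' (fun w => Ex P' (fun w' =>
      ridge (fun l => r l + c * W l w + c * Num.sqrt n%:R * W l w'))) =
    Ex P' (fun w => ridge (fun l => r l + c * Num.sqrt n.+1%:R * W l w)).
  rewrite stableW//; have -> : c ^+ 2 + (c * Num.sqrt n%:R) ^+ 2 = c ^+ 2 * n.+1%:R.
    by rewrite exprMn sqr_sqrtr// -[n.+1]addn1 natrD; ring.
  by rewrite sqrtrM ?sqr_ge0// sqrtr_sqr ger0_norm.
rewrite -/(Phi _) E1 -E3 -natr1 mulrDl mul1r.
move: step1 step2; rewrite E2 !ler_norml; lra.
Qed.

End all_replacements.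

End test_functions.

(** * The normal law *)

Section normal_law.
Context {R : realType}.
Local Notation mu := (@lebesgue_measure R).

(** The Radon-Nikodym derivative and [normal_pdf] have the same integral over every measurable set,
    hence agree almost everywhere. *)
Lemma normal_prob_density (m s : R) (f : R -> R) (M : R) : measurable_fun setT f ->
  (forall x, `|f x| <= M) ->
  (\int[normal_prob m s]_x (f x)%:E = \int[mu]_x (f x * normal_pdf m s x)%:E)%E.
Proof.
move=> mf fM.
have If : (normal_prob m s).-integrable setT (EFin \o f).
  exact: (L1_bnd (normal_prob m s) mf fM).
rewrite -(Radon_Nikodym_change_of_variables (normal_prob_dominates m s))//=.
apply: ae_eq_integral => //.
- apply: emeasurable_funM => //; first exact/measurable_EFinP.
  apply: (measurable_int mu); apply: (integrableS _ _ (@subsetT _ _)) => //=.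
  by apply: Radon_Nikodym_integrable; exact: normal_prob_dominates.
- apply/measurable_EFinP/measurable_funM => //; exact: measurable_normal_pdf.
- under [X in ae_eq _ _ _ X]eq_fun do rewrite EFinM.
  apply: ae_eqe_mul2l => /=.
  rewrite Radon_NikodymE//=; first exact: normal_prob_dominates.
  move=> abmu.
  case: cid => /= h [h1 h2 h3].
  apply: integral_ae_eq => //=.
  + by apply/measurable_EFinP; exact: measurable_normal_pdf.
  + by move=> E E01 mE; rewrite -h3.
Qed.

Lemma measurable_borel_id : measurable_fun setT (fun x : measurableTypeR R => x : R).
Proof. exact: measurable_id. Qed.

(* [normal_prob] as a law on [R] itself rather than on its Borel alias. *)
Definition normalR (m s : R) : probability R R :=
  distribution (normal_prob m s)
    (mfun_Sub (mem_set measurable_borel_id) : {RV (normal_prob m s) >-> R}).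

Lemma normalRE (m s : R) A : normalR m s A = normal_prob m s A.
Proof. by []. Qed.

Lemma Ex_normalR (m s : R) (f : R -> R) (M : R) : measurable_fun setT f ->
  (forall x, `|f x| <= M) -> Ex (normalR m s) f = Ex (normal_prob m s) f.
Proof.
by move=> mf fM; apply: Ex_distribution => //; exact: (L1_bnd (normal_prob m s) mf fM).
Qed.

Lemma normal_density (m s : R) (f : R -> R) (M : R) : measurable_fun setT f ->
  (forall x, `|f x| <= M) ->
  (\int[normalR m s]_x (f x)%:E = \int[mu]_x (f x * normal_pdf m s x)%:E)%E.
Proof.
move=> mf fM; have Lf := L1_bnd (normalR m s) mf fM.
have Lf' := L1_bnd (normal_prob m s) mf fM.
rewrite (L1_int Lf) (Ex_normalR _ _ mf fM).
by rewrite -(normal_prob_density m s mf fM); exact/esym/(L1_int Lf').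
Qed.

Lemma normal_peakM (s : R) : 0 < s -> normal_peak s = s^-1 * normal_peak 1.
Proof.
move=> s0; rewrite /normal_peak expr1n mul1r -invfM -mulrnAr sqrtrM ?sqr_ge0//.
by rewrite sqrtr_sqr gtr0_norm.
Qed.

Lemma normal_affine (m s : R) (f : R -> R) (M : R) : 0 < s -> continuous f ->
  (forall x, `|f x| <= M) ->
  Ex (normalR m s) f = Ex (normalR 0 1) (fun x => f (m + s * x)).
Proof.
move=> s0 cf fM.
have M0 : 0 <= M by exact: le_trans (normr_ge0 _) (fM 0).
(* The substitution rule is applied to a nonnegative integrand, so [f] is replaced by f + M. *)
suff pos (g : R -> R) (N : R) : continuous g -> (forall x, 0 <= g x <= N) ->
    Ex (normalR m s) g = Ex (normalR 0 1) (fun x => g (m + s * x)).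
  have cg : continuous (fun x => f x + M).
    by move=> x; apply: cvgD; [exact: cf|exact: cvg_cst].
  have g0 x : 0 <= f x + M <= M + M.
    by have := fM x; rewrite ler_norml => /andP[h1 h2]; apply/andP; split; lra.
  have := pos _ _ cg g0.
  have mf : measurable_fun setT f by apply: continuous_measurable_fun; exact: cf.
  have mfF : measurable_fun setT (fun x => f (m + s * x)).
    by apply: (measurableT_comp mf); apply: measurable_funD => //; apply: measurable_funM.
  have shift (Q : probability R R) (u : R -> R) : measurable_fun setT u -> (forall x, `|u x| <= M) ->
      Ex Q (fun x => u x + M) = Ex Q u + M.
    by move=> mu' uM; rewrite (ExD (L1_bnd Q mu' uM) (L1_cst Q M)) Ex_cst.
  rewrite (shift _ _ mf fM) (shift _ _ mfF (fun x => fM _)); exact: addIr.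
move=> cg g0N.
have mg : measurable_fun setT g by apply: continuous_measurable_fun; exact: cg.
have gN x : `|g x| <= N by have /andP[h1 h2] := g0N x; rewrite ger0_norm.
have mgF : measurable_fun setT (fun x => g (m + s * x)).
  by apply: (measurableT_comp mg); apply: measurable_funD => //; apply: measurable_funM.
rewrite /Ex (normal_density _ _ mg gN) (normal_density _ _ mgF (fun x => gN _)); congr fine.
(* The map m + s x, written as a translation followed by a scaling so that its limits at both
   infinities are immediate. *)
pose F (x : R^o) : R^o := (x + m / s) * s.
have sn : s != 0 by rewrite gt_eqF.
have FE x : F x = m + s * x by rewrite /F; field.
have dF (x : R) : is_derive x 1 F s.
  rewrite (_ : F = cst (m : R^o) + s *: (id : R^o -> R^o)).
    have := is_deriveD (is_derive_cst (m : R^o) x (1 : R))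
      (is_deriveZ s (is_derive_id x (1 : R))).
    by rewrite add0r /GRing.scale /= mulr1.
  by apply/funext => y; rewrite FE.
have F'E : F^`()%classic = fun=> s.
  by apply/funext => x; rewrite derive1E; have := dF x => ?; rewrite derive_val.
rewrite (@increasing_ge0_integration_by_substitutionT _ F (fun x => g x * normal_pdf m s x)).
- apply: eq_integral => x _; congr EFin; rewrite fctE /= F'E FE -mulrA; congr (_ * _).
  rewrite !normal_pdfE ?oner_eq0//= (normal_peakM s0) /normal_fun.
  rewrite (_ : - (m + s * x - m) ^+ 2 / (s ^+ 2 *+ 2) = - (x - 0) ^+ 2 / (1 ^+ 2 *+ 2)).
    by field.
  by field.
- by move=> x y xy; rewrite !FE ltrD2l ltr_pM2l.
- by rewrite F'E => ?; exact: cvg_cst.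
- by rewrite F'E; exact: is_cvg_cst.
- by rewrite F'E; exact: is_cvg_cst.
- by move=> x; case: (dF x).
- by apply/gt0_cvgMlNy => //; exact: cvg_addrr_Ny.
- by apply/gt0_cvgMly => //; exact: cvg_addrr.
- by move=> x; apply: cvgM; [exact: cg|apply: continuous_normal_pdf; rewrite gt_eqF].
- by move=> x; rewrite mulr_ge0 ?normal_pdf_ge0//; have /andP[] := g0N x.
Qed.

(** Completing the square. For y = a x + b z the joint density of (x, y) is written once as
    conditional density of y given x, and once as the N(0, c^2) density of y times the conditional
    density of x given y. *)
Lemma normal_pdf_product (a b x y : R) : 0 < b ->
  let c := Num.sqrt (a ^+ 2 + b ^+ 2) in
  normal_pdf (a * x) b y * normal_pdf 0 1 x =
  normal_pdf 0 c y * normal_pdf (a * y / c ^+ 2) (b / c) x.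
Proof.
move=> b0 c.
have c2 : c ^+ 2 = a ^+ 2 + b ^+ 2 by rewrite sqr_sqrtr// addr_ge0// sqr_ge0.
have c0 : 0 < c by rewrite sqrtr_gt0 ltr_wpDl ?sqr_ge0// exprn_gt0.
have cn : c != 0 by rewrite gt_eqF.
have bn : b != 0 by rewrite gt_eqF.
have c2n : a ^+ 2 + b ^+ 2 != 0 by rewrite -c2 sqrf_eq0.
have bc0 : 0 < b / c by rewrite divr_gt0.
rewrite !normal_pdfE ?oner_eq0 ?(gt_eqF bc0)//= (normal_peakM b0) (normal_peakM c0) (normal_peakM bc0).
rewrite /normal_fun mulrACA [RHS]mulrACA -!expRD; congr (_ * expR _).
  by field; rewrite bn cn.
rewrite expr_div_n c2; field; by rewrite bn c2n.
Qed.

(** Both sides become integrals against Lebesgue measure. After exchanging the order, the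
    conditional density of x given y integrates to 1 and the N(0, c^2) density remains. *)
Lemma normal_stable (a b : R) (f : R -> R) (M : R) : 0 <= a -> 0 <= b -> continuous f ->
  (forall x, `|f x| <= M) ->
  Ex (normalR 0 1) (fun x => Ex (normalR 0 1) (fun y => f (a * x + b * y))) =
  Ex (normalR 0 1) (fun x => f (Num.sqrt (a ^+ 2 + b ^+ 2) * x)).
Proof.
move=> a0; rewrite le_eqVlt => /predU1P[<- _ _|b0 cf fM].
  rewrite expr0n/= addr0 sqrtr_sqr ger0_norm//; apply: eq_Ex => x.
  by rewrite -[RHS](Ex_cst (normalR 0 1)); apply: eq_Ex => y; rewrite mul0r addr0.
set c := Num.sqrt _.
have c0 : 0 < c by rewrite sqrtr_gt0 ltr_wpDl ?sqr_ge0// exprn_gt0.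
have M0 : 0 <= M by exact: le_trans (normr_ge0 _) (fM 0).
suff pos (g : R -> R) (N : R) : continuous g -> (forall x, 0 <= g x <= N) ->
    Ex (normalR 0 1) (fun x => Ex (normalR 0 1) (fun y => g (a * x + b * y))) =
    Ex (normalR 0 1) (fun x => g (c * x)).
  have cg : continuous (fun x => f x + M).
    by move=> x; apply: cvgD; [exact: cf|exact: cvg_cst].
  have g0 x : 0 <= f x + M <= M + M.
    by have := fM x; rewrite ler_norml => /andP[h1 h2]; apply/andP; split; lra.
  have mf : measurable_fun setT f by apply: continuous_measurable_fun; exact: cf.
  have := pos _ _ cg g0.
  have L1in x : L1 (normalR 0 1) (fun y => f (a * x + b * y)).
    apply: (L1_bnd _ (M := M)) => //; apply: (measurableT_comp mf).
    by apply: measurable_funD => //; apply: measurable_funM.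
  rewrite [X in X = _](_ : _ =
    Ex (normalR 0 1) (fun x => Ex (normalR 0 1) (fun y => f (a * x + b * y))) + M).
    rewrite ExD; [|apply: (L1_bnd _ (M := M)) => //|exact: L1_cst].
      by rewrite Ex_cst => /addIr.
    by apply: (measurableT_comp mf); apply: measurable_funM.
  rewrite -[X in _ = _ + X](Ex_cst (normalR 0 1)) -ExD; last 2 first.
  - apply: (L1_bnd _ (M := M)) => [|x]; last by apply: normr_Ex_le.
    apply: (measurable_Ex_slice (normalR 0 1) (f := fun z : R * R => f (a * z.1 + b * z.2))).
    apply: (measurableT_comp mf).
    by apply: measurable_funD => //; apply: measurable_funM.
  - exact: L1_cst.
  by apply: eq_Ex => x; rewrite ExD//; [rewrite Ex_cst|exact: L1_cst].
move=> cg g0N.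
have mg : measurable_fun setT g by apply: continuous_measurable_fun; exact: cg.
have gN x : `|g x| <= N by have /andP[h1 h2] := g0N x; rewrite ger0_norm.
have g0 x : 0 <= g x by have /andP[] := g0N x.
transitivity (Ex (normalR 0 1) (fun x => Ex (normalR (a * x) b) g)).
  by apply: eq_Ex => x; rewrite (normal_affine _ b0 cg gN).
transitivity (Ex (normalR 0 c) g); last first.
  by rewrite (normal_affine _ c0 cg gN); apply: eq_Ex => x; rewrite add0r.
have L1g m s : L1 (normalR m s) g by exact: (L1_bnd (normalR m s) mg gN).
have mE : measurable_fun setT (fun x : R => Ex (normalR (a * x) b) g).
  rewrite (_ : (fun x => _) = fun x => Ex (normalR 0 1) (fun y => g (a * x + b * y))).
    apply: (measurable_Ex_slice (normalR 0 1) (f := fun z : R * R => g (a * z.1 + b * z.2))).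
    apply: (measurableT_comp mg).
    by apply: measurable_funD => //; apply: measurable_funM.
  by apply/funext => x; rewrite (normal_affine _ b0 cg gN).
have bE x : `|Ex (normalR (a * x) b) g| <= N by exact: normr_Ex_le.
rewrite {1}/Ex (normal_density _ _ mE bE) /Ex (normal_density _ _ mg gN); congr fine.
have mpdf : measurable_fun setT (fun z : R * R => normal_pdf (a * z.1) b z.2).
  rewrite (_ : (fun z => _) = fun z : R * R =>
      normal_peak b * expR (- (z.2 - a * z.1) ^+ 2 / (b ^+ 2 *+ 2))).
    apply: measurable_funM => //; apply: measurableT_comp => //.
    apply: measurable_funM => //; apply: measurableT_comp => //; apply: measurable_funX.
    by apply: measurable_funB => //; apply: measurable_funM.
  by apply/funext => z; rewrite normal_pdfE ?gt_eqF.
pose h (z : R * R) := g z.2 * (normal_pdf (a * z.1) b z.2 * normal_pdf 0 1 z.1).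
have mh : measurable_fun setT h.
  apply: measurable_funM; first exact: (measurableT_comp mg).
  apply: measurable_funM => //; apply: (measurableT_comp (measurable_normal_pdf 0 1)) => //.
have h0 z : 0 <= h z by rewrite mulr_ge0// mulr_ge0 ?normal_pdf_ge0.
transitivity (\int[mu]_x \int[mu]_y (h (x, y))%:E)%E.
  apply: eq_integral => x _; rewrite EFinM -(L1_int (L1g _ _)) (normal_density _ _ mg gN).
  rewrite muleC -ge0_integralZl.
  - by apply: eq_integral => y _; rewrite /h /= -EFinM; congr EFin; ring.
  - exact: measurableT.
  - by apply/measurable_EFinP; apply: measurable_funM => //; exact: measurable_normal_pdf.
  - by move=> y _; rewrite lee_fin mulr_ge0 ?normal_pdf_ge0.
  - by rewrite lee_fin normal_pdf_ge0.
have := @fubini_tonelli _ _ _ _ R mu mu (fun z => (h z)%:E).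
rewrite /fubini_F /fubini_G => -> //; last first.
  exact/measurable_EFinP.
apply: eq_integral => y _.
transitivity (\int[mu]_x ((g y * normal_pdf 0 c y)%:E * (normal_pdf (a * y / c ^+ 2) (b / c) x)%:E))%E.
  by apply: eq_integral => x _; rewrite /h /= normal_pdf_product// -EFinM mulrA.
rewrite ge0_integralZl//.
- by rewrite integral_normal_pdf mule1.
- by apply/measurable_EFinP; exact: measurable_normal_pdf.
- by move=> x _; rewrite lee_fin normal_pdf_ge0.
- by rewrite lee_fin mulr_ge0 ?normal_pdf_ge0.
Qed.

(** With s = (1 + 2 h)^(-1/2), multiplying the standard normal density by exp(- h x^2) gives s times
    the normal density of standard deviation s. *)
Lemma normal_exp_sqr (h : R) : 0 <= h ->
  Ex (normalR 0 1) (fun x => expR (- (h * x ^+ 2))) = (Num.sqrt (1 + 2 * h))^-1.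
Proof.
move=> h0; set s := (Num.sqrt _)^-1.
have h1 : 0 < 1 + 2 * h by rewrite ltr_pwDl// mulr_ge0.
have s0 : 0 < s by rewrite invr_gt0 sqrtr_gt0.
have s2 : s ^+ 2 = (1 + 2 * h)^-1 by rewrite exprVn sqr_sqrtr// ltW.
have mf : measurable_fun setT (fun x : R => expR (- (h * x ^+ 2))).
  apply: measurableT_comp => //; apply: measurableT_comp => //.
  by apply: measurable_funM => //; exact: measurable_funX.
have fb x : `|expR (- (h * x ^+ 2))| <= 1.
  by rewrite ger0_norm ?expR_ge0// expR_le1 oppr_le0 mulr_ge0// sqr_ge0.
rewrite /Ex (normal_density _ _ mf fb).
have E x : expR (- (h * x ^+ 2)) * normal_pdf 0 1 x = s * normal_pdf 0 s x.
  rewrite !normal_pdfE ?oner_eq0 ?(gt_eqF s0)//= (normal_peakM s0) /normal_fun.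
  have sn : s != 0 by rewrite gt_eqF.
  rewrite mulrCA -expRD [RHS](_ : _ = normal_peak 1 * expR (- (x - 0) ^+ 2 / (s ^+ 2 *+ 2))).
    by congr (_ * expR _); rewrite s2; field; rewrite gt_eqF.
  by field.
under eq_integral do rewrite E EFinM.
rewrite ge0_integralZl ?lee_fin ?(ltW s0)//.
- by rewrite integral_normal_pdf mule1.
- by apply/measurable_EFinP; exact: measurable_normal_pdf.
- by move=> x _; rewrite lee_fin normal_pdf_ge0.
Qed.

(* [(1 - exp (- h x^2)) / h] increases to [x^2] as [h] decreases to [0], and its
   expectation [(1 - (1 + 2 h)^(-1/2)) / h] tends to [1]. *)
Let g_ (n : nat) (x : R) : R := n.+1%:R * (1 - expR (- (n.+1%:R^-1 * x ^+ 2))).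

Let mg_ n : measurable_fun setT (g_ n).
Proof.
apply: measurable_funM => //; apply: measurable_funB => //.
apply: measurableT_comp => //; apply: measurableT_comp => //.
by apply: measurable_funM => //; exact: measurable_funX.
Qed.

Let g_ge0 n x : 0 <= g_ n x.
Proof.
by rewrite mulr_ge0// subr_ge0 expR_le1 oppr_le0 mulr_ge0// ?invr_ge0// sqr_ge0.
Qed.

Let g_le n x : g_ n x <= x ^+ 2.
Proof.
have n0 : 0 < n.+1%:R :> R by rewrite ltr0n.
rewrite /g_ -ler_pdivlMl//; set u := n.+1%:R^-1 * x ^+ 2.
have := expR_ge1Dx (- u); lra.
Qed.

Let g_cvg x : g_ n x @[n --> \oo] --> x ^+ 2.
Proof.
have lo n : x ^+ 2 - x ^+ 2 * (n.+1%:R^-1 * x ^+ 2) <= g_ n x.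
  have n0 : 0 < n.+1%:R :> R by rewrite ltr0n.
  set u := n.+1%:R^-1 * x ^+ 2.
  have u0 : 0 <= u by rewrite mulr_ge0 ?invr_ge0 ?sqr_ge0.
  have x2 : x ^+ 2 = n.+1%:R * u by rewrite /u mulrA divff ?mul1r// gt_eqF.
  rewrite /g_ -/u x2 -mulrA -mulrBr ler_wpM2l//.
  have e1 := expR_ge1Dx u; have e0 := expR_gt0 (- u).
  have ee : expR u * expR (- u) = 1 by rewrite -expRD subrr expR0.
  have : (1 + u) * expR (- u) <= 1 by rewrite -[leRHS]ee ler_wpM2r ?expR_ge0.
  have : 0 <= u * u * expR (- u) by rewrite mulr_ge0 ?expR_ge0// mulr_ge0.
  nra.
apply: (@squeeze_cvgr _ _ _ _ (fun n => x ^+ 2 - x ^+ 2 * (n.+1%:R^-1 * x ^+ 2)) (fun=> x ^+ 2)).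
- by near=> n; rewrite lo g_le.
- rewrite -[X in _ --> X]subr0; apply: cvgB; first exact: cvg_cst.
  rewrite -[X in _ --> X](mulr0 (x ^+ 2)); apply: cvgM; first exact: cvg_cst.
  rewrite -[X in _ --> X](mul0r (x ^+ 2)); apply: cvgM; last exact: cvg_cst.
  exact: cvg_harmonic.
- exact: cvg_cst.
Unshelve. all: by end_near. Qed.

Let Eg_ n : Ex (normalR 0 1) (g_ n) = n.+1%:R * (1 - (Num.sqrt (1 + 2 * n.+1%:R^-1))^-1).
Proof.
have h0 : 0 <= n.+1%:R^-1 :> R by rewrite invr_ge0.
have L : L1 (normalR 0 1) (fun x : R => expR (- (n.+1%:R^-1 * x ^+ 2))).
  apply: (L1_bnd _ (M := 1)).
    apply: measurableT_comp => //; apply: measurableT_comp => //.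
    by apply: measurable_funM => //; exact: measurable_funX.
  by move=> x; rewrite ger0_norm ?expR_ge0// expR_le1 oppr_le0 mulr_ge0// sqr_ge0.
rewrite ExZ; last by apply: L1B => //; exact: L1_cst.
by rewrite ExB//; [rewrite Ex_cst normal_exp_sqr|exact: L1_cst].
Qed.

Let Eg_cvg : Ex (normalR 0 1) (g_ n) @[n --> \oo] --> (1 : R).
Proof.
pose h n : R := n.+1%:R^-1; pose s n := (Num.sqrt (1 + 2 * h n))^-1.
have h0 n : 0 < h n by rewrite invr_gt0.
have h1 n : 0 < 1 + 2 * h n by rewrite ltr_pwDl// mulr_ge0// ltW.
have s0 n : 0 < s n by rewrite invr_gt0 sqrtr_gt0.
have s2 n : s n ^+ 2 * (1 + 2 * h n) = 1.
  by rewrite exprVn sqr_sqrtr ?mulVf ?gt_eqF// ltW.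
have s1 n : s n <= 1 by rewrite -(ler_pXn2r (n := 2)) ?nnegrE ?(ltW (s0 n))// expr1n; have := s2 n; have := h0 n; nra.
(* Everything follows from (1 - s)(1 + s) = 2 h s^2, which determines 1 - s up to an error of order
   h^2. *)
have bound n : 1 - 3 * h n <= Ex (normalR 0 1) (g_ n) <= 1.
  rewrite Eg_ -/(h n) -/(s n).
  have hn : n.+1%:R * h n = 1 by rewrite divff// pnatr_eq0.
  have n0 : 0 < n.+1%:R :> R by rewrite ltr0n.
  have E : (1 - s n) * (1 + s n) = 2 * h n * s n ^+ 2 by have := s2 n; lra.
  have h0n := h0 n; have s0n := s0 n; have s1n := s1 n; have s2n := s2 n.
  have s2le1 : s n ^+ 2 <= 1 by rewrite exprn_ile1// ltW.
  have hs2 : 0 <= h n * s n ^+ 2 by rewrite mulr_ge0 ?sqr_ge0// ltW.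
  have up : 1 - s n <= h n.
    have k1 : 0 <= h n * ((1 - s n) * (1 + 2 * s n)).
      by rewrite mulr_ge0 ?(ltW h0n)// mulr_ge0 ?subr_ge0// addr_ge0// mulr_ge0// ltW.
    have p1 : 0 < 1 + s n by rewrite addr_gt0.
    by rewrite -(ler_pM2r p1) E; nra.
  have lo : h n * (1 - 3 * h n) <= 1 - s n.
    have k2 : h n * s n ^+ 2 <= 1 - s n.
      have : (1 - s n) * (1 + s n) <= (1 - s n) * 2 by rewrite ler_wpM2l ?subr_ge0//; lra.
      by rewrite E; lra.
    have k3 : 1 - 3 * h n <= s n ^+ 2 by lra.
    by apply: le_trans k2; rewrite ler_pM2l.
  apply/andP; split.
    rewrite -(ler_pM2l h0n) (_ : h n * (n.+1%:R * (1 - s n)) = n.+1%:R * h n * (1 - s n)).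
      by rewrite hn mul1r.
    by ring.
  by rewrite -[leRHS]hn ler_pM2l.
apply: (@squeeze_cvgr _ _ _ _ (fun n => 1 - 3 * h n) (fun=> 1)).
- by near=> n; exact: bound.
- rewrite -[X in _ --> X]subr0; apply: cvgB; first exact: cvg_cst.
  rewrite -[X in _ --> X](mulr0 3); apply: cvgM; first exact: cvg_cst.
  exact: cvg_harmonic.
- exact: cvg_cst.
Unshelve. all: by end_near. Qed.

(** Fatou's lemma for the approximations [g_] of the square, whose expectations tend to 1. *)
Lemma L2_normal : L2 (normalR 0 1) (fun x : R => x).
Proof.
split; first exact: measurable_id.
apply/integrableP; split; first by apply/measurable_EFinP; exact: measurable_funX.
have := @fatou _ _ _ (normalR 0 1) setT measurableT (fun n x => (g_ n x)%:E)
  (fun n => (measurable_EFinP _ _).2 (mg_ n)) (fun n x _ => g_ge0 n x).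
have L1g n : L1 (normalR 0 1) (g_ n).
  have gb (x : R) : `|g_ n x| <= n.+1%:R.
    by rewrite ger0_norm// /g_ -[leRHS]mulr1 ler_wpM2l.
  exact: (L1_bnd (normalR 0 1) (mg_ n) gb).
move=> H; apply: le_lt_trans (le_trans _ H) _.
  rewrite le_eqVlt; apply/orP; left; apply/eqP; apply: eq_integral => x _.
  rewrite /= ger0_norm ?sqr_ge0//; apply/esym.
  have h : (g_ n x)%:E @[n --> \oo] --> (x ^+ 2)%:E by apply: cvg_EFin; [exact: nearW|exact: g_cvg].
  by rewrite is_cvg_limn_einfE ?(cvg_lim _ h)//; apply/cvg_ex; eexists; exact: h.
rewrite (_ : limn_einf _ = 1%:E) ?ltry//.
have h : (\int[normalR 0 1]_x (g_ n x)%:E)%E @[n --> \oo] --> (1 : R)%:E.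
  apply: cvg_EFin; last exact: Eg_cvg.
  by apply: nearW => n; rewrite (L1_int (L1g n)).
by rewrite is_cvg_limn_einfE ?(cvg_lim _ h)//; apply/cvg_ex; eexists; exact: h.
Qed.

Lemma normal_variance : Ex (normalR 0 1) (fun x : R => x ^+ 2) = 1.
Proof.
have [_ L] := L2_normal.
have := @Ex_dct _ _ _ (normalR 0 1) g_ (fun x => x ^+ 2) (fun x => x ^+ 2) mg_
  (L1_measurable L) L.
have H1 n (x : R) : `|g_ n x| <= x ^+ 2 by rewrite ger0_norm.
have H3 : {ae normalR 0 1, forall x : R, g_ n x @[n --> \oo] --> x ^+ 2}.
  by apply: aeW => x; exact: g_cvg.
move=> /(_ H1) /(_ H3) H2.
exact: (cvg_unique _ H2 Eg_cvg).
Qed.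

(** By stability a sum of two independent standard normals is distributed as sqrt 2 times one, so
    the mean m satisfies 2 m = sqrt 2 m. Stability is stated for bounded functions, hence the
    truncations [t n] and dominated convergence. *)
Lemma normal_mean : Ex (normalR 0 1) (fun x : R => x) = 0.
Proof.
have LZ := L2_L1 L2_normal.
pose t n (x : R) := Num.max (- n%:R) (Num.min x n%:R).
have tL n (x' y' : R) : `|t n x' - t n y'| <= `|x' - y'|.
  have Lmax (c x y : R) : `|Num.max c x - Num.max c y| <= `|x - y|.
    by have [h1|h1] := ler0P (x - y); case: (leP c x) => ?; case: (leP c y) => ?;
       rewrite ler_norml; apply/andP; split; lra.
  have Lmin (c x y : R) : `|Num.min x c - Num.min y c| <= `|x - y|.
    by have [h1|h1] := ler0P (x - y); case: (leP x c) => ?; case: (leP y c) => ?;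
       rewrite ler_norml; apply/andP; split; lra.
  exact: le_trans (Lmax _ _ _) (Lmin _ _ _).
have ct n : continuous (t n).
  by apply: (lipschitz_continuous (K := 1)) => x y; rewrite mul1r.
have tn n x : `|t n x| <= n%:R.
  have n0 : 0 <= n%:R :> R by [].
  by rewrite ler_norml /t le_max lexx /= ge_max ge_min lexx orbT andbT; lra.
have tx n x : `|t n x| <= `|x|.
  have n0 : 0 <= n%:R :> R by [].
  have := tL n x 0; rewrite subr0 (_ : t n 0 = 0) ?subr0//.
  by rewrite /t (min_idPl n0) (max_idPr _)// oppr_le0.
have tcvg x : t n x @[n --> \oo] --> x.
  apply: cvg_near_cst; near=> n.
  have : `|x| <= n%:R by near: n; exact: nbhs_infty_ger.
  by rewrite ler_norml => /andP[h1 h2]; rewrite /t (min_idPl h2) (max_idPr h1).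
have mt n : measurable_fun setT (t n) by apply: continuous_measurable_fun; exact: ct.
have L1a : L1 (normalR 0 1 \x normalR 0 1)%E (fun z : R * R => z.1).
  by have := L1_prod LZ (L1_cst (normalR 0 1) (1 : R)); apply: eq_L1 => z; rewrite /= mulr1.
have L1b : L1 (normalR 0 1 \x normalR 0 1)%E (fun z : R * R => z.2).
  by have := L1_prod (L1_cst (normalR 0 1) (1 : R)) LZ; apply: eq_L1 => z; rewrite /= mul1r.
have LS := L1D L1a L1b.
set m := Ex _ _.
have ES : Ex (normalR 0 1 \x normalR 0 1)%E (fun z : R * R => z.1 + z.2) = m + m.
  rewrite Ex_fubini//=.
  transitivity (Ex (normalR 0 1) (fun x : R => x + m)).
    apply: eq_Ex => x.
    by have := ExD (L1_cst (normalR 0 1) (x : R)) LZ; rewrite Ex_cst.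
  by have := ExD LZ (L1_cst (normalR 0 1) m); rewrite Ex_cst.
pose c : R := Num.sqrt 2.
have c2 : Num.sqrt (1 ^+ 2 + 1 ^+ 2) = c by rewrite expr1n.
have E n : Ex (normalR 0 1 \x normalR 0 1)%E (fun z : R * R => t n (z.1 + z.2)) =
    Ex (normalR 0 1) (fun x => t n (c * x)).
  have mtt : measurable_fun setT (fun z : R * R => t n (z.1 + z.2)).
    by apply: (measurableT_comp (mt n)); exact: measurable_funD.
  rewrite Ex_fubini//=; last by apply: (L1_bnd _ (M := n%:R)).
  rewrite -c2 -(normal_stable ler01 ler01 (ct n) (tn n)).
  by apply: eq_Ex => x; apply: eq_Ex => y; rewrite !mul1r.
have cv1 : Ex (normalR 0 1 \x normalR 0 1)%E (fun z : R * R => t n (z.1 + z.2))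
    @[n --> \oo] --> m + m.
  rewrite -ES; apply: (Ex_dct (g := fun z : R * R => `|z.1 + z.2|)).
  - by move=> n; apply: (measurableT_comp (mt n)); exact: measurable_funD.
  - exact: L1_measurable LS.
  - exact: L1_norm.
  - by move=> n z; exact: tx.
  - by apply: aeW => z; exact: tcvg.
have cv2 : Ex (normalR 0 1) (fun x => t n (c * x)) @[n --> \oo] --> c * m.
  rewrite /m -(ExZ c LZ); apply: (Ex_dct (g := fun x : R => `|c * x|)).
  - by move=> n; apply: (measurableT_comp (mt n)); exact: measurable_funM.
  - by apply: measurable_funM => //; exact: measurable_id.
  - exact/L1_norm/L1Z.
  - by move=> n z; exact: tx.
  - by apply: aeW => z; exact: tcvg.
rewrite (_ : (fun n => _) = (fun n => Ex (normalR 0 1) (fun x => t n (c * x)))) in cv1; last first.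
  by apply/funext => n; exact: E.
have h : m + m = c * m by exact: (cvg_unique _ cv1 cv2).
have cc : c ^+ 2 = 2 by rewrite sqr_sqrtr.
have : (2 - c) * m = 0 by rewrite mulrBl -h; ring.
move=> /eqP; rewrite mulf_eq0 => /orP[/eqP h2|/eqP//].
have c_2 : c = 2 by lra.
by move: cc; rewrite c_2 => cc; lra.
Unshelve. all: by end_near. Qed.

End normal_law.

(** * Independent standard normal sequences *)

Section gaussian_vectors.
Context {R : realType} {d : measure_display} {O : measurableType d}
  (P : probability O R) (Z : nat -> {RV P >-> R}).
Hypothesis iZ : mutually_independent P (fun j w => Z j w).
Hypothesis nZ : forall j A, measurable A -> P (Z j @^-1` A) = normal_prob 0 1 A.

Lemma normal_law_integral j (f : R -> \bar R) : measurable_fun setT f ->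
  (forall x, 0 <= f x)%E -> (\int[P]_w f (Z j w) = \int[normalR 0 1]_x f x)%E.
Proof.
move=> mf f0; transitivity (\int[distribution P (Z j)]_x f x)%E.
  by rewrite ge0_integral_distribution.
by apply: eq_measure_integral => A mA _; exact: nZ.
Qed.

Lemma L1_normal_law j (f : R -> R) : measurable_fun setT f ->
  L1 (normalR 0 1) f -> L1 P (fun w => f (Z j w)).
Proof.
move=> mf /integrableP[_ fin]; apply/integrableP; split.
  by apply/measurable_EFinP; exact: measurableT_comp.
rewrite (normal_law_integral j (f := fun x => `|(f x)%:E|%E))//.
by apply: measurableT_comp => //; exact/measurable_EFinP.
Qed.

Lemma Ex_normal_law j (f : R -> R) : measurable_fun setT f ->
  L1 (normalR 0 1) f -> Ex P (fun w => f (Z j w)) = Ex (normalR 0 1) f.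
Proof.
move=> mf Lf; have LfZ := (L1_distribution (Z j) mf).1 (L1_normal_law j mf Lf).
rewrite -(Ex_distribution mf (L1_normal_law j mf Lf)); congr fine.
by apply: eq_measure_integral => A mA _; exact: nZ.
Qed.

Lemma L2_Z j : L2 P (Z j).
Proof.
split; first exact: measurable_funP.
have [_ L] := @L2_normal R.
exact: (L1_normal_law j (f := fun x => x ^+ 2) (L1_measurable L) L).
Qed.

Lemma mean_Z j : Ex P (Z j) = 0.
Proof.
have L := L2_L1 (@L2_normal R).
by rewrite (Ex_normal_law j (f := fun x => x) (L1_measurable L) L) normal_mean.
Qed.

Lemma cov_Z i j : Ex P (fun w => Z i w * Z j w) = if i == j then 1 else 0.
Proof.
have mZ k : measurable_fun setT (Z k) by exact: measurable_funP.
case: eqP => [->|/eqP ij].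
  have [_ L] := @L2_normal R.
  by rewrite -normal_variance -(Ex_normal_law j (f := fun x => x ^+ 2) (L1_measurable L) L).
have fin : finitary [:: i; j] (fun z : nat -> R => z i * z j).
  split => [z z' zz'|dT T Y mY]; first by rewrite !zz'// !inE eqxx ?orbT.
  exact: measurable_funM.
rewrite (Ex_resample mZ iZ (pred1 j) fin); last exact: L2M (L2_Z i) (L2_Z j).
rewrite (@eq_Ex _ _ _ _ _ (fun=> 0)) ?Ex_cst// => w.
rewrite /= (negbTE ij) eqxx ExZ ?mean_Z ?mulr0//.
exact/L2_L1/L2_Z.
Qed.

Let Q := (P \x P)%E.
Let ZZ (i : nat * bool) (z : O * O) : R := Z i.1 (if i.2 then z.2 else z.1).

Let mZZ i : measurable_fun setT (ZZ i).
Proof.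
rewrite /ZZ; case: i => i b /=; have mZ : measurable_fun setT (Z i) by exact: measurable_funP.
by case: b; exact: (measurableT_comp mZ).
Qed.

(** Two copies of the sequence on the product space form one independent family indexed by nat *
    bool, so resampling applies to them as well. *)
Lemma independent_pairs : mutually_independent (P \x P)%E ZZ.
Proof.
move=> J A uJ mA.
pose B := [set z | z \in J].
pose J' (b : bool) := [seq i <- J | i.2 == b].
have uJ' b : uniq [seq i.1 | i <- J' b].
  rewrite map_inj_in_uniq ?filter_uniq//.
  move=> [i c] [j c']; rewrite !mem_filter /= => /andP[/eqP -> _] /andP[/eqP -> _].
  by move=> ->.
have E : \big[setI/setT]_(i <- J) (ZZ i @^-1` A i) =
    (\big[setI/setT]_(i <- [seq i.1 | i <- J' false]) (Z i @^-1` A (i, false))) `*`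
    (\big[setI/setT]_(i <- [seq i.1 | i <- J' true]) (Z i @^-1` A (i, true))).
  apply/seteqP; split => [z /bigsetIP zA|z [/bigsetIP z1 /bigsetIP z2]].
    by split; apply/bigsetIP => i /mapP[[j b]]; rewrite mem_filter /= => /andP[/eqP -> jJ] ->;
      exact: (zA _ jJ).
  apply/bigsetIP => -[i b] iJ; rewrite /= /ZZ /=; case: b iJ => iJ.
    by apply: z2; apply/mapP; exists (i, true) => //; rewrite mem_filter.
  by apply: z1; apply/mapP; exists (i, false) => //; rewrite mem_filter.
have mZA b (s : seq nat) : (forall i, i \in s -> measurable (A (i, b))) ->
    measurable (\big[setI/setT]_(i <- s) (Z i @^-1` A (i, b))).
  move=> msA; rewrite big_seq; apply: bigsetI_measurable => i /msA mi.
  by rewrite -[X in measurable X]setTI; exact: measurable_funP.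
have mJ b i : i \in [seq i.1 | i <- J' b] -> measurable (A (i, b)).
  move=> /mapP[[j c]]; rewrite mem_filter /= => /andP[/eqP -> jJ] ->; exact: mA.
rewrite E; apply: etrans (product_measure1E P P (mZA _ _ (mJ false)) (mZA _ _ (mJ true))) _.
have i1 b : P (\big[setI/setT]_(i <- [seq i.1 | i <- J' b]) (Z i @^-1` A (i, b))) =
    (\prod_(i <- [seq i.1 | i <- J' b]) P (Z i @^-1` A (i, b)))%E.
  by apply: (iZ (A := fun i => A (i, b))) => //; exact: mJ.
have e1 i : i \in J -> (P \x P)%E (ZZ i @^-1` A i) = P (Z i.1 @^-1` A i).
  move=> iJ; have mi : measurable (Z i.1 @^-1` A i).
    by rewrite -[X in measurable X]setTI; apply: measurable_funP => //; exact: mA.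
  case: i iJ mi => i b iJ /= mi; rewrite /ZZ /=; case: b iJ mi => iJ mi.
    rewrite (_ : _ @^-1` _ = setT `*` (Z i @^-1` A (i, true))).
      apply: etrans (product_measure1E P P measurableT mi) _.
      by rewrite [X in (X * _)%E](probability_setT P) mul1e.
    by apply/seteqP; split => [z ?|z []].
  rewrite (_ : _ @^-1` _ = (Z i @^-1` A (i, false)) `*` setT).
    apply: etrans (product_measure1E P P mi measurableT) _.
    by rewrite [X in (_ * X)%E](probability_setT P) mule1.
  by apply/seteqP; split => [z ?|z []].
have -> : (\prod_(i <- J) (P \x P) (ZZ i @^-1` A i) = \prod_(i <- J) P (Z i.1 @^-1` A i))%E.
  by apply: eq_big_seq => i iJ; exact: e1.
rewrite (bigID (fun i : nat * bool => i.2 == false)) /=.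
congr (_ * _)%E; apply: etrans (i1 _) _; rewrite big_map big_filter.
  by apply: eq_bigr => -[i b] /= /eqP ->.
by apply: eq_big => [[i []]//|[i []]//].
Qed.

Let mZ k : measurable_fun setT (Z k).
Proof. exact: measurable_funP. Qed.

Lemma normal_pair_stable j (a b : R) (f : R -> R) (M : R) : 0 <= a -> 0 <= b ->
  continuous f -> (forall x, `|f x| <= M) ->
  Ex (P \x P)%E (fun z => f (a * Z j z.1 + b * Z j z.2)) =
  Ex P (fun w => f (Num.sqrt (a ^+ 2 + b ^+ 2) * Z j w)).
Proof.
move=> a0 b0 cf fM.
have mf : measurable_fun setT f by apply: continuous_measurable_fun; exact: cf.
have mlin c e : measurable_fun setT (fun y : R => f (c + e * y)).
  by apply: (measurableT_comp mf); apply: measurable_funD => //; exact: measurable_funM.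
rewrite Ex_fubini /=; last first.
  apply: (L1_bnd _ (M := M)) => // ; apply: (measurableT_comp mf).
  by apply: measurable_funD; apply: measurable_funM => //; exact: (measurableT_comp (mZ j)).
have msl : measurable_fun setT (fun x : R => Ex (normalR 0 1) (fun y => f (a * x + b * y))).
  apply: (measurable_Ex_slice (normalR 0 1) (f := fun z : R * R => f (a * z.1 + b * z.2))).
  apply: (measurableT_comp mf).
  by apply: measurable_funD; exact: measurable_funM.
transitivity (Ex P (fun w => Ex (normalR 0 1) (fun y => f (a * Z j w + b * y)))).
  apply: eq_Ex => w; rewrite -(Ex_normal_law j (f := fun y => f (a * Z j w + b * y)))//.
  by apply: (L1_bnd _ (M := M)).
rewrite (Ex_normal_law j (f := fun x => Ex (normalR 0 1) (fun y => f (a * x + b * y))))//.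
  rewrite (normal_stable a0 b0 cf fM).
  rewrite -(Ex_normal_law j (f := fun x => f (Num.sqrt (a ^+ 2 + b ^+ 2) * x)))//.
  - by apply: (measurableT_comp mf); exact: measurable_funM.
  - apply: (L1_bnd _ (M := M)) => //.
    by apply: (measurableT_comp mf); exact: measurable_funM.
apply: (L1_bnd _ (M := M)) => // x; apply: normr_Ex_le => //.
by apply: (L1_bnd _ (M := M)).
Qed.

(** Induction on J: the last coordinate is separated by resampling and treated by
    [normal_pair_stable]. The test function is quantified after J because the induction hypothesis
    is used for translates of [f]. *)
Lemma gaussian_stable (a b : R) (theta : nat -> R -> R) (r : nat -> R) :
  0 <= a -> 0 <= b -> (forall l, continuous (theta l)) ->
  forall (J : nat) (f : R -> R) (M : R), continuous f -> (forall x, `|f x| <= M) ->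
  Ex (P \x P)%E (fun z => f (\sum_(l < J) theta l (r l + a * Z l z.1 + b * Z l z.2))) =
  Ex P (fun w => f (\sum_(l < J) theta l (r l + Num.sqrt (a ^+ 2 + b ^+ 2) * Z l w))).
Proof.
move=> a0 b0 ct; set c := Num.sqrt _; elim=> [|J IH] f M cf fM.
  by rewrite (@eq_Ex _ _ _ _ _ (fun=> f 0)) ?[RHS](@eq_Ex _ _ _ _ _ (fun=> f 0)) ?Ex_cst//;
     move=> z; rewrite big_ord0.
have mT l : measurable_fun setT (theta l) by apply: continuous_measurable_fun; exact: ct.
have mf : measurable_fun setT f by apply: continuous_measurable_fun; exact: cf.
have mZ1 l : measurable_fun setT (fun z : O * O => Z l z.1) by exact: (measurableT_comp (mZ l)).
have mZ2 l : measurable_fun setT (fun z : O * O => Z l z.2) by exact: (measurableT_comp (mZ l)).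
pose Phi (y : nat * bool -> R) :=
  f (\sum_(l < J.+1) theta l (r l + a * y (nat_of_ord l, false) + b * y (nat_of_ord l, true))).
pose L := [seq (l, e) | l <- iota 0 J.+1, e <- [:: false; true]].
have inL l e : (l < J.+1)%N -> (l, e) \in L.
  move=> lJ; apply/allpairsP; exists (l, e); split; [|by case: e|by []].
  by rewrite mem_iota add0n.
have finPhi : finitary L Phi.
  split => [y y' yy'|dT T Y mY].
    congr f; apply: eq_bigr => l _; rewrite !yy'//; exact: inL.
  apply: (measurableT_comp mf); apply: measurable_sum => l; apply: (measurableT_comp (mT l)).
  by apply: measurable_funD; [apply: measurable_funD => //|]; apply: measurable_funM.
pose A : pred (nat * bool) := fun i => i.1 == J.
have L1Phi : L1 (P \x P)%E (fun z => Phi (ZZ ^~ z)).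
  apply: (L1_bnd _ (M := M)); last by move=> z; exact: fM.
  by case: finPhi => _ mPhi; exact: (mPhi _ _ ZZ mZZ).
transitivity (Ex (P \x P)%E (fun z => Phi (ZZ ^~ z))); first by [].
rewrite (Ex_resample mZZ independent_pairs A finPhi L1Phi).
pose S1 (z : O * O) := \sum_(l < J) theta l (r l + a * Z l z.1 + b * Z l z.2).
pose S2 (w : O) := \sum_(l < J) theta l (r l + c * Z l w).
pose T1 (z : O * O) := theta J (r J + a * Z J z.1 + b * Z J z.2).
pose T2 (w : O) := theta J (r J + c * Z J w).
have mS1 : measurable_fun setT S1.
  apply: measurable_sum => l; apply: (measurableT_comp (mT l)).
  by apply: measurable_funD; [apply: measurable_funD => //|]; apply: measurable_funM.
have mS2 : measurable_fun setT S2.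
  apply: measurable_sum => l; apply: (measurableT_comp (mT l)).
  by apply: measurable_funD => //; apply: measurable_funM.
have mT1 : measurable_fun setT T1.
  apply: (measurableT_comp (mT J)).
  by apply: measurable_funD; [apply: measurable_funD => //|]; apply: measurable_funM.
transitivity (Ex (P \x P)%E (fun z => Ex (P \x P)%E (fun z' => f (S1 z + T1 z')))).
  apply: eq_Ex => z; apply: eq_Ex => z'; rewrite /Phi big_ord_recr /= /A /ZZ /= eqxx.
  congr (f (_ + _)); apply: eq_bigr => l _.
  by rewrite (ltn_eqF (ltn_ord l)).
rewrite (Ex_swap (f := fun x => f (S1 x.1 + T1 x.2))); last first.
  apply: (L1_bnd _ (M := M)) => //; apply: (measurableT_comp mf); apply: measurable_funD.
    exact: (measurableT_comp mS1).
  exact: (measurableT_comp mT1).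
have cfy y : continuous (fun x => f (x + y)).
  by move=> x; apply: continuous_comp; [apply: cvgD; [exact: cvg_id|exact: cvg_cst]|exact: cf].
transitivity (Ex (P \x P)%E (fun z' => Ex P (fun w => f (S2 w + T1 z')))).
  by apply: eq_Ex => z'; exact: (IH (fun x => f (x + T1 z')) M (cfy _)).
rewrite -(Ex_swap (f := fun x : O * (O * O) => f (S2 x.1 + T1 x.2))); last first.
  apply: (L1_bnd _ (M := M)) => //; apply: (measurableT_comp mf); apply: measurable_funD.
    exact: (measurableT_comp mS2).
  exact: (measurableT_comp mT1).
transitivity (Ex P (fun w => Ex P (fun w' => f (S2 w + T2 w')))).
  apply: eq_Ex => w /=.
  have cg : continuous (fun x => f (S2 w + theta J (r J + x))).
    move=> x; apply: continuous_comp; last exact: cf.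
    apply: cvgD; first exact: cvg_cst.
    apply: continuous_comp; last exact: ct.
    by apply: cvgD; [exact: cvg_cst|exact: cvg_id].
  have := normal_pair_stable J a0 b0 cg (fun x => fM _); rewrite -/c => <-.
  by apply: eq_Ex => z; rewrite /T1 addrA.
pose Psi (y : nat -> R) := f (\sum_(l < J.+1) theta l (r l + c * y l)).
have finPsi : finitary (iota 0 J.+1) Psi.
  split => [y y' yy'|dT T Y mY].
    by congr f; apply: eq_bigr => l _; rewrite yy'// mem_iota add0n ltn_ord.
  apply: (measurableT_comp mf); apply: measurable_sum => l; apply: (measurableT_comp (mT l)).
  by apply: measurable_funD => //; apply: measurable_funM.
have L1Psi : L1 P (fun w => Psi (fun l => Z l w)).
  apply: (L1_bnd _ (M := M)); last by move=> z; exact: fM.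
  by case: finPsi => _ mPsi; exact: (mPsi _ _ Z mZ).
rewrite [RHS](Ex_resample mZ iZ (fun l => l == J) finPsi L1Psi).
apply: eq_Ex => w; apply: eq_Ex => w'; rewrite /Psi big_ord_recr /= eqxx.
congr (f (_ + _)); apply: eq_bigr => l _.
by rewrite (ltn_eqF (ltn_ord l)).
Qed.

End gaussian_vectors.

(** * Central limit theorem for ridge functions *)

Section central_limit.
Context {R : realType} {d d' dS : measure_display} {O : measurableType d}
  {O' : measurableType d'} {S : measurableType dS}
  (P : probability O R) (P' : probability O' R) (X : nat -> O -> S)
  (Z : nat -> {RV P' >-> R}) (u : nat -> S -> R) (J : nat).
Hypothesis mX : forall i, measurable_fun setT (X i).
Hypothesis iX : mutually_independent P X.
Hypothesis idX : forall i j A, measurable A -> P (X i @^-1` A) = P (X j @^-1` A).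
Hypothesis L2Zl : forall l, (l < J)%N -> L2 P' (Z l).
Hypothesis meanZl : forall l, (l < J)%N -> Ex P' (Z l) = 0.
Hypothesis stabZ : forall (a b : R) (theta : nat -> R -> R) (r : nat -> R),
  0 <= a -> 0 <= b -> (forall l, continuous (theta l)) ->
  forall (f : R -> R) (M : R), continuous f -> (forall x, `|f x| <= M) ->
  Ex (P' \x P')%E (fun z => f (\sum_(l < J) theta l (r l + a * Z l z.1 + b * Z l z.2))) =
  Ex P' (fun w => f (\sum_(l < J) theta l (r l + Num.sqrt (a ^+ 2 + b ^+ 2) * Z l w))).
Hypothesis mu_ : forall l, (l < J)%N -> measurable_fun setT (u l).
Hypothesis L2u : forall l, (l < J)%N -> L2 P (fun w => u l (X 0%N w)).
Hypothesis meanu : forall l, (l < J)%N -> Ex P (fun w => u l (X 0%N w)) = 0.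
Hypothesis covuZ : forall l m, (l < J)%N -> (m < J)%N ->
  Ex P (fun w => u l (X 0%N w) * u m (X 0%N w)) = Ex P' (fun w => Z l w * Z m w).

(** Replacing n summands at step n^(-1/2) costs n times the error of one replacement, which
    [replacement_error_cvg] sends to 0. [Z] is any stable vector with the covariances of [u],
    possibly degenerate. *)
Lemma ridge_clt (f : R -> R) (theta theta1 theta2 : nat -> R -> R) (M : R) :
  smooth f ->
  (forall l (x : R), is_derive x 1 (theta l) (theta1 l x)) ->
  (forall l (x : R), is_derive x 1 (theta1 l) (theta2 l x)) ->
  (forall l x, `|theta1 l x| <= M) -> (forall l x, `|theta2 l x| <= M) ->
  (forall l x y, `|theta2 l x - theta2 l y| <= M * `|x - y|) ->
  Ex P (fun w => f (\sum_(l < J) theta l ((Num.sqrt n%:R)^-1 * \sum_(i < n) u l (X i w))))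
    @[n --> \oo] --> Ex P' (fun w => f (\sum_(l < J) theta l (Z l w))).
Proof.
move=> [f1 [f2 [M' [df df1 [fM f1M f2M f2L]]]]] dt dt1 t1M t2M t2L.
pose N := Num.max M M'.
have MN : M <= N by rewrite le_max lexx.
have MN' : M' <= N by rewrite le_max lexx orbT.
have fN x : `|f x| <= N by exact: le_trans (fM x) MN'.
have f1N x : `|f1 x| <= N by exact: le_trans (f1M x) MN'.
have f2N x : `|f2 x| <= N by exact: le_trans (f2M x) MN'.
have f2LN x y : `|f2 x - f2 y| <= N * `|x - y|.
  by apply: le_trans (f2L x y) _; rewrite ler_wpM2r.
have t1N l x : `|theta1 l x| <= N by exact: le_trans (t1M l x) MN.
have t2N l x : `|theta2 l x| <= N by exact: le_trans (t2M l x) MN.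
have t2LN l x y : `|theta2 l x - theta2 l y| <= N * `|x - y|.
  by apply: le_trans (t2L l x y) _; rewrite ler_wpM2r.
have [C C0 HC] := one_replacement df df1 fN f1N f2N f2LN dt dt1 t1N t2N t2LN
  L2u L2Zl meanu meanZl covuZ.
have mZl l : (l < J)%N -> measurable_fun setT (Z l) by move=> _; exact: measurable_funP.
have cf := is_derive_continuous df.
have ct l := is_derive_continuous (dt l).
have stab (a b : R) (r : nat -> R) : 0 <= a -> 0 <= b ->
    Ex P' (fun w => Ex P' (fun w' => ridge J f theta (fun l => r l + a * Z l w + b * Z l w'))) =
    Ex P' (fun w => ridge J f theta (fun l => r l + Num.sqrt (a ^+ 2 + b ^+ 2) * Z l w)).
  move=> a0 b0; rewrite /ridge -(stabZ r a0 b0 ct cf fM) Ex_fubini//.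
  apply: (L1_bnd _ (M := M')) => //.
  apply: (measurable_ridge df dt (y := fun l z => r l + a * Z l z.1 + b * Z l z.2)) => l lJ.
  by apply: measurable_funD; [apply: measurable_funD => //|]; apply: measurable_funM => //;
     exact: (measurableT_comp (mZl l lJ)).
pose D n := replacement_error J P P' (fun l w => u l (X 0%N w)) (fun l w => Z l w) C
  (Num.sqrt n%:R)^-1.
(* Mean and covariances are given at index 0; identical distribution carries the bound to every
   index. *)
have HDi n i (r : nat -> R) : `|Ex P (fun w => ridge J f theta (fun l => r l +
    (Num.sqrt n%:R)^-1 * u l (X i w))) -
    Ex P' (fun w => ridge J f theta (fun l => r l + (Num.sqrt n%:R)^-1 * Z l w))| <= D n.
  have c0 : 0 <= (Num.sqrt n%:R)^-1 :> R by rewrite invr_ge0.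
  have := HC _ r c0.
  pose Phi (z : nat -> S) := ridge J f theta (fun l => r l + (Num.sqrt n%:R)^-1 * u l (z 0%N)).
  have finPhi : finitary [:: 0%N] Phi.
    split => [z z' zz'|dT T Y mY]; first by rewrite /Phi zz' ?inE.
    apply: (measurable_ridge df dt) => l lJ; apply: measurable_funD => //.
    by apply: measurable_funM => //; apply: (measurableT_comp (mu_ lJ)); exact: mY.
  have := @Ex_reindex _ _ _ _ _ _ P X mX iX idX (fun=> i) [:: 0%N] Phi.
  rewrite /Phi => ->//.
  by move=> x y; rewrite !inE => /eqP -> /eqP ->.
have main n : `|Ex P (fun w => f (\sum_(l < J) theta l
      ((Num.sqrt n.+1%:R)^-1 * \sum_(i < n.+1) u l (X i w)))) -
    Ex P' (fun w => f (\sum_(l < J) theta l (Z l w)))| <= n.+1%:R * D n.+1.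
  have c0 : 0 <= (Num.sqrt n.+1%:R)^-1 :> R by rewrite invr_ge0.
  have := all_replacements df fN dt mX iX mu_ mZl stab c0 (HDi n.+1) n.+1 (fun=> 0).
  rewrite (@eq_Ex _ _ _ P _ (fun w => f (\sum_(l < J) theta l
      ((Num.sqrt n.+1%:R)^-1 * \sum_(i < n.+1) u l (X i w))))); last first.
    by move=> w; congr f; apply: eq_bigr => l _; rewrite add0r.
  rewrite (@eq_Ex _ _ _ P' _ (fun w => f (\sum_(l < J) theta l (Z l w))))// => w.
  congr f; apply: eq_bigr => l _.
  by rewrite add0r mulVf ?mul1r// gt_eqF// sqrtr_gt0 ltr0n.
have cvD : n%:R * D n @[n --> \oo] --> (0 : R).
  by apply: (replacement_error_cvg (P := P) (P' := P')).
apply/cvgrPdist_le => e e0.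
move/cvgrPdist_le : cvD => /(_ _ e0) [n0 _ Hn0].
exists n0.+1 => // -[//|n] /= n0n; rewrite distrC; apply: le_trans (main n) _.
have := Hn0 n.+1 (leqW n0n); rewrite sub0r normrN => H.
exact: le_trans (ler_norm _) H.
Qed.

End central_limit.

(** * Counting overlaps *)

(** The quotient of 'C(n - r, m - r) by 'C(n, m) is the product over i < r of (m - i) / (n - i), and
    each factor is at most m / n. *)
Lemma bin_falling_le (n m r : nat) : (r <= m)%N -> (m <= n)%N ->
  ('C(n - r, m - r) * n ^ r <= 'C(n, m) * m ^ r)%N.
Proof.
elim: r => [|r IH] rm mn; first by rewrite !subn0 !expn0.
have rn : (r < n)%N by exact: leq_trans rm mn.
have IHr := IH (ltnW rm) mn.
rewrite -(leq_pmul2l (m := n - r)) ?subn_gt0//.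
have E : ((n - r) * 'C(n - r.+1, m - r.+1) = (m - r) * 'C(n - r, m - r))%N.
  rewrite -[in LHS](subnSK rn) -[in RHS](subnSK rn) -[in RHS](subnSK rm).
  exact: mul_bin_diag.
rewrite mulnA E !expnS.
rewrite [leqLHS](_ : _ = (n * (m - r)) * ('C(n - r, m - r) * n ^ r))%N; last by ring.
rewrite [leqRHS](_ : _ = (m * (n - r)) * ('C(n, m) * m ^ r))%N; last by ring.
apply: leq_mul => //; rewrite !mulnBr mulnC leq_sub2l//.
by rewrite leq_mul2r mn orbT.
Qed.

(** Removing [D] is a bijection from these supersets onto the subsets of its complement with m -
    #|D| elements. *)
Lemma card_supersets (T : finType) (D : {set T}) (m : nat) : (#|D| <= m)%N ->
  #|[set A : {set T} | (D \subset A) && (#|A| == m)]%SET| = 'C(#|T| - #|D|, m - #|D|).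
Proof.
move=> Dm; have -> : (#|T| - #|D| = #|~: D|)%N by rewrite -(cardsC D) addKn.
rewrite -cards_draws.
rewrite -[RHS](card_in_imset (f := fun B => B :|: D)); last first.
  move=> B B'; rewrite !inE => /andP[BD _] /andP[BD' _] E.
  have K (C : {set T}) : C \subset ~: D -> (C :|: D) :\: D = C.
    move=> /fintype.subsetP CD; apply/setP => x; have := CD x; rewrite !inE.
    by case: (x \in C); case: (x \in D) => // /(_ isT).
  by rewrite -(K _ BD) E K.
congr #|pred_of_set _|; apply/setP => A; rewrite !inE; apply/idP/imsetP.
  move=> /andP[DA /eqP Am]; exists (A :\: D); last first.
    by apply/setP => x; rewrite !inE; have := fintype.subsetP DA x; case: (x \in D) => [->|_] //; rewrite ?orbF.
  rewrite !inE finset.setDE finset.subsetIr /=.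
  by rewrite -finset.setDE cardsDS// Am.
move=> [B]; rewrite !inE => /andP[BD /eqP Bm] ->; rewrite finset.subsetUr /=.
rewrite cardsU Bm (_ : B :&: D = finset.set0) ?cards0 ?subn0 ?subnK//.
apply/setP => x; have := fintype.subsetP BD x; rewrite !inE.
by case: (x \in B); case: (x \in D) => // /(_ isT).
Qed.

Section sorted_tuples.
Local Open Scope set_scope.
Context {R : realType} (n m : nat).
Implicit Types (t : m.-tuple 'I_n).

Local Notation incr := (sorted (fun a b : 'I_n => (a < b)%N)).

Let tset t : {set 'I_n} := [set x in t].

Lemma incr_uniq t : incr t -> uniq t.
Proof.
apply: (sorted_uniq (leT := fun a b : 'I_n => (a < b)%N)).
- by move=> a b c; exact: ltn_trans.
- by move=> a; rewrite ltnn.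
Qed.

Lemma card_tset t : incr t -> #|tset t| = m.
Proof. by move=> /incr_uniq u; rewrite cardsE (card_uniqP u) size_tuple. Qed.

(** Increasing tuples encode m-subsets. Injectivity is uniqueness of sorted lists; surjectivity
    comes from comparing cardinals, not from sorting a set. *)
Lemma sorted_tuple_sum (F : {set 'I_n} -> R) :
  \sum_(t : m.-tuple 'I_n | incr t) F [set x in t] =
  \sum_(A : {set 'I_n} | #|A| == m) F A.
Proof.
have inj : {in [set t : m.-tuple 'I_n | incr t] &, injective tset}.
  move=> t t'; rewrite !inE => it it' /setP tt'.
  apply/val_inj; apply: (irr_sorted_eq (leT := fun a b : 'I_n => (a < b)%N)) => //.
  - by move=> a b c; exact: ltn_trans.
  - by move=> a; rewrite ltnn.
  - by move=> x; have := tt' x; rewrite !inE.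
have im : tset @: [set t : m.-tuple 'I_n | incr t] = [set A : {set 'I_n} | #|A| == m].
  apply/eqP; rewrite eqEcard; apply/andP; split.
    by apply/fintype.subsetP => _ /imsetP[t + ->]; rewrite !inE => /card_tset ->.
  rewrite card_in_imset// card_draws card_ord.
  rewrite (_ : #|_| = #|[set t : m.-tuple 'I_n | sorted ltn (map val t)]|).
    by rewrite card_ltn_sorted_tuples.
  by congr #|pred_of_set _|; apply/setP => t; rewrite !inE sorted_map.
transitivity (\sum_(A in [set A : {set 'I_n} | #|A| == m]) F A); last first.
  by apply: eq_bigl => A; rewrite inE.
by rewrite -im big_imset//=; apply: eq_bigl => t; rewrite inE.
Qed.

(** The left side is the probability that two uniform m-subsets share at least r elements. The bound
    is a union bound over the 'C(m, r) subsets D of the first one, each contained in the second with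
    probability at most (m / n)^r. *)
Lemma sum_overlap_le (r : nat) :
  ('C(n, m)%:R ^-1) ^+ 2 *
  (\sum_(t : m.-tuple 'I_n | incr t) \sum_(t' : m.-tuple 'I_n | incr t')
     (r <= #|[set x in t] :&: [set x in t']|)%N%:R) <=
  'C(m, r)%:R * (m%:R / n%:R) ^+ r :> R.
Proof.
rewrite (sorted_tuple_sum (fun A : {set 'I_n} =>
  \sum_(t' : m.-tuple 'I_n | incr t') (r <= #|A :&: [set x in t']|)%N%:R)).
under eq_bigr do rewrite (sorted_tuple_sum (fun B : {set 'I_n} => (r <= #|_ :&: B|)%N%:R)).
have [mn|nm] := leqP m n; last first.
  by rewrite bin_small// invr0 expr0n mul0r mulr_ge0// exprn_ge0// divr_ge0.
have [rm|mr] := leqP r m; last first.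
  rewrite (bin_small mr) mul0r big1 ?mulr0// => A /eqP Am; rewrite big1// => B _.
  by rewrite leqNgt (leq_ltn_trans (subset_leq_card (finset.subsetIl _ _)))// Am.
have C0 : 0 < 'C(n, m)%:R :> R by rewrite ltr0n bin_gt0.
have step (A : {set 'I_n}) : #|A| == m ->
    \sum_(B : {set 'I_n} | #|B| == m) (r <= #|A :&: B|)%N%:R <=
    'C(m, r)%:R * 'C(n - r, m - r)%:R :> R.
  move=> /eqP Am.
  apply: (@le_trans _ _ (\sum_(B : {set 'I_n} | #|B| == m)
      \sum_(D : {set 'I_n} | (D \subset A) && (#|D| == r)) (D \subset B)%:R)).
    apply: ler_sum => B _; have [rAB|_] := leqP r; last by apply: sumr_ge0.
    have /card_geqP[s [us sr sAB]] := rAB.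
    rewrite (bigD1 [set x in s]) /=; last first.
      rewrite cardsE (card_uniqP us) sr eqxx andbT; apply/fintype.subsetP => x; rewrite inE => /sAB.
      by rewrite inE => /andP[].
    rewrite (_ : _ \subset B); last first.
      by apply/fintype.subsetP => x; rewrite inE => /sAB; rewrite inE => /andP[].
    by rewrite lerDl; apply: sumr_ge0.
  rewrite exchange_big /= -Am -(cards_draws A r) Am -sum1_card natr_sum mulr_suml.
  rewrite le_eqVlt; apply/orP; left; apply/eqP; apply: eq_big => [D|D /andP[_ /eqP Dr]].
    by rewrite inE.
  have := @card_supersets _ D m; rewrite Dr card_ord => /(_ rm) <-; rewrite mul1r.
  rewrite -sum1_card natr_sum (bigID (fun B : {set 'I_n} => D \subset B)) /=.
  rewrite [X in _ + X]big1 ?addr0 => [|B /andP[_ /negbTE ->]]//.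
  by apply: eq_big => [B|B /andP[_ ->]//]; rewrite inE andbC.
apply: (@le_trans _ _ (('C(n, m)%:R ^-1) ^+ 2 *
    ('C(n, m)%:R * ('C(m, r)%:R * 'C(n - r, m - r)%:R)))).
  rewrite ler_wpM2l ?sqr_ge0//.
  apply: le_trans (ler_sum _ step) _.
  rewrite sumr_const (_ : #|_| = 'C(n, m)).
    by rewrite [leRHS]mulr_natl.
  by have := card_draws 'I_n m; rewrite card_ord => <-; apply: eq_card => A; rewrite !inE.
rewrite [leLHS](_ : _ = 'C(m, r)%:R * ('C(n - r, m - r)%:R / 'C(n, m)%:R)); last first.
  by field; rewrite gt_eqF.
rewrite ler_wpM2l// expr_div_n ler_pdivrMr// mulrAC.
have [r0|r0] := posnP r; first by rewrite r0 !subn0 !expr0 divr1 mul1r.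
have n0 : (0 < n)%N by apply: leq_trans mn; exact: leq_trans rm.
rewrite ler_pdivlMr ?exprn_gt0 ?ltr0n// -!natrX -!natrM ler_nat [leqRHS]mulnC.
exact: bin_falling_le.
Qed.

End sorted_tuples.

(** * Variance of a two-sample U-statistic *)

Lemma sum_prod_pairs (R : realType) (I J : finType) (Q1 : pred I) (Q2 : pred J)
    (f : I -> I -> R) (g : J -> J -> R) :
  \sum_(q : I * J | Q1 q.1 && Q2 q.2) \sum_(q' : I * J | Q1 q'.1 && Q2 q'.2)
    f q.1 q'.1 * g q.2 q'.2 =
  (\sum_(i | Q1 i) \sum_(i' | Q1 i') f i i') * (\sum_(j | Q2 j) \sum_(j' | Q2 j') g j j').
Proof.
rewrite mulr_suml -(pair_big Q1 Q2 (fun i j => \sum_(q' : I * J | Q1 q'.1 && Q2 q'.2)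
  f i q'.1 * g j q'.2)) /=.
apply: eq_bigr => i _; rewrite mulr_sumr; apply: eq_bigr => j _.
by rewrite -(pair_big Q1 Q2 (fun i' j' => f i i' * g j j')) /= big_distrlr.
Qed.

(** Integrating out a variable contracts L2: Jensen's inequality holds on every slice, its right
    side being +oo where the square is not integrable. *)
Lemma L2_fubini {d d' : measure_display} {T : measurableType d} {T' : measurableType d'}
    {R : realType} (P : probability T R) (Q : probability T' R) (f : T * T' -> R) :
  L2 (P \x Q)%E f -> L2 P (fun x => Ex Q (fun y => f (x, y))).
Proof.
move=> [mf Lf]; have mg := measurable_Ex_slice Q mf; split => //.
have mf2 : measurable_fun setT (fun z => (f z ^+ 2)%:E).
  by apply/measurable_EFinP; exact: measurable_funX.
apply/integrableP; split; first by apply/measurable_EFinP; exact: measurable_funX.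
have f20 z : (0 <= (f z ^+ 2)%:E)%E by rewrite lee_fin sqr_ge0.
have key x : ((Ex Q (fun y => f (x, y)) ^+ 2)%:E <= \int[Q]_y (f (x, y) ^+ 2)%:E)%E.
  have msl := measurable_slice1 x mf.
  have [Lx|nLx] := pselect (L1 Q (fun y => f (x, y) ^+ 2)).
    have L2x : L2 Q (fun y => f (x, y)) by [].
    rewrite L1_int// lee_fin; apply: le_trans (sqr_Ex_norm_le L2x).
    rewrite -real_normK ?num_real// ler_sqr ?nnegrE//; last exact: Ex_ge0.
    by apply: normr_Ex; exact: L2_L1.
  rewrite [leRHS](_ : _ = +oo%E) ?leey//; apply/eqP; apply: contra_notT nLx.
  rewrite -ltey => fin; apply/integrableP; split.
    by apply/measurable_EFinP; exact: measurable_funX.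
  by under eq_integral do rewrite /= ger0_norm ?sqr_ge0//.
have : (\int[(P \x Q)%E]_z (f z ^+ 2)%:E < +oo)%E by rewrite (L1_int Lf) ltey.
rewrite fubini_tonelli1//; apply: le_lt_trans; apply: ge0_le_integral => //.
- by apply: measurableT_comp => //; apply/measurable_EFinP; exact: measurable_funX.
- exact: measurable_fun_fubini_tonelli_F.
- by move=> x _; rewrite /fubini_F /= ger0_norm ?sqr_ge0//; exact: key.
Qed.

(** Moves the entries shared with [s'] to the front, since projections fix an initial block of
    arguments. *)
Lemma reorder_tuple m (s s' : m.-tuple nat) : exists so : m.-tuple nat,
  perm_eq s so /\ (forall i : 'I_m, (tnth so i \in s') = (i < count (mem s') s)%N).
Proof.
pose q := [seq i <- s | i \in s'] ++ [seq i <- s | i \notin s'].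
have sq : perm_eq q s by rewrite /q perm_filterC.
have qm : size q == m by rewrite (perm_size sq) size_tuple.
exists (Tuple qm); split => [|i]; first by rewrite perm_sym.
rewrite (tnth_nth 0%N) /= /q nth_cat size_filter; case: ltnP => ia.
  have : nth 0%N [seq i <- s | i \in s'] i \in [seq i <- s | i \in s'].
    by rewrite mem_nth// size_filter.
  by rewrite mem_filter => /andP[].
set k := (i - _)%N.
have : nth 0%N [seq i <- s | i \notin s'] k \in [seq i <- s | i \notin s'].
  rewrite mem_nth// /k ltn_subLR// size_filter.
  by have := eqP qm; rewrite size_cat !size_filter => ->.
by rewrite mem_filter => /andP[/negbTE].
Qed.

Section ustat_variance.
Context {R : realType} {p m0 m1 : nat} {d : measure_display} {O : measurableType d}
  (P : probability O R) (X : bool * nat -> O -> p.-tuple R).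
Local Notation S := (p.-tuple R).
Hypothesis mX : forall i, measurable_fun setT (X i).
Hypothesis iX : mutually_independent P X.
Hypothesis idX : forall i j A, measurable A -> P (X i @^-1` A) = P (X j @^-1` A).

(** Almost sure vanishing of Phi is the vanishing of the expectation of min(|Phi|, 1), and
    expectations are invariant under relabelling. *)
Lemma ae_reindex (f : bool * nat -> bool * nat) L (Phi : (bool * nat -> S) -> R) :
  {in L &, injective f} -> finitary L Phi ->
  {ae P, forall w, Phi (X ^~ w) = 0} -> {ae P, forall w, Phi (fun i => X (f i) w) = 0}.
Proof.
move=> fI finPhi Phi0.
pose Psi z := Num.min `|Phi z| 1.
have finPsi : finitary L Psi.
  case: finPhi => Pd Pm; split => [z z' zz'|d' T Y mY]; first by rewrite /Psi (Pd z z').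
  by apply: measurable_minr => //; apply: measurableT_comp => //; exact: Pm.
have Psi01 z : 0 <= Psi z <= 1 by rewrite le_min normr_ge0 ler01 ge_min lexx orbT.
have mPsi (Y : bool * nat -> O -> S) : (forall i, measurable_fun setT (Y i)) ->
    measurable_fun setT (fun w => Psi (Y ^~ w)) by case: finPsi => _; apply.
have E0 : Ex P (fun w => Psi (X ^~ w)) = 0.
  rewrite -[RHS](Ex_cst P 0); apply: ae_eq_Ex => //; first exact: mPsi.
  by apply: filterS Phi0 => w Pw; rewrite /Psi Pw normr0 minEle ler01.
move: E0; rewrite (Ex_reindex mX iX idX fI finPsi) => E0.
have L1Psi : L1 P (fun w => Psi (fun i => X (f i) w)).
  apply: (L1_bnd _ (M := 1)); first by apply: mPsi => i; exact: mX.
  by move=> w; have /andP[h1 h2] := Psi01 (fun i => X (f i) w); rewrite ger0_norm.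
have := Ex0_ae L1Psi (fun w => proj1 (andP (Psi01 _))) E0.
apply: filterS => w; rewrite /Psi minEle; case: ifP => _; first by move/normr0_eq0.
by move/eqP; rewrite oner_eq0.
Qed.

Lemma measurable_kernel_eval (r : m0.-tuple S -> m1.-tuple S -> R) (d' : measure_display)
    (T : measurableType d') (Y0 : 'I_m0 -> T -> S) (Y1 : 'I_m1 -> T -> S) :
  measurable_fun setT (fun z : m0.-tuple S * m1.-tuple S => r z.1 z.2) ->
  (forall i, measurable_fun setT (Y0 i)) -> (forall j, measurable_fun setT (Y1 j)) ->
  measurable_fun setT (fun w => r [tuple Y0 i w | i < m0] [tuple Y1 j w | j < m1]).
Proof.
move=> mr mY0 mY1.
pose g w := ([tuple Y0 i w | i < m0], [tuple Y1 j w | j < m1]).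
apply: (measurableT_comp mr (g := g)); apply: measurable_fun_pair.
  apply/measurable_fun_tnthP => i; rewrite (_ : _ \o _ = Y0 i)//.
  by apply/funext => w /=; rewrite tnth_mktuple.
apply/measurable_fun_tnthP => i; rewrite (_ : _ \o _ = Y1 i)//.
by apply/funext => w /=; rewrite tnth_mktuple.
Qed.

Definition ker (r : m0.-tuple S -> m1.-tuple S -> R) (s : m0.-tuple nat) (t : m1.-tuple nat)
  (z : bool * nat -> S) : R :=
  r [tuple z (false, tnth s i) | i < m0] [tuple z (true, tnth t j) | j < m1].

Definition sym_kernel (r : m0.-tuple S -> m1.-tuple S -> R) : Prop :=
  [/\ measurable_fun setT (fun z : m0.-tuple S * m1.-tuple S => r z.1 z.2),
      (forall (x x' : m0.-tuple S) (y : m1.-tuple S), perm_eq x x' -> r x y = r x' y) &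
      (forall (x : m0.-tuple S) (y y' : m1.-tuple S), perm_eq y y' -> r x y = r x y')].

Lemma hprojE (r : m0.-tuple S -> m1.-tuple S -> R) a b x y :
  hproj P X r a b x y = Ex P (hfill X r a b x y).
Proof. by rewrite /hproj unlock. Qed.

Let support (s t : seq nat) : seq (bool * nat) :=
  [seq (false, i) | i <- s] ++ [seq (true, j) | j <- t].

Let in_support s t e : (e \in support s t) = (e.2 \in (if e.1 then t else s)).
Proof.
case: e => b i; rewrite mem_cat; case: b => /=.
  rewrite (mem_map (f := pair true)); last by move=> ? ? [].
  by rewrite orb_idl// => /mapP[].
rewrite (mem_map (f := pair false)); last by move=> ? ? [].
by rewrite orb_idr// => /mapP[].
Qed.

Section one_kernel.
Variable r : m0.-tuple S -> m1.-tuple S -> R.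
Hypothesis rK : sym_kernel r.
Let base (w : O) : R :=
  r [tuple X (false, nat_of_ord i) w | i < m0] [tuple X (true, nat_of_ord j) w | j < m1].
Hypothesis L2r : L2 P base.

Let mr : measurable_fun setT (fun z : m0.-tuple S * m1.-tuple S => r z.1 z.2).
Proof. by case: rK. Qed.

Lemma finitary_ker (s : m0.-tuple nat) (t : m1.-tuple nat) : finitary (support s t) (ker r s t).
Proof.
split => [z z' zz'|d' T Y mY]; last exact: (measurable_kernel_eval mr).
by congr r; apply: eq_mktuple => i; apply: zz'; rewrite in_support /= mem_tnth.
Qed.

Lemma ker_perm (s s' : m0.-tuple nat) (t t' : m1.-tuple nat) z : perm_eq s s' -> perm_eq t t' -> ker r s t z = ker r s' t' z.
Proof.
case: rK => _ r1 r2 ss' tt'; rewrite /ker.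
have H m b (q q' : m.-tuple nat) : perm_eq q q' ->
    perm_eq [tuple z (b, tnth q i) | i < m] [tuple z (b, tnth q' i) | i < m].
  have E (u : m.-tuple nat) : [tuple z (b, tnth u i) | i < m] = map (fun i => z (b, i)) u :> seq S.
    by rewrite -[X in map _ X](map_tnth_enum u) -map_comp.
  by move=> qq'; rewrite !E perm_map.
by rewrite (r1 _ _ _ (H _ _ _ _ ss')) (r2 _ _ _ (H _ _ _ _ tt')).
Qed.

Let relabel (s t : seq nat) (e : bool * nat) : bool * nat :=
  (e.1, nth 0%N (if e.1 then t else s) e.2).

Let relabel_inj (s : m0.-tuple nat) (t : m1.-tuple nat) : uniq s -> uniq t ->
  {in support (iota 0 m0) (iota 0 m1) &, injective (relabel s t)}.
Proof.
move=> us ut [b i] [b' i']; rewrite !in_support /= => iL iL' [bb]; subst b'; rewrite /=.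
case: b iL iL' => /=; rewrite !mem_iota !add0n => iL iL' /eqP.
  by rewrite nth_uniq ?size_tuple// => /eqP ->.
by rewrite nth_uniq ?size_tuple// => /eqP ->.
Qed.

Let basef (z : bool * nat -> S) : R :=
  r [tuple z (false, nat_of_ord i) | i < m0] [tuple z (true, nat_of_ord j) | j < m1].

Let finitary_basef : finitary (support (iota 0 m0) (iota 0 m1)) basef.
Proof.
split => [z z' zz'|d' T Y mY]; last exact: (measurable_kernel_eval mr).
by congr r; apply: eq_mktuple => i; apply: zz'; rewrite in_support /= mem_iota add0n ltn_ord.
Qed.

Lemma ker_relabel (s : m0.-tuple nat) (t : m1.-tuple nat) z :
  ker r s t z = basef (fun e => z (relabel s t e)).
Proof. by congr r; apply: eq_mktuple => i; rewrite /relabel /= -tnth_nth. Qed.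

Let sqr_finitary L Phi : finitary L Phi -> finitary L (fun z : bool * nat -> S => Phi z ^+ 2 : R).
Proof.
move=> [Pd Pm]; split => [z z' zz'|d' T Y mY]; first by rewrite (Pd z z').
by apply: measurable_funX; exact: Pm.
Qed.

Lemma L2_ker (s : m0.-tuple nat) (t : m1.-tuple nat) : uniq s -> uniq t ->
  L2 P (fun w => ker r s t (X ^~ w)) /\
  Ex P (fun w => ker r s t (X ^~ w) ^+ 2) = Ex P (fun w => base w ^+ 2).
Proof.
move=> us ut; have inj := relabel_inj us ut; split.
  split; first by case: (finitary_ker s t) => _; apply.
  have := L1_reindex mX iX idX inj (sqr_finitary finitary_basef) L2r.2.
  by apply: eq_L1 => w; rewrite ker_relabel.
have := Ex_reindex mX iX idX inj (sqr_finitary finitary_basef).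
by move=> /esym E; apply: etrans E; apply: eq_Ex => w; rewrite ker_relabel.
Qed.

(** The projection as a functional of the whole family, the form to which resampling and relabelling
    apply. *)
Definition hprojf a b (z : bool * nat -> S) : R :=
  hproj P X r a b (fun i => z (false, i)) (fun j => z (true, j)).

Lemma measurable_hfill a b (d' : measure_display) (T : measurableType d')
    (Y : bool * nat -> T -> S) : (forall e, measurable_fun setT (Y e)) ->
  measurable_fun setT (fun q : T * O =>
    hfill X r a b (fun i => Y (false, i) q.1) (fun j => Y (true, j) q.1) q.2).
Proof.
move=> mY; apply: (measurable_kernel_eval mr
  (Y0 := fun i q => if (i < a)%N then Y (false, nat_of_ord i) q.1 else X (false, nat_of_ord i) q.2)
  (Y1 := fun j q => if (j < b)%N then Y (true, nat_of_ord j) q.1 else X (true, nat_of_ord j) q.2))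
  => i; case: (i < _)%N; by apply: measurableT_comp => //; exact: mX.
Qed.

Lemma finitary_hprojf a b : finitary (support (iota 0 m0) (iota 0 m1)) (hprojf a b).
Proof.
split => [z z' zz'|d' T Y mY].
  rewrite /hprojf !hprojE; apply: eq_Ex => w; rewrite /hfill.
  by congr r; apply: eq_mktuple => i; case: ifP => // _; apply: zz';
     rewrite in_support /= mem_iota add0n ltn_ord.
rewrite /hprojf; under eq_fun do rewrite hprojE.
exact: (measurable_Ex_slice P (measurable_hfill a b mY)).
Qed.

(** The coordinates that h_{a,b} integrates out: resampling them turns the kernel at the sample into
    [hfill]. *)
Let hidden a b : pred (bool * nat) := fun e => ~~ (e.2 < (if e.1 then b else a))%N.

Let hfill_remix a b w w' : basef (remix X (hidden a b) ^~ (w, w')) =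
  hfill X r a b (fun i => X (false, i) w) (fun j => X (true, j) w) w'.
Proof.
by congr r; apply: eq_mktuple => i; rewrite /remix /hidden /= -if_neg; case: ltnP.
Qed.

Lemma L1_hfill_ae a b : {ae P, forall w,
  L1 P (hfill X r a b (fun i => X (false, i) w) (fun j => X (true, j) w))}.
Proof.
have := L1_slice_ae ((L1_remix mX iX (hidden a b) finitary_basef).1 (L2_L1 L2r)).
by apply: filterS => w; apply: eq_L1 => w'; exact: hfill_remix.
Qed.

Lemma L2_hprojf a b : L2 P (fun w => hprojf a b (X ^~ w)).
Proof.
have Lr : L2 (P \x P)%E (fun z => basef (remix X (hidden a b) ^~ z)).
  split; first by case: finitary_basef => _; apply => e; exact: measurable_remix.
  exact: (L1_remix mX iX (hidden a b) (sqr_finitary finitary_basef)).1 L2r.2.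
apply: eq_L2 (L2_fubini Lr) => w; rewrite /hprojf hprojE.
by apply: eq_Ex => w'; exact: hfill_remix.
Qed.

Lemma Ex_hprojf a b : Ex P (fun w => hprojf a b (X ^~ w)) = Ex P base.
Proof.
rewrite [RHS](Ex_resample mX iX (hidden a b) finitary_basef (L2_L1 L2r)).
apply: eq_Ex => w; rewrite /hprojf hprojE; apply: eq_Ex => w'.
by rewrite -hfill_remix.
Qed.

(* Conditionally on the shared observations, [ker r s t] has mean [hprojf a b]
   (up to reordering), independently of the remaining arguments of [ker r s' t']. *)
Lemma overlap_orthogonal (s s' : m0.-tuple nat) (t t' : m1.-tuple nat) :
  uniq s -> uniq t -> uniq s' -> uniq t' ->
  {ae P, forall w, hprojf (count (mem s') s) (count (mem t') t) (X ^~ w) = 0} ->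
  Ex P (fun w => ker r s t (X ^~ w) * ker r s' t' (X ^~ w)) = 0.
Proof.
move=> us ut us' ut'; set a := count _ _; set b := count _ _ => h0.
have [so [sso so_in]] := reorder_tuple s s'.
have [to [tto to_in]] := reorder_tuple t t'.
have uso : uniq so by rewrite -(perm_uniq sso).
have uto : uniq to by rewrite -(perm_uniq tto).
(* Resampling what [s'] and [t'] do not use leaves the factor [ker r s' t'] untouched, so it leaves
   the inner expectation. *)
pose A : pred (bool * nat) := fun e => e.2 \notin (if e.1 then t' : seq nat else s').
pose Phi z := ker r s' t' z * ker r so to z.
rewrite (@eq_Ex _ _ _ P _ (fun w => Phi (X ^~ w))); last first.
  by move=> w; rewrite mulrC /Phi (ker_perm _ sso tto).
have [L2' _] := L2_ker us' ut'; have [L2o _] := L2_ker uso uto.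
have finPhi : finitary (support s' t' ++ support so to) Phi.
  have [d1 e1] := finitary_ker s' t'; have [d2 e2] := finitary_ker so to.
  split => [z z' zz'|d' T Y mY].
    by congr (_ * _); [apply: d1|apply: d2] => i iL; apply: zz'; rewrite mem_cat iL ?orbT.
  by apply: measurable_funM; [exact: e1|exact: e2].
have L1Phi : L1 P (fun w => Phi (X ^~ w)) by exact: L2M.
rewrite (Ex_resample mX iX A finPhi L1Phi).
rewrite -[RHS](Ex_cst P 0); apply: ae_eq_Ex => //.
  exact: (L1_measurable (L1_fubini ((L1_remix mX iX A finPhi).1 L1Phi))).
have inj := relabel_inj uso uto.
have h0' := ae_reindex inj (finitary_hprojf a b) h0.
have sl := L1_slice_ae ((L1_remix mX iX A (finitary_ker so to)).1 (L2_L1 L2o)).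
apply: filterS2 h0' sl => w hw Lw.
rewrite (@eq_Ex _ _ _ P _ (fun w' => ker r s' t' (X ^~ w) *
    ker r so to (fun i => X i (if A i then w' else w)))); last first.
  move=> w'; congr (_ * _); congr r; apply: eq_mktuple => i; rewrite /A /=.
    by rewrite mem_tnth.
  by rewrite mem_tnth.
rewrite ExZ//.
rewrite [X in _ * X](_ : _ = 0) ?mulr0//.
rewrite -[RHS]hw /hprojf hprojE.
(* The shared observations are frozen at [w] and the others are read at canonical indices;
   relabelling by [so] and [to] then gives the inner expectation. *)
pose Psi (z : bool * nat -> S) := r
  [tuple if (i < a)%N then X (false, nth 0%N so i) w else z (false, nat_of_ord i) | i < m0]
  [tuple if (j < b)%N then X (true, nth 0%N to j) w else z (true, nat_of_ord j) | j < m1].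
have finPsi : finitary (support (iota 0 m0) (iota 0 m1)) Psi.
  split => [z z' zz'|d' T Y mY].
    by congr r; apply: eq_mktuple => i; case: ifP => // _; apply: zz';
       rewrite in_support /= mem_iota add0n ltn_ord.
  apply: (measurable_kernel_eval mr
    (Y0 := fun i q => if (i < a)%N then X (false, nth 0%N so i) w else Y (false, nat_of_ord i) q)
    (Y1 := fun j q => if (j < b)%N then X (true, nth 0%N to j) w else Y (true, nat_of_ord j) q));
  by move=> i; case: (i < _)%N => //; exact: mY.
apply/esym; apply: etrans (Ex_reindex mX iX idX inj finPsi) _.
apply: eq_Ex => w'; congr r; apply: eq_mktuple => i; rewrite /A /relabel /= -tnth_nth.
  by rewrite so_in; case: ltnP.
by rewrite to_in; case: ltnP.
Qed.

Let nat_tuple n m (s : m.-tuple 'I_n) : m.-tuple nat := [tuple of map (@nat_of_ord n) s].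

Let count_overlap n m (s s' : m.-tuple 'I_n) : uniq s ->
  count (mem (nat_tuple s')) (nat_tuple s) = #|[set x in s]%SET :&: [set x in s']%SET|.
Proof.
move=> us; rewrite /= count_map -size_filter -(card_uniqP (filter_uniq _ us)).
apply: eq_card => x; rewrite !inE mem_filter /= mem_map; last exact: val_inj.
by rewrite andbC.
Qed.

Let UstatE n0 n1 w : Ustat X r n0 n1 w = ('C(n0, m0)%:R)^-1 * ('C(n1, m1)%:R)^-1 *
  \sum_(q : m0.-tuple 'I_n0 * m1.-tuple 'I_n1 |
    sorted (fun a b : 'I_n0 => (a < b)%N) q.1 && sorted (fun a b : 'I_n1 => (a < b)%N) q.2)
    ker r (nat_tuple q.1) (nat_tuple q.2) (X ^~ w).
Proof.
rewrite /Ustat; congr (_ * _).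
rewrite -(pair_big (fun s : m0.-tuple 'I_n0 => sorted (fun a b : 'I_n0 => (a < b)%N) s)
   (fun t : m1.-tuple 'I_n1 => sorted (fun a b : 'I_n1 => (a < b)%N) t)
   (fun s t => ker r (nat_tuple s) (nat_tuple t) (X ^~ w))) /=.
apply: eq_bigr => s _; apply: eq_bigr => t _; congr r; apply: eq_mktuple => i;
  by rewrite tnth_map.
Qed.

Let uniq_nat_tuple n m (s : m.-tuple 'I_n) :
  sorted (fun a b : 'I_n => (a < b)%N) s -> uniq (nat_tuple s).
Proof. by move=> /incr_uniq us; rewrite map_inj_uniq//; exact: val_inj. Qed.

Lemma L2_Ustat n0 n1 : L2 P (fun w => Ustat X r n0 n1 w).
Proof.
apply: (@eq_L2 _ _ _ P _ _ (fun w => esym (UstatE n0 n1 w))); apply: L2Z.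
apply: L2_sum => -[s t] /andP[/uniq_nat_tuple us /uniq_nat_tuple ut].
by case: (L2_ker us ut).
Qed.

(** The square expands into pairs of index tuples. A pair with overlap (a, b) contributes 0 if
    h_{a,b} vanishes, and at most the second moment of the kernel otherwise, by Cauchy-Schwarz. [L]
    lists minimal overlaps: every contributing pair dominates an entry of [L], and the sum over [L]
    is a union bound. *)
Lemma ustat_variance (L : seq (nat * nat)) n0 n1 :
  (forall a b, (a <= m0)%N -> (b <= m1)%N ->
    ~~ has (fun q => (q.1 <= a)%N && (q.2 <= b)%N) L ->
    {ae P, forall w, hprojf a b (X ^~ w) = 0}) ->
  Ex P (fun w => Ustat X r n0 n1 w ^+ 2) <= Ex P (fun w => base w ^+ 2) *
    \sum_(q <- L) ('C(m0, q.1)%:R * (m0%:R / n0%:R) ^+ q.1) *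
                  ('C(m1, q.2)%:R * (m1%:R / n1%:R) ^+ q.2).
Proof.
move=> degen; set V := Ex P (fun w => base w ^+ 2).
have V0 : 0 <= V by apply: Ex_ge0 => w; exact: sqr_ge0.
pose Q1 (s : m0.-tuple 'I_n0) := sorted (fun a b : 'I_n0 => (a < b)%N) s.
pose Q2 (t : m1.-tuple 'I_n1) := sorted (fun a b : 'I_n1 => (a < b)%N) t.
pose e (q : m0.-tuple 'I_n0 * m1.-tuple 'I_n1) w := ker r (nat_tuple q.1) (nat_tuple q.2) (X ^~ w).
set c0 := ('C(n0, m0)%:R)^-1 : R; set c1 := ('C(n1, m1)%:R)^-1 : R.
pose ov n m k (s s' : m.-tuple 'I_n) : R := (k <= #|[set x in s]%SET :&: [set x in s']%SET|)%N%:R.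
have L2e q : Q1 q.1 && Q2 q.2 -> L2 P (e q) /\ Ex P (fun w => e q w ^+ 2) = V.
  by move=> /andP[/uniq_nat_tuple us /uniq_nat_tuple ut]; exact: L2_ker.
rewrite (@eq_Ex _ _ _ P _ (fun w => (c0 ^+ 2 * c1 ^+ 2) *
    \sum_(q | Q1 q.1 && Q2 q.2) \sum_(q' | Q1 q'.1 && Q2 q'.2) e q w * e q' w)); last first.
  by move=> w; rewrite UstatE exprMn -/c0 -/c1 exprMn; congr (_ * _); rewrite expr2 big_distrlr.
rewrite ExZ; last first.
  by apply: L1_sum => q Qq; apply: L1_sum => q' Qq'; apply: L2M; [case: (L2e q)|case: (L2e q')].
rewrite Ex_sum; last first.
  by move=> q Qq; apply: L1_sum => q' Qq'; apply: L2M; [case: (L2e q)|case: (L2e q')].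
apply: (@le_trans _ _ (c0 ^+ 2 * c1 ^+ 2 * \sum_(q | Q1 q.1 && Q2 q.2)
    \sum_(q' | Q1 q'.1 && Q2 q'.2) V * \sum_(l <- L) ov _ _ l.1 q.1 q'.1 * ov _ _ l.2 q.2 q'.2)).
  apply: ler_wpM2l; first by rewrite mulr_ge0 ?sqr_ge0.
  apply: ler_sum => q Qq.
  rewrite Ex_sum; last by move=> q' Qq'; apply: L2M; [case: (L2e q)|case: (L2e q')].
  apply: ler_sum => q' Qq'.
  have [L2q Vq] := L2e q Qq; have [L2q' Vq'] := L2e q' Qq'.
  have ov0 (l : nat * nat) : 0 <= ov _ _ l.1 q.1 q'.1 * ov _ _ l.2 q.2 q'.2 by rewrite mulr_ge0.
  have [bad|good] := boolP (has (fun l => (l.1 <= #|[set x in q.1]%SET :&: [set x in q'.1]%SET|)%N &&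
      (l.2 <= #|[set x in q.2]%SET :&: [set x in q'.2]%SET|)%N) L).
    apply: (@le_trans _ _ V).
      have := Ex_cauchy_schwarz L2q L2q'; rewrite Vq Vq' -expr2 => CS.
      by rewrite (le_trans (ler_norm _))// -(ler_pXn2r (n := 2)) ?nnegrE// real_normK ?num_real.
    rewrite -[leLHS]mulr1 ler_wpM2l//.
    have /hasP[l lL /andP[l1 l2]] := bad.
    rewrite (big_rem l) //= /ov l1 l2 mulr1 lerDl; apply: sumr_ge0 => l' _; exact: ov0.
  rewrite [leLHS](_ : _ = 0); first by rewrite mulr_ge0// sumr_ge0.
  move: Qq Qq' => /andP[/[dup] s1 /uniq_nat_tuple us /[dup] s2 /uniq_nat_tuple ut].
  move=> /andP[/[dup] s1' /uniq_nat_tuple us' /[dup] s2' /uniq_nat_tuple ut'].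
  apply: overlap_orthogonal => //; rewrite !count_overlap ?incr_uniq//.
  apply: degen => //.
    by rewrite (leq_trans (subset_leq_card (finset.subsetIl _ _)))// card_tset.
  by rewrite (leq_trans (subset_leq_card (finset.subsetIl _ _)))// card_tset.
under eq_bigr => q _ do rewrite -mulr_sumr exchange_big.
rewrite -mulr_sumr exchange_big mulrCA ler_wpM2l// mulr_sumr; apply: ler_sum => l _.
rewrite sum_prod_pairs mulrACA; apply: ler_pM.
- by rewrite mulr_ge0 ?sqr_ge0// sumr_ge0// => s _; rewrite sumr_ge0.
- by rewrite mulr_ge0 ?sqr_ge0// sumr_ge0// => s _; rewrite sumr_ge0.
- exact: sum_overlap_le.
- exact: sum_overlap_le.
Qed.

End one_kernel.
End ustat_variance.

(** * Transfer between a random variable and a prescribed law *)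

Section law.
Context {d dT : measure_display} {O : measurableType d} {T : measurableType dT}
  {R : realType} (P : probability O R) (G : probability T R) (U : O -> T).
Hypothesis mU : measurable_fun setT U.
Hypothesis UG : forall A, measurable A -> P (U @^-1` A) = G A.

Let V : {RV P >-> T} := mfun_Sub (mem_set mU).

Let law_int (f : T -> \bar R) : (\int[distribution P V]_x f x = \int[G]_x f x)%E.
Proof. by apply: eq_measure_integral => A mA _; exact: UG. Qed.

Lemma L1_law (f : T -> R) : measurable_fun setT f -> L1 P (fun w => f (U w)) <-> L1 G f.
Proof.
move=> mf; apply: iff_trans (L1_distribution V mf) _.
by split => /integrableP[mEf fin]; apply/integrableP; split => //; move: fin; rewrite law_int.
Qed.

Lemma Ex_law (f : T -> R) : measurable_fun setT f -> L1 G f ->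
  Ex P (fun w => f (U w)) = Ex G f.
Proof.
move=> mf Lf; rewrite -(Ex_distribution (X := V) mf); last exact/L1_law.
by congr fine; exact: law_int.
Qed.

Lemma L2_law (f : T -> R) : measurable_fun setT f -> L2 P (fun w => f (U w)) <-> L2 G f.
Proof.
move=> mf; have H := L1_law (measurable_funX 2 mf).
by split => -[_ Lf]; split => //; [exact/H|exact: measurableT_comp|exact/H].
Qed.

Lemma ae_law (Q : T -> Prop) : {ae G, forall x, Q x} -> {ae P, forall w, Q (U w)}.
Proof.
move=> [A [mA A0 QA]]; exists (U @^-1` A); split.
- by rewrite -[X in measurable X]setTI; exact: mU.
- by rewrite UG.
- by move=> w nQ; exact: QA.
Qed.

Lemma ae_law_inv (g : T -> R) : measurable_fun setT g ->
  {ae P, forall w, g (U w) = 0} -> {ae G, forall x, g x = 0}.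
Proof.
move=> mg g0.
have mA : measurable (g @^-1` (~` [set 0])).
  by rewrite -[X in measurable X]setTI; apply: mg => //; exact: measurableC.
exists (g @^-1` (~` [set 0])); split => //.
rewrite -UG//; apply/negligibleP.
  by rewrite -[X in measurable X]setTI; exact: mU.
by apply: negligibleS g0 => w /= gw.
Qed.

End law.

Section pair_law.
Context {d dS : measure_display} {O : measurableType d} {S : measurableType dS}
  {R : realType} {I : eqType} (P : probability O R) (X : I -> O -> S) (F : probability S R).
Hypothesis mX : forall i, measurable_fun setT (X i).
Hypothesis iX : mutually_independent P X.
Hypothesis FX : forall e A, measurable A -> P (X e @^-1` A) = F A.

Lemma measurable_sample_pair e e' : measurable_fun setT (fun w => (X e w, X e' w)).
Proof. exact: measurable_fun_pair. Qed.

Lemma pair_law e e' : e != e' -> forall B, measurable B ->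
  P ((fun w => (X e w, X e' w)) @^-1` B) = (F \x F)%E B.
Proof.
move=> ee' B mB.
pose V : {RV P >-> (S * S)%type} := mfun_Sub (mem_set (measurable_sample_pair e e')).
apply/esym; apply: (product_measure_unique (m1 := F) (m2 := F) (m' := distribution P V)) => // A C mA mC.
have := iX (J := [:: e; e']) (A := fun i => if i == e then A else C).
rewrite /= inE ee' /= => /(_ isT) H.
have {}H := H (fun i => ltac:(by case: ifP)).
move: H; rewrite !big_cons !big_nil eqxx eq_sym (negbTE ee') setIT mule1 !FX// => <-.
Qed.

End pair_law.

(** * Sums over increasing tuples *)

Section sorted_sums.
Context {R : realType} (n m : nat).
Local Open Scope set_scope.
Local Notation incr := (sorted (fun a b : 'I_n => (a < b)%N)).

Lemma sum_sorted_const (c : R) : \sum_(t : m.-tuple 'I_n | incr t) c = 'C(n, m)%:R * c.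
Proof.
rewrite (sorted_tuple_sum m (fun=> c)) sumr_const mulr_natl; congr (_ *+ _).
by have := card_draws 'I_n m; rewrite card_ord => <-; apply: eq_card => A; rewrite !inE.
Qed.

Let sum_tnth (t : m.-tuple 'I_n) (c : 'I_n -> R) : incr t ->
  \sum_(i < m) c (tnth t i) = \sum_(x in [set x in t]) c x.
Proof.
move=> /incr_uniq ut; rewrite -(big_tuple _ _ t predT) /= big_uniq//=.
by apply: eq_bigl => x; rewrite inE.
Qed.

Let count_supersets (D : {set 'I_n}) : (#|D| <= m)%N ->
  \sum_(A : {set 'I_n} | #|A| == m) (D \subset A)%:R = 'C(n - #|D|, m - #|D|)%:R :> R.
Proof.
move=> Dm; have := @card_supersets _ D m Dm; rewrite card_ord => <-.
rewrite -sum1_card natr_sum (bigID (fun B : {set 'I_n} => D \subset B)) /=.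
rewrite [X in _ + X]big1 ?addr0 => [|B /andP[_ /negbTE ->]]//.
by apply: eq_big => [B|B /andP[_ ->]//]; rewrite inE andbC.
Qed.

(** Double counting: each index lies in 'C(n - 1, m - 1) of the m-subsets. *)
Lemma sum_sorted_single (c : 'I_n -> R) : (0 < m)%N ->
  \sum_(t : m.-tuple 'I_n | incr t) \sum_(i < m) c (tnth t i) =
  'C(n - 1, m - 1)%:R * \sum_(i < n) c i.
Proof.
move=> m0; under eq_bigr => t it do rewrite sum_tnth//.
rewrite (sorted_tuple_sum m (fun A : {set 'I_n} => \sum_(x in A) c x)).
under eq_bigr => A _ do rewrite big_mkcond /=.
rewrite exchange_big mulr_sumr; apply: eq_bigr => x _ /=.
rewrite -[X in 'C(n - X, _)](cards1 x) -[X in 'C(_, m - X)](cards1 x).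
rewrite -count_supersets ?cards1// mulr_suml; apply: eq_bigr => A _.
by rewrite finset.sub1set; case: (x \in A); rewrite ?mul1r ?mul0r.
Qed.

Lemma sum_sorted_pairs (c : 'I_n -> 'I_n -> R) : (1 < m)%N ->
  \sum_(t : m.-tuple 'I_n | incr t) \sum_(i < m) \sum_(j < m | j != i) c (tnth t i) (tnth t j) =
  'C(n - 2, m - 2)%:R * \sum_(i < n) \sum_(j < n | j != i) c i j.
Proof.
move=> m1.
have H (t : m.-tuple 'I_n) : incr t ->
    \sum_(i < m) \sum_(j < m | j != i) c (tnth t i) (tnth t j) =
    \sum_(x in [set x in t]) \sum_(y in [set x in t]) (if y != x then c x y else 0).
  move=> it; rewrite -(sum_tnth (fun x => \sum_(y in [set x in t]) (if y != x then c x y else 0)) it).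
  apply: eq_bigr => i _; rewrite -(sum_tnth (fun y => if y != tnth t i then c (tnth t i) y else 0) it).
  rewrite big_mkcond; apply: eq_bigr => j _; congr (if ~~ _ then _ else _).
  by apply/eqP/eqP => [->//|]; move/tuple_uniqP : (incr_uniq it); apply.
under eq_bigr => t it do rewrite H//.
rewrite (sorted_tuple_sum m (fun A : {set 'I_n} =>
  \sum_(x in A) \sum_(y in A) (if y != x then c x y else 0))).
under eq_bigr => A _ do rewrite big_mkcond /=.
rewrite exchange_big mulr_sumr; apply: eq_bigr => x _ /=.
transitivity (\sum_(A : {set 'I_n} | #|A| == m) \sum_(y < n | y != x) ([set x; y] \subset A)%:R * c x y).
  apply: eq_bigr => A _; rewrite [RHS]big_mkcond big_mkcond /=; case: ifP => xA.
    rewrite [LHS]big_mkcond; apply: eq_bigr => y _; rewrite finset.subUset !finset.sub1set xA /=.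
    by case: (y \in A); case: ifP => _; rewrite ?mul1r ?mul0r.
  rewrite big1// => y _; case: ifP => // _.
  by rewrite finset.subUset !finset.sub1set xA /= mul0r.
rewrite exchange_big mulr_sumr; apply: eq_bigr => y yx /=.
have D2 : #|[set x; y]| = 2%N by rewrite cards2 eq_sym yx.
by rewrite -mulr_suml count_supersets D2.
Qed.

End sorted_sums.

(** * Kernels that are sums over cases or pairs of cases *)

Section additive_kernels.
Context {R : realType} {p m0 m1 : nat} {d : measure_display} {O : measurableType d}
  (P : probability O R) (X : bool * nat -> O -> p.-tuple R) (F : probability (p.-tuple R) R).
Local Notation S := (p.-tuple R).
Hypothesis mX : forall i, measurable_fun setT (X i).
Hypothesis iX : mutually_independent P X.
Hypothesis FX : forall e A, measurable A -> P (X e @^-1` A) = F A.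

Let idX i j A : measurable A -> P (X i @^-1` A) = P (X j @^-1` A).
Proof. by move=> mA; rewrite !FX. Qed.

Definition sumker (g : S -> R) (y : m1.-tuple S) : R := \sum_(j < m1) g (tnth y j).

(** For symmetric [k] this is the sum over unordered pairs. Summing over ordered pairs makes
    invariance under permutations of [y] a matter of reordering big sums. *)
Definition pairker (k : S -> S -> R) (y : m1.-tuple S) : R :=
  2^-1 * \sum_(i < m1) \sum_(j < m1 | j != i) k (tnth y i) (tnth y j).

Lemma sym_kernel_sumker (g : S -> R) : measurable_fun setT g ->
  sym_kernel (fun (_ : m0.-tuple S) y => sumker g y).
Proof.
move=> mg; split => // [|_ y y' yy'].
  apply: measurable_sum => j; apply: (measurableT_comp mg).
  exact: (measurableT_comp (measurable_tnth j)).
by rewrite /sumker -!(big_tuple _ _ _ predT) /=; exact: perm_big.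
Qed.

Lemma L2_sumker (g : S -> R) : L2 F g ->
  L2 P (fun w => sumker g [tuple X (true, nat_of_ord j) w | j < m1]).
Proof.
move=> L2g; apply: L2_sum => j _.
apply: (@eq_L2 _ _ _ P (fun w => g (X (true, nat_of_ord j) w))).
  by move=> w; rewrite tnth_mktuple.
by apply/(L2_law (mX _) (FX _)) => //; case: L2g.
Qed.

Lemma hprojf_sumker (g : S -> R) a b w : L2 F g -> Ex F g = 0 ->
  hprojf P X (fun (_ : m0.-tuple S) y => sumker g y) a b (X ^~ w) =
  \sum_(j < m1 | (j < b)%N) g (X (true, nat_of_ord j) w).
Proof.
move=> L2g Eg; rewrite /hprojf hprojE /hfill /sumker.
have L1j e : L1 P (fun w' => g (X e w')).
  by apply/(L1_law (mX _) (FX _)); [case: L2g|exact: L2_L1].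
under eq_Ex do under eq_bigr do rewrite tnth_mktuple.
rewrite Ex_sum => [|j _]; last by case: (j < b)%N => //; exact: L1_cst.
rewrite [RHS]big_mkcond; apply: eq_bigr => j _; case: (j < b)%N; first by rewrite Ex_cst.
by rewrite (Ex_law (mX _) (FX _)) ?Eg//; [case: L2g|exact: L2_L1].
Qed.

Section pair_kernel.
Variable k : S -> S -> R.
Hypothesis L2k : L2 (F \x F)%E (fun z => k z.1 z.2).
Hypothesis symk : forall x y, k x y = k y x.
Hypothesis degk : {ae F, forall x, Ex F (k x) = 0}.

Let mk : measurable_fun setT (fun z : S * S => k z.1 z.2).
Proof. by case: L2k. Qed.

Let pair_neq (i j : nat) : i != j -> (true, i) != (true, j).
Proof. by apply: contraNneq => -[->]. Qed.

Lemma L2_pair e e' : e != e' -> L2 P (fun w => k (X e w) (X e' w)).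
Proof.
move=> ee'; have := L2_law (measurable_sample_pair mX e e') (pair_law mX iX FX ee') mk.
by move=> [_]; apply.
Qed.

Lemma Ex_pair0 : Ex (F \x F)%E (fun z => k z.1 z.2) = 0.
Proof.
rewrite Ex_fubini; last exact: L2_L1.
rewrite -[RHS](Ex_cst F 0); apply: ae_eq_Ex => //.
exact: (measurable_Ex_slice F mk).
Qed.

Lemma sym_kernel_pairker : sym_kernel (fun (_ : m0.-tuple S) y => pairker k y).
Proof.
split => // [|_ y y' yy'].
  apply: measurable_funM => //; apply: measurable_sum => i.
  under eq_fun do rewrite big_mkcond; apply: measurable_sum => j; case: (j != i) => //.
  pose f (z : m0.-tuple S * m1.-tuple S) := (tnth z.2 i, tnth z.2 j).
  apply: (measurableT_comp mk (g := f)).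
  by apply: measurable_fun_pair; exact: (measurableT_comp (measurable_tnth _)).
have E (u : m1.-tuple S) : \sum_(i < m1) \sum_(j < m1 | j != i) k (tnth u i) (tnth u j) =
    \sum_(x <- u) \sum_(x' <- u) k x x' - \sum_(x <- u) k x x.
  rewrite !big_tuple -sumrB; apply: eq_bigr => i _.
  by rewrite big_tuple [in RHS](bigD1 i)//= addrAC subrr add0r.
by rewrite /pairker !E !(perm_big _ yy'); congr (_ * (_ - _)); apply: eq_bigr => x _; exact: perm_big.
Qed.

Lemma L2_pairker : L2 P (fun w => pairker k [tuple X (true, nat_of_ord j) w | j < m1]).
Proof.
apply: L2Z; apply: L2_sum => i _; apply: L2_sum => j ji.
apply: (@eq_L2 _ _ _ P (fun w => k (X (true, nat_of_ord i) w) (X (true, nat_of_ord j) w))).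
  by move=> w; rewrite !tnth_mktuple.
by apply: L2_pair; apply: pair_neq; rewrite eq_sym.
Qed.

(** Only terms with both arguments fixed survive: one free argument integrates to 0 by degeneracy of
    [k], and two free arguments do so by [Ex_pair0]. *)
Lemma hprojf_pairker a b : {ae P, forall w,
  hprojf P X (fun (_ : m0.-tuple S) y => pairker k y) a b (X ^~ w) =
  2^-1 * \sum_(i < m1 | (i < b)%N) \sum_(j < m1 | (j != i) && (j < b)%N)
    k (X (true, nat_of_ord i) w) (X (true, nat_of_ord j) w)}.
Proof.
have good : {ae P, forall w, forall i : 'I_m1,
    L1 F (k (X (true, nat_of_ord i) w)) /\ Ex F (k (X (true, nat_of_ord i) w)) = 0}.
  apply: filter_forall => i.
  have := L1_slice_ae (L2_L1 L2k) => sl.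
  have : {ae F, forall x, L1 F (k x) /\ Ex F (k x) = 0} by apply: filterS2 sl degk.
  exact: (ae_law (mX (true, nat_of_ord i)) (FX _)).
apply: filterS good => w good.
pose fill (i : 'I_m1) (w' : O) := if (i < b)%N then X (true, nat_of_ord i) w
  else X (true, nat_of_ord i) w'.
have mslice x : measurable_fun setT (k x) by exact: (measurable_slice1 x mk).
have term i j : j != i -> L1 P (fun w' => k (fill i w') (fill j w')) /\
    Ex P (fun w' => k (fill i w') (fill j w')) = if (j < b)%N then
      (if (i < b)%N then k (X (true, nat_of_ord i) w) (X (true, nat_of_ord j) w) else 0) else 0.
  move=> ji; rewrite /fill; case: (i < b)%N; case: (j < b)%N.
  - by split; [exact: L1_cst|rewrite Ex_cst].
  - have [Li Ei] := good i; split.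
      exact: (L1_law (mX (true, nat_of_ord j)) (FX _) (mslice _)).2.
    by rewrite (Ex_law (mX (true, nat_of_ord j)) (FX _) (mslice _) Li).
  - have [Lj Ej] := good j.
    have E : (fun w' => k (X (true, nat_of_ord i) w') (X (true, nat_of_ord j) w)) =
        fun w' => k (X (true, nat_of_ord j) w) (X (true, nat_of_ord i) w').
      by apply/funext => w'; rewrite symk.
    rewrite E; split.
      exact: (L1_law (mX (true, nat_of_ord i)) (FX _) (mslice _)).2.
    by rewrite (Ex_law (mX (true, nat_of_ord i)) (FX _) (mslice _) Lj).
  - have ij : (true, nat_of_ord i) != (true, nat_of_ord j) by apply: pair_neq; rewrite eq_sym.
    split; first by apply: L2_L1; exact: L2_pair.
    have := Ex_law (measurable_sample_pair mX _ _) (pair_law mX iX FX ij) mk (L2_L1 L2k).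
    by rewrite Ex_pair0.
rewrite /hprojf hprojE /hfill /pairker.
transitivity (Ex P (fun w' => 2^-1 * \sum_(i < m1) \sum_(j < m1 | j != i)
    k (fill i w') (fill j w'))).
  by apply: eq_Ex => w'; congr (_ * _); apply: eq_bigr => i _; apply: eq_bigr => j _;
     rewrite !tnth_mktuple.
rewrite ExZ; last by apply: L1_sum => i _; apply: L1_sum => j ji; case: (term i j ji).
congr (_ * _); rewrite Ex_sum; last by move=> i _; apply: L1_sum => j ji; case: (term i j ji).
rewrite [RHS]big_mkcond; apply: eq_bigr => i _.
rewrite Ex_sum; last by move=> j ji; case: (term i j ji).
rewrite (eq_bigr _ (fun j ji => (term i j ji).2)) big_mkcondr /=.
case: (i < b)%N => //; by rewrite big1// => j _; case: (j < b)%N.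
Qed.

End pair_kernel.

Lemma UstatD (r r' : m0.-tuple S -> m1.-tuple S -> R) n0 n1 w :
  Ustat X (fun x y => r x y + r' x y) n0 n1 w = Ustat X r n0 n1 w + Ustat X r' n0 n1 w.
Proof.
rewrite /Ustat -mulrDr -big_split /=; congr (_ * _).
by apply: eq_bigr => s _; rewrite -big_split.
Qed.

Let Ustat_case_kernel (g : m1.-tuple S -> R) n0 n1 w : (m0 <= n0)%N ->
  Ustat X (fun (_ : m0.-tuple S) y => g y) n0 n1 w = ('C(n1, m1)%:R)^-1 *
  \sum_(t : m1.-tuple 'I_n1 | sorted (fun a b : 'I_n1 => (a < b)%N) t)
    g [tuple X (true, nat_of_ord (tnth t j)) w | j < m1].
Proof.
move=> mn; rewrite /Ustat sum_sorted_const mulrA; congr (_ * _).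
by rewrite mulrAC mulVf ?mul1r// pnatr_eq0 -lt0n bin_gt0.
Qed.

Lemma Ustat_sumker (g : S -> R) n0 n1 w : (m0 <= n0)%N -> (0 < m1)%N -> (m1 <= n1)%N ->
  Ustat X (fun (_ : m0.-tuple S) y => sumker g y) n0 n1 w =
  m1%:R / n1%:R * \sum_(i < n1) g (X (true, nat_of_ord i) w).
Proof.
move=> mn0 m1_gt0 mn1; rewrite Ustat_case_kernel// /sumker.
under eq_bigr do under eq_bigr do rewrite tnth_mktuple.
rewrite (sum_sorted_single (fun i => g (X (true, nat_of_ord i) w)))// mulrA; congr (_ * _).
have n1_gt0 : (0 < n1)%N by exact: leq_trans mn1.
have C0 : 'C(n1, m1)%:R != 0 :> R by rewrite pnatr_eq0 -lt0n bin_gt0.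
apply/eqP; rewrite mulrC eqr_div ?pnatr_eq0 -?lt0n ?bin_gt0// -!natrM; apply/eqP; congr _%:R.
by have := mul_bin_diag n1 (m1 - 1); rewrite [in X in _ = X -> _]subn1 prednK// -subn1 mulnC.
Qed.

(** Origin of the factor m1 (m1 - 1) / 2 of the limit: 'C(n1 - 2, m1 - 2) / 'C(n1, m1) = m1 (m1 - 1)
    / (n1 (n1 - 1)), and the half comes from [pairker]. *)
Lemma Ustat_pairker (k : S -> S -> R) n0 n1 w : (m0 <= n0)%N -> (1 < m1)%N -> (m1 <= n1)%N ->
  Ustat X (fun (_ : m0.-tuple S) y => pairker k y) n0 n1 w =
  m1%:R * (m1%:R - 1) / 2 * ((n1%:R * (n1%:R - 1))^-1 *
  \sum_(i < n1) \sum_(j < n1 | j != i) k (X (true, nat_of_ord i) w) (X (true, nat_of_ord j) w)).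
Proof.
move=> mn0 m1_gt1 mn1; rewrite Ustat_case_kernel// /pairker -mulr_sumr.
under eq_bigr do under eq_bigr do under eq_bigr do rewrite !tnth_mktuple.
rewrite (sum_sorted_pairs (fun i j => k (X (true, nat_of_ord i) w) (X (true, nat_of_ord j) w)))//.
rewrite !mulrA; congr (_ * _).
have n1_gt1 : (1 < n1)%N by exact: leq_trans mn1.
have C0 : 'C(n1, m1)%:R != 0 :> R by rewrite pnatr_eq0 -lt0n bin_gt0.
have E : (n1%:R * (n1%:R - 1)) * 'C(n1 - 2, m1 - 2)%:R = m1%:R * (m1%:R - 1) * 'C(n1, m1)%:R :> R.
  case: n1 n1_gt1 mn1 C0 => [//|[//|n]] _; case: m1 m1_gt1 => [//|[//|m]] _ mn C0.
  rewrite -!natr1 !addrK !natr1 -!natrM; congr _%:R; rewrite !subSS !subn0.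
  rewrite -mulnA; have -> := mul_bin_diag n.+1 m; rewrite mulnCA.
  by have -> := mul_bin_diag n.+2 m.+1; rewrite mulnCA mulnA.
have n1n : n1%:R * (n1%:R - 1) != 0 :> R.
  rewrite mulf_neq0 ?pnatr_eq0 -?lt0n//; first exact: ltnW.
  by rewrite subr_eq0 -[1]/(1%:R) eqr_nat gtn_eqF.
have n1a : n1%:R != 0 :> R by move: n1n; rewrite mulf_eq0 negb_or => /andP[].
have n1b : n1%:R - 1 != 0 :> R by move: n1n; rewrite mulf_eq0 negb_or => /andP[].
have -> : 'C(n1 - 2, m1 - 2)%:R = m1%:R * (m1%:R - 1) * 'C(n1, m1)%:R / (n1%:R * (n1%:R - 1)) :> R.
  by rewrite -E mulrC mulKf.
by field; rewrite C0 n1a n1b.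
Qed.

End additive_kernels.

(** * Completeness of L2 *)

Section ae_comparison.
Context {d : measure_display} {T : measurableType d} {R : realType} (P : probability T R).
Implicit Types (f g : T -> R).

Lemma L1_dom_ae f g : measurable_fun setT f -> {ae P, forall x, `|f x| <= g x} ->
  L1 P g -> L1 P f.
Proof.
move=> mf fg Lg; have mg := L1_measurable Lg.
apply/integrableP; split; first exact/measurable_EFinP.
have /integrableP[_ fin] := Lg; apply: le_lt_trans fin.
apply: ae_ge0_le_integral => //.
- by apply: measurableT_comp => //; exact/measurable_EFinP.
- by apply: measurableT_comp => //; exact/measurable_EFinP.
- by apply: filterS fg => x fgx _; rewrite lee_fin (le_trans fgx)// ler_norm.
Qed.

Lemma le_Ex_ae f g : L1 P f -> L1 P g -> {ae P, forall x, f x <= g x} -> Ex P f <= Ex P g.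
Proof.
move=> Lf Lg fg; have mf := L1_measurable Lf; have mg := L1_measurable Lg.
rewrite (@ae_eq_Ex _ _ _ P f (fun x => Num.min (f x) (g x)))//.
- apply: le_Ex => //; last by move=> x; rewrite ge_min lexx orbT.
  apply: (L1_dom (g := fun x => `|f x| + `|g x|)); first exact: measurable_minr.
    by move=> x; rewrite minEle; case: ifP => _; rewrite ?lerDl ?lerDr.
  by apply: L1D; exact: L1_norm.
- exact: measurable_minr.
- by apply: filterS fg => x fgx; rewrite minEle fgx.
Qed.

Lemma Ex_sqr0_ae f : L2 P f -> Ex P (fun x => f x ^+ 2) = 0 -> {ae P, forall x, f x = 0}.
Proof.
move=> [_ Lf] /(Ex0_ae Lf (fun x => sqr_ge0 _)); apply: filterS => x /eqP.
by rewrite sqrf_eq0 => /eqP.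
Qed.

Lemma Ex_sqrD_le f g : L2 P f -> L2 P g ->
  Ex P (fun x => (f x + g x) ^+ 2) <=
  2 * Ex P (fun x => f x ^+ 2) + 2 * Ex P (fun x => g x ^+ 2).
Proof.
move=> Lf Lg; rewrite -!ExZ; [|by case: Lg|by case: Lf].
rewrite -ExD; [|by apply: L1Z; case: Lf|by apply: L1Z; case: Lg].
apply: le_Ex; first by case: (L2D Lf Lg).
  by apply: L1D; apply: L1Z; [case: Lf|case: Lg].
by move=> x; have := sqr_ge0 (f x - g x); nra.
Qed.

Lemma limn_einf_le (a : nat -> \bar R) (e : \bar R) K :
  (forall k, (K <= k)%N -> a k <= e)%E -> (limn_einf a <= e)%E.
Proof.
move=> ae; rewrite limn_einf_lim; apply: lime_le; first exact: is_cvg_einfs.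
exists K => // k /= Kk; apply: le_trans (ae _ Kk).
by apply: ereal_inf_lbound; exists k => /=.
Qed.

(** Riesz-Fischer. A subsequence whose increments have L1 norms at most 2^-k converges almost
    everywhere, and Fatou's lemma bounds the distance of [u n] to its limit. *)
Lemma L2_complete (u : nat -> T -> R) : (forall n, L2 P (u n)) ->
  (forall e, 0 < e -> exists N, forall n m, (N <= n)%N -> (N <= m)%N ->
     Ex P (fun x => (u n x - u m x) ^+ 2) <= e) ->
  exists v, L2 P v /\ (forall e, 0 < e -> exists N, forall n, (N <= n)%N ->
     Ex P (fun x => (u n x - v x) ^+ 2) <= e).
Proof.
move=> L2u cau.
have quarter k : 0 < (4^-1 : R) ^+ k by rewrite exprn_gt0.
have [N HN] := choice (fun k => cau _ (quarter k)).
(* A closed form that is at least k and at least N i for all i <= k, so the subsequence needs no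
   recursive choice. *)
pose nk k := (k + \sum_(i < k.+1) N i)%N.
have nkN k j : (k <= j)%N -> (N k <= nk j)%N.
  move=> kj; rewrite /nk (bigD1 (Ordinal (kj : (k < j.+1)%N))) //=.
  by rewrite addnCA leq_addr.
pose v k := u (nk k); pose dd k x := v k.+1 x - v k x.
have L2v k : L2 P (v k) by exact: L2u.
have mv k : measurable_fun setT (v k) by case: (L2v k).
have L2d k : L2 P (dd k) by exact: L2B.
have md k : measurable_fun setT (dd k) by case: (L2d k).
have Ed k : Ex P (fun x => `|dd k x|) <= (2^-1) ^+ k.
  apply: Ex_norm_le_sqrt => //.
  rewrite -exprM mulnC exprM (_ : 2^-1 ^+ 2 = 4^-1 :> R); last by field.
  by apply: HN; apply: nkN.
have geo n : \sum_(0 <= k < n) (2^-1 : R) ^+ k <= 2.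
  have -> : \sum_(0 <= k < n) (2^-1 : R) ^+ k = 2 - 2 * (2^-1) ^+ n.
    elim: n => [|n IH]; first by rewrite big_geq// expr0; lra.
    by rewrite big_nat_recr//= IH exprS; lra.
  by rewrite gerBl mulr_ge0// exprn_ge0.
pose D x := (\sum_(0 <= k <oo) `|dd k x|%:E)%E.
have mdE k : measurable_fun setT (fun x => `|dd k x|%:E).
  by apply/measurable_EFinP; exact: measurableT_comp.
have mD : measurable_fun setT D.
  apply: (emeasurable_fun_cvg (fun n x => \sum_(0 <= k < n) `|dd k x|%:E)%E).
    by move=> n; exact: emeasurable_sum.
  by move=> x _; apply: is_cvg_nneseries => k _ _; rewrite lee_fin.
have D0 x : (0 <= D x)%E by apply: nneseries_ge0 => k _ _; rewrite lee_fin.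
have Dfin : P.-integrable setT D.
  apply/integrableP; split => //.
  under eq_integral do rewrite gee0_abs//.
  rewrite integral_nneseries//; apply: (@le_lt_trans _ _ 2%:E); last exact: ltey.
  apply: lime_le; first by apply: is_cvg_nneseries => k _ _; exact: integral_ge0.
  apply: nearW => n; under eq_bigr do rewrite (L1_int (L1_norm (L2_L1 (L2d _)))).
  by rewrite sumEFin lee_fin; apply: le_trans (geo n); exact: ler_sum.
pose G := D @^-1` (~` [set +oo%E]).
have mG : measurable G by rewrite -[G]setTI; apply: mD => //; exact: measurableC.
have aeG : {ae P, forall x, G x}.
  by apply: filterS (integrable_ae measurableT Dfin) => x /(_ I) + Dx; rewrite Dx.
have cvgv x : G x -> cvgn (v ^~ x).
  move=> Gx; have Df : D x \is a fin_num by rewrite ge0_fin_numE// lt_neqAle leey andbT; exact/eqP.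
  have : cvgn (series (dd ^~ x)).
    apply: normed_cvg; apply: nondecreasing_is_cvgn.
      by apply: nondecreasing_series => k _ _ /=.
    exists (fine (D x)) => _ [n _ <-]; rewrite -lee_fin fineK// /series /= -sumEFin.
    by apply: nneseries_lim_ge => k _ _; rewrite lee_fin.
  have -> : series (dd ^~ x) = fun n => v n x - v 0%N x.
    by apply/funext => n; rewrite /series /= telescope_sumr.
  move=> cv; have -> : v ^~ x = fun n => (v n x - v 0%N x) + v 0%N x.
    by apply/funext => n; rewrite subrK.
  by apply: is_cvgD => //; exact: is_cvg_cst.
(* Cut off outside the convergence set, the subsequence converges everywhere and its limit is
   measurable. *)
pose w k x := \1_G x * v k x.
have mw k : measurable_fun setT (w k) by apply: measurable_funM => //; exact: measurable_indic.
pose l x := lim (w ^~ x @ \oo).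
have wl x : w ^~ x @ \oo --> l x.
  have [Gx|nGx] := pselect (G x).
    have -> : w ^~ x = v ^~ x by apply/funext => k; rewrite /w indicE mem_set// mul1r.
    by rewrite /l (_ : w ^~ x = v ^~ x); [exact: cvgv|apply/funext => k; rewrite /w indicE mem_set// mul1r].
  have E : w ^~ x = fun=> 0 by apply/funext => k; rewrite /w indicE memNset// mul0r.
  by rewrite /l E; apply: (@is_cvg_cst R).
have ml : measurable_fun setT l by apply: (measurable_fun_cvg mw) => x _.
have key e n : 0 < e -> (exists K, forall k, (K <= k)%N -> Ex P (fun x => (u n x - v k x) ^+ 2) <= e) ->
    (\int[P]_x ((u n x - l x) ^+ 2)%:E <= e%:E)%E.
  move=> e0 [K HK].
  have mu_ : measurable_fun setT (u n) by case: (L2u n).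
  have mf k : measurable_fun setT (fun x => ((u n x - w k x) ^+ 2)%:E).
    by apply/measurable_EFinP; apply: measurable_funX; exact: measurable_funB.
  have := @fatou _ _ _ P setT measurableT (fun k x => ((u n x - w k x) ^+ 2)%:E) mf
    (fun k x _ => ltac:(by rewrite lee_fin sqr_ge0)).
  rewrite (eq_integral (fun x => ((u n x - l x) ^+ 2)%:E)); last first.
    move=> x _; apply: (cvg_limn_einf_sup _).1; apply: cvg_EFin; first exact: nearW.
    have E : (u n x - w k x) @[k --> \oo] --> u n x - l x.
      by apply: cvgB; [exact: cvg_cst|exact: wl].
    by rewrite [X in X @ _ --> _](_ : _ = fun k => (u n x - w k x) * (u n x - w k x))//; exact: (cvgM E E).
  move=> H; apply: le_trans H _; apply: (limn_einf_le (K := K)) => k Kk.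
  have -> : (\int[P]_x ((u n x - w k x) ^+ 2)%:E = \int[P]_x ((u n x - v k x) ^+ 2)%:E)%E.
    apply: ae_eq_integral => //.
      by apply/measurable_EFinP; apply: measurable_funX; exact: measurable_funB.
    by apply: filterS aeG => x Gx _; rewrite /w indicE mem_set// mul1r.
  by rewrite (L1_int (L2B (L2u n) (L2v k)).2) lee_fin HK.
have kk e n : (exists N0, forall m, (N0 <= m)%N -> Ex P (fun x => (u n x - u m x) ^+ 2) <= e) ->
    exists K, forall k, (K <= k)%N -> Ex P (fun x => (u n x - v k x) ^+ 2) <= e.
  by move=> [N0 HN0]; exists N0 => k N0k; apply: HN0; rewrite (leq_trans N0k)// leq_addr.
have L2ul n e : 0 < e -> (\int[P]_x ((u n x - l x) ^+ 2)%:E <= e%:E)%E ->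
    L2 P (fun x => u n x - l x).
  move=> e0 H; split; first by apply: measurable_funB => //; case: (L2u n).
  apply/integrableP; split.
    by apply/measurable_EFinP; apply: measurable_funX; apply: measurable_funB => //; case: (L2u n).
  under eq_integral do rewrite /= ger0_norm ?sqr_ge0//.
  by apply: le_lt_trans H _; exact: ltey.
have L2l : L2 P l.
  have [N0 HN0] := cau 1 ltr01.
  have H := key 1 N0 ltr01 (kk 1 N0 (ex_intro _ N0 (fun m => HN0 N0 m (leqnn _)))).
  apply: (@eq_L2 _ _ _ P (fun x => u N0 x - (u N0 x - l x))); first by move=> x; rewrite subKr.
  by apply: L2B => //; exact: L2ul H.
exists l; split => // e e0; have [N0 HN0] := cau e e0; exists N0 => n N0n.
have := key e n e0 (kk e n (ex_intro _ N0 (fun m => HN0 n m N0n))).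
by rewrite (L1_int (L2B (L2u n) L2l).2) lee_fin.
Qed.

End ae_comparison.

(** The sets over which [f] integrates to 0 form a Dynkin system. It contains the rectangles, hence
    every measurable set, and an integrable function with all integrals 0 vanishes almost
    everywhere. *)
Lemma rectangles_ae0 {d d' : measure_display} {T : measurableType d} {T' : measurableType d'}
    {R : realType} (P : probability T R) (Q : probability T' R) (f : T * T' -> R) :
  L1 (P \x Q)%E f ->
  (forall A B, measurable A -> measurable B ->
     Ex (P \x Q)%E (fun z => \1_A z.1 * \1_B z.2 * f z) = 0) ->
  {ae (P \x Q)%E, forall z, f z = 0}.
Proof.
move=> Lf rect; have mf := L1_measurable Lf.
have mI (C : set (T * T')) : measurable C -> measurable_fun setT (fun z => \1_C z * f z).
  by move=> mC; apply: measurable_funM => //; exact: measurable_indic.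
have dom (C : set (T * T')) z : `|\1_C z * f z| <= `|f z|.
  by rewrite normrM ler_piMl// indicE; case: (z \in C); rewrite ?normr1 ?normr0.
have LI (C : set (T * T')) : measurable C -> L1 (P \x Q)%E (fun z => \1_C z * f z).
  by move=> mC; apply: L1_dom (L1_norm Lf) => //; exact: mI.
have E0 (C : set (T * T')) : measurable C -> Ex (P \x Q)%E (fun z => \1_C z * f z) = 0.
  rewrite measurable_prod_measurableType; move: C.
  apply: dynkin_induction => /=.
  - by rewrite measurable_prod_measurableType.
  - move=> _ _ [A1 mA1 [A2 mA2 <-]] [B1 mB1 [B2 mB2 <-]].
    exists (A1 `&` B1); first exact: measurableI.
    exists (A2 `&` B2); first exact: measurableI.
    by rewrite setXI.
  - rewrite -[RHS](rect setT setT)//; apply: eq_Ex => z.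
    by rewrite !indicE !in_setT mulr1.
  - move=> _ [A mA [B mB <-]]; rewrite -[RHS](rect A B)//; apply: eq_Ex => z.
    rewrite !indicE -natrM mulnb; congr (_%:R * _); congr nat_of_bool.
    by apply/idP/andP => [/set_mem[? ?]|[/set_mem ? /set_mem ?]]; rewrite !inE.
  - move=> C mC C0.
    have : Ex (P \x Q)%E f = 0.
      by rewrite -[RHS](rect setT setT)//; apply: eq_Ex => z; rewrite !indicE !in_setT !mul1r.
    move=> Ef; transitivity (Ex (P \x Q)%E f - Ex (P \x Q)%E (fun z => \1_C z * f z)).
      rewrite -ExB//; last exact: LI.
      apply: eq_Ex => z.
      by rewrite !indicE in_setC; case: (z \in C); rewrite /= ?mul1r ?mul0r ?subrr ?subr0.
    by rewrite Ef C0 subrr.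
  - move=> C mC tC C0.
    have mU : measurable (\bigcup_k C k) by exact: bigcup_measurable.
    pose s n z := \1_(\big[setU/set0]_(k < n) C k) z * f z.
    have : Ex (P \x Q)%E (s n) @[n --> \oo] -->
        Ex (P \x Q)%E (fun z => \1_(\bigcup_k C k) z * f z).
      apply: (Ex_dct (g := fun z => `|f z|)) => //.
      + by move=> n; apply: mI; exact: bigsetU_measurable.
      + exact: mI.
      + exact: L1_norm.
      + by move=> n z; exact: dom.
      + apply: aeW => z; apply: cvgM; last exact: cvg_cst.
        have [[k _ Ck]|nU] := pselect ((\bigcup_k C k) z).
          apply: (cvg_near_cst); exists k.+1 => // n /= kn.
          by rewrite -bigcup_mkord !indicE !mem_set//; exists k.
        apply: (cvg_near_cst); apply: nearW => n.
        rewrite !indicE !memNset// => -Un; apply: nU; move: Un; rewrite -bigcup_mkord.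
        by move=> [k _ Ck]; exists k.
    have -> : (fun n => Ex (P \x Q)%E (s n)) = fun=> 0.
      apply/funext => n; rewrite (@eq_Ex _ _ _ _ _ (fun z => \sum_(k < n) \1_(C k) z * f z)).
        by rewrite Ex_sum => [|k _]; [rewrite big1|exact: LI].
      move=> z; rewrite /s -mulr_suml; congr (_ * _).
      elim: n => [|n IH]; first by rewrite !big_ord0 indic0.
      rewrite !big_ord_recr /= -IH !indicE -natrD; congr _%:R.
      have dj : (\big[setU/set0]_(k < n) C k) `&` C n = set0.
        rewrite -bigcup_mkord setI_bigcupl bigcup0// => k /= kn.
        by move/trivIsetP : tC => /(_ k n Logic.I Logic.I); apply; rewrite ltn_eqF.
      rewrite in_setU; case: (boolP (z \in C n)) => zn; last by rewrite orbF addn0.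
      rewrite orbT memNset// => zU; have : (\big[setU/set0]_(k < n) C k `&` C n) z.
        by split => //; exact: set_mem.
      by rewrite dj.
    by move=> H; apply: cvg_unique H _; [exact: Rhausdorff|exact: cvg_cst].
have := @integral_ae_eq _ _ _ (P \x Q)%E setT measurableT (fun=> 0%E) (fun z => (f z)%:E) Lf.
move=> /(_ (measurable_cst _)) H.
have : ae_eq (P \x Q)%E setT (fun z => (f z)%:E) (fun=> 0%E).
  apply: H => C _ mC; rewrite integral0 integral_mkcond -[RHS]/((0 : R)%:E) -(E0 C mC) -L1_int; last exact: LI.
  apply: eq_integral => z _; rewrite patchE indicE; case: (z \in C); by rewrite ?mul1r ?mul0r.
by apply: filterS => z /(_ Logic.I) [].
Qed.

(** * Hilbert-Schmidt operators *)

Section unconditional_scaling.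
Context {d : measure_display} {T : measurableType d} {R : realType} (P : probability T R).

(** The positive or the negative part has infinite integral, so the integral is infinite and [fine]
    returns 0. *)
Lemma Ex_not_L1 (f : T -> R) : measurable_fun setT f -> ~ L1 P f -> Ex P f = 0.
Proof.
move=> mf nL; have mE : measurable_fun setT (fun x => (f x)%:E) by exact/measurable_EFinP.
rewrite /Ex integralE.
have : (\int[P]_x `|(f x)%:E| = +oo)%E.
  apply/eqP; apply: contra_notT nL; rewrite -ltey => fin.
  by apply/integrableP; split.
have -> : (\int[P]_x `|(f x)%:E| = \int[P]_x ((fun y => (f y)%:E)^\+ x + (fun y => (f y)%:E)^\- x))%E.
  by apply: eq_integral => x _; rewrite -[LHS]/((abse \o (fun y => (f y)%:E)) x) fune_abse.
rewrite ge0_integralD//; [|exact: measurable_funepos|exact: measurable_funeneg].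
have : (0 <= \int[P]_x (fun y => (f y)%:E)^\+ x)%E by apply: integral_ge0.
have : (0 <= \int[P]_x (fun y => (f y)%:E)^\- x)%E by apply: integral_ge0.
by case: (\int[P]_x _)%E => [a| |] //; case: (\int[P]_x _)%E => [b| |].
Qed.

(* Holds without integrability because [Ex] is then the junk value [0] on both sides. *)
Lemma Ex_scale (f : T -> R) (c : R) : measurable_fun setT f ->
  Ex P (fun x => c * f x) = c * Ex P f.
Proof.
move=> mf; have [Lf|nLf] := pselect (L1 P f); first exact: ExZ.
have [->|c0] := eqVneq c 0.
  by rewrite mul0r -[RHS](Ex_cst P 0); apply: eq_Ex => x; rewrite mul0r.
rewrite (Ex_not_L1 mf nLf) mulr0 Ex_not_L1//; first exact: measurable_funM.
move=> Lcf; apply: nLf; apply: eq_L1 (L1Z c^-1 Lcf) => x.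
by rewrite mulrA mulVf// mul1r.
Qed.

End unconditional_scaling.

Section kernel_operators.
Context {d : measure_display} {S : measurableType d} {R : realType} (F : probability S R).
Local Notation FF := (F \x F)%E.
Implicit Types (k u v : S * S -> R) (g h : S -> R).

Definition opr k g (x : S) : R := Ex F (fun t => k (x, t) * g t).

(** The kernel of the composed operator, written as [opr k] acting on the columns of [u], so that
    facts about functions lift to kernels column by column. *)
Definition comp k u (z : S * S) : R := opr k (fun t => u (t, z.2)) z.1.

Definition sym k := forall x y, k (x, y) = k (y, x).

Lemma ae_fst (Q : S -> Prop) : {ae F, forall x, Q x} -> {ae FF, forall z, Q z.1}.
Proof.
apply: (ae_law (U := fst) (P := FF)) => // A mA.
have -> : (@fst S S) @^-1` A = A `*` setT by apply/seteqP; split => [z|z []].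
apply: etrans (product_measure1E F F mA measurableT) _.
by rewrite [X in (_ * X)%E](probability_setT F) mule1.
Qed.

Lemma ae_snd (Q : S -> Prop) : {ae F, forall x, Q x} -> {ae FF, forall z, Q z.2}.
Proof.
apply: (ae_law (U := snd) (P := FF)) => // A mA.
have -> : (@snd S S) @^-1` A = setT `*` A by apply/seteqP; split => [z|z []].
apply: etrans (product_measure1E F F measurableT mA) _.
by rewrite [X in (X * _)%E](probability_setT F) mul1e.
Qed.

Lemma Ex_transpose k : L1 FF k -> Ex FF (fun z => k (z.2, z.1)) = Ex FF k /\
  L1 FF (fun z => k (z.2, z.1)).
Proof.
move=> Lk; have mk := L1_measurable Lk.
have mk' : measurable_fun setT (fun z : S * S => k (z.2, z.1)) by exact: measurable_swapped.
have Lk' : L1 FF (fun z => k (z.2, z.1)).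
  apply/integrableP; split; first exact/measurable_EFinP.
  have /integrableP[_] := Lk.
  rewrite fubini_tonelli2//; last by apply: measurableT_comp => //; exact/measurable_EFinP.
  by rewrite fubini_tonelli1//; apply: measurableT_comp => //; exact/measurable_EFinP.
by split => //; rewrite Ex_fubini// Ex_fubini2.
Qed.

Lemma L2_row_ae k : L2 FF k -> {ae F, forall x, L2 F (fun t => k (x, t))}.
Proof.
move=> [mk Lk]; apply: filterS (L1_slice_ae Lk) => x Lx; split => //.
exact: measurable_slice1.
Qed.

Lemma L2_col_ae k : L2 FF k -> {ae F, forall y, L2 F (fun t => k (t, y))}.
Proof.
move=> [mk Lk]; apply: filterS (L1_slice2_ae Lk) => x Lx; split => //.
exact: measurable_slice2.
Qed.

Lemma L2_tensor g h : L2 F g -> L2 F h -> L2 FF (fun z => g z.1 * h z.2).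
Proof.
move=> Lg Lh; split.
  by apply: measurable_funM; apply: measurableT_comp => //; [case: Lg|case: Lh].
by apply: eq_L1 (L1_prod Lg.2 Lh.2) => z; rewrite exprMn.
Qed.

Lemma measurable_opr k g : measurable_fun setT k -> measurable_fun setT g ->
  measurable_fun setT (opr k g).
Proof.
move=> mk mg; apply: (measurable_Ex_slice F (f := fun z => k z * g z.2)).
by apply: measurable_funM => //; exact: measurableT_comp.
Qed.

Lemma measurable_comp k u : measurable_fun setT k -> measurable_fun setT u ->
  measurable_fun setT (comp k u).
Proof.
move=> mk mu.
apply: (measurable_Ex_slice F (f := fun q : (S * S) * S => k (q.1.1, q.2) * u (q.2, q.1.2))).
apply: measurable_funM.
  apply: (measurableT_comp mk (g := fun q : (S * S) * S => (q.1.1, q.2))).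
  by apply: measurable_fun_pair => //; exact: measurableT_comp.
apply: (measurableT_comp mu (g := fun q : (S * S) * S => (q.2, q.1.2))).
by apply: measurable_fun_pair => //; exact: measurableT_comp.
Qed.

Lemma L2_opr k g : L2 FF k -> L2 F g -> L2 F (opr k g) /\
  Ex F (fun x => opr k g x ^+ 2) <= Ex FF (fun z => k z ^+ 2) * Ex F (fun x => g x ^+ 2).
Proof.
move=> Lk Lg; have mo := measurable_opr (proj1 Lk) (proj1 Lg).
pose a x := Ex F (fun t => k (x, t) ^+ 2) * Ex F (fun t => g t ^+ 2).
have La : L1 F a.
  apply: (@eq_L1 _ _ _ F (fun x => Ex F (fun t => g t ^+ 2) * Ex F (fun t => k (x, t) ^+ 2))).
    by move=> x; rewrite mulrC.
  by apply: L1Z; exact: (L1_fubini Lk.2).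
have ob : {ae F, forall x, opr k g x ^+ 2 <= a x}.
  by apply: filterS (L2_row_ae Lk) => x Lx; exact: Ex_cauchy_schwarz.
have Lo : L1 F (fun x => opr k g x ^+ 2).
  apply: L1_dom_ae La; first exact: measurable_funX.
  by apply: filterS ob => x; rewrite ger0_norm// sqr_ge0.
split => //; apply: le_trans (le_Ex_ae Lo La ob) _.
rewrite (@eq_Ex _ _ _ F a (fun x => Ex F (fun t => g t ^+ 2) * Ex F (fun t => k (x, t) ^+ 2))).
  rewrite ExZ; last exact: (L1_fubini Lk.2).
  by rewrite mulrC -(Ex_fubini Lk.2).
by move=> x; rewrite mulrC.
Qed.

(** Submultiplicativity of the Hilbert-Schmidt norm, from Cauchy-Schwarz between a row of [k] and a
    column of [u]. *)
Lemma L2_comp k u : L2 FF k -> L2 FF u -> L2 FF (comp k u) /\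
  Ex FF (fun z => comp k u z ^+ 2) <= Ex FF (fun z => k z ^+ 2) * Ex FF (fun z => u z ^+ 2).
Proof.
move=> Lk Lu; have mo := measurable_comp (proj1 Lk) (proj1 Lu).
pose a x := Ex F (fun t => k (x, t) ^+ 2); pose b y := Ex F (fun t => u (t, y) ^+ 2).
have La : L1 F a by exact: (L1_fubini Lk.2).
have [Eu Lu'] := Ex_transpose Lu.2.
have Lb : L1 F b by exact: (L1_fubini Lu').
have ob : {ae FF, forall z, comp k u z ^+ 2 <= a z.1 * b z.2}.
  apply: filterS2 (ae_fst (L2_row_ae Lk)) (ae_snd (L2_col_ae Lu)) => z L1z L2z.
  exact: (Ex_cauchy_schwarz L1z L2z).
have Lo : L1 FF (fun z => comp k u z ^+ 2).
  apply: L1_dom_ae (L1_prod La Lb); first exact: measurable_funX.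
  by apply: filterS ob => x; rewrite ger0_norm// sqr_ge0.
split => //; apply: le_trans (le_Ex_ae Lo (L1_prod La Lb) ob) _.
by rewrite (Ex_prod La Lb) -(Ex_fubini Lk.2) -(Ex_fubini2 Lu.2).
Qed.

Lemma opr_adjoint k g h : L2 FF k -> sym k -> L2 F g -> L2 F h ->
  Ex F (fun x => opr k g x * h x) = Ex F (fun x => g x * opr k h x).
Proof.
move=> Lk sk Lg Lh.
have mrow x : measurable_fun setT (fun t => k (x, t)) by apply: measurable_slice1; case: Lk.
have mg : measurable_fun setT g by case: Lg.
have mh : measurable_fun setT h by case: Lh.
have L : L1 FF (fun z => k z * (h z.1 * g z.2)) by apply: L2M => //; exact: L2_tensor.
transitivity (Ex F (fun x => Ex F (fun t => k (x, t) * (h x * g t)))).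
  apply: eq_Ex => x; rewrite mulrC -Ex_scale; last exact: measurable_funM.
  by apply: eq_Ex => t; ring.
rewrite (Ex_swap L); apply: eq_Ex => t.
rewrite -Ex_scale; last exact: measurable_funM.
by apply: eq_Ex => x; rewrite /= sk; ring.
Qed.

Lemma comp_adjoint k u v : L2 FF k -> sym k -> L2 FF u -> L2 FF v ->
  Ex FF (fun z => comp k u z * v z) = Ex FF (fun z => u z * comp k v z).
Proof.
move=> Lk sk Lu Lv.
have [Lku _] := L2_comp Lk Lu; have [Lkv _] := L2_comp Lk Lv.
rewrite (Ex_fubini2 (L2M Lku Lv)) (Ex_fubini2 (L2M Lu Lkv)).
apply: ae_eq_Ex.
- exact: (measurable_Ex_slice2 F (L1_measurable (L2M Lku Lv))).
- exact: (measurable_Ex_slice2 F (L1_measurable (L2M Lu Lkv))).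
apply: filterS2 (L2_col_ae Lu) (L2_col_ae Lv) => y Luy Lvy.
exact: (opr_adjoint Lk sk Luy Lvy).
Qed.

Lemma opr_comp k u g x : L2 F (fun t => k (x, t)) -> L2 FF u -> L2 F g ->
  opr k (opr u g) x = opr (comp k u) g x.
Proof.
move=> Lk Lu Lg; have mg : measurable_fun setT g by case: Lg.
have mu : measurable_fun setT u by case: Lu.
have L : L1 FF (fun z => u z * (k (x, z.1) * g z.2)).
  by apply: L2M => //; exact: (L2_tensor Lk Lg).
transitivity (Ex F (fun t => Ex F (fun s => u (t, s) * (k (x, t) * g s)))).
  apply: eq_Ex => t; rewrite -Ex_scale; first by apply: eq_Ex => s; ring.
  by apply: measurable_funM => //; exact: measurable_slice1.
rewrite (Ex_swap L); apply: eq_Ex => s.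
rewrite /comp /opr /= mulrC -Ex_scale; first by apply: eq_Ex => t; ring.
by apply: measurable_funM; [case: Lk|exact: measurable_slice2].
Qed.

Lemma comp_assoc k u v : L2 FF k -> L2 FF u -> L2 FF v ->
  {ae FF, forall z, comp k (comp u v) z = comp (comp k u) v z}.
Proof.
move=> Lk Lu Lv.
apply: filterS2 (ae_fst (L2_row_ae Lk)) (ae_snd (L2_col_ae Lv)) => z L1z L2z.
exact: (opr_comp L1z Lu L2z).
Qed.

Lemma compB k u v : L2 FF k -> L2 FF u -> L2 FF v ->
  {ae FF, forall z, comp k (fun z => u z - v z) z = comp k u z - comp k v z}.
Proof.
move=> Lk Lu Lv.
apply: filterS3 (ae_fst (L2_row_ae Lk)) (ae_snd (L2_col_ae Lu)) (ae_snd (L2_col_ae Lv)).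
move=> z Lkz Luz Lvz.
rewrite /comp /opr -ExB; [|exact: (L2M Lkz Luz)|exact: (L2M Lkz Lvz)].
by apply: eq_Ex => t; rewrite mulrBr.
Qed.

Lemma compZ k u c z : measurable_fun setT k -> measurable_fun setT u ->
  comp k (fun z => c * u z) z = c * comp k u z.
Proof.
move=> mk mu; rewrite /comp /opr -Ex_scale; first by apply: eq_Ex => t; ring.
by apply: measurable_funM; [exact: measurable_slice1|exact: measurable_slice2].
Qed.

Lemma Ex_sqr_comp_diff k u v : L2 FF k -> L2 FF u -> L2 FF v ->
  Ex FF (fun z => (comp k u z - comp k v z) ^+ 2) <=
  Ex FF (fun z => k z ^+ 2) * Ex FF (fun z => (u z - v z) ^+ 2).
Proof.
move=> Lk Lu Lv; have [_] := L2_comp Lk (L2B Lu Lv); apply: le_trans.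
have [Lku _] := L2_comp Lk Lu; have [Lkv _] := L2_comp Lk Lv.
rewrite le_eqVlt; apply/orP; left; apply/eqP; apply: ae_eq_Ex.
- by apply: measurable_funX; case: (L2B Lku Lkv).
- by apply: measurable_funX; case: (L2_comp Lk (L2B Lu Lv)) => -[].
- by apply: filterS (compB Lk Lu Lv) => z ->.
Qed.

End kernel_operators.

(** To be applied to the squared norms of the powers of an operator. Log-convexity makes the ratios
    of successive terms nondecreasing, submultiplicativity bounds them by b 0, and rho is their
    limit. Chaining ratios gives r_j^(i+1) b_j <= b_(i+j+1) <= b_i b_j, hence rho^(i+1) <= b_i. *)
Lemma logconvex_growth {R : realType} (b : nat -> R) : 0 < b 0%N -> 0 < b 1%N ->
  (forall j, b j.+1 ^+ 2 <= b j * b j.+2) -> (forall i j, b (i + j).+1 <= b i * b j) ->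
  exists rho, [/\ 0 < rho, (forall i, rho ^+ i.+1 <= b i) & (forall i, b i.+1 <= rho * b i)].
Proof.
move=> b0 b1 lc sm.
have bpos j : 0 < b j /\ 0 < b j.+1.
  elim: j => [//|j [pj pj1]]; split => //.
  have h : 0 < b j * b j.+2 by apply: lt_le_trans (lc j); rewrite exprn_gt0.
  by rewrite -(pmulr_rgt0 _ pj).
have bp j : 0 < b j by case: (bpos j).
pose r j := b j.+1 / b j.
have rE j : b j.+1 = r j * b j by rewrite /r divfK// gt_eqF.
have r_gt0 j : 0 < r j by rewrite divr_gt0.
have rS j : r j <= r j.+1.
  have := lc j; have p1 := bp j; have p2 := bp j.+1.
  by rewrite /r ler_pdivrMr// mulrAC ler_pdivlMr// -expr2 [leRHS]mulrC.
have r_nd : nondecreasing_seq r by apply/nondecreasing_seqP.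
have r_ub j : r j <= b 0%N by rewrite /r ler_pdivrMr//; have := sm 0%N j; rewrite add0n.
have cr : cvgn r by apply: nondecreasing_is_cvgn => //; exists (b 0%N) => _ [j _ <-].
pose rho := limn r.
have r_le j : r j <= rho by exact: nondecreasing_cvgn_le.
exists rho; split => [|i|i].
- exact: lt_le_trans (r_gt0 0%N) (r_le 0%N).
- have pw j : r j ^+ i.+1 <= b i.
    have H m : r j ^+ m * b j <= b (m + j)%N.
      elim: m => [|m IH]; first by rewrite expr0 mul1r.
      rewrite exprS -mulrA addSn rE; apply: ler_pM => //.
      - exact: ltW.
      - by rewrite mulr_ge0 ?exprn_ge0// ltW.
      - by apply: r_nd; exact: leq_addl.
    by have := le_trans (H i.+1) (sm i j); rewrite ler_pM2r.
  have cp : (fun j => r j ^+ i.+1) @ \oo --> rho ^+ i.+1.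
    apply: (@continuous_cvg _ _ _ _ _ r (fun y : R => y ^+ i.+1) rho); [exact: exprn_continuous|exact: cr].
  by apply: (cvgr_to_le cp); exact: nearW.
- by rewrite rE ler_wpM2r// ltW.
Qed.

(** * Existence of an eigenfunction for a symmetric L2 kernel *)

Section eigenfunction.
Context {d : measure_display} {S : measurableType d} {R : realType} (F : probability S R).
Local Notation FF := (F \x F)%E.
Variable k : S * S -> R.
Hypothesis Lk : L2 FF k.
Hypothesis sk : sym k.

(** Off by one: [kp n] is the kernel of the power n + 1 of the operator. *)
Let kp := fix kp (n : nat) : S * S -> R := if n is m.+1 then comp F k (kp m) else k.

Let Lkp n : L2 FF (kp n).
Proof. by elim: n => [//|n IH]; case: (L2_comp Lk IH). Qed.

(** Self-adjointness moves one factor of [k] at a time across the inner product, which thus depends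
    on i + j alone. Cauchy-Schwarz then makes [b] log-convex. *)
Let inner_shift i j : Ex FF (fun z => kp i z * kp j z) = Ex FF (fun z => kp 0%N z * kp (i + j)%N z).
Proof.
elim: i j => [|i IH] j; first by rewrite add0n.
by rewrite addSnnS -IH; exact: (comp_adjoint Lk sk (Lkp i) (Lkp j)).
Qed.

Let b j := Ex FF (fun z => kp j z ^+ 2).

Let innerE i j n : (i + j)%N = n.*2 -> Ex FF (fun z => kp i z * kp j z) = b n.
Proof. by move=> ijn; rewrite inner_shift ijn -addnn -inner_shift; apply: eq_Ex. Qed.

(** Associativity of [comp] holds only almost everywhere; the induction carries null sets through
    [comp F k] by means of the L2 norm. *)
Let kp_add i j : {ae FF, forall z, kp (i + j).+1 z = comp F (kp i) (kp j) z}.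
Proof.
elim: i => [|i IH]; first exact: aeW.
have [Lij _] := L2_comp (Lkp i) (Lkp j).
have E0 : Ex FF (fun z => (kp (i + j).+1 z - comp F (kp i) (kp j) z) ^+ 2) = 0.
  rewrite -[RHS](Ex_cst FF 0); apply: ae_eq_Ex => //.
    by apply: measurable_funX; case: (L2B (Lkp (i + j).+1) Lij).
  by apply: filterS IH => z ->; rewrite subrr expr0n.
have := Ex_sqr_comp_diff Lk (Lkp (i + j).+1) Lij; rewrite E0 mulr0 => le0.
have [L1' _] := L2_comp Lk (Lkp (i + j).+1); have [L2' _] := L2_comp Lk Lij.
have E1 : Ex FF (fun z => (comp F k (kp (i + j).+1) z - comp F k (comp F (kp i) (kp j)) z) ^+ 2) = 0.
  by apply/eqP; rewrite eq_le le0 /=; apply: Ex_ge0 => z; exact: sqr_ge0.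
apply: filterS2 (Ex_sqr0_ae (L2B L1' L2') E1) (comp_assoc Lk (Lkp i) (Lkp j)) => z /eqP.
by rewrite subr_eq0 => /eqP E <-; rewrite -E.
Qed.

Hypothesis k_neq0 : 0 < Ex FF (fun z => k z ^+ 2).

(* If [comp k k = 0] then [opr k] kills every indicator, so [k] integrates to zero on rectangles. *)
Let b1_gt0 : 0 < b 1%N.
Proof.
rewrite lt_neqAle eq_sym; apply/andP; split; last by apply: Ex_ge0 => z; exact: sqr_ge0.
apply/negP => /eqP b10.
have kk0 := Ex_sqr0_ae (Lkp 1%N) b10.
suff k0 : {ae FF, forall z, k z = 0}.
  move: k_neq0; rewrite (@ae_eq_Ex _ _ _ FF _ (fun=> 0)) ?Ex_cst ?ltxx//.
    by apply: measurable_funX; case: Lk.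
  by apply: filterS k0 => z ->; rewrite expr0n.
apply: rectangles_ae0; first exact: L2_L1.
have mk : measurable_fun setT k by case: Lk.
have L2I A : measurable A -> L2 F (\1_A : S -> R).
  move=> mA; apply: (L2_bnd _ (M := 1)); first exact: measurable_indic.
  by move=> x; rewrite indicE; case: (x \in A); rewrite ?normr1 ?normr0.
move=> A B mA mB; have LA := L2I A mA; have LB := L2I B mB.
have [LoB _] := L2_opr Lk LB.
(* By self-adjointness the squared norm of [opr F k \1_B] is the inner product of the indicator with
   its image under [comp F k k], which is 0. *)
have o0 : {ae F, forall x, opr F k \1_B x = 0}.
  apply: (Ex_sqr0_ae LoB).
  rewrite (@eq_Ex _ _ _ F _ (fun x => opr F k \1_B x * opr F k \1_B x))//.
  rewrite (opr_adjoint Lk sk LB LoB).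
  have [LooB _] := L2_opr Lk LoB.
  transitivity (Ex F (fun x => \1_B x * opr F (comp F k k) \1_B x)).
    apply: ae_eq_Ex; first by apply: measurable_funM; [case: LB|case: LooB].
      apply: measurable_funM; first by case: LB.
      by apply: measurable_opr; [case: (Lkp 1%N)|case: LB].
    by apply: filterS (L2_row_ae Lk) => x Lx; rewrite (opr_comp Lx Lk LB).
  have L : L1 FF (fun z => kp 1%N z * (\1_B z.1 * \1_B z.2)) by apply: L2M => //; exact: L2_tensor.
  transitivity (Ex FF (fun z => kp 1%N z * (\1_B z.1 * \1_B z.2))).
    rewrite Ex_fubini//; apply: eq_Ex => x; rewrite -Ex_scale.
      by apply: eq_Ex => t /=; ring.
    apply: measurable_funM; last by case: LB.
    by apply: measurable_slice1; case: (Lkp 1%N).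
  rewrite -[RHS](Ex_cst FF 0); apply: ae_eq_Ex => //; first exact: (L1_measurable L).
  by apply: filterS kk0 => z ->; rewrite mul0r.
have L : L1 FF (fun z => k z * (\1_A z.1 * \1_B z.2)) by apply: L2M => //; exact: L2_tensor.
transitivity (Ex FF (fun z => k z * (\1_A z.1 * \1_B z.2))).
  by apply: eq_Ex => z; rewrite mulrC.
rewrite Ex_fubini//; transitivity (Ex F (fun x => \1_A x * opr F k \1_B x)).
  apply: eq_Ex => x; rewrite -Ex_scale; first by apply: eq_Ex => t /=; ring.
  by apply: measurable_funM; [exact: measurable_slice1|case: LB].
rewrite -[RHS](Ex_cst F 0); apply: ae_eq_Ex => //.
  by apply: measurable_funM; [case: LA|case: LoB].
by apply: filterS o0 => x ->; rewrite mulr0.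
Qed.

Let growth : exists rho, [/\ 0 < rho, (forall i, rho ^+ i.+1 <= b i) &
  (forall i, b i.+1 <= rho * b i)].
Proof.
apply: logconvex_growth => [||j|i j]; [exact: k_neq0|exact: b1_gt0| |].
  rewrite -(innerE (i := j) (j := j.+2)); last by rewrite addnS -addSn addnn.
  exact: Ex_cauchy_schwarz.
have [Lij le] := L2_comp (Lkp i) (Lkp j); apply: le_trans le.
rewrite le_eqVlt; apply/orP; left; apply/eqP; apply: ae_eq_Ex.
- by apply: measurable_funX; case: (Lkp (i + j).+1).
- by apply: measurable_funX; case: Lij.
- by apply: filterS (kp_add i j) => z ->.
Qed.

(* The normalised even powers of [k] converge in L2 to a fixed point of [comp k (comp k _) / rho]. *)
Let fixed_kernel : exists rho u, [/\ 0 < rho, L2 FF u, 0 < Ex FF (fun z => u z ^+ 2) &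
  {ae FF, forall z, comp F k (comp F k u) z = rho * u z}].
Proof.
have [rho [rho0 lo up]] := growth.
pose s i := b i / rho ^+ i.+1.
have s_ge1 i : 1 <= s i by rewrite ler_pdivlMr ?exprn_gt0// mul1r.
have s_ni : nonincreasing_seq s.
  apply/nonincreasing_seqP => i; rewrite /s ler_pdivrMr ?exprn_gt0// [rho ^+ i.+2]exprS.
  rewrite [leRHS](_ : _ = rho * b i); first exact: up.
  by field; rewrite expf_neq0// gt_eqF.
have cs : cvgn s by apply: nonincreasing_is_cvgn => //; exists 1 => _ [i _ <-].
(* The operator power 2 n + 2 divided by rho^(n+1). The inner product of u n and u m is s (n +
   m).+1, and convergence of [s] makes the sequence Cauchy. *)
pose u n z := (rho ^+ n.+1)^-1 * kp n.*2.+1 z.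
have Lu n : L2 FF (u n) by exact: L2Z.
have innu n m : Ex FF (fun z => u n z * u m z) = s (n + m).+1.
  rewrite (@eq_Ex _ _ _ FF _ (fun z => ((rho ^+ n.+1)^-1 * (rho ^+ m.+1)^-1) *
      (kp n.*2.+1 z * kp m.*2.+1 z))); last by move=> z; rewrite /u; ring.
  rewrite ExZ; last exact: L2M.
  rewrite (innerE (n := (n + m).+1)); last by rewrite addSn addnS doubleS doubleD.
  by rewrite /s mulrC -invfM -exprD addnS addSn.
have diffu n m : Ex FF (fun z => (u n z - u m z) ^+ 2) =
    s (n + n).+1 + s (m + m).+1 - 2 * s (n + m).+1.
  rewrite -!innu -ExZ; last exact: L2M.
  rewrite -ExD; [|exact: L2M|exact: L2M].
  rewrite -ExB; [|by apply: L1D; exact: L2M|by apply: L1Z; exact: L2M].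
  by apply: eq_Ex => z; ring.
have cau e : 0 < e -> exists N, forall n m, (N <= n)%N -> (N <= m)%N ->
    Ex FF (fun z => (u n z - u m z) ^+ 2) <= e.
  move=> e0; have e4 : 0 < e / 4 by rewrite divr_gt0.
  have /cvgrPdist_le /(_ _ e4) [N _ HN] := cs.
  exists N => n m Nn Nm; rewrite diffu.
  have H i : (N <= i)%N -> `|limn s - s i| <= e / 4 by exact: HN.
  have h1 := H (n + n).+1 (leqW (leq_trans Nn (leq_addr _ _))).
  have h2 := H (m + m).+1 (leqW (leq_trans Nm (leq_addr _ _))).
  have h3 := H (n + m).+1 (leqW (leq_trans Nn (leq_addr _ _))).
  move: h1 h2 h3; rewrite !ler_norml => /andP[a1 a2] /andP[a3 a4] /andP[a5 a6].
  by lra.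
have [v [Lv cvv]] := L2_complete Lu cau.
exists rho, v; split => //.
  (* Every u N has squared norm at least 1. At squared distance at most 1/4 from u N, the limit has
     squared norm at least 1/4 and is not zero. *)
  have q : (0 : R) < 4^-1 by rewrite invr_gt0.
  have [N HN] := cvv _ q.
  have h1 : 1 <= Ex FF (fun z => u N z ^+ 2).
    by apply: le_trans (s_ge1 (N + N).+1) _; rewrite -innu.
  have := Ex_sqrD_le Lv (L2B (Lu N) Lv).
  rewrite (@eq_Ex _ _ _ FF (fun z => (v z + (u N z - v z)) ^+ 2) (fun z => u N z ^+ 2)); last first.
    by move=> z; congr (_ ^+ 2); ring.
  by move=> h2; have := HN N (leqnn _); lra.
have [Lkv _] := L2_comp Lk Lv; have [Lkkv _] := L2_comp Lk Lkv.
have LD : L2 FF (fun z => comp F k (comp F k v) z - rho * v z) by apply: L2B => //; exact: L2Z.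
suff E0 : Ex FF (fun z => (comp F k (comp F k v) z - rho * v z) ^+ 2) = 0.
  by apply: filterS (Ex_sqr0_ae LD E0) => z /eqP; rewrite subr_eq0 => /eqP.
set K := Ex FF (fun z => k z ^+ 2).
have K0 : 0 <= K by exact: ltW.
(* Applying [comp F k] twice sends u N to rho u N.+1 exactly, so the defect of the limit is
   controlled by its distances to u N and u N.+1. *)
have bound e : 0 < e -> Ex FF (fun z => (comp F k (comp F k v) z - rho * v z) ^+ 2) <=
    2 * (K * (K * e)) + 2 * (rho ^+ 2 * e).
  move=> e0; have [N HN] := cvv _ e0.
  have [Lku _] := L2_comp Lk (Lu N); have [Lkku _] := L2_comp Lk Lku.
  have uS z : comp F k (comp F k (u N)) z = rho * u N.+1 z.
    have -> : comp F k (u N) = fun z => (rho ^+ N.+1)^-1 * kp N.*2.+2 z.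
      by apply/funext => y; apply: compZ; [case: Lk|case: (Lkp N.*2.+1)].
    rewrite compZ; [|by case: Lk|by case: (Lkp N.*2.+2)].
    rewrite /u doubleS -[comp F k (kp N.*2.+2) z]/(kp N.*2.+3 z) [rho ^+ N.+2]exprS.
    by field; rewrite expf_neq0 ?gt_eqF.
  have LA : L2 FF (fun z => comp F k (comp F k v) z - comp F k (comp F k (u N)) z) by exact: (L2B Lkkv Lkku).
  have LB : L2 FF (fun z => rho * (u N.+1 z - v z)) by apply: L2Z; exact: L2B.
  have := Ex_sqrD_le LA LB.
  rewrite (@eq_Ex _ _ _ FF _ (fun z => (comp F k (comp F k v) z - rho * v z) ^+ 2)); last first.
    by move=> z; congr (_ ^+ 2); rewrite uS; ring.
  move=> h; apply: le_trans h _; apply: lerD.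
    rewrite ler_wpM2l//; apply: le_trans (Ex_sqr_comp_diff Lk Lkv Lku) _.
    rewrite ler_wpM2l//; apply: le_trans (Ex_sqr_comp_diff Lk Lv (Lu N)) _.
    rewrite ler_wpM2l//; apply: le_trans (HN N (leqnn _)).
    by rewrite le_eqVlt; apply/orP; left; apply/eqP; apply: eq_Ex => z; rewrite -sqrrN opprB.
  rewrite ler_wpM2l// (@eq_Ex _ _ _ FF _ (fun z => rho ^+ 2 * (u N.+1 z - v z) ^+ 2)); last first.
    by move=> z; rewrite exprMn.
  rewrite ExZ; last by case: (L2B (Lu N.+1) Lv).
  by rewrite ler_wpM2l ?sqr_ge0// HN.
apply/eqP; rewrite eq_le; apply/andP; split; last by apply: Ex_ge0 => z; exact: sqr_ge0.
apply/ler_addgt0Pr => e e0; rewrite add0r.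
have C0 : 0 < 2 * (K * K) + 2 * rho ^+ 2 + 1.
  by have h1 : 0 <= K * K by [rewrite mulr_ge0]; have h2 : 0 <= rho ^+ 2 by [exact: sqr_ge0]; lra.
have := bound (e / (2 * (K * K) + 2 * rho ^+ 2 + 1)) (divr_gt0 e0 C0).
move=> h; apply: le_trans h _; set C := 2 * (K * K) + _ + _ in C0 *.
have -> : 2 * (K * (K * (e / C))) + 2 * (rho ^+ 2 * (e / C)) = (C - 1) * (e / C) by rewrite /C; ring.
rewrite mulrCA ger_pMr// ler_pdivrMr// mul1r; lra.
Qed.

(** A column g of the fixed kernel satisfies A A g = rho g. With c = sqrt rho, the function A g + c
    g is an eigenfunction for c; if it vanishes, g is one for - c. *)
Theorem hilbert_schmidt_eigenfunction : exists mu g,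
  [/\ mu != 0, L2 F g, 0 < Ex F (fun x => g x ^+ 2) & {ae F, forall x, opr F k g x = mu * g x}].
Proof.
have [rho [u [rho0 Lu u0 fu]]] := fixed_kernel.
have [Lku _] := L2_comp Lk Lu; have [Lkku _] := L2_comp Lk Lku.
pose f z := comp F k (comp F k u) z - rho * u z.
have Lf : L2 FF f by apply: L2B => //; exact: L2Z.
have Ef : Ex FF (fun z => f z ^+ 2) = 0.
  rewrite -[RHS](Ex_cst FF 0); apply: ae_eq_Ex => //; first by apply: measurable_funX; case: Lf.
  by apply: filterS fu => z E; rewrite /f E subrr expr0n.
(* Almost every column satisfies the equation, so a nonzero one among them exists; otherwise the
   fixed kernel would have norm 0. *)
have [y [Luy Lfy Efy Euy]] : exists y, [/\ L2 F (fun x => u (x, y)), L2 F (fun x => f (x, y)),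
    Ex F (fun x => f (x, y) ^+ 2) = 0 & 0 < Ex F (fun x => u (x, y) ^+ 2)].
  apply: contrapT => nex; move: u0; rewrite (Ex_fubini2 Lu.2).
  rewrite (@ae_eq_Ex _ _ _ F _ (fun=> 0)) ?Ex_cst ?ltxx//.
    apply: (measurable_Ex_slice2 F (f := fun z => u z ^+ 2)).
    by apply: measurable_funX; case: Lu.
  have [Et Lt] := Ex_transpose Lf.2.
  have Ef2 : Ex F (fun y => Ex F (fun x => f (x, y) ^+ 2)) = 0 by rewrite -(Ex_fubini2 Lf.2).
  have := Ex0_ae (L1_fubini Lt) (fun y => Ex_ge0 F (fun x => sqr_ge0 _)) Ef2.
  apply: filterS3 (L2_col_ae Lu) (L2_col_ae Lf) => y Luy Lfy Efy.
  apply/eqP/negPn/negP => n0; apply: nex; exists y; split => //.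
  by rewrite lt_neqAle eq_sym n0 /=; apply: Ex_ge0 => x; exact: sqr_ge0.
pose g x := u (x, y); pose c := Num.sqrt rho.
have c0 : 0 < c by rewrite sqrtr_gt0.
have c2 : c ^+ 2 = rho by rewrite sqr_sqrtr// ltW.
have [LAg _] := L2_opr Lk Luy.
have AAg : {ae F, forall x, opr F k (opr F k g) x = rho * g x}.
  by apply: filterS (Ex_sqr0_ae Lfy Efy) => x /eqP; rewrite subr_eq0 => /eqP.
pose gp x := opr F k g x + c * g x.
have Lgp : L2 F gp by apply: L2D => //; exact: L2Z.
have Agp : {ae F, forall x, opr F k gp x = c * gp x}.
  apply: filterS2 AAg (L2_row_ae Lk) => x AAx Lx.
  rewrite /opr (@eq_Ex _ _ _ F _ (fun t => k (x, t) * opr F k g t + c * (k (x, t) * g t))); last first.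
    by move=> t; rewrite /gp; ring.
  rewrite ExD; [|exact: L2M|by apply: L1Z; exact: L2M].
  rewrite ExZ; last exact: L2M.
  rewrite -[Ex F (fun t => k (x, t) * opr F k g t)]/(opr F k (opr F k g) x) AAx.
  by rewrite -[Ex F (fun t => k (x, t) * g t)]/(opr F k g x) /gp -c2; ring.
have [gp0|gpn0] := eqVneq (Ex F (fun x => gp x ^+ 2)) 0.
  exists (- c), g; split => //; first by rewrite oppr_eq0 gt_eqF.
  apply: filterS (Ex_sqr0_ae Lgp gp0) => x /eqP; rewrite addr_eq0 => /eqP ->.
  by rewrite mulNr.
exists c, gp; split => //; first by rewrite gt_eqF.
by rewrite lt_neqAle eq_sym gpn0 /=; apply: Ex_ge0 => x; exact: sqr_ge0.
Qed.

End eigenfunction.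

(** * L2 convergence of the eigenfunction expansion *)

Section truncation.
Context {d : measure_display} {S : measurableType d} {R : realType} (F : probability S R).
Local Notation FF := (F \x F)%E.
Variables (k : S -> S -> R) (lam : nat -> R) (phi : nat -> S -> R).
Let kk (z : S * S) := k z.1 z.2.
Hypothesis Lk : L2 FF kk.
Hypothesis sk : forall x y, k x y = k y x.
Hypothesis L2phi : forall j, lam j != 0 -> L2 F (phi j).
Hypothesis orthphi : forall i j, lam i != 0 -> lam j != 0 ->
  Ex F (fun x => phi i x * phi j x) = if i == j then 1 else 0.
Hypothesis eigphi : forall j, lam j != 0 -> {ae F, forall x, opr F kk (phi j) x = lam j * phi j x}.
(** The integrability clause allows an equation between real expectations to be turned back into one
    between extended integrals. *)
Hypothesis complphi : forall (mu : R) (g : S -> R), mu != 0 -> L2 F g ->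
  {ae F, forall x, L1 F (fun y => kk (x, y) * g y) /\ opr F kk g x = mu * g x} ->
  (forall j, lam j = mu -> Ex F (fun x => g x * phi j x) = 0) ->
  {ae F, forall x, g x = 0}.

(* [phi j] is arbitrary when [lam j = 0]. *)
Definition efun j (x : S) : R := if lam j == 0 then 0 else phi j x.

Local Notation psi := efun.

Lemma L2_efun j : L2 F (psi j).
Proof.
rewrite /efun; case: eqVneq => [_|lj]; first exact: L2_cst.
exact: L2phi.
Qed.

Lemma orth_efun i j : Ex F (fun x => psi i x * psi j x) =
  if (i == j) && (lam i != 0) then 1 else 0.
Proof.
rewrite /efun; have [i0|i0] := eqVneq (lam i) 0.
  by rewrite andbF -[RHS](Ex_cst F 0); apply: eq_Ex => x; rewrite mul0r.
have [j0|j0] := eqVneq (lam j) 0; last by rewrite andbT orthphi.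
rewrite -[LHS](_ : 0 = _); first by case: eqP => // ij; rewrite ij j0 eqxx in i0.
by rewrite -[LHS](Ex_cst F 0); apply: eq_Ex => x; rewrite mulr0.
Qed.

Lemma eig_efun j : {ae F, forall x, opr F kk (psi j) x = lam j * psi j x}.
Proof.
have [j0|j0] := eqVneq (lam j) 0.
  apply: aeW => x; rewrite j0 mul0r -[RHS](Ex_cst F 0); apply: eq_Ex => t.
  by rewrite /efun j0 eqxx mulr0.
by rewrite /efun (negbTE j0); exact: eigphi.
Qed.

Definition tensor j (z : S * S) : R := psi j z.1 * psi j z.2.

Definition resid J (z : S * S) : R := kk z - \sum_(l < J) lam l * tensor l z.

Lemma L2_tensor_efun j : L2 FF (tensor j).
Proof. exact: (L2_tensor (L2_efun j) (L2_efun j)). Qed.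

Lemma L2_resid J : L2 FF (resid J).
Proof. by apply: L2B => //; apply: L2_sum => l _; apply: L2Z; exact: L2_tensor_efun. Qed.

Let inner_tensor i j : Ex FF (fun z => tensor i z * tensor j z) =
  if (i == j) && (lam i != 0) then 1 else 0.
Proof.
rewrite (@eq_Ex _ _ _ FF _ (fun z => (psi i z.1 * psi j z.1) * (psi i z.2 * psi j z.2))).
  rewrite (Ex_prod (L2M (L2_efun i) (L2_efun j)) (L2M (L2_efun i) (L2_efun j))) orth_efun.
  by case: ifP; rewrite ?mulr1 ?mulr0.
by move=> z; rewrite /tensor; ring.
Qed.

Let Ex_bilinear (u : S * S -> R) (g h : S -> R) : L2 FF u -> L2 F g -> L2 F h ->
  Ex FF (fun z => u z * (g z.1 * h z.2)) = Ex F (fun x => g x * opr F u h x).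
Proof.
move=> Lu Lg Lh; rewrite Ex_fubini; last by apply: L2M => //; exact: L2_tensor.
apply: eq_Ex => x; rewrite -Ex_scale; first by apply: eq_Ex => t /=; ring.
by apply: measurable_funM; [apply: measurable_slice1; case: Lu|case: Lh].
Qed.

Let inner_k j : Ex FF (fun z => kk z * tensor j z) = lam j.
Proof.
rewrite (Ex_bilinear Lk (L2_efun j) (L2_efun j)).
transitivity (Ex F (fun x => lam j * (psi j x * psi j x))).
  apply: ae_eq_Ex.
  - apply: measurable_funM; first by case: (L2_efun j).
    by apply: measurable_opr; [case: Lk|case: (L2_efun j)].
  - apply: measurable_funM => //.
    by apply: measurable_funM; case: (L2_efun j).
  - by apply: filterS (eig_efun j) => x ->; ring.
rewrite ExZ; last by apply: L2M; exact: L2_efun.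
rewrite orth_efun eqxx /=; case: eqVneq => [->|_]; rewrite ?mulr1//.
by rewrite mulr0.
Qed.

Let inner_resid J j : Ex FF (fun z => resid J z * tensor j z) = if (j < J)%N then 0 else lam j.
Proof.
rewrite (@eq_Ex _ _ _ FF _ (fun z => kk z * tensor j z -
    \sum_(l < J) lam l * (tensor l z * tensor j z))); last first.
  by move=> z; rewrite /resid mulrBl mulr_suml; congr (_ - _); apply: eq_bigr => l _; ring.
have Lt l : L1 FF (fun z => tensor l z * tensor j z) by apply: L2M; exact: L2_tensor_efun.
rewrite ExB; [|by apply: L2M => //; exact: L2_tensor_efun|by apply: L1_sum => l _; exact: L1Z].
rewrite inner_k Ex_sum; last by move=> l _; exact: L1Z.
under eq_bigr do rewrite ExZ// inner_tensor.
have [jJ|Jj] := ltnP j J.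
  rewrite (bigD1 (Ordinal jJ)) //= eqxx /= big1 ?addr0.
    by case: eqVneq => [->|_]; rewrite ?mulr0 ?mulr1 subrr.
  move=> l; rewrite -val_eqE /= => /negbTE ->; by rewrite mulr0.
rewrite big1 ?subr0// => l _; rewrite (_ : (nat_of_ord l == j) = false) ?mulr0//.
by apply: ltn_eqF; exact: leq_trans (ltn_ord l) Jj.
Qed.

Let A J := Ex FF (fun z => resid J z ^+ 2).

Let inner_resid2 J J' : (J <= J')%N -> Ex FF (fun z => resid J z * resid J' z) = A J'.
Proof.
move=> JJ'.
rewrite (@eq_Ex _ _ _ FF _ (fun z => resid J' z ^+ 2 +
    \sum_(l < J' | (J <= l)%N) lam l * (resid J' z * tensor l z))); last first.
  move=> z; have -> : resid J z = resid J' z + \sum_(l < J' | (J <= l)%N) lam l * tensor l z.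
    have E : \sum_(l < J') lam l * tensor l z = \sum_(l < J' | (J <= l)%N) lam l * tensor l z +
        \sum_(l < J) lam l * tensor l z.
      rewrite (bigID (fun l : 'I_J' => (J <= l)%N)) /=; congr (_ + _).
      rewrite (big_ord_widen _ (fun l => lam l * tensor l z) JJ').
      by apply: eq_bigl => l; rewrite ltnNge.
    by rewrite /resid E; ring.
  by rewrite mulrDl -expr2 mulr_suml; congr (_ + _); apply: eq_bigr => l _; ring.
have Lt l : L1 FF (fun z => resid J' z * tensor l z).
  by apply: L2M; [exact: L2_resid|exact: L2_tensor_efun].
rewrite ExD; [|by case: (L2_resid J')|by apply: L1_sum => l _; exact: L1Z].
rewrite Ex_sum; last by move=> l _; exact: L1Z.
by rewrite big1 ?addr0// => l _; rewrite ExZ// inner_resid ltn_ord mulr0.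
Qed.

(** Pythagoras: a later residual is orthogonal to the terms removed before it. Hence [A] decreases
    and the residuals are Cauchy. *)
Let diff_resid J J' : (J <= J')%N -> Ex FF (fun z => (resid J z - resid J' z) ^+ 2) = A J - A J'.
Proof.
move=> JJ'.
rewrite (@eq_Ex _ _ _ FF _ (fun z => (resid J z ^+ 2 - 2 * (resid J z * resid J' z)) + resid J' z ^+ 2)); last first.
  by move=> z; ring.
have L : L1 FF (fun z => resid J z * resid J' z) by apply: L2M; exact: L2_resid.
rewrite ExD; [|by apply: L1B; [case: (L2_resid J)|exact: L1Z]|by case: (L2_resid J')].
rewrite ExB; [|by case: (L2_resid J)|exact: L1Z].
by rewrite ExZ// inner_resid2// -/(A J) -/(A J'); ring.
Qed.

Lemma opr_resid J g : L2 F g -> {ae F, forall x, opr F (resid J) g x =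
  opr F kk g x - \sum_(l < J) lam l * psi l x * Ex F (fun t => psi l t * g t)}.
Proof.
move=> Lg; apply: filterS (L2_row_ae Lk) => x Lx.
rewrite /opr (@eq_Ex _ _ _ F _ (fun t => kk (x, t) * g t -
    \sum_(l < J) (lam l * psi l x) * (psi l t * g t))); last first.
  by move=> t; rewrite /resid mulrBl mulr_suml; congr (_ - _); apply: eq_bigr => l _; rewrite /tensor /=; ring.
have Lt l : L1 F (fun t => psi l t * g t) by apply: L2M => //; exact: L2_efun.
rewrite ExB; [|exact: L2M|by apply: L1_sum => l _; exact: L1Z].
by congr (_ - _); rewrite Ex_sum => [|l _]; [apply: eq_bigr => l _; rewrite ExZ|exact: L1Z].
Qed.

Lemma resid_limit : exists k', [/\ L2 FF k', sym k' &
  forall e, 0 < e -> exists N, forall J, (N <= J)%N -> Ex FF (fun z => (resid J z - k' z) ^+ 2) <= e].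
Proof.
have A0 J : 0 <= A J by apply: Ex_ge0 => z; exact: sqr_ge0.
have A_ni : nonincreasing_seq A.
  apply/nonincreasing_seqP => J; rewrite -subr_ge0 -diff_resid//.
  by apply: Ex_ge0 => z; exact: sqr_ge0.
have cA : cvgn A by apply: nonincreasing_is_cvgn => //; exists 0 => _ [J _ <-].
have cau e : 0 < e -> exists N, forall n m, (N <= n)%N -> (N <= m)%N ->
    Ex FF (fun z => (resid n z - resid m z) ^+ 2) <= e.
  move=> e0; have e2 : 0 < e / 2 by rewrite divr_gt0.
  have /cvgrPdist_le /(_ _ e2) [N _ HN] := cA.
  have H n m : (N <= n)%N -> (n <= m)%N -> Ex FF (fun z => (resid n z - resid m z) ^+ 2) <= e.
    move=> Nn nm; rewrite diff_resid//.
    have := HN n Nn; have := HN m (leq_trans Nn nm); rewrite /= !ler_norml.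
    by move=> /andP[a1 a2] /andP[a3 a4]; lra.
  exists N => n m Nn Nm; have [nm|/ltnW mn] := leqP n m; first exact: H.
  rewrite (@eq_Ex _ _ _ FF _ (fun z => (resid m z - resid n z) ^+ 2)); first exact: H.
  by move=> z; rewrite -sqrrN opprB.
have [v [Lv cv]] := L2_complete L2_resid cau.
have LT u : L2 FF u -> L2 FF (fun z => u (z.2, z.1)) /\
    Ex FF (fun z => u (z.2, z.1) ^+ 2) = Ex FF (fun z => u z ^+ 2).
  move=> Lu; have [E L] := Ex_transpose Lu.2; split => //; split => //.
  by apply: measurable_swapped; case: Lu.
(* An L2 limit of symmetric kernels is symmetric only almost everywhere. Averaging with the
   transpose makes it symmetric at every point and keeps it a limit. *)
exists (fun z => 2^-1 * (v z + v (z.2, z.1))); split.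
- by apply: L2Z; apply: L2D => //; case: (LT v Lv).
- by move=> x y /=; rewrite addrC.
- move=> e e0; have [N HN] := cv e e0; exists N => J NJ.
  pose u z := resid J z - v z.
  have Lu : L2 FF u by apply: L2B => //; exact: L2_resid.
  have [LuT EuT] := LT u Lu.
  have rs z : resid J (z.2, z.1) = resid J z.
    rewrite /resid /kk /= sk; congr (_ - _); apply: eq_bigr => l _.
    by rewrite /tensor /= [psi l z.2 * _]mulrC.
  rewrite (@eq_Ex _ _ _ FF _ (fun z => 4^-1 * (u z + u (z.2, z.1)) ^+ 2)); last first.
    by move=> z; rewrite /u rs; field.
  rewrite ExZ; last by case: (L2D Lu LuT).
  have := Ex_sqrD_le Lu LuT; rewrite EuT => h.
  by have := HN J NJ; rewrite -/(u _); lra.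
Qed.

(** Suppose the limit k' is not zero and g is an eigenfunction of it for mu. Residuals with J > j
    annihilate psi j, hence so does k', and g is orthogonal to every psi j. Then the operators of
    h_{0,2} and of k' agree on g, so g belongs to the mu-eigenspace and completeness forces g =
    0. *)
Theorem resid_cvg0 e : 0 < e -> exists N, forall J, (N <= J)%N ->
  Ex FF (fun z => resid J z ^+ 2) <= e.
Proof.
move=> e0; have [k' [Lk' sk' ck']] := resid_limit.
have [k'0|k'n0] := eqVneq (Ex FF (fun z => k' z ^+ 2)) 0.
  have [N HN] := ck' (e / 2) (divr_gt0 e0 (ltr0n _ 2)); exists N => J NJ.
  have := Ex_sqrD_le (L2B (L2_resid J) Lk') Lk'; rewrite k'0 mulr0 addr0.
  rewrite (@eq_Ex _ _ _ FF _ (fun z => resid J z ^+ 2)); last by move=> z; rewrite subrK.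
  by have := HN J NJ; lra.
exfalso.
have k'_gt0 : 0 < Ex FF (fun z => k' z ^+ 2).
  by rewrite lt_neqAle eq_sym k'n0 /=; apply: Ex_ge0 => z; exact: sqr_ge0.
have [mu [g [mu0 Lg g0 eg]]] := hilbert_schmidt_eigenfunction Lk' sk' k'_gt0.
set G := Ex F (fun x => g x ^+ 2) in g0.
have orth j : Ex F (fun x => psi j x * g x) = 0.
  have [LAg _] := L2_opr Lk' Lg.
  have LT := L2_tensor (L2_efun j) Lg.
  have E1 : Ex FF (fun z => k' z * (psi j z.1 * g z.2)) = mu * Ex F (fun x => psi j x * g x).
    rewrite (Ex_bilinear Lk' (L2_efun j) Lg) -ExZ; last by apply: L2M => //; exact: L2_efun.
    apply: ae_eq_Ex.
    - by apply: measurable_funM; [case: (L2_efun j)|case: LAg].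
    - by apply: measurable_funM => //; apply: measurable_funM; [case: (L2_efun j)|case: Lg].
    - by apply: filterS eg => x ->; ring.
  have E2 J : (j < J)%N -> Ex FF (fun z => resid J z * (psi j z.1 * g z.2)) = 0.
    move=> jJ; have LR := L2_resid J.
    rewrite (Ex_bilinear LR (L2_efun j) Lg) -(opr_adjoint LR _ (L2_efun j) Lg); last first.
      move=> x y; rewrite /resid /kk /= sk; congr (_ - _); apply: eq_bigr => l _.
      by rewrite /tensor /= [psi l y * _]mulrC.
    rewrite -[RHS](Ex_cst F 0); apply: ae_eq_Ex => //.
      apply: measurable_funM; last by case: Lg.
      by apply: measurable_opr; [case: LR|case: (L2_efun j)].
    apply: filterS2 (opr_resid J (L2_efun j)) (eig_efun j) => x -> ->.
    rewrite (bigD1 (Ordinal jJ)) //= big1 ?addr0.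
      rewrite orth_efun eqxx /=; case: eqVneq => [->|_]; first by rewrite !mul0r subrr mul0r.
      by rewrite mulr1 subrr mul0r.
    move=> l; rewrite -val_eqE /= orth_efun => /negbTE ->; by rewrite mulr0.
  set m := Ex F _ in E1 *.
  set C := Ex FF (fun z => (psi j z.1 * g z.2) ^+ 2).
  have C0 : 0 <= C by apply: Ex_ge0 => z; exact: sqr_ge0.
  have small e' : 0 < e' -> (mu * m) ^+ 2 <= e' * C.
    move=> e'0; have [N HN] := ck' e' e'0.
    pose J := maxn N j.+1.
    have LD : L2 FF (fun z => resid J z - k' z) by apply: L2B => //; exact: L2_resid.
    have := Ex_cauchy_schwarz LD LT.
    rewrite (@eq_Ex _ _ _ FF (fun z => (resid J z - k' z) * _)
      (fun z => resid J z * (psi j z.1 * g z.2) - k' z * (psi j z.1 * g z.2))); last first.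
      by move=> z; rewrite mulrBl.
    rewrite ExB; [|by apply: L2M => //; exact: L2_resid|exact: L2M].
    rewrite E2 ?leq_max ?ltnSn ?orbT// E1 sub0r sqrrN => h; apply: le_trans h _.
    by rewrite ler_wpM2r// HN// leq_max leqnn.
  have : (mu * m) ^+ 2 <= 0.
    apply/ler_addgt0Pr => e' e'0; rewrite add0r.
    have C1 : 0 < C + 1 by rewrite ltr_wpDl.
    apply: le_trans (small (e' / (C + 1)) (divr_gt0 e'0 C1)) _.
    by rewrite mulrAC ler_pdivrMr// ler_wpM2l ?lerDl// ltW.
  rewrite real_exprn_even_le0 ?num_real//= mulf_eq0 (negbTE mu0) /= => /eqP.
  by [].
have Eg : {ae F, forall x, opr F kk g x = mu * g x}.
  have [Lkg _] := L2_opr Lk Lg.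
  have LD : L2 F (fun x => opr F kk g x - mu * g x) by apply: L2B => //; exact: L2Z.
  suff E0 : Ex F (fun x => (opr F kk g x - mu * g x) ^+ 2) = 0.
    by apply: filterS (Ex_sqr0_ae LD E0) => x /eqP; rewrite subr_eq0 => /eqP.
  have small e' : 0 < e' -> Ex F (fun x => (opr F kk g x - mu * g x) ^+ 2) <= e' * G.
    move=> e'0; have [N HN] := ck' e' e'0.
    have LR : L2 FF (fun z => resid N z - k' z) by apply: L2B => //; exact: L2_resid.
    have [LRg leRg] := L2_opr LR Lg.
    apply: (@le_trans _ _ (Ex F (fun x => opr F (fun z => resid N z - k' z) g x ^+ 2))).
      rewrite le_eqVlt; apply/orP; left; apply/eqP; apply: ae_eq_Ex.
      - by apply: measurable_funX; case: LD.
      - by apply: measurable_funX; case: LRg.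
      - have rows : {ae F, forall x, L2 F (fun t => resid N (x, t)) /\ L2 F (fun t => k' (x, t))}.
          by apply: filterS2 (L2_row_ae (L2_resid N)) (L2_row_ae Lk').
        apply: filterS3 (opr_resid N Lg) eg rows => x E1 E2 [r1 r2]; congr (_ ^+ 2).
        rewrite /opr (@eq_Ex _ _ _ F (fun t => (resid N (x, t) - k' (x, t)) * g t)
          (fun t => resid N (x, t) * g t - k' (x, t) * g t)); last by move=> t; rewrite mulrBl.
        rewrite ExB; [|exact: L2M|exact: L2M].
        rewrite -/(opr F (resid N) g x) -/(opr F k' g x) E1 E2; congr (_ - _).
        by rewrite big1 ?subr0// => l _; rewrite orth mulr0.
    by apply: le_trans leRg _; rewrite ler_wpM2r ?HN// ltW.
  apply/eqP; rewrite eq_le; apply/andP; split; last by apply: Ex_ge0 => x; exact: sqr_ge0.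
  apply/ler_addgt0Pr => e' e'0; rewrite add0r.
  apply: le_trans (small (e' / G) (divr_gt0 e'0 g0)) _.
  by rewrite divfK// gt_eqF.
have : {ae F, forall x, g x = 0}.
  apply: (complphi mu0 Lg).
    by apply: filterS2 Eg (L2_row_ae Lk) => x -> Lx; split => //; exact: L2M.
  move=> j lj; rewrite -[RHS](orth j); apply: eq_Ex => x.
  by rewrite mulrC /efun lj (negbTE mu0).
move=> ag; move: g0; rewrite /G (@ae_eq_Ex _ _ _ F _ (fun=> 0)) ?Ex_cst ?ltxx//.
  by apply: measurable_funX; case: Lg.
by apply: filterS ag => x ->; rewrite expr0n.
Qed.

End truncation.

(** * Laws of large numbers and quadratic forms *)

Section case_sample.
Context {d dS : measure_display} {O : measurableType d} {S : measurableType dS}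
  {R : realType} (P : probability O R).

Lemma independent_cases (X : bool * nat -> O -> S) : mutually_independent P X ->
  mutually_independent P (fun j => X (true, j)).
Proof.
move=> iX J A uJ mA.
have uJ' : uniq [seq (true, j) | j <- J] by rewrite map_inj_uniq// => ? ? [].
have := iX [seq (true, j) | j <- J] (fun e => A e.2) uJ'.
by rewrite !big_map; apply => e /mapP[j jJ ->]; exact: mA.
Qed.

End case_sample.

Section iid_sums.
Context {d dS : measure_display} {O : measurableType d} {S : measurableType dS}
  {R : realType} (P : probability O R) (X : nat -> O -> S) (F : probability S R).
Hypothesis mX : forall i, measurable_fun setT (X i).
Hypothesis iX : mutually_independent P X.
Hypothesis FX : forall e A, measurable A -> P (X e @^-1` A) = F A.

Lemma L2_iid_sum (c : S -> R) n : L2 F c -> L2 P (fun w => \sum_(i < n) c (X i w)).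
Proof.
move=> Lc; apply: L2_sum => i _; apply/(L2_law (mX _) (FX _)) => //; by case: Lc.
Qed.

Lemma Ex_sqr_iid_sum (c : S -> R) n : L2 F c -> Ex F c = 0 ->
  Ex P (fun w => (\sum_(i < n) c (X i w)) ^+ 2) = n%:R * Ex F (fun x => c x ^+ 2).
Proof.
move=> Lc Ec; have mc : measurable_fun setT c by case: Lc.
have LX i : L2 P (fun w => c (X i w)) by exact/(L2_law (mX _) (FX _)).
rewrite (@eq_Ex _ _ _ P _ (fun w => \sum_(i < n) \sum_(j < n) c (X i w) * c (X j w))); last first.
  by move=> w; rewrite expr2 big_distrlr.
rewrite Ex_sum; last by move=> i _; apply: L1_sum => j _; exact: L2M.
rewrite (eq_bigr (fun=> Ex F (fun x => c x ^+ 2))).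
  by rewrite sumr_const card_ord mulr_natl.
move=> i _; rewrite Ex_sum; last by move=> j _; exact: L2M.
rewrite (bigD1 i)//= big1 ?addr0.
  rewrite -(Ex_law (mX i) (FX _) _ Lc.2)//; exact: measurable_funX.
move=> j ji.
have ij : nat_of_ord i != nat_of_ord j by rewrite eq_sym.
have Lcc := L1_prod (L2_L1 Lc) (L2_L1 Lc).
have := Ex_law (measurable_sample_pair mX _ _) (pair_law mX iX FX ij) (L1_measurable Lcc) Lcc.
by rewrite (Ex_prod (L2_L1 Lc) (L2_L1 Lc)) Ec mulr0.
Qed.

(** Stated in L1 for integrable g >= 0, since squares of eigenfunctions need not have second
    moments. The truncation at K has variance at most K^2, and the part cut off has small mean. *)
Lemma weak_lln (g : S -> R) : L1 F g -> (forall x, 0 <= g x) -> forall e, 0 < e ->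
  exists N, forall n, (N <= n)%N ->
    Ex P (fun w => `|n%:R^-1 * \sum_(i < n) g (X i w) - Ex F g|) <= e.
Proof.
move=> Lg g0 e e0; have mg := L1_measurable Lg.
pose gK (K : nat) x := Num.min (g x) K%:R.
have mgK K : measurable_fun setT (gK K) by exact: measurable_minr.
have gK0 K x : 0 <= gK K x by rewrite le_min g0 ler0n.
have gKK K x : gK K x <= K%:R by rewrite ge_min lexx orbT.
have gKg K x : gK K x <= g x by rewrite ge_min lexx.
have cK : Ex F (gK K) @[K --> \oo] --> Ex F g.
  apply: (Ex_dct (g := g)) => //; first by move=> K x; rewrite ger0_norm.
  apply: aeW => x; apply: cvg_near_cst.
  have [K _ HK] := nbhs_infty_ger (g x); exists K => // K' KK'.
  by rewrite /gK minEle (HK K').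
have e3 : 0 < e / 3 by rewrite divr_gt0.
have /cvgrPdist_le /(_ _ e3) [K _ /(_ K (leqnn _)) HK] := cK.
have LK : L1 F (gK K) by apply: L1_dom Lg => // x; rewrite ger0_norm.
pose m := Ex F (gK K); pose c x := gK K x - m.
have m0 : 0 <= m by exact: Ex_ge0.
have mK : m <= K%:R by rewrite -[leRHS](Ex_cst F); apply: le_Ex => //; exact: L1_cst.
have cb x : `|c x| <= K%:R.
  by have h1 := gK0 K x; have h2 := gKK K x; rewrite /c ler_norml; apply/andP; split; lra.
have Lc : L2 F c by apply: (L2_bnd _ (M := K%:R)) => //; exact: measurable_funB.
have Ec : Ex F c = 0 by rewrite ExB//; [rewrite Ex_cst subrr|exact: L1_cst].
have Ec2 : Ex F (fun x => c x ^+ 2) <= K%:R ^+ 2.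
  rewrite -[leRHS](Ex_cst F); apply: le_Ex; [by case: Lc|exact: L1_cst|move=> x].
  by rewrite -real_normK ?num_real// lerXn2r ?nnegrE.
have gm : 0 <= Ex F g - m <= e / 3.
  have h : m <= Ex F g by exact: le_Ex.
  by move: HK; rewrite -/m ler_norml => /andP[h1 h2]; apply/andP; split; lra.
(* From this size on K / sqrt n <= e / 3. *)
have [N _ HN] := nbhs_infty_ger ((K%:R * 3 / e) ^+ 2).
exists N.+1 => -[//|n] Nn.
have n0 : 0 < n.+1%:R :> R by rewrite ltr0n.
have Lgi i : L1 P (fun w => g (X i w)) by exact/(L1_law (mX _) (FX _)).
have LgKi i : L1 P (fun w => gK K (X i w)) by exact/(L1_law (mX _) (FX _)).
have LS := L2_iid_sum n.+1 Lc.
have LS' : L2 P (fun w => n.+1%:R^-1 * \sum_(i < n.+1) c (X i w)) by exact: L2Z.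
pose D w := n.+1%:R^-1 * \sum_(i < n.+1) (g (X i w) - gK K (X i w)).
have LD : L1 P D by apply: L1Z; apply: L1_sum => i _; exact: L1B.
have D0 w : 0 <= D w.
  by rewrite mulr_ge0 ?invr_ge0// sumr_ge0// => i _; rewrite subr_ge0.
have ED : Ex P D = Ex F g - m.
  rewrite ExZ; last by apply: L1_sum => i _; exact: L1B.
  rewrite Ex_sum; last by move=> i _; exact: L1B.
  rewrite (eq_bigr (fun=> Ex F g - m)); last first.
    by move=> i _; rewrite ExB// (Ex_law (mX i) (FX _) mg Lg) (Ex_law (mX i) (FX _) (mgK K) LK).
  rewrite sumr_const card_ord -[(_ - _) *+ _]mulr_natl mulrA mulVf ?mul1r// gt_eqF//.
have split_ w : n.+1%:R^-1 * (\sum_(i < n.+1) g (X i w)) - Ex F g =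
    n.+1%:R^-1 * (\sum_(i < n.+1) c (X i w)) + D w + (m - Ex F g).
  rewrite /D /c sumrB sumrB sumr_const card_ord -[m *+ _]mulr_natl.
  by field; rewrite gt_eqF.
apply: (@le_trans _ _ (Ex P (fun w => `|n.+1%:R^-1 * \sum_(i < n.+1) c (X i w)| + D w + (Ex F g - m)))).
  apply: le_Ex.
  - apply: L1_norm; apply: L1B; last exact: L1_cst.
    by apply: L1Z; apply: L1_sum => i _.
  - by apply: L1D; [apply: L1D => //; apply: L1_norm; exact: L2_L1|exact: L1_cst].
  - move=> w; rewrite split_; apply: le_trans (ler_normD _ _) _; apply: lerD.
      by apply: le_trans (ler_normD _ _) _; rewrite [`|D w|]ger0_norm.
    by rewrite distrC ger0_norm//; have /andP[] := gm.
rewrite ExD; [|by apply: L1D => //; apply: L1_norm; exact: L2_L1|exact: L1_cst].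
rewrite (ExD (L1_norm (L2_L1 LS')) LD).
rewrite ED Ex_cst.
have h : Ex P (fun w => `|n.+1%:R^-1 * \sum_(i < n.+1) c (X i w)|) <= e / 3.
  apply: Ex_norm_le_sqrt => //; first exact: ltW.
  rewrite (@eq_Ex _ _ _ P _ (fun w => (n.+1%:R^-1) ^+ 2 * (\sum_(i < n.+1) c (X i w)) ^+ 2)); last first.
    by move=> w; rewrite exprMn.
  rewrite ExZ; last by case: LS.
  rewrite Ex_sqr_iid_sum// mulrA.
  have -> : (n.+1%:R^-1) ^+ 2 * n.+1%:R = n.+1%:R^-1 :> R by rewrite expr2 -mulrA mulVf ?mulr1// gt_eqF.
  rewrite mulrC ler_pdivrMr//; apply: le_trans Ec2 _.
  have := HN n.+1 (ltnW Nn); rewrite /= => h.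
  have -> : K%:R ^+ 2 = (e / 3) ^+ 2 * (K%:R * 3 / e) ^+ 2 by field; rewrite gt_eqF.
  by rewrite ler_wpM2l// sqr_ge0.
by have /andP[_ ?] := gm; lra.
Qed.

End iid_sums.

(** * Bounded substitutes for squares *)

Section cosine_square.
Context {R : realType}.
Implicit Types (e x : R).

Lemma is_derive_cosM e x : is_derive x 1 (fun x => cos (e * x)) (- (e * sin (e * x))).
Proof.
have dl : is_derive x 1 (fun x : R => e * x) e.
  by have := is_deriveZ e (is_derive_id x (1 : R)); rewrite /GRing.scale /= mulr1.
have := @is_derive1_comp _ cos (fun x => e * x) x _ _ (is_derive_cos (e * x)) dl.
by move=> H; apply: is_derive_eq H _; ring.
Qed.

Lemma is_derive_sinM e x : is_derive x 1 (fun x => sin (e * x)) (e * cos (e * x)).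
Proof.
have dl : is_derive x 1 (fun x : R => e * x) e.
  by have := is_deriveZ e (is_derive_id x (1 : R)); rewrite /GRing.scale /= mulr1.
have := @is_derive1_comp _ sin (fun x => e * x) x _ _ (is_derive_sin (e * x)) dl.
by move=> H; apply: is_derive_eq H _; ring.
Qed.

Definition cossqr (e a x : R) : R := a * (2 / e ^+ 2 * (1 - cos (e * x)) - 1).

Lemma is_derive_cossqr e a x : e != 0 ->
  is_derive x 1 (cossqr e a) (a * (2 / e) * sin (e * x)).
Proof.
move=> e0.
rewrite (_ : cossqr e a = (fun x => a * (2 / e ^+ 2 - 1)) + (- (a * (2 / e ^+ 2))) *: (fun x => cos (e * x))).
  have := is_deriveD (is_derive_cst (a * (2 / e ^+ 2 - 1)) x (1 : R))
    (is_deriveZ (- (a * (2 / e ^+ 2))) (is_derive_cosM e x)).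
  by move=> H; apply: is_derive_eq H _; rewrite add0r /GRing.scale /=; field.
by apply/funext => y; rewrite /cossqr !fctE /GRing.scale /=; ring.
Qed.

Lemma is_derive_scaled_sinM e b x : is_derive x 1 (fun x => b * sin (e * x)) (b * e * cos (e * x)).
Proof. by have := is_deriveZ b (is_derive_sinM e x) => H; apply: is_derive_eq H _; rewrite /GRing.scale /= mulrA. Qed.

Lemma is_derive_scaled_cosM e b x :
  is_derive x 1 (fun x => b * cos (e * x)) (- (b * e) * sin (e * x)).
Proof.
by have := is_deriveZ b (is_derive_cosM e x) => H; apply: is_derive_eq H _; rewrite /GRing.scale /=; ring.
Qed.

Lemma cossqr_approx e a x : 0 < e -> `|cossqr e a x - a * (x ^+ 2 - 1)| <= `|a| * (2 * e * `|x| ^+ 3).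
Proof.
move=> e0; have en : e != 0 by rewrite gt_eqF.
have dc (y : R) : is_derive y 1 cos (- sin y) by exact: is_derive_cos.
have ds (y : R) : is_derive y 1 (fun y => - sin y) (- cos y).
  by have := is_deriveN (is_derive_sin y).
have lip (y z : R) : `|- cos y - - cos z| <= 1 * `|y - z|.
  rewrite -opprD normrN; apply: (derive_lipschitz dc) => t.
  by rewrite normrN ler_norml sin_geN1 sin_le1.
have := taylor2_cubic dc ds lip 0 (e * x).
rewrite add0r cos0 sin0 oppr0 mul0r subr0 mul1r => h.
have -> : cossqr e a x - a * (x ^+ 2 - 1) = a * (- (2 / e ^+ 2) * (cos (e * x) - 1 - - 1 * (e * x) ^+ 2 / 2)).
  by rewrite /cossqr; field.
have q0 : 0 <= 2 / e ^+ 2 by rewrite divr_ge0// sqr_ge0.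
rewrite normrM ler_wpM2l// normrM normrN (ger0_norm q0).
apply: le_trans (ler_wpM2l q0 h) _.
rewrite normrM exprMn (gtr0_norm e0) [leLHS](_ : _ = 2 * e * `|x| ^+ 3)//.
by field.
Qed.

(** If all |s l| <= K, the cosine error is of order e K^3. Otherwise the trivial bound 2 M is
    charged to the sum of the s l ^ 2, which then exceeds K^2, as in Chebyshev's inequality. *)
Lemma quadratic_replacement (f : R -> R) (M e K : R) (J : nat) (a s : nat -> R) :
  (forall x, `|f x| <= M) -> (forall x y, `|f x - f y| <= M * `|x - y|) -> 0 < e -> 0 < K ->
  `|f (\sum_(l < J) a l * (s l ^+ 2 - 1)) - f (\sum_(l < J) cossqr e (a l) (s l))| <=
  M * ((\sum_(l < J) `|a l|) * (2 * e * K ^+ 3)) + 2 * M / K ^+ 2 * \sum_(l < J) s l ^+ 2.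
Proof.
move=> fM fL e0 K0; have M0 : 0 <= M by exact: le_trans (normr_ge0 _) (fM 0).
have K2 : 0 < K ^+ 2 by rewrite exprn_gt0.
have s0 : 0 <= \sum_(l < J) s l ^+ 2 by apply: sumr_ge0 => l _; exact: sqr_ge0.
have t1 : 0 <= M * ((\sum_(l < J) `|a l|) * (2 * e * K ^+ 3)).
  rewrite mulr_ge0// mulr_ge0//; first exact: sumr_ge0.
  by rewrite mulr_ge0// ?mulr_ge0// ltW// exprn_gt0.
have t2 : 0 <= 2 * M / K ^+ 2 * \sum_(l < J) s l ^+ 2.
  by rewrite mulr_ge0// divr_ge0 ?mulr_ge0// ltW.
have [/forallP sK|] := boolP [forall l : 'I_J, `|s l| <= K].
  apply: (@le_trans _ _ (M * ((\sum_(l < J) `|a l|) * (2 * e * K ^+ 3)))); last by rewrite lerDl.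
  apply: le_trans (fL _ _) _; rewrite ler_wpM2l// -sumrB mulr_suml.
  apply: le_trans (ler_norm_sum _ _ _) _; apply: ler_sum => l _.
  rewrite distrC; apply: le_trans (cossqr_approx _ _ e0) _.
  rewrite ler_wpM2l// ler_wpM2l//; first by rewrite mulr_ge0// ltW.
  by rewrite lerXn2r ?nnegrE// ?ltW// sK.
rewrite negb_forall => /existsP[l]; rewrite -ltNge => Kl.
apply: (@le_trans _ _ (2 * M)).
  by apply: le_trans (ler_normB _ _) _; have := fM (\sum_(l < J) a l * (s l ^+ 2 - 1));
     have := fM (\sum_(l < J) cossqr e (a l) (s l)); lra.
apply: (@le_trans _ _ (2 * M / K ^+ 2 * \sum_(l < J) s l ^+ 2)); last by rewrite lerDr.
rewrite -mulrA ler_peMr ?mulr_ge0// ler_pdivlMl// mulr1 (bigD1 l)//=.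
apply: (@le_trans _ _ (s l ^+ 2)).
  by rewrite -[leRHS]real_normK ?num_real// lerXn2r ?nnegrE// ltW.
by rewrite lerDl; apply: sumr_ge0 => j _; exact: sqr_ge0.
Qed.

End cosine_square.

Lemma Ex_lipschitz_diff {d : measure_display} {T : measurableType d} {R : realType}
    (P : probability T R) (f : R -> R) (M : R) (U V : T -> R) :
  (forall x, `|f x| <= M) -> (forall x y, `|f x - f y| <= M * `|x - y|) ->
  measurable_fun setT U -> measurable_fun setT V -> L1 P (fun w => U w - V w) ->
  `|Ex P (fun w => f (U w)) - Ex P (fun w => f (V w))| <= M * Ex P (fun w => `|U w - V w|).
Proof.
move=> fM fL mU mV LUV.
have mf : measurable_fun setT f by apply: continuous_measurable_fun; exact: (lipschitz_continuous fL).
have LfU : L1 P (fun w => f (U w)) by apply: (L1_bnd _ (M := M)) => //; exact: (measurableT_comp mf).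
have LfV : L1 P (fun w => f (V w)) by apply: (L1_bnd _ (M := M)) => //; exact: (measurableT_comp mf).
rewrite -ExB//; apply: le_trans (normr_Ex (L1B LfU LfV)) _.
rewrite -ExZ; last exact: L1_norm.
by apply: le_Ex => //; [apply: L1_norm; exact: L1B|apply: L1Z; exact: L1_norm].
Qed.

(** * Limit law of finite quadratic forms *)

Section quadratic_clt.
Context {d dS d' : measure_display} {O : measurableType d} {S : measurableType dS}
  {O' : measurableType d'} {R : realType} (P : probability O R) (X : nat -> O -> S)
  (F : probability S R) (P' : probability O' R) (Z : nat -> {RV P' >-> R})
  (u : nat -> S -> R) (v : pred nat) (a : nat -> R) (J : nat).
Hypothesis mX : forall i, measurable_fun setT (X i).
Hypothesis iX : mutually_independent P X.
Hypothesis FX : forall e A, measurable A -> P (X e @^-1` A) = F A.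
Hypothesis iZ : mutually_independent P' (fun j w => Z j w).
Hypothesis nZ : forall j A, measurable A -> P' (Z j @^-1` A) = normal_prob 0 1 A.
Hypothesis L2u : forall l, L2 F (u l).
Hypothesis Eu : forall l, Ex F (u l) = 0.
Hypothesis covu : forall l m, Ex F (fun x => u l x * u m x) = if (l == m) && v l then 1 else 0.
Hypothesis av : forall l, ~~ v l -> a l = 0.

Definition nsum n l w : R := (Num.sqrt n%:R)^-1 * \sum_(i < n) u l (X i w).

Lemma L2_nsum n l : L2 P (nsum n l).
Proof. by apply: L2Z; exact: (L2_iid_sum mX FX n (L2u l)). Qed.

Lemma Ex_sqr_nsum_le n l : Ex P (fun w => nsum n l w ^+ 2) <= 1.
Proof.
rewrite (@eq_Ex _ _ _ P _ (fun w => ((Num.sqrt n%:R)^-1) ^+ 2 * (\sum_(i < n) u l (X i w)) ^+ 2)); last first.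
  by move=> w; rewrite exprMn.
rewrite ExZ; last by case: (L2_iid_sum mX FX n (L2u l)).
rewrite (Ex_sqr_iid_sum mX iX FX n (L2u l) (Eu l)) exprVn sqr_sqrtr// mulrA.
have u1 : 0 <= Ex F (fun x => u l x ^+ 2) <= 1.
  have -> : Ex F (fun x => u l x ^+ 2) = if (l == l) && v l then 1 else 0 by rewrite -covu.
  by case: ifP; rewrite ?ler01 ?lexx.
case: n => [|n]; first by rewrite mulr0 mul0r.
by rewrite mulVf ?mul1r ?pnatr_eq0//; have /andP[] := u1.
Qed.

Let mzv l : measurable_fun setT (fun w => (v l)%:R * Z l w).
Proof. by apply: measurable_funM => //; exact: measurable_funP. Qed.

(** Coordinates with [u l] of variance 0 get the limit 0, so that the covariances of [Zv] are those
    of [u]. *)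
Let Zv l : {RV P' >-> R} := mfun_Sub (mem_set (mzv l)).

Let ZvE l w : Zv l w = (v l)%:R * Z l w.
Proof. by []. Qed.

Let L2Zv l : L2 P' (Zv l).
Proof. by apply: (L2Z (f := Z l)); exact: L2_Z. Qed.

Let Ex_Zv2 l : Ex P' (fun w => Zv l w ^+ 2) <= 1.
Proof.
rewrite (@eq_Ex _ _ _ P' _ (fun w => (v l)%:R ^+ 2 * (Z l w * Z l w))); last first.
  by move=> w; rewrite ZvE; ring.
rewrite ExZ; last by apply: L2M; exact: L2_Z.
by rewrite (cov_Z iZ nZ) eqxx mulr1; case: (v l); rewrite ?expr1n ?expr0n.
Qed.

Let cos_clt (f : R -> R) (e : R) : smooth f -> 0 < e ->
  Ex P (fun w => f (\sum_(l < J) cossqr e (a l) (nsum n l w))) @[n --> \oo] -->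
  Ex P' (fun w => f (\sum_(l < J) cossqr e (a l) (Zv l w))).
Proof.
move=> sf e0; have en : e != 0 by rewrite gt_eqF.
(* [ridge_clt] asks for derivative bounds uniform over all l, so the coefficients beyond J are set
   to 0. *)
pose b l := if (l < J)%N then a l else 0.
pose A := \sum_(l < J) `|a l|.
have A0 : 0 <= A by exact: sumr_ge0.
have bA l : `|b l| <= A.
  rewrite /b; case: ifP => [lJ|_]; last by rewrite normr0.
  by rewrite /A (bigD1 (Ordinal lJ))//= lerDl; exact: sumr_ge0.
have bE l : (l < J)%N -> b l = a l by rewrite /b => ->.
pose th l := cossqr e (b l).
pose th1 l x := b l * (2 / e) * sin (e * x).
pose th2 l x := b l * (2 / e) * e * cos (e * x).
have dth l (x : R) : is_derive x 1 (th l) (th1 l x) by exact: is_derive_cossqr.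
have dth1 l (x : R) : is_derive x 1 (th1 l) (th2 l x) by exact: is_derive_scaled_sinM.
have dth2 l (x : R) : is_derive x 1 (th2 l) (- (b l * (2 / e) * e * e) * sin (e * x)).
  exact: is_derive_scaled_cosM.
have sin1 (x : R) : `|sin x| <= 1 by rewrite ler_norml sin_geN1 sin_le1.
have cos1 (x : R) : `|cos x| <= 1 by rewrite ler_norml cos_geN1 cos_le1.
have c0 : 0 <= 2 / e by rewrite divr_ge0// ltW.
have pm (y s c : R) : `|y| <= A -> `|s| <= 1 -> 0 <= c -> `|y| * c * `|s| <= A * c.
  move=> yA s1 cp; apply: (@le_trans _ _ (`|y| * c)); first by rewrite ler_piMr// mulr_ge0.
  by rewrite ler_wpM2r.
pose M := A * (2 / e) + A * 2 + A * (2 * e).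
have t1 : 0 <= A * (2 / e) by rewrite mulr_ge0.
have t2 : 0 <= A * 2 by rewrite mulr_ge0.
have t3 : 0 <= A * (2 * e) by rewrite mulr_ge0// mulr_ge0// ltW.
have th1M l x : `|th1 l x| <= M.
  apply: (@le_trans _ _ (A * (2 / e))); last by rewrite /M; lra.
  rewrite /th1 normrM normrM (ger0_norm c0).
  exact: pm.
have th2M l x : `|th2 l x| <= M.
  apply: (@le_trans _ _ (A * 2)); last by rewrite /M; lra.
  have -> : th2 l x = b l * 2 * cos (e * x) by rewrite /th2; field.
  rewrite normrM normrM (ger0_norm (ler0n _ 2)).
  exact: pm.
have th2L l x y : `|th2 l x - th2 l y| <= M * `|x - y|.
  apply: (derive_lipschitz (dth2 l)) => z; apply: (@le_trans _ _ (A * (2 * e))); last by rewrite /M; lra.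
  have -> : - (b l * (2 / e) * e * e) * sin (e * z) = - (b l * (2 * e) * sin (e * z)) by field.
  rewrite normrN normrM normrM (ger0_norm (mulr_ge0 (ler0n _ 2) (ltW e0))).
  by apply: pm => //; rewrite mulr_ge0// ltW.
have idX i j B : measurable B -> P (X i @^-1` B) = P (X j @^-1` B) by move=> mB; rewrite !FX.
have mu l : measurable_fun setT (u l) by case: (L2u l).
have meanZ l : Ex P' (Zv l) = 0.
  have := @ExZ _ _ _ P' (Z l) (v l)%:R (L2_L1 (L2_Z nZ l)).
  by rewrite (mean_Z nZ) mulr0.
have stab (s t : R) (theta : nat -> R -> R) (r : nat -> R) :
    0 <= s -> 0 <= t -> (forall l, continuous (theta l)) ->
    forall (g : R -> R) (M : R), continuous g -> (forall x, `|g x| <= M) ->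
    Ex (P' \x P')%E (fun z => g (\sum_(l < J) theta l (r l + s * Zv l z.1 + t * Zv l z.2))) =
    Ex P' (fun w => g (\sum_(l < J) theta l (r l + Num.sqrt (s ^+ 2 + t ^+ 2) * Zv l w))).
  move=> s0 t0 ct g N cg gN.
  pose theta' l x := theta l (r l + (v l)%:R * x).
  have ct' l : continuous (theta' l).
    move=> x; apply: continuous_comp; last exact: ct.
    by apply: cvgD; [exact: cvg_cst|apply: cvgM; [exact: cvg_cst|exact: cvg_id]].
  have := gaussian_stable iZ nZ (fun=> 0) s0 t0 ct' J cg gN.
  rewrite (@eq_Ex _ _ _ (P' \x P')%E _ (fun z => g (\sum_(l < J) theta l (r l + s * Zv l z.1 + t * Zv l z.2)))).
    move=> ->; apply: eq_Ex => w; congr g; apply: eq_bigr => l _; congr (theta l _).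
    by rewrite ZvE; ring.
  by move=> z; congr g; apply: eq_bigr => l _; congr (theta l _); rewrite !ZvE; ring.
have := @ridge_clt _ _ _ _ _ _ _ P P' X Zv u J mX iX idX (fun l _ => L2Zv l) (fun l _ => meanZ l) stab
  (fun l _ => mu l) _ _ _ f th th1 th2 M sf dth dth1 th1M th2M th2L.
have H1 l : (l < J)%N -> L2 P (fun w => u l (X 0%N w)).
  by move=> _; exact/(L2_law (mX _) (FX _)).
have H2 l : (l < J)%N -> Ex P (fun w => u l (X 0%N w)) = 0.
  by move=> _; rewrite (Ex_law (mX _) (FX _)) ?Eu//; exact: L2_L1.
have H3 l m : (l < J)%N -> (m < J)%N ->
    Ex P (fun w => u l (X 0%N w) * u m (X 0%N w)) = Ex P' (fun w => Zv l w * Zv m w).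
  move=> _ _; rewrite (Ex_law (f := fun x => u l x * u m x) (mX _) (FX _)); last 2 first.
  - exact: measurable_funM.
  - exact: L2M.
  rewrite covu (@eq_Ex _ _ _ P' _ (fun w => ((v l)%:R * (v m)%:R) * (Z l w * Z m w))); last first.
    by move=> w; rewrite !ZvE; ring.
  rewrite ExZ; last by apply: L2M; exact: L2_Z.
  rewrite (cov_Z iZ nZ); case: eqVneq => [->|_] /=; last by rewrite mulr0.
  by case: (v m); rewrite ?mulr1 ?mulr0.
move=> /(_ H1 H2 H3).
have E1 n : Ex P (fun w => f (\sum_(l < J) th l ((Num.sqrt n%:R)^-1 * \sum_(i < n) u l (X i w)))) =
    Ex P (fun w => f (\sum_(l < J) cossqr e (a l) (nsum n l w))).
  by apply: eq_Ex => w; congr f; apply: eq_bigr => l _; rewrite /th bE.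
under eq_fun do rewrite E1.
rewrite (@eq_Ex _ _ _ P' (fun w => f (\sum_(l < J) th l (Zv l w)))
  (fun w => f (\sum_(l < J) cossqr e (a l) (Zv l w))))//.
by move=> w; congr f; apply: eq_bigr => l _; rewrite /th bE.
Qed.

Theorem quadratic_clt (f : R -> R) : smooth f ->
  Ex P (fun w => f (\sum_(l < J) a l * (nsum n l w ^+ 2 - 1))) @[n --> \oo] -->
  Ex P' (fun w => f (\sum_(l < J) a l * (Z l w ^+ 2 - 1))).
Proof.
move=> sf; have [f1 [f2 [M [df df1 [fM f1M f2M f2L]]]]] := sf.
have fL := derive_lipschitz df f1M.
have cf := is_derive_continuous df.
have mf : measurable_fun setT f by apply: continuous_measurable_fun; exact: cf.
have M0 : 0 <= M by exact: le_trans (normr_ge0 _) (fM 0).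
have -> : Ex P' (fun w => f (\sum_(l < J) a l * (Z l w ^+ 2 - 1))) =
    Ex P' (fun w => f (\sum_(l < J) a l * (Zv l w ^+ 2 - 1))).
  apply: eq_Ex => w; congr f; apply: eq_bigr => l _; rewrite ZvE.
  by have [vl|/av ->] := boolP (v l); rewrite ?mul1r ?mul0r.
pose A := \sum_(l < J) `|a l|.
have A0 : 0 <= A by exact: sumr_ge0.
have MA0 : 0 <= M * A by rewrite mulr_ge0.
have approx (dT : measure_display) (T : measurableType dT) (Q : probability T R)
    (s : nat -> T -> R) (e K : R) : (forall l, L2 Q (s l)) ->
    (forall l, Ex Q (fun w => s l w ^+ 2) <= 1) -> 0 < e -> 0 < K ->
    `|Ex Q (fun w => f (\sum_(l < J) a l * (s l w ^+ 2 - 1))) -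
      Ex Q (fun w => f (\sum_(l < J) cossqr e (a l) (s l w)))| <=
    M * (A * (2 * e * K ^+ 3)) + 2 * M / K ^+ 2 * J%:R.
  move=> Ls Es e0 K0.
  have ms l : measurable_fun setT (s l) by case: (Ls l).
  have L1' : L1 Q (fun w => f (\sum_(l < J) a l * (s l w ^+ 2 - 1))).
    apply: (L1_bnd _ (M := M)) => //; apply: (measurableT_comp mf); apply: measurable_sum => l.
    by apply: measurable_funM => //; apply: measurable_funB => //; exact: measurable_funX.
  have L2' : L1 Q (fun w => f (\sum_(l < J) cossqr e (a l) (s l w))).
    apply: (L1_bnd _ (M := M)) => //; apply: (measurableT_comp mf); apply: measurable_sum => l.
    apply: (measurableT_comp (f := cossqr e (a l))) => //; apply: continuous_measurable_fun.
    by have := is_derive_continuous (fun x => is_derive_cossqr (a l) x (lt0r_neq0 e0)).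
  rewrite -ExB//; apply: le_trans (normr_Ex (L1B L1' L2')) _.
  have Ls2 : L1 Q (fun w => \sum_(l < J) s l w ^+ 2) by apply: L1_sum => l _; case: (Ls l).
  apply: (@le_trans _ _ (Ex Q (fun w => M * (A * (2 * e * K ^+ 3)) +
      2 * M / K ^+ 2 * \sum_(l < J) s l w ^+ 2))).
    apply: le_Ex.
    - by apply: L1_norm; exact: L1B.
    - by apply: L1D; [exact: L1_cst|exact: L1Z].
    - by move=> w; exact: (@quadratic_replacement _ f M e K J a (fun l => s l w) fM fL e0 K0).
  rewrite ExD; [|exact: L1_cst|exact: L1Z].
  rewrite Ex_cst ExZ// lerD2l ler_wpM2l//.
    by apply: divr_ge0; [rewrite mulr_ge0|rewrite exprn_ge0// ltW].
  rewrite Ex_sum; last by move=> l _; case: (Ls l).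
  apply: (@le_trans _ _ (\sum_(l < J) (1 : R))); first exact: ler_sum.
  by rewrite sumr_const card_ord.
apply/cvgrPdist_le => e e0.
(* The budget e splits into e / 3 for [cos_clt] and e / 3 for the replacement on each side. The
   latter is e / 6 for large arguments, which fixes K, and e / 6 for the cosine error, which then
   fixes [ep]. *)
pose K := 1 + 12 * (M * J%:R) / e.
have MJ0 : 0 <= M * J%:R by rewrite mulr_ge0.
have K1 : 1 <= K by rewrite lerDl divr_ge0 ?mulr_ge0// ltW.
have K0 : 0 < K by exact: lt_le_trans K1.
have KK : 2 * M / K ^+ 2 * J%:R <= e / 6.
  have -> : 2 * M / K ^+ 2 * J%:R = 2 * (M * J%:R) / K ^+ 2 by ring.
  rewrite ler_pdivrMr ?exprn_gt0//.
  apply: (@le_trans _ _ (e / 6 * K)); last first.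
    by rewrite ler_pM2l ?divr_gt0// expr2 ler_peMl// ltW.
  rewrite /K mulrDr mulr1; have -> : e / 6 * (12 * (M * J%:R) / e) = 2 * (M * J%:R) by field; rewrite gt_eqF.
  by rewrite lerDr divr_ge0// ltW.
pose ep := e / (12 * (M * A + 1) * K ^+ 3).
have K3 : 0 < K ^+ 3 by rewrite exprn_gt0.
have MA1 : 0 < M * A + 1 by rewrite ltr_wpDl.
have ep0 : 0 < ep by rewrite divr_gt0// mulr_gt0// mulr_gt0.
have EE : M * (A * (2 * ep * K ^+ 3)) <= e / 6.
  have -> : M * (A * (2 * ep * K ^+ 3)) = e / 6 * (M * A / (M * A + 1)).
    by rewrite /ep; field; rewrite !gt_eqF.
  have q1 : M * A / (M * A + 1) <= 1 by rewrite ler_pdivrMr// mul1r lerDl.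
  by rewrite -[leRHS]mulr1 ler_wpM2l// divr_ge0// ltW.
have e3 : 0 < e / 3 by rewrite divr_gt0.
have /cvgrPdist_le /(_ _ e3) [N _ HN] := cos_clt sf ep0.
exists N => // n /= Nn.
have h1 := approx _ _ P (nsum n) ep K (L2_nsum n) (Ex_sqr_nsum_le n) ep0 K0.
have h2 := approx _ _ P' (fun l w => Zv l w) ep K L2Zv Ex_Zv2 ep0 K0.
have h3 := HN n Nn.
move: h1 h2 h3; rewrite !ler_norml => /andP[a1 a2] /andP[a3 a4] /andP[a5 a6].
apply/andP; split; lra.
Qed.

End quadratic_clt.

(** * Projections of the kernel *)

Lemma sym_kernelB {R : realType} {p m0 m1 : nat} (r r' : m0.-tuple (p.-tuple R) -> m1.-tuple (p.-tuple R) -> R) :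
  sym_kernel r -> sym_kernel r' -> sym_kernel (fun x y => r x y - r' x y).
Proof.
move=> [mr r1 r2] [mr' r1' r2']; split.
- exact: measurable_funB.
- by move=> x x' y xx'; rewrite (r1 _ _ _ xx') (r1' _ _ _ xx').
- by move=> x y y' yy'; rewrite (r2 _ _ _ yy') (r2' _ _ _ yy').
Qed.

Section projections.
Context {R : realType} {p m0 m1 : nat} {d : measure_display} {O : measurableType d}
  (P : probability O R) (X : bool * nat -> O -> p.-tuple R) (F : probability (p.-tuple R) R).
Local Notation S := (p.-tuple R).
Local Notation FF := (F \x F)%E.
Hypothesis mX : forall i, measurable_fun setT (X i).
Hypothesis iX : mutually_independent P X.
Hypothesis FX : forall e A, measurable A -> P (X e @^-1` A) = F A.

Let idX i j A : measurable A -> P (X i @^-1` A) = P (X j @^-1` A).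
Proof. by move=> mA; rewrite !FX. Qed.

Local Notation base r := (fun w => r [tuple X (false, nat_of_ord i) w | i < m0]
  [tuple X (true, nat_of_ord j) w | j < m1]).

Lemma hprojf_sub (r r' : m0.-tuple S -> m1.-tuple S -> R) a b :
  sym_kernel r -> sym_kernel r' -> L2 P (base r) -> L2 P (base r') ->
  {ae P, forall w, hprojf P X (fun x y => r x y - r' x y) a b (X ^~ w) =
    hprojf P X r a b (X ^~ w) - hprojf P X r' a b (X ^~ w)}.
Proof.
move=> sr sr' Lr Lr'.
apply: filterS2 (L1_hfill_ae mX iX sr Lr a b) (L1_hfill_ae mX iX sr' Lr' a b) => w Lw Lw'.
by rewrite /hprojf !hprojE -ExB.
Qed.

Variable h : m0.-tuple S -> m1.-tuple S -> R.
Hypothesis sh : sym_kernel h.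
Hypothesis L2h : L2 P (base h).
Hypothesis Eh : Ex P (base h) = 0.

Definition proj01 (x : S) : R := hproj P X h 0 1 (fun=> x) (fun=> x).

Definition proj02 (x y : S) : R :=
  hproj P X h 0 2 (fun=> x) (fun j => if j == 0%N then x else y).

Let mh : measurable_fun setT (fun z : m0.-tuple S * m1.-tuple S => h z.1 z.2).
Proof. by case: sh. Qed.

Let hproj0 b x x' y y' : (forall j, (j < b)%N -> y j = y' j) ->
  hproj P X h 0 b x y = hproj P X h 0 b x' y'.
Proof.
move=> yy'; rewrite !hprojE; apply: eq_Ex => w; congr h; apply: eq_mktuple => i.
by case: ltnP => // ib; exact: yy'.
Qed.

Lemma hprojf01 z : hprojf P X h 0 1 z = proj01 (z (true, 0%N)).
Proof. by apply: hproj0 => -[|j]. Qed.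

Lemma hprojf02 z : hprojf P X h 0 2 z = proj02 (z (true, 0%N)) (z (true, 1%N)).
Proof. by apply: hproj0 => -[|[|j]]. Qed.

Lemma hprojf00 z : hprojf P X h 0 0 z = 0.
Proof.
by rewrite /hprojf hprojE -[RHS]Eh; apply: eq_Ex => w; congr h; apply: eq_mktuple => i; rewrite ltn0.
Qed.

Lemma measurable_proj01 : measurable_fun setT proj01.
Proof.
have := measurable_Ex_slice P (measurable_hfill mX sh 0 1 (Y := fun _ (x : S) => x) (fun=> @measurable_id _ _ _)).
by rewrite (_ : (fun x => _) = proj01)//; apply/funext => x; rewrite /proj01 hprojE.
Qed.

Lemma measurable_proj02 : measurable_fun setT (fun z : S * S => proj02 z.1 z.2).
Proof.
pose Y (e : bool * nat) (z : S * S) := if e.2 == 0%N then z.1 else z.2.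
have mY e : measurable_fun setT (Y e) by rewrite /Y; case: (e.2 == 0%N); [exact: measurable_fst|exact: measurable_snd].
have := measurable_Ex_slice P (measurable_hfill mX sh 0 2 mY).
rewrite (_ : (fun z => _) = fun z : S * S => proj02 z.1 z.2)//; apply/funext => z.
transitivity (hproj P X h 0 2 (fun i => Y (false, i) z) (fun j => Y (true, j) z)).
  by rewrite hprojE.
exact: hproj0.
Qed.

Lemma L2_proj01 : L2 F proj01.
Proof.
apply/(L2_law (mX (true, 0%N)) (FX _) measurable_proj01).
by apply: eq_L2 (L2_hprojf mX iX sh L2h 0 1) => w; rewrite hprojf01.
Qed.

Lemma Ex_proj01 : Ex F proj01 = 0.
Proof.
rewrite -(Ex_law (mX (true, 0%N)) (FX _) measurable_proj01 (L2_L1 L2_proj01)).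
by rewrite -[RHS]Eh -(Ex_hprojf mX iX sh L2h 0 1); apply: eq_Ex => w; rewrite hprojf01.
Qed.

Lemma L2_proj02 : L2 FF (fun z => proj02 z.1 z.2).
Proof.
have ne : (true, 0%N) != (true, 1%N) by [].
apply/(L2_law (measurable_sample_pair mX _ _) (pair_law mX iX FX ne) measurable_proj02).
by apply: eq_L2 (L2_hprojf mX iX sh L2h 0 2) => w; rewrite hprojf02.
Qed.

(** For m1 > 1 both arguments occupy positions of the tuple, and the transposition of the first two
    positions exchanges them. For m1 = 1 the second argument would be lost. *)
Lemma proj02_sym x y : (1 < m1)%N -> proj02 x y = proj02 y x.
Proof.
case: sh => _ _ h2 m1_gt1; rewrite /proj02 !hprojE; apply: eq_Ex => w; rewrite /hfill.
have -> : [tuple if (i < 0)%N then x else X (false, nat_of_ord i) w | i < m0] =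
    [tuple if (i < 0)%N then y else X (false, nat_of_ord i) w | i < m0].
  by apply: eq_mktuple => i; rewrite ltn0.
apply: h2.
pose t := [tuple if (j < 2)%N then (if nat_of_ord j == 0%N then x else y) else
  X (true, nat_of_ord j) w | j < m1].
pose i0 := Ordinal (ltnW m1_gt1 : (0 < m1)%N); pose i1 := Ordinal m1_gt1.
apply/tuple_permP; exists (tperm i0 i1); congr (tval _); apply: eq_from_tnth => j.
rewrite !tnth_mktuple; case: tpermP => [->|->|j0 j1] //=.
have : (1 < j)%N.
  case: j j0 j1 => [[|[|j]] jm] //= j0 j1.
    by case: j0; exact: val_inj.
  by case: j1; exact: val_inj.
by move=> j2; rewrite ltnNge j2.
Qed.

(** Tower property: in the mean defining h_{0,1}, all coordinates except the second case are
    resampled, and the inner mean is h_{0,2}. *)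
Lemma Ex_proj02_ae : {ae F, forall x, Ex F (proj02 x) = proj01 x}.
Proof.
have mk1 x : measurable_fun setT (proj02 x) by exact: (measurable_slice1 x measurable_proj02).
have mE : measurable_fun setT (fun x => Ex F (proj02 x)) by exact: (measurable_Ex_slice F measurable_proj02).
suff : {ae F, forall x, Ex F (proj02 x) - proj01 x = 0}.
  by apply: filterS => x /eqP; rewrite subr_eq0 => /eqP.
apply: (ae_law_inv (mX (true, 0%N)) (FX _)).
  by apply: measurable_funB => //; exact: measurable_proj01.
have sl := ae_law (mX (true, 0%N)) (FX _) (L1_slice_ae (L2_L1 L2_proj02)).
apply: filterS2 (L1_hfill_ae mX iX sh L2h 0 1) sl => w Lw Lk; apply/eqP; rewrite subr_eq0; apply/eqP.
rewrite -(Ex_law (mX (true, 1%N)) (FX _) (mk1 _) Lk).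
rewrite /proj01 hprojE.
pose y := X (true, 0%N) w.
pose Phi (z : bool * nat -> S) := h [tuple z (false, nat_of_ord i) | i < m0]
  [tuple if (j < 1)%N then y else z (true, nat_of_ord j) | j < m1].
pose L : seq (bool * nat) := [seq (e, i) | e <- [:: false; true], i <- iota 0 (m0 + m1)].
have inL e i : (i < m0 + m1)%N -> (e, i) \in L.
  by move=> im; apply/allpairsP; exists (e, i); split; [case: e|rewrite mem_iota|].
have finPhi : finitary L Phi.
  split => [z z' zz'|d' T Y mY].
    congr h; apply: eq_mktuple => i.
      by apply: zz'; apply: inL; rewrite ltn_addr.
    by case: ifP => // _; apply: zz'; apply: inL; rewrite ltn_addl.
  apply: (measurable_kernel_eval mh (Y0 := fun i t => Y (false, nat_of_ord i) t)
    (Y1 := fun j t => if (j < 1)%N then y else Y (true, nat_of_ord j) t)) => // j.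
  by case: (j < 1)%N.
have E z : hfill X h 0 1 (fun=> y) (fun=> y) z = Phi (X ^~ z).
  by [].
have LPhi : L1 P (fun w' => Phi (X ^~ w')).
  apply: eq_L1 Lw => w'; rewrite -E; congr h; apply: eq_mktuple => i.
  by case: i => [[|i] im].
rewrite [RHS](eq_Ex P E) (Ex_resample mX iX (fun e => e != (true, 1%N)) finPhi LPhi).
apply: eq_Ex => w'; rewrite /proj02 hprojE; apply: eq_Ex => w''.
congr h; apply: eq_mktuple => i.
case: i => [[|[|i]] im] //=.
Qed.

Lemma xiE a b : xi P X h a b = (Ex P (fun w => hprojf P X h a b (X ^~ w) ^+ 2))%:E.
Proof.
have Lab := L2_hprojf mX iX sh L2h a b.
rewrite /xi /variance unlock [in X in X = _]unlock.
have -> : fine (\int[P]_w (hproj P X h a b (fun i => X (false, i) w) (fun j => X (true, j) w))%:E)%E = 0.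
  exact: (etrans (Ex_hprojf mX iX sh L2h a b) Eh).
rewrite -L1_int; last by case: Lab.
by apply: eq_integral => w _; rewrite !fctE /= subr0 -expr2.
Qed.

Lemma xi0_ae a b : xi P X h a b = 0%E -> {ae P, forall w, hprojf P X h a b (X ^~ w) = 0}.
Proof.
by rewrite xiE => -[E]; exact: (Ex_sqr0_ae (L2_hprojf mX iX sh L2h a b) E).
Qed.

Lemma xi01E : xi P X h 0 1 = (Ex F (fun x => proj01 x ^+ 2))%:E.
Proof.
rewrite xiE -(Ex_law (mX (true, 0%N)) (FX _) _ L2_proj01.2).
  by congr EFin; apply: eq_Ex => w; rewrite hprojf01.
by apply: measurable_funX; exact: measurable_proj01.
Qed.

(** Subtracting the linear part kills the overlaps (0, 0) and (0, 1). Any other overlap contains one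
    control, of order 1 / n0, or two cases, of order 1 / n1^2. *)
Lemma residual1_variance n0 n1 : (0 < m1)%N ->
  Ex P (fun w => Ustat X (fun x y => h x y - sumker proj01 y) n0 n1 w ^+ 2) <=
  Ex P (fun w => (base h w - sumker proj01 [tuple X (true, nat_of_ord j) w | j < m1]) ^+ 2) *
  (m0%:R * (m0%:R / n0%:R) + 'C(m1, 2)%:R * (m1%:R / n1%:R) ^+ 2).
Proof.
move=> m1_gt0.
have ss := sym_kernel_sumker (m0 := m0) (m1 := m1) measurable_proj01.
have Ls := L2_sumker (m1 := m1) mX FX L2_proj01.
have := ustat_variance mX iX idX (sym_kernelB sh ss) (L2B L2h Ls) (L := [:: (1%N, 0%N); (0%N, 2)]) n0 n1.
rewrite big_cons big_seq1 /= !bin0 !expr0 !expr1 !bin1 !mulr1 !mul1r; apply.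
move=> a b _ _ /=; rewrite orbF negb_or !negb_and -!ltnNge /= orbF ltnS leqn0 => /andP[/eqP -> b2].
apply: filterS (hprojf_sub 0 b sh ss L2h Ls) => w ->.
rewrite (hprojf_sumker mX FX _ _ _ L2_proj01 Ex_proj01).
case: b b2 => [|[|b]] // _.
  by rewrite hprojf00 big1 ?subrr// => j; rewrite ltn0.
rewrite hprojf01 (big_pred1 (Ordinal m1_gt0)); first by rewrite subrr.
by case=> [[|j] jm].
Qed.

Lemma pairker_proj02_degenerate a b : (1 < m1)%N -> (b <= 2)%N ->
  {ae F, forall x, Ex F (proj02 x) = 0} ->
  {ae P, forall w, hprojf P X (fun (_ : m0.-tuple S) (y : m1.-tuple S) => pairker proj02 y) a b (X ^~ w) =
    if b == 2 then proj02 (X (true, 0%N) w) (X (true, 1%N) w) else 0}.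
Proof.
move=> m1_gt1 b2 deg.
apply: filterS (hprojf_pairker (m0 := m0) (m1 := m1) mX iX FX L2_proj02 (fun x y => proj02_sym x y m1_gt1) deg a b) => w ->.
case: b b2 => [|[|[|b]]] //= _.
- by rewrite big1 ?mulr0// => j; rewrite ltn0.
- rewrite big1 ?mulr0// => i; rewrite ltnS leqn0 => /eqP i0.
  rewrite big1// => j /andP[ji]; rewrite ltnS leqn0 => /eqP j0.
  by move: ji; rewrite -val_eqE /= i0 j0.
pose i0 := Ordinal (ltnW m1_gt1 : (0 < m1)%N); pose i1 := Ordinal m1_gt1.
have key (i j l : 'I_m1) : i != j -> (i < 2)%N -> (j < 2)%N -> (l != i) && (l < 2)%N = (l == j).
  by case: i => [[|[|?]] ?]; case: j => [[|[|?]] ?]; case: l => [[|[|?]] ?].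
have single (i j : 'I_m1) : i != j -> (j < 2)%N ->
    (i < 2)%N -> \sum_(l < m1 | (l != i) && (l < 2)%N)
      proj02 (X (true, nat_of_ord i) w) (X (true, nat_of_ord l) w) =
    proj02 (X (true, nat_of_ord i) w) (X (true, nat_of_ord j) w).
  by move=> ij j2 i2; rewrite (big_pred1 j)// => l; exact: key.
rewrite (bigD1 i0)// (single i0 i1)// (bigD1 i1)// (single i1 i0)// big1 ?addr0 /=.
  rewrite [proj02 (X (true, 1%N) w) _]proj02_sym//.
  by field.
move=> i; rewrite -!val_eqE /= => /andP[/andP[i2 n0] n1].
by move: i2 n0 n1; case: (nat_of_ord i) => [|[|?]].
Qed.

(** [L] is left open because conditions (a) and (b) call for different lists: the overlap (1, 0)
    vanishes under (a) but must be counted under (b). *)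
Lemma residual2_variance (L : seq (nat * nat)) n0 n1 : (1 < m1)%N ->
  xi P X h 0 1 = 0%E ->
  (forall a b, ~~ has (fun q => (q.1 <= a)%N && (q.2 <= b)%N) L ->
     (a = 0%N /\ (b <= 2)%N) \/ [/\ a = 1%N, b = 0%N & xi P X h 1 0 = 0%E]) ->
  Ex P (fun w => Ustat X (fun x y => h x y - pairker proj02 y) n0 n1 w ^+ 2) <=
  Ex P (fun w => (base h w - pairker proj02 [tuple X (true, nat_of_ord j) w | j < m1]) ^+ 2) *
    \sum_(q <- L) ('C(m0, q.1)%:R * (m0%:R / n0%:R) ^+ q.1) *
                  ('C(m1, q.2)%:R * (m1%:R / n1%:R) ^+ q.2).
Proof.
move=> m1_gt1 xi01 good.
have p0 : {ae F, forall x, proj01 x = 0}.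
  apply: (ae_law_inv (mX (true, 0%N)) (FX _) measurable_proj01).
  by apply: filterS (xi0_ae xi01) => w; rewrite hprojf01.
have deg : {ae F, forall x, Ex F (proj02 x) = 0}.
  by apply: filterS2 Ex_proj02_ae p0 => x -> ->.
have sk x y := proj02_sym x y m1_gt1.
have ss := sym_kernel_pairker (m0 := m0) (m1 := m1) L2_proj02.
have Ls := L2_pairker (m1 := m1) mX iX FX L2_proj02.
apply: (ustat_variance mX iX idX (sym_kernelB sh ss) (L2B L2h Ls)) => a b _ _ nL.
have [[-> b2]|[-> -> xi10]] := good a b nL.
  apply: filterS3 (hprojf_sub 0 b sh ss L2h Ls) (pairker_proj02_degenerate 0 m1_gt1 b2 deg) (xi0_ae xi01).
  move=> w -> ->; case: b b2 {nL} => [|[|[|b]]] //= _.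
  - by rewrite hprojf00 subrr.
  - by move=> ->; rewrite subrr.
  - by rewrite hprojf02 subrr.
apply: filterS3 (hprojf_sub 1 0 sh ss L2h Ls) (pairker_proj02_degenerate 1 m1_gt1 (leq0n 2) deg) (xi0_ae xi10).
by move=> w -> -> ->; rewrite subrr.
Qed.

End projections.

(** * Limits *)

Section rates.
Context {R : realType} (n0 n1 : nat -> nat).
Hypothesis n1_oo : ((n1 k)%:R : R) @[k --> \oo] --> +oo.
Hypothesis ratio0 : (n1 k)%:R / (n0 k + n1 k)%:R @[k --> \oo] --> (0 : R).

Lemma n1_large (c : R) : \forall k \near \oo, c <= (n1 k)%:R.
Proof. by move/cvgryPge : n1_oo => /(_ c). Qed.

Lemma n1_dominated (e : R) : 0 < e -> \forall k \near \oo, (n1 k)%:R <= e * (n0 k)%:R.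
Proof.
move=> e0; have e1 : 0 < 1 + e by rewrite addr_gt0.
(* n1 <= e / (1 + e) (n0 + n1) amounts to n1 <= e n0. *)
have e' : 0 < e / (1 + e) by rewrite divr_gt0.
move/cvgrPdist_le : ratio0 => /(_ _ e') H.
apply: filterS2 H (n1_large 1) => k; rewrite sub0r normrN => h n1_ge1.
have n_gt0 : 0 < (n0 k + n1 k)%:R :> R by rewrite natrD ltr_wpDl//; lra.
move: h; rewrite ger0_norm ?divr_ge0// ler_pdivrMr// mulrAC ler_pdivlMr// natrD.
by move=> h; lra.
Qed.

Lemma n0_large (c : R) : \forall k \near \oo, c <= (n0 k)%:R.
Proof.
by apply: filterS2 (n1_dominated ltr01) (n1_large c) => k; rewrite mul1r => h1 h2; exact: le_trans h2 h1.
Qed.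

Lemma sizes_large (a b : nat) : \forall k \near \oo, (a <= n0 k)%N /\ (b <= n1 k)%N.
Proof.
by apply: filterS2 (n0_large a%:R) (n1_large b%:R) => k; rewrite !ler_nat.
Qed.

Lemma cvg_subsample (G : nat -> R) (l : R) : G n @[n --> \oo] --> l -> G (n1 k) @[k --> \oo] --> l.
Proof.
move/cvgrPdist_le => H; apply/cvgrPdist_le => e e0; have [N _ HN] := H e e0.
by apply: filterS (sizes_large 0 N) => k [_ h]; exact: HN.
Qed.

End rates.

Lemma small_multiple {R : realType} (D e : R) : 0 <= D -> 0 < e ->
  exists2 del, 0 < del & D * del <= e.
Proof.
move=> D0 e0; have D1 : 0 < D + 1 by rewrite ltr_wpDl.
exists (e / (D + 1)); first by rewrite divr_gt0.
by rewrite mulrCA ger_pMr// ler_pdivrMr// mul1r lerDl.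
Qed.

(** Slutsky's lemma for errors that vanish in L1, tested on bounded Lipschitz functions. *)
Lemma cvg_perturbation {d : measure_display} {T : measurableType d} {R : realType}
    (P : probability T R) (f : R -> R) (M l : R) (Y B : nat -> T -> R) :
  (forall x, `|f x| <= M) -> (forall x y, `|f x - f y| <= M * `|x - y|) ->
  (forall k, measurable_fun setT (Y k)) -> (forall k, measurable_fun setT (B k)) ->
  (forall e, 0 < e -> \forall k \near \oo, exists D : T -> R,
     [/\ (forall w, Y k w - B k w = D w), L1 P D & Ex P (fun w => `|D w|) <= e]) ->
  Ex P (fun w => f (B k w)) @[k --> \oo] --> l ->
  Ex P (fun w => f (Y k w)) @[k --> \oo] --> l.
Proof.
move=> fM fL mY mB small /cvgrPdist_le H; apply/cvgrPdist_le => e e0.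
have M0 : 0 <= M by exact: le_trans (normr_ge0 _) (fM 0).
have e2 : 0 < e / 2 by rewrite divr_gt0.
have [del del0 Mdel] := small_multiple M0 e2.
apply: filterS2 (small _ del0) (H _ e2) => k [D [DE LD ED]] h.
have Lk : L1 P (fun w => Y k w - B k w) by apply: eq_L1 LD => w; rewrite DE.
have := Ex_lipschitz_diff fM fL (mY k) (mB k) Lk.
rewrite (@eq_Ex _ _ _ P (fun w => `|Y k w - B k w|) (fun w => `|D w|)); last by move=> w; rewrite DE.
move=> h'; have h2 := le_trans h' (le_trans (ler_wpM2l M0 ED) Mdel).
move: h h2; rewrite !ler_norml => /andP[a1 a2] /andP[a3 a4].
by apply/andP; split; lra.
Qed.

Section limits.
Context {R : realType} {p m0 m1 : nat} {d : measure_display} {O : measurableType d}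
  (P : probability O R) (X : bool * nat -> O -> p.-tuple R) (F : probability (p.-tuple R) R).
Local Notation S := (p.-tuple R).
Local Notation FF := (F \x F)%E.
Hypothesis mX : forall i, measurable_fun setT (X i).
Hypothesis iX : mutually_independent P X.
Hypothesis FX : forall e A, measurable A -> P (X e @^-1` A) = F A.
Local Notation base r := (fun w => r [tuple X (false, nat_of_ord i) w | i < m0]
  [tuple X (true, nat_of_ord j) w | j < m1]).
Variable h : m0.-tuple S -> m1.-tuple S -> R.
Hypothesis sh : sym_kernel h.
Hypothesis L2h : L2 P (base h).
Hypothesis Eh : Ex P (base h) = 0.
Variables n0 n1 : nat -> nat.
Hypothesis n1_oo : ((n1 k)%:R : R) @[k --> \oo] --> +oo.
Hypothesis ratio0 : (n1 k)%:R / (n0 k + n1 k)%:R @[k --> \oo] --> (0 : R).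
Local Notation p1 := (proj01 P X h).
Local Notation p2 := (proj02 P X h).

Let idX i j A : measurable A -> P (X i @^-1` A) = P (X j @^-1` A).
Proof. by move=> mA; rewrite !FX. Qed.

Let XC j := X (true, j).

Let iXC : mutually_independent P XC.
Proof. exact: independent_cases. Qed.

Let mXC j : measurable_fun setT (XC j).
Proof. exact: mX. Qed.

Let FXC j A : measurable A -> P (XC j @^-1` A) = F A.
Proof. exact: FX. Qed.

(** The case J = 1 of [ridge_clt] with the linear map m1 x: its derivatives are bounded although it
    is not. The limit coordinate is a standard normal scaled by the standard deviation. *)
Lemma linear_clt (f : R -> R) : smooth f ->
  Ex P (fun w => f (m1%:R * nsum XC (fun=> p1) n 0 w)) @[n --> \oo] -->
  Ex (normalR 0 1) (fun x => f (m1%:R * (Num.sqrt (Ex F (fun x => p1 x ^+ 2)) * x))).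
Proof.
move=> sf; set s2 := Ex F _; pose s := Num.sqrt s2.
have s20 : 0 <= s2 by apply: Ex_ge0 => x; exact: sqr_ge0.
have ss : s ^+ 2 = s2 by rewrite sqr_sqrtr.
pose P' := normalR (0 : R) 1.
have mN : measurable_fun setT (fun x : R => x) by [].
pose N (_ : nat) : {RV P' >-> R} := mfun_Sub (mem_set mN).
have NE j x : N j x = x by [].
have nN j A : measurable A -> P' (N j @^-1` A) = normal_prob 0 1 A by move=> mA; rewrite -normalRE.
have mZ : measurable_fun setT (fun x : R => s * x) by exact: measurable_funM.
pose Z (_ : nat) : {RV P' >-> R} := mfun_Sub (mem_set mZ).
have ZE j x : Z j x = s * x by [].
have L2N : L2 P' (fun x => x) by exact: L2_normal.
have L2Z_ j : L2 P' (Z j) by exact: (L2Z s L2N).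
have EZ j : Ex P' (Z j) = 0 by rewrite (ExZ s (L2_L1 L2N)) normal_mean mulr0.
have stab (a b : R) (theta : nat -> R -> R) (r : nat -> R) :
    0 <= a -> 0 <= b -> (forall l, continuous (theta l)) ->
    forall (g : R -> R) (M : R), continuous g -> (forall x, `|g x| <= M) ->
    Ex (P' \x P')%E (fun z => g (\sum_(l < 1) theta l (r l + a * Z l z.1 + b * Z l z.2))) =
    Ex P' (fun w => g (\sum_(l < 1) theta l (r l + Num.sqrt (a ^+ 2 + b ^+ 2) * Z l w))).
  move=> a0 b0 ct g K cg gK.
  pose g' y := g (theta 0%N (r 0%N + s * y)).
  have cg' : continuous g'.
    move=> x; apply: continuous_comp; last exact: cg.
    apply: continuous_comp; last exact: ct.
    by apply: cvgD; [exact: cvg_cst|apply: cvgM; [exact: cvg_cst|exact: cvg_id]].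
  have := normal_pair_stable nN 0 a0 b0 cg' (fun x => gK _).
  rewrite (@eq_Ex _ _ _ (P' \x P')%E _
    (fun z => g (\sum_(l < 1) theta l (r l + a * Z l z.1 + b * Z l z.2)))).
    by move=> ->; apply: eq_Ex => w; rewrite /g' big_ord1 ZE NE; congr (g (theta _ _)); ring.
  by move=> z; rewrite /g' big_ord1 !ZE !NE; congr (g (theta _ _)); ring.
have mp1 := measurable_proj01 P mX sh.
have L2p1 := L2_proj01 mX iX FX sh L2h.
pose th (_ : nat) (x : R) := m1%:R * x.
have dth l (x : R) : is_derive x 1 (th l) (m1%:R : R).
  by have := is_deriveZ (m1%:R : R) (is_derive_id x (1 : R)); rewrite /GRing.scale /= mulr1.
have dth1 (l : nat) (x : R) : is_derive x 1 (fun _ : R => m1%:R : R) 0 by exact: is_derive_cst.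
have b1 (l : nat) (x : R) : `|m1%:R : R| <= m1%:R by rewrite ger0_norm.
have b2 (l : nat) (x : R) : `|0 : R| <= m1%:R by rewrite normr0.
have b3 (l : nat) (x y : R) : `|0 - 0 : R| <= m1%:R * `|x - y| by rewrite subrr normr0 mulr_ge0.
have H1 (l : nat) : (l < 1)%N -> L2 P (fun w => p1 (XC 0 w)).
  by move=> _; exact/(L2_law (mX _) (FX _)).
have H2 (l : nat) : (l < 1)%N -> Ex P (fun w => p1 (XC 0 w)) = 0.
  move=> _; rewrite (Ex_law (mX _) (FX _) mp1 (L2_L1 L2p1)).
  exact: Ex_proj01.
have H3 (l m : nat) : (l < 1)%N -> (m < 1)%N ->
    Ex P (fun w => p1 (XC 0 w) * p1 (XC 0 w)) = Ex P' (fun w => Z l w * Z m w).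
  move=> _ _; rewrite (Ex_law (f := fun x => p1 x * p1 x) (mX _) (FX _)); last 2 first.
  - exact: measurable_funM.
  - exact: L2M.
  rewrite (@eq_Ex _ _ _ P' _ (fun x => s ^+ 2 * x ^+ 2)); last by move=> x; rewrite !ZE; ring.
  rewrite ExZ; last by case: L2N.
  by rewrite normal_variance mulr1 ss.
have := @ridge_clt _ _ _ _ _ _ _ P P' XC Z (fun=> p1) 1 (fun i => mX _) iXC (fun i j => idX (true, i) (true, j))
  (fun l _ => L2Z_ l) (fun l _ => EZ l) stab (fun l _ => mp1) H1 H2 H3 f th (fun=> fun=> m1%:R) (fun=> fun=> 0)
  m1%:R sf dth dth1 b1 b2 b3.
have E1 n : Ex P (fun w => f (\sum_(l < 1) th l ((Num.sqrt n%:R)^-1 * \sum_(i < n) p1 (XC i w)))) =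
    Ex P (fun w => f (m1%:R * nsum XC (fun=> p1) n 0 w)).
  by apply: eq_Ex => w; rewrite big_ord1.
under eq_fun do rewrite E1.
rewrite (@eq_Ex _ _ _ P' (fun w => f (\sum_(l < 1) th l (Z l w))) (fun x => f (m1%:R * (s * x))))//.
by move=> w; rewrite big_ord1.
Qed.

Let measurable_Ustat (c : R) a b : measurable_fun setT (fun w => c * Ustat X h a b w).
Proof. by apply: measurable_funM => //; case: (L2_Ustat mX iX idX sh L2h a b). Qed.

Lemma part1_limit (f : R -> R) : (0 < m1)%N -> smooth f ->
  Ex P (fun w => f (Num.sqrt (n1 k)%:R * Ustat X h (n0 k) (n1 k) w)) @[k --> \oo] -->
  Ex (normalR 0 1) (fun x => f (m1%:R * (Num.sqrt (Ex F (fun x => p1 x ^+ 2)) * x))).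
Proof.
move=> m1_gt0 sf; have [f1 [f2 [M [df df1 [fM f1M f2M f2L]]]]] := sf.
have fL := derive_lipschitz df f1M.
have mp1 := measurable_proj01 P mX sh.
have L2p1 := L2_proj01 mX iX FX sh L2h.
pose r x y := h x y - sumker p1 y.
have sr : sym_kernel r by apply: sym_kernelB => //; exact: sym_kernel_sumker.
have Lr : L2 P (base r) by apply: L2B => //; exact: (L2_sumker mX FX L2p1).
apply: (cvg_perturbation (M := M) (B := fun k w => m1%:R * nsum XC (fun=> p1) (n1 k) 0 w)) => //.
- by move=> k; apply: measurable_funM => //; case: (L2_nsum mXC FXC (fun=> L2p1) (n1 k) 0).
- move=> e e0.
  set V := Ex P (fun w => base r w ^+ 2).
  have V0 : 0 <= V by apply: Ex_ge0 => w; exact: sqr_ge0.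
  have D0 : 0 <= V * (m0%:R * m0%:R + 'C(m1, 2)%:R * (m1%:R * m1%:R)).
    by rewrite mulr_ge0// addr_ge0// mulr_ge0// mulr_ge0.
  have e2 : 0 < e ^+ 2 by rewrite exprn_gt0.
  have [del del0 Ddel] := small_multiple D0 e2.
  have szl := sizes_large n1_oo ratio0 (maxn m0 1) m1.
  apply: filterS3 (n1_dominated n1_oo ratio0 del0) (n1_large n1_oo del^-1) szl => k dom large [].
  rewrite geq_max => /andP[m0n0 n0_gt0] m1n1.
  have n1_gt0 : 0 < (n1 k)%:R :> R by rewrite ltr0n; exact: leq_trans m1n1.
  have n0p : 0 < (n0 k)%:R :> R by rewrite ltr0n.
  have LU := L2_Ustat mX iX idX sr Lr (n0 k) (n1 k).
  have s0 : Num.sqrt (n1 k)%:R != 0 :> R by rewrite gt_eqF// sqrtr_gt0.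
  have ss : Num.sqrt (n1 k)%:R ^+ 2 = (n1 k)%:R :> R by rewrite sqr_sqrtr.
  exists (fun w => Num.sqrt (n1 k)%:R * Ustat X r (n0 k) (n1 k) w); split.
  + move=> w.
    have -> : Ustat X h (n0 k) (n1 k) w = Ustat X r (n0 k) (n1 k) w + Ustat X (fun (_ : m0.-tuple S) (y : m1.-tuple S) => sumker p1 y) (n0 k) (n1 k) w.
      by rewrite -UstatD; congr (Ustat X _ _ _ _); apply/funext => x; apply/funext => y; rewrite /r subrK.
    rewrite Ustat_sumker// /nsum /XC; move: s0 ss.
    by move: (Num.sqrt (n1 k)%:R) => s s0 <-; field.
  + by apply: L2_L1; exact: L2Z.
  + apply: Ex_norm_le_sqrt => //; [exact: L2Z|exact: ltW|].
    rewrite (@eq_Ex _ _ _ P _ (fun w => (n1 k)%:R * Ustat X r (n0 k) (n1 k) w ^+ 2)); last first.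
      by move=> w; rewrite exprMn ss.
    rewrite ExZ; last by case: LU.
    have := residual1_variance mX iX FX sh L2h Eh (n0 k) (n1 k) m1_gt0; rewrite -/r -/V => var.
    apply: le_trans (ler_wpM2l (ltW n1_gt0) var) _; apply: le_trans Ddel.
    have -> : (n1 k)%:R * (V * (m0%:R * (m0%:R / (n0 k)%:R) + 'C(m1, 2)%:R * (m1%:R / (n1 k)%:R) ^+ 2)) =
        V * (m0%:R * m0%:R * ((n1 k)%:R / (n0 k)%:R) + 'C(m1, 2)%:R * (m1%:R * m1%:R) * (n1 k)%:R^-1).
      by field; rewrite !gt_eqF.
    rewrite -[leRHS]mulrA ler_wpM2l// [leRHS]mulrDl; apply: lerD.
      by rewrite ler_wpM2l ?mulr_ge0// ler_pdivrMr.
    by rewrite ler_wpM2l ?mulr_ge0// -[leRHS]invrK lef_pV2// posrE// invr_gt0.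
- by apply: (cvg_subsample n1_oo ratio0 (G := fun n => Ex P (fun w => f (m1%:R * nsum XC (fun=> p1) n 0 w)))); exact: linear_clt.
Qed.

Local Notation C := (m1%:R * (m1%:R - 1) / 2 : R).

Let rest x y := h x y - pairker p2 y.

Let n1_sqr_residual_small (e : R) : (1 < m1)%N -> xi P X h 0 1 = 0%E ->
  (xi P X h 1 0 = 0%E \/ ((n1 k ^ 2)%:R / (n0 k)%:R @[k --> \oo] --> (0 : R))) ->
  0 < e -> \forall k \near \oo,
    (n1 k)%:R ^+ 2 * Ex P (fun w => Ustat X rest (n0 k) (n1 k) w ^+ 2) <= e.
Proof.
move=> m1_gt1 xi01 ab e0.
pose V := Ex P (fun w => (base h w - pairker p2 [tuple X (true, nat_of_ord j) w | j < m1]) ^+ 2).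
have V0 : 0 <= V by apply: Ex_ge0 => w; exact: sqr_ge0.
have szl := sizes_large n1_oo ratio0 1 1.
case: ab => [xi10|n1n0].
  pose D : R := V * ('C(m0, 2)%:R * m0%:R ^+ 2 + 'C(m1, 3)%:R * m1%:R ^+ 3 + m0%:R * m0%:R * (m1%:R * m1%:R)).
  have D0 : 0 <= D by rewrite mulr_ge0// !addr_ge0// !mulr_ge0.
  have [del del0 Ddel] := small_multiple D0 e0.
  have dom1 := n1_dominated n1_oo ratio0 ltr01.
  have dl : \forall k \near \oo, (n1 k)%:R <= 1 * (n0 k)%:R :> R /\ (n1 k)%:R <= del * (n0 k)%:R.
    by apply: filterS2 dom1 (n1_dominated n1_oo ratio0 del0).
  apply: filterS3 dl (n1_large n1_oo del^-1) szl => k [d1 d2] large [n0_gt0 n1_gt0].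
  have n1p : 0 < (n1 k)%:R :> R by rewrite ltr0n.
  have n0p : 0 < (n0 k)%:R :> R by rewrite ltr0n.
  (* Under (a) the list is (2, 0), (0, 3), (1, 1). Multiplied by n1^2, its entries are of orders (n1
     / n0)^2, 1 / n1 and n1 / n0. *)
  have good a b : ~~ has (fun q : nat * nat => (q.1 <= a)%N && (q.2 <= b)%N) [:: (2, 0); (0, 3); (1, 1)]%N ->
      (a = 0%N /\ (b <= 2)%N) \/ [/\ a = 1%N, b = 0%N & xi P X h 1 0 = 0%E].
    by case: a => [|[|a]]; case: b => [|[|[|b]]] //= _; [left|left|left|right].
  have var := residual2_variance mX iX FX sh L2h Eh (n0 k) (n1 k) m1_gt1 xi01 good.
  apply: le_trans (ler_wpM2l (sqr_ge0 _) var) _; apply: le_trans Ddel.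
  rewrite !big_cons big_nil /= -/V !bin0 !bin1 !expr0 !expr1 !mulr1 !mul1r addr0.
  pose q : R := (n1 k)%:R / (n0 k)%:R.
  have q0 : 0 <= q by rewrite divr_ge0.
  have q1 : q <= 1 by rewrite ler_pdivrMr.
  have qd : q <= del by rewrite ler_pdivrMr.
  have nd : (n1 k)%:R^-1 <= del by rewrite -[leRHS]invrK lef_pV2// posrE// invr_gt0.
  rewrite [leLHS](_ : _ = V * ('C(m0, 2)%:R * m0%:R ^+ 2 * q ^+ 2 + 'C(m1, 3)%:R * m1%:R ^+ 3 * (n1 k)%:R^-1 +
      m0%:R * m0%:R * (m1%:R * m1%:R) * q)); last by rewrite /q; field; rewrite !gt_eqF.
  rewrite /D -[leRHS]mulrA ler_wpM2l// [leRHS]mulrDl [in leRHS]mulrDl; apply: lerD; [apply: lerD|].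
  - rewrite ler_wpM2l ?mulr_ge0//; apply: le_trans qd.
    by rewrite expr2 ler_piMl.
  - by rewrite ler_wpM2l ?mulr_ge0.
  - by rewrite ler_wpM2l ?mulr_ge0.
pose D : R := V * (m0%:R * m0%:R + 'C(m1, 3)%:R * m1%:R ^+ 3).
have D0 : 0 <= D by rewrite mulr_ge0// !addr_ge0// !mulr_ge0.
have [del del0 Ddel] := small_multiple D0 e0.
move/cvgrPdist_le : n1n0 => /(_ _ del0) dl.
apply: filterS3 dl (n1_large n1_oo del^-1) szl => k; rewrite sub0r normrN.
rewrite ger0_norm ?divr_ge0// natrX => d2 large [n0_gt0 n1_gt0].
have n1p : 0 < (n1 k)%:R :> R by rewrite ltr0n.
have n0p : 0 < (n0 k)%:R :> R by rewrite ltr0n.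
(* Under (b) the overlap (1, 0) is kept: multiplied by n1^2 it is of order n1^2 / n0, which tends to
   0 by assumption. *)
have good a b : ~~ has (fun q : nat * nat => (q.1 <= a)%N && (q.2 <= b)%N) [:: (1, 0); (0, 3)]%N ->
    (a = 0%N /\ (b <= 2)%N) \/ [/\ a = 1%N, b = 0%N & xi P X h 1 0 = 0%E].
  by case: a => [|a]; case: b => [|[|[|b]]] //= _; left.
have var := residual2_variance mX iX FX sh L2h Eh (n0 k) (n1 k) m1_gt1 xi01 good.
apply: le_trans (ler_wpM2l (sqr_ge0 _) var) _; apply: le_trans Ddel.
rewrite !big_cons big_nil /= -/V !bin0 !bin1 !expr0 !expr1 !mulr1 !mul1r addr0.
have nd : (n1 k)%:R^-1 <= del by rewrite -[leRHS]invrK lef_pV2// posrE// invr_gt0.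
rewrite [leLHS](_ : _ = V * (m0%:R * m0%:R * ((n1 k)%:R ^+ 2 / (n0 k)%:R) +
    'C(m1, 3)%:R * m1%:R ^+ 3 * (n1 k)%:R^-1)); last by field; rewrite !gt_eqF.
rewrite /D -[leRHS]mulrA ler_wpM2l// [leRHS]mulrDl; apply: lerD.
- by rewrite ler_wpM2l ?mulr_ge0.
- by rewrite ler_wpM2l ?mulr_ge0.
Qed.

Definition pairsum (K : S -> S -> R) n w : R :=
  \sum_(i < n) \sum_(j < n | j != i) K (XC i w) (XC j w).

(** [ustat_variance] for m0 = 0 and m1 = 2, where [pairker K] is K itself and degeneracy leaves only
    the full overlap. *)
Lemma pairsum_variance (K : S -> S -> R) n : L2 FF (fun z => K z.1 z.2) ->
  (forall x y, K x y = K y x) -> {ae F, forall x, Ex F (K x) = 0} -> (1 < n)%N ->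
  L2 P (pairsum K n) /\
  Ex P (fun w => ((n%:R * (n%:R - 1))^-1 * pairsum K n w) ^+ 2) <=
  Ex FF (fun z => K z.1 z.2 ^+ 2) * (2 / n%:R) ^+ 2.
Proof.
move=> LK sK dK n_gt1; split.
  apply: L2_sum => i _; apply: L2_sum => j ji; apply: (L2_pair mX iX FX LK).
  by apply: contraNneq ji => -[/val_inj ->].
have sk2 := sym_kernel_pairker (m0 := 0) (m1 := 2) LK.
have L2k2 := L2_pairker (m1 := 2) mX iX FX LK.
have := ustat_variance mX iX idX sk2 L2k2 (L := [:: (0%N, 2)]) 0 n.
rewrite big_seq1 /= !bin0 binn !expr0 !mul1r => var.
have E2 (y0 y1 : S) (y : 2.-tuple S) : tnth y ord0 = y0 -> tnth y (lift ord0 ord0) = y1 ->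
    pairker K y = K y0 y1.
  move=> t0 t1; rewrite /pairker big_ord_recl big_ord1 big_mkcond !big_ord_recl big_ord0 /= [X in _ + X]big_mkcond !big_ord_recl big_ord0 /=.
  by rewrite t0 t1 [K y1 y0]sK; field.
have -> : Ex FF (fun z => K z.1 z.2 ^+ 2) =
    Ex P (fun w => pairker K [tuple XC (nat_of_ord j) w | j < 2] ^+ 2).
  have ne : (true, 0%N) != (true, 1%N) by [].
  rewrite -(Ex_law (measurable_sample_pair mX _ _) (pair_law mX iX FX ne) _ LK.2); last exact: (L1_measurable LK.2).
  by apply: eq_Ex => w; congr (_ ^+ 2); apply/esym/E2; rewrite tnth_mktuple.
rewrite (@eq_Ex _ _ _ P _ (fun w => Ustat X (fun (_ : 0.-tuple S) (y : 2.-tuple S) => pairker K y) 0 n w ^+ 2)); last first.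
  move=> w; congr (_ ^+ 2); rewrite Ustat_pairker// /pairsum; field.
  by rewrite subr_eq0 !pnatr_eq1 pnatr_eq0; case: n n_gt1 {var} => [|[]].
apply: var => a b _ _; rewrite orbF -ltnNge => b2.
apply: filterS (hprojf_pairker (m0 := 0) (m1 := 2) mX iX FX LK sK dK a b) => w ->.
rewrite big1 ?mulr0// => i ib; rewrite big1// => j /andP[ji jb].
have i0 : nat_of_ord i = 0%N by case: (nat_of_ord i) ib b2 => [//|i'] ib b2; have := leq_trans ib (b2 : (b <= 1)%N).
have j0 : nat_of_ord j = 0%N by case: (nat_of_ord j) jb b2 => [//|j'] jb b2; have := leq_trans jb (b2 : (b <= 1)%N).
by move: ji; rewrite -val_eqE /= i0 j0.
Qed.

(** * The degenerate case *)

Section second_order.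
Variables (lam : nat -> R) (phi : nat -> S -> R).
Hypothesis m1_gt1 : (1 < m1)%N.
Hypothesis xi01 : xi P X h 0 1 = 0%E.
Hypothesis cases_ab : xi P X h 1 0 = 0%E \/ ((n1 k ^ 2)%:R / (n0 k)%:R @[k --> \oo] --> (0 : R)).
Let kk (z : S * S) := p2 z.1 z.2.
Hypothesis L2phi : forall j, lam j != 0 -> L2 F (phi j).
Hypothesis orthphi : forall i j, lam i != 0 -> lam j != 0 ->
  Ex F (fun x => phi i x * phi j x) = if i == j then 1 else 0.
Hypothesis eigphi : forall j, lam j != 0 -> {ae F, forall x, opr F kk (phi j) x = lam j * phi j x}.
Hypothesis complphi : forall (mu : R) (g : S -> R), mu != 0 -> L2 F g ->
  {ae F, forall x, L1 F (fun y => kk (x, y) * g y) /\ opr F kk g x = mu * g x} ->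
  (forall j, lam j = mu -> Ex F (fun x => g x * phi j x) = 0) ->
  {ae F, forall x, g x = 0}.
Local Notation psi := (efun lam phi).
Local Notation Res := (resid p2 lam phi).

Let Lk : L2 FF kk.
Proof. exact: L2_proj02. Qed.

Let sk x y : p2 x y = p2 y x.
Proof. exact: proj02_sym. Qed.

Let deg : {ae F, forall x, Ex F (p2 x) = 0}.
Proof.
have p0 : {ae F, forall x, p1 x = 0}.
  apply: (ae_law_inv (mX (true, 0%N)) (FX _) (measurable_proj01 P mX sh)).
  by apply: filterS (xi0_ae mX iX sh L2h Eh xi01) => w; rewrite hprojf01.
by apply: filterS2 (Ex_proj02_ae mX iX FX sh L2h) p0 => x -> ->.
Qed.

Let L2psi l : L2 F (psi l).
Proof. exact: L2_efun. Qed.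

Let oprk1 : {ae F, forall x, opr F kk (fun=> 1) x = 0}.
Proof. by apply: filterS deg => x dx; rewrite -[RHS]dx; apply: eq_Ex => t; rewrite mulr1. Qed.

(** Degeneracy says that the operator annihilates constants, and eigenfunctions for a nonzero
    eigenvalue are orthogonal to its kernel. *)
Let Epsi l : Ex F (psi l) = 0.
Proof.
have [l0|l0] := eqVneq (lam l) 0.
  by rewrite -[RHS](Ex_cst F 0); apply: eq_Ex => x; rewrite /efun l0 eqxx.
apply: (mulfI l0); rewrite mulr0.
have sk' : sym kk by move=> x y; exact: sk.
have := opr_adjoint Lk sk' (L2psi l) (L2_cst F 1).
rewrite (@ae_eq_Ex _ _ _ F (fun x => opr F kk (psi l) x * 1) (fun x => lam l * psi l x)).
- rewrite ExZ; last exact: L2_L1.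
  move=> ->; rewrite -[RHS](Ex_cst F 0); apply: ae_eq_Ex => //.
    apply: measurable_funM; first by case: (L2psi l).
    by apply: measurable_opr => //; case: Lk.
  by apply: filterS oprk1 => x ->; rewrite mulr0.
- apply: measurable_funM => //; apply: measurable_opr; first by case: Lk.
  by case: (L2psi l).
- by apply: measurable_funM => //; case: (L2psi l).
- by apply: filterS (eig_efun eigphi l) => x ->; rewrite mulr1.
Qed.

Let LRes J : L2 FF (Res J).
Proof. exact: L2_resid. Qed.

Let sRes J x y : Res J (x, y) = Res J (y, x).
Proof.
rewrite /resid /= sk; congr (_ - _); apply: eq_bigr => l _.
by rewrite /tensor /= [efun lam phi l x * _]mulrC.
Qed.

Let dRes J : {ae F, forall x, Ex F (fun y => Res J (x, y)) = 0}.
Proof.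
apply: filterS2 (opr_resid Lk L2phi J (L2_cst F 1)) oprk1 => x E0 E1.
rewrite (@eq_Ex _ _ _ F _ (fun t => Res J (x, t) * 1)); last by move=> t; rewrite mulr1.
rewrite -/(opr F (Res J) (fun=> 1) x) E0 E1 big1 ?subrr// => l _.
rewrite (@eq_Ex _ _ _ F _ (psi l)) ?Epsi ?mulr0// => t; by rewrite mulr1.
Qed.

Local Notation nS n l := (nsum XC psi n l).
Let nV n l w : R := n%:R^-1 * \sum_(i < n) psi l (XC i w) ^+ 2.
Let v l : R := Ex F (fun x => psi l x ^+ 2).

Let covpsi l m : Ex F (fun x => psi l x * psi m x) = if (l == m) && (lam l != 0) then 1 else 0.
Proof. exact: orth_efun. Qed.

Let lam_v l : lam l * v l = lam l.
Proof.
have -> : v l = if (l == l) && (lam l != 0) then 1 else 0 by rewrite -covpsi.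
by rewrite eqxx /=; case: eqVneq => [->|_]; rewrite ?mulr1 ?mul0r.
Qed.

Let v01 l : 0 <= v l <= 1.
Proof.
have -> : v l = if (l == l) && (lam l != 0) then 1 else 0 by rewrite -covpsi.
by case: ifP; rewrite ?ler01 ?lexx.
Qed.

Let LnV n l : L1 P (nV n l).
Proof.
apply: L1Z; apply: L1_sum => i _; apply/(L1_law (mX _) (FX _) (f := fun x => psi l x ^+ 2)).
  by apply: measurable_funX; case: (L2psi l).
by case: (L2psi l).
Qed.

Let EnV n l : Ex P (nV n.+1 l) = v l.
Proof.
have L1i i : L1 P (fun w => psi l (XC i w) ^+ 2).
  apply/(L1_law (mX _) (FX _) (f := fun x => psi l x ^+ 2)); last by case: (L2psi l).
  by apply: measurable_funX; case: (L2psi l).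
rewrite ExZ; last by apply: L1_sum => i _; exact: L1i.
rewrite Ex_sum; last by move=> i _; exact: L1i.
rewrite (eq_bigr (fun=> v l)); last first.
  move=> i _; rewrite (Ex_law (mX _) (FX _) (f := fun x => psi l x ^+ 2))//; last by case: (L2psi l).
  by apply: measurable_funX; case: (L2psi l).
by rewrite sumr_const card_ord -[v l *+ _]mulr_natl mulrA mulVf ?mul1r// pnatr_eq0.
Qed.

(** The normalised off-diagonal sum is n / (n - 1) (nS^2 - nV). Its difference from nS^2 - v has two
    sources: the factor n / (n - 1), and the empirical diagonal nV in place of its mean v. *)
Let gap n l w : R := (n%:R - 1)^-1 * (nS n l w ^+ 2 - nV n l w) - (nV n l w - v l).

Let Lgap n l : L1 P (gap n l).
Proof.
have LS : L1 P (fun w => nS n l w ^+ 2).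
  by case: (L2_nsum mXC FXC L2psi n l).
by apply: L1B; [apply: L1Z; exact: L1B|apply: L1B => //; exact: L1_cst].
Qed.

Let gap_small J (e : R) : 0 < e -> \forall n \near \oo,
  Ex P (fun w => `|\sum_(l < J) lam l * gap n l w|) <= e.
Proof.
move=> e0; pose A := \sum_(l < J) `|lam l|.
have A0 : 0 <= A by exact: sumr_ge0.
have [del del0 Adel] := small_multiple A0 e0.
have d2 : 0 < del / 2 by rewrite divr_gt0.
have lln : \forall n \near \oo, forall l : 'I_J, Ex P (fun w => `|nV n l w - v l|) <= del / 2.
  apply: filter_forall => l.
  have [N HN] := @weak_lln _ _ _ _ _ P XC F (fun i => mX _) iXC (fun i => FX _) (fun x => psi l x ^+ 2)
    (L2psi l).2 (fun x => sqr_ge0 _) _ d2.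
  by exists N => // n; exact: HN.
apply: filterS3 lln (nbhs_infty_ger (4 / del + 1)) (nbhs_infty_gt 1) => n lln large n_gt1.
have n1p : 0 < n%:R - 1 :> R by rewrite subr_gt0 ltr1n.
have inv_small : (n%:R - 1)^-1 * 2 <= del / 2.
  rewrite mulrC ler_pdivrMr// mulrC -ler_pdivrMr//; apply: (@le_trans _ _ (4 / del)); last by lra.
  by rewrite [leLHS](_ : _ = 4 / del)//; field; rewrite gt_eqF.
have LS l : L1 P (fun w => nS n l w ^+ 2).
  by case: (L2_nsum mXC FXC L2psi n l).
have one l : (l < J)%N -> Ex P (fun w => `|gap n l w|) <= del.
  move=> lJ.
  apply: (@le_trans _ _ (Ex P (fun w => (n%:R - 1)^-1 * (nS n l w ^+ 2 + nV n l w) + `|nV n l w - v l|))).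
    apply: le_Ex.
    - exact: L1_norm.
    - by apply: L1D; [apply: L1Z; exact: L1D|apply: L1_norm; apply: L1B => //; exact: L1_cst].
    - move=> w; rewrite /gap; apply: le_trans (ler_normB _ _) _; rewrite lerD2r.
      rewrite normrM (gtr0_norm (x := (n%:R - 1)^-1)) ?invr_gt0//.
      rewrite ler_wpM2l ?invr_ge0 ?(ltW n1p)//; apply: le_trans (ler_normB _ _) _.
      rewrite !ger0_norm ?sqr_ge0// mulr_ge0 ?invr_ge0// sumr_ge0// => i _; exact: sqr_ge0.
  rewrite ExD; [|by apply: L1Z; exact: L1D|by apply: L1_norm; apply: L1B => //; exact: L1_cst].
  rewrite ExZ; last exact: L1D.
  rewrite ExD//.
  have h1 := Ex_sqr_nsum_le (fun i => mX _) iXC (fun i => FX _) L2psi Epsi covpsi n l.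
  have h2 : Ex P (nV n l) <= 1 by case: n n_gt1 {lln large n1p inv_small LS h1} => // n _; rewrite EnV; have /andP[] := v01 l.
  have h3 := lln (Ordinal lJ).
  have h4 : (n%:R - 1)^-1 * (Ex P (fun w => nS n l w ^+ 2) + Ex P (nV n l)) <= (n%:R - 1)^-1 * 2.
    by rewrite ler_wpM2l ?invr_ge0 ?(ltW n1p)//; lra.
  by move: h3; rewrite /= => h3; lra.
apply: (@le_trans _ _ (Ex P (fun w => \sum_(l < J) `|lam l| * `|gap n l w|))).
  apply: le_Ex.
  - by apply: L1_norm; apply: L1_sum => l _; exact: L1Z.
  - by apply: L1_sum => l _; apply: L1Z; exact: L1_norm.
  - by move=> w; apply: le_trans (ler_norm_sum _ _ _) _; apply: ler_sum => l _; rewrite normrM.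
rewrite Ex_sum; last by move=> l _; apply: L1Z; exact: L1_norm.
apply: le_trans Adel; rewrite mulr_suml; apply: ler_sum => l _.
by rewrite ExZ; [rewrite ler_wpM2l// one|exact: L1_norm].
Qed.

Let pairsum_p2 J n w : (1 < n)%N ->
  n%:R * ((n%:R * (n%:R - 1))^-1 * pairsum p2 n w) =
  n%:R * ((n%:R * (n%:R - 1))^-1 * pairsum (fun x y => Res J (x, y)) n w) +
  \sum_(l < J) lam l * gap n l w + \sum_(l < J) lam l * (nS n l w ^+ 2 - 1).
Proof.
move=> n_gt1.
have n1p : 0 < n%:R - 1 :> R by rewrite subr_gt0 ltr1n.
have np : 0 < n%:R :> R by rewrite ltr0n; exact: ltnW.
have nn : n%:R != 0 :> R by rewrite gt_eqF.
have n1n : n%:R - 1 != 0 :> R by rewrite gt_eqF.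
have T l : pairsum (fun x y => psi l x * psi l y) n w = n%:R * (nS n l w ^+ 2 - nV n l w).
  have -> : nS n l w ^+ 2 = n%:R^-1 * (\sum_(i < n) psi l (XC i w)) ^+ 2.
    by rewrite /nsum exprMn exprVn sqr_sqrtr// ltW.
  rewrite /nV -mulrBr mulrA divff// mul1r expr2 big_distrlr /= -sumrB; apply: eq_bigr => i _.
  by rewrite [in RHS](bigD1 i)//= -expr2 addrAC subrr add0r.
have -> : pairsum p2 n w = pairsum (fun x y => Res J (x, y)) n w +
    \sum_(l < J) lam l * (n%:R * (nS n l w ^+ 2 - nV n l w)).
  under [X in _ = _ + X]eq_bigr do rewrite -T.
  have -> : \sum_(l < J) lam l * pairsum (fun x y => psi l x * psi l y) n w =
      pairsum (fun x y => \sum_(l < J) lam l * (psi l x * psi l y)) n w.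
    rewrite /pairsum; under [RHS]eq_bigr do rewrite exchange_big.
    rewrite [RHS]exchange_big; apply: eq_bigr => l _; rewrite mulr_sumr; apply: eq_bigr => i _.
    by rewrite mulr_sumr.
  rewrite /pairsum -big_split; apply: eq_bigr => i _; rewrite -big_split; apply: eq_bigr => j _.
  by rewrite /resid /tensor /= subrK.
rewrite mulrDr mulrDr -addrA; congr (_ + _).
rewrite !mulr_sumr -big_split; apply: eq_bigr => l _ /=.
have -> : lam l * (nS n l w ^+ 2 - 1) = lam l * nS n l w ^+ 2 - lam l * v l by rewrite lam_v mulrBr mulr1.
by rewrite /gap; field; rewrite nn n1n.
Qed.

Let C_ge0 : 0 <= C.
Proof. by rewrite divr_ge0// mulr_ge0// subr_ge0 ler1n ltnW. Qed.

(** Three errors: [D1] from the projection residual, [D2] from truncating the kernel, [D3] from the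
    diagonal. [D1] and [D3] vanish as k grows. [D2] does not, but its L2 norm is at most 2 rho for
    all k, since the variance bound (2 / n1)^2 rho^2 is multiplied by n1^2. *)
Let approximation (f : R -> R) (M rho del : R) J :
  (forall x, `|f x| <= M) -> (forall x y, `|f x - f y| <= M * `|x - y|) ->
  0 <= rho -> Ex FF (fun z => Res J z ^+ 2) <= rho ^+ 2 -> 0 < del ->
  \forall k \near \oo, `|Ex P (fun w => f ((n1 k)%:R * Ustat X h (n0 k) (n1 k) w)) -
     Ex P (fun w => f (\sum_(l < J) (C * lam l) * (nS (n1 k) l w ^+ 2 - 1)))| <=
   M * (C * (2 * rho) + del).
Proof.
move=> fM fL rho0 Rrho del0.
have M0 : 0 <= M by exact: le_trans (normr_ge0 _) (fM 0).
have d2 : 0 < del / 2 by rewrite divr_gt0.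
have [dC dC0 CdC] := small_multiple C_ge0 d2.
have sm1 := n1_sqr_residual_small m1_gt1 xi01 cases_ab (exprn_gt0 2 d2).
have sm2 : \forall k \near \oo, Ex P (fun w => `|\sum_(l < J) lam l * gap (n1 k) l w|) <= dC.
  have [N _ HN] := gap_small J dC0.
  by apply: filterS (sizes_large n1_oo ratio0 0 N) => k [_ ?]; exact: HN.
apply: filterS3 sm1 sm2 (sizes_large n1_oo ratio0 m0 m1) => k h1 h2 [m0n0 m1n1].
have n_gt1 : (1 < n1 k)%N by exact: leq_trans m1n1.
have np : 0 < (n1 k)%:R :> R by rewrite ltr0n; exact: ltnW.
have ss := sym_kernel_pairker (m0 := m0) (m1 := m1) Lk.
have Ls := L2_pairker (m1 := m1) mX iX FX Lk.
have LU := L2_Ustat mX iX idX (sym_kernelB sh ss) (L2B L2h Ls) (n0 k) (n1 k).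
pose D1 w := (n1 k)%:R * Ustat X rest (n0 k) (n1 k) w.
pose pR w := ((n1 k)%:R * ((n1 k)%:R - 1))^-1 * pairsum (fun x y => Res J (x, y)) (n1 k) w.
pose D2 w := (n1 k)%:R * pR w.
pose D3 w := \sum_(l < J) lam l * gap (n1 k) l w.
have LD1 : L2 P D1 by exact: L2Z.
have LRJ : L2 FF (fun z => Res J (z.1, z.2)) by apply: eq_L2 (LRes J) => -[].
have [LpR var] := pairsum_variance LRJ (sRes J) (dRes J) n_gt1.
have LpR' : L2 P pR by exact: L2Z.
have LD2 : L2 P D2 by exact: L2Z.
have LD3 : L1 P D3 by apply: L1_sum => l _; exact: L1Z.
have ED1 : Ex P (fun w => `|D1 w|) <= del / 2.
  apply: Ex_norm_le_sqrt => //; first exact: ltW.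
  rewrite (@eq_Ex _ _ _ P _ (fun w => (n1 k)%:R ^+ 2 * Ustat X rest (n0 k) (n1 k) w ^+ 2)).
    by rewrite ExZ//; case: LU.
  by move=> w; rewrite exprMn.
have ED2 : Ex P (fun w => `|D2 w|) <= 2 * rho.
  apply: Ex_norm_le_sqrt => //; first by rewrite mulr_ge0.
  rewrite (@eq_Ex _ _ _ P _ (fun w => (n1 k)%:R ^+ 2 * pR w ^+ 2)); last by move=> w; rewrite exprMn.
  rewrite ExZ; last by case: LpR'.
  apply: le_trans (ler_wpM2l (sqr_ge0 _) var) _.
  rewrite (@eq_Ex _ _ _ FF (fun z => Res J (z.1, z.2) ^+ 2) (fun z => Res J z ^+ 2)); last by case.
  rewrite [leLHS](_ : _ = 4 * Ex FF (fun z => Res J z ^+ 2)); last by field; rewrite gt_eqF.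
  by rewrite exprMn; lra.
pose D w := D1 w + C * D2 w + C * D3 w.
have LD : L1 P D.
  by apply: L1D; [apply: L1D; [exact: L2_L1|apply: L1Z; exact: L2_L1]|exact: L1Z].
have DE w : (n1 k)%:R * Ustat X h (n0 k) (n1 k) w -
    \sum_(l < J) (C * lam l) * (nS (n1 k) l w ^+ 2 - 1) = D w.
  have -> : Ustat X h (n0 k) (n1 k) w = Ustat X rest (n0 k) (n1 k) w + Ustat X (fun (_ : m0.-tuple S) (y : m1.-tuple S) => pairker p2 y) (n0 k) (n1 k) w.
    by rewrite -UstatD; congr (Ustat X _ _ _ _); apply/funext => x; apply/funext => y; rewrite /rest subrK.
  rewrite Ustat_pairker//.
  have := pairsum_p2 J w n_gt1; rewrite /pairsum => E.
  rewrite mulrDr [(n1 k)%:R * (C * _)]mulrCA E /D /D1 /D2 /pR /D3.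
  have -> : \sum_(l < J) C * lam l * (nS (n1 k) l w ^+ 2 - 1) =
      C * \sum_(l < J) lam l * (nS (n1 k) l w ^+ 2 - 1).
    by rewrite mulr_sumr; apply: eq_bigr => l _; rewrite mulrA.
  by rewrite /pairsum; ring.
have mB : measurable_fun setT (fun w => \sum_(l < J) (C * lam l) * (nS (n1 k) l w ^+ 2 - 1)).
  apply: measurable_sum => l; apply: measurable_funM => //; apply: measurable_funB => //.
  apply: measurable_funX.
  by case: (L2_nsum mXC FXC L2psi (n1 k) l).
have LYB : L1 P (fun w => (n1 k)%:R * Ustat X h (n0 k) (n1 k) w -
    \sum_(l < J) (C * lam l) * (nS (n1 k) l w ^+ 2 - 1)) by apply: eq_L1 LD => w; rewrite DE.
apply: le_trans (Ex_lipschitz_diff fM fL (measurable_Ustat _ _ _) mB LYB) _.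
rewrite ler_wpM2l//.
rewrite (@eq_Ex _ _ _ P _ (fun w => `|D w|)); last by move=> w; rewrite DE.
apply: (@le_trans _ _ (Ex P (fun w => `|D1 w| + C * `|D2 w| + C * `|D3 w|))).
  apply: le_Ex; first exact: L1_norm.
    apply: L1D; [apply: L1D; [apply: L1_norm; exact: L2_L1|]|]; apply: L1Z; apply: L1_norm => //.
    exact: L2_L1.
  move=> w; rewrite /D; apply: le_trans (ler_normD _ _) _; apply: lerD.
    by apply: le_trans (ler_normD _ _) _; rewrite lerD2l normrM (ger0_norm C_ge0).
  by rewrite normrM (ger0_norm C_ge0).
have L1n1 : L1 P (fun w => `|D1 w|) by apply: L1_norm; exact: L2_L1.
have L1n2 : L1 P (fun w => C * `|D2 w|) by apply: L1Z; apply: L1_norm; exact: L2_L1.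
have L1n3 : L1 P (fun w => C * `|D3 w|) by apply: L1Z; exact: L1_norm.
rewrite (ExD (L1D L1n1 L1n2) L1n3) (ExD L1n1 L1n2).
rewrite (ExZ C (L1_norm (L2_L1 LD2))) (ExZ C (L1_norm LD3)).
have h3 : C * Ex P (fun w => `|D2 w|) <= C * (2 * rho) by rewrite ler_wpM2l.
have h4 : C * Ex P (fun w => `|D3 w|) <= del / 2 by apply: le_trans CdC; rewrite ler_wpM2l.
by lra.
Qed.

Context {d' : measure_display} {O' : measurableType d'} (P' : probability O' R)
  (Z : nat -> {RV P' >-> R}) (eta : {RV P' >-> R}).
Hypothesis iZ : mutually_independent P' (fun j w => Z j w).
Hypothesis nZ : forall j A, measurable A -> P' (Z j @^-1` A) = normal_prob 0 1 A.
Hypothesis cvg_eta : {ae P', forall w,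
  (\sum_(j < N) lam j * ((Z j w) ^+ 2 - 1)) @[N --> \oo] --> eta w}.

Lemma part2_limit (f : R -> R) : smooth f ->
  Ex P (fun w => f ((n1 k)%:R * Ustat X h (n0 k) (n1 k) w)) @[k --> \oo] -->
  Ex P' (fun w => f (C * eta w)).
Proof.
move=> sf; have [f1 [f2 [M [df df1 [fM f1M f2M f2L]]]]] := sf.
have fL := derive_lipschitz df f1M.
have M0 : 0 <= M by exact: le_trans (normr_ge0 _) (fM 0).
have cf := is_derive_continuous df.
have mf : measurable_fun setT f by apply: continuous_measurable_fun; exact: cf.
pose eJ J w := \sum_(l < J) (C * lam l) * (Z l w ^+ 2 - 1).
have cJ : Ex P' (fun w => f (eJ J w)) @[J --> \oo] --> Ex P' (fun w => f (C * eta w)).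
  apply: (Ex_dct (g := fun=> M)) => //.
  - move=> J; apply: (measurableT_comp mf); apply: measurable_sum => l.
    by apply: measurable_funM => //; apply: measurable_funB => //; apply: measurable_funX; exact: measurable_funP.
  - by apply: (measurableT_comp mf); apply: measurable_funM => //; exact: measurable_funP.
  - exact: L1_cst.
  - apply: filterS cvg_eta => w cw.
    have cw' : eJ J w @[J --> \oo] --> C * eta w.
      have -> : eJ ^~ w = fun J => C * \sum_(l < J) lam l * (Z l w ^+ 2 - 1).
        by apply/funext => J; rewrite /eJ mulr_sumr; apply: eq_bigr => l _; rewrite mulrA.
      by apply: cvgM; [exact: cvg_cst|exact: cw].
    by apply: (@continuous_cvg _ _ _ _ _ (eJ ^~ w) f (C * eta w)); [exact: cf|exact: cw'].
apply/cvgrPdist_le => e e0.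
have e4 : 0 < e / 4 by rewrite divr_gt0.
(* The accuracy rho of the truncation and then J are fixed before k tends to infinity; J also has to
   make the finite sums in the [Z l] close to [eta]. *)
have [rho rho0 Mrho] := small_multiple (mulr_ge0 M0 (mulr_ge0 C_ge0 (ler0n _ 2))) e4.
have [del del0 Mdel] := small_multiple M0 e4.
have [N1 HN1] := resid_cvg0 Lk sk L2phi orthphi eigphi complphi (exprn_gt0 2 rho0).
move/cvgrPdist_le : cJ => /(_ _ e4) [N2 _ HN2].
pose J := maxn N1 N2.
have RJ : Ex FF (fun z => Res J z ^+ 2) <= rho ^+ 2 by apply: HN1; rewrite leq_maxl.
have hJ := HN2 J (leq_maxr _ _).
have clt := @quadratic_clt _ _ _ _ _ _ _ P XC F P' Z psi (fun l => lam l != 0) (fun l => C * lam l) J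
  (fun i => mX _) iXC (fun i => FX _) iZ nZ L2psi Epsi covpsi
  (fun l => ltac:(by move/negPn/eqP => ->; rewrite mulr0)) f sf.
have clt' := cvg_subsample n1_oo ratio0 clt.
move/cvgrPdist_le : clt' => /(_ _ e4) clt'.
apply: filterS2 (approximation fM fL (ltW rho0) RJ del0) clt' => k a1 a2.
have MC : M * (C * (2 * rho) + del) <= e / 4 + e / 4.
  rewrite mulrDr; apply: lerD => //.
  by rewrite [leLHS](_ : _ = M * (C * 2) * rho)//; ring.
have {}a1 := le_trans a1 MC.
move: a1 a2 hJ; rewrite /= -/(eJ J _) !ler_norml => /andP[b1 b2] /andP[b3 b4] /andP[b5 b6].
by apply/andP; split; lra.
Qed.

End second_order.

End limits.

Theorem theorem1 (R : realType) (p m0 m1 : nat)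
  (d : measure_display) (Omega : measurableType d) (P : probability Omega R)
  (X : bool * nat -> {RV P >-> p.-tuple R})
  (h : m0.-tuple (p.-tuple R) -> m1.-tuple (p.-tuple R) -> R)
  (n0 n1 : nat -> nat) :
  (0 < m0)%N -> (0 < m1)%N ->
  (* all observations are independent *)
  mutually_independent P (fun i w => X i w) ->
  (* null hypothesis: controls and cases all have the same distribution *)
  (forall i A, measurable A -> P (X i @^-1` A) = P (X (false, 0%N) @^-1` A)) ->
  (* the kernel: measurable, symmetric in each block of arguments *)
  measurable_fun setT
    (fun z : m0.-tuple (p.-tuple R) * m1.-tuple (p.-tuple R) => h z.1 z.2) ->
  (forall (x x' : m0.-tuple (p.-tuple R)) (y : m1.-tuple (p.-tuple R)),
      perm_eq x x' -> h x y = h x' y) ->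
  (forall (x : m0.-tuple (p.-tuple R)) (y y' : m1.-tuple (p.-tuple R)),
      perm_eq y y' -> h x y = h x y') ->
  (* mean zero and finite second moment *)
  ('E_P[fun w => h [tuple X (false, nat_of_ord i) w | i < m0]
                  [tuple X (true, nat_of_ord j) w | j < m1]] = 0)%E ->
  P.-integrable setT (fun w => ((h [tuple X (false, nat_of_ord i) w | i < m0]
                  [tuple X (true, nat_of_ord j) w | j < m1]) ^+ 2)%:E) ->
  (* asymptotic regime: n1 -> oo, n1 / n -> 0 with n = n0 + n1 *)
  (((n1 k)%:R : R) @[k --> \oo] --> +oo) ->
  ((n1 k)%:R / (n0 k + n1 k)%:R @[k --> \oo] --> (0 : R)) ->
  let T k w := Ustat (fun i w => X i w) h (n0 k) (n1 k) w in
  let xi_ a b := xi P (fun i w => X i w) h a b in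
  (* (1) *)
  ((0 < xi_ 0%N 1%N)%E ->
     cvg_in_dist P (fun k w => Num.sqrt (n1 k)%:R * T k w)
       (normal_prob 0 (m1%:R * Num.sqrt (fine (xi_ 0%N 1%N)))) (fun r => r)) /\
  (* (2) *)
  (xi_ 0%N 1%N = 0%E -> (0 < xi_ 0%N 2%N)%E ->
     (xi_ 1%N 0%N = 0%E \/ (((n1 k) ^ 2)%:R / (n0 k)%:R @[k --> \oo] --> (0 : R))) ->
     forall lam : nat -> R,
       eigenvalue_seq (distribution P (X (true, 0%N)))
         (fun x y => hproj P (fun i w => X i w) h 0 2
                       (fun _ => x) (fun j => if j == 0%N then x else y)) lam ->
     forall (d' : measure_display) (Omega' : measurableType d')
            (P' : probability Omega' R) (Z : nat -> {RV P' >-> R}),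
       mutually_independent P' (fun j w => Z j w) ->
       (forall j A, measurable A -> P' (Z j @^-1` A) = normal_prob 0 1 A) ->
       forall eta : {RV P' >-> R},
       {ae P', forall w, (\sum_(j < N) lam j * ((Z j w) ^+ 2 - 1)) @[N --> \oo]
                           --> eta w} ->
       cvg_in_dist P (fun k w => (n1 k)%:R * T k w)
         P' (fun w => m1%:R * (m1%:R - 1) / 2 * eta w)).
Proof.
move=> _ m1_gt0 iX null mh s0 s1 Eh L2h n1_oo ratio0 T xi_.
pose X' i w := X i w; pose F := distribution P (X (true, 0%N)).
have mX i : measurable_fun setT (X' i) by exact: measurable_funP.
have FX e A : measurable A -> P (X' e @^-1` A) = F A.
  by move=> mA; rewrite /X' null// -(null (true, 0%N)).
have idX i j A : measurable A -> P (X' i @^-1` A) = P (X' j @^-1` A).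
  by move=> mA; rewrite !FX.
have sh : sym_kernel h by [].
have L2h' : L2 P (fun w => h [tuple X' (false, nat_of_ord i) w | i < m0]
    [tuple X' (true, nat_of_ord j) w | j < m1]).
  by split => //; exact: measurable_kernel_eval.
have Eh' : Ex P (fun w => h [tuple X' (false, nat_of_ord i) w | i < m0]
    [tuple X' (true, nat_of_ord j) w | j < m1]) = 0.
  by move: Eh; rewrite unlock => E; rewrite /Ex E.
have mU (c : nat -> R) k : measurable_fun setT (fun w => c k * T k w).
  by apply: measurable_funM => //; case: (L2_Ustat mX iX idX sh L2h' (n0 k) (n1 k)).
split.
  rewrite /xi_ (xi01E mX iX FX sh L2h' Eh') lte_fin /= => xi01.
  (* A positive standard deviation allows the limit to be rewritten as m1 s x with x standard
     normal. *)
  have s_gt0 : 0 < m1%:R * Num.sqrt (Ex F (fun x => proj01 P X' h x ^+ 2)).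
    by rewrite mulr_gt0 ?ltr0n// sqrtr_gt0.
  apply: cvg_in_dist_smooth => [k||f sf]; [exact: (mU (fun k => Num.sqrt (n1 k)%:R))|exact: measurable_borel_id|].
  have [f1 [f2 [M [df _ [fM _ _ _]]]]] := sf.
  have cf := is_derive_continuous df.
  have mf : measurable_fun setT f by apply: continuous_measurable_fun; exact: cf.
  rewrite -(Ex_normalR _ _ mf fM) (normal_affine 0 s_gt0 cf fM).
  under eq_Ex do rewrite add0r -mulrA.
  exact: part1_limit.
move=> xi01 xi02 ab lam [phi [phi2 [orth [eig compl]]]] d' O' P' Z iZ nZ eta cvg_eta.
(* With a single case argument h_{0,2} and h_{0,1} coincide, so xi_{0,2} > 0 = xi_{0,1} rules out m1
   = 1. *)
have m1_gt1 : (1 < m1)%N.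
  rewrite ltn_neqAle m1_gt0 andbT; apply/eqP => m1E.
  have E : xi_ 0%N 2%N = xi_ 0%N 1%N; last by move: xi02; rewrite E xi01 ltxx.
  rewrite /xi_ /xi; congr (variance P _); apply/funext => w; rewrite !hprojE.
  apply: eq_Ex => w'; congr h; apply: eq_mktuple => i.
  by rewrite !(leq_trans (ltn_ord i))// -m1E.
have L2phi j : lam j != 0 -> L2 F (phi j) by move=> /phi2[].
have orthphi i j : lam i != 0 -> lam j != 0 ->
    Ex F (fun x => phi i x * phi j x) = if i == j then 1 else 0.
  by move=> li lj; rewrite /Ex orth.
apply: cvg_in_dist_smooth => [k||f sf]; [exact: (mU (fun k => (n1 k)%:R))| |].
  by apply: measurable_funM => //; exact: measurable_funP.
apply: (part2_limit mX iX FX sh L2h' Eh' n1_oo ratio0 m1_gt1 xi01 ab L2phi orthphi _ _ iZ nZ cvg_eta sf).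
  by move=> j lj; apply: filterS (eig j lj) => x E; rewrite /opr /Ex E.
move=> mu g mu0 Lg eg og; apply: (compl mu g mu0 Lg.1 Lg.2).
  by apply: filterS eg => x [Lx <-]; rewrite -L1_int.
move=> j lj; rewrite L1_int ?og//; apply: L2M => //; apply: L2phi; by rewrite lj.
Qed.
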